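(* Let $n\ge2$, let $U(t)$, $t\ge 0$, be a Brownian motion on $\mathbf{U}(n)$ started from $U(0)\in\mathcal{D}$, let $w_{kj}(t)=U_{kj}(t)/U_{nj}(t)$ ($1\le k\le n-1$, $1\le j\le n$) be the associated Brownian motion on the full flag manifold $F_{1,2,\dots,n-1}(\mathbb{C}^n)$, let $r_j(t)=\big(\sum_{k=1}^{n-1}|w_{kj}(t)|^2\big)^{1/2}$, and let $$\lambda(t)=\left(\frac{1}{1+r_1(t)^2},\dots,\frac1{1+r_n(t)^2}\right),\quad t\ge0.$$ Then $(\lambda(t))_{t\ge0}$ satisfies the stochastic differential equation $$d\lambda_j=2(1-n\lambda_j)\,dt+2\sum_{\ell=1,\ell\ne j}^n\sqrt{\lambda_\ell\lambda_j}\,d\gamma_{\ell j},\qquad 1\le j\le n,$$ where $(\gamma_{\ell j}(t))_{\ell<j}$, $t\ge0$, is a Brownian motion on $\mathbb{R}^{\frac12n(n-1)}$ and $\gamma_{\ell j}:=-\gamma_{j\ell}$ for $\ell>j$. Consequently, $(\lambda(t))_{t\ge0}$ is a Jacobi process in the simplex $\mathcal{T}_n=\{\lambda\in\mathbb{R}^n:\lambda_j\ge0,\ 1\le j\le n,\ \lambda_1+\dots+\lambda_n=1\}$ with generator $2\widehat{\mathcal{G}}_{1/2,\dots,1/2}$, where $$\widehat{\mathcal{G}}_{1/2,\dots,1/2}=\sum_{j=1}^n\lambda_j(1-\lambda_j)\frac{\partial^2}{\partial\lambda_j^2}+\sum_{j=1}^n(1-n\lambda_j)\frac{\partial}{\partial\lambda_j}-\sum_{1\le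 j\ne\ell\le n}\lambda_j\lambda_\ell\frac{\partial^2}{\partial\lambda_j\partial\lambda_\ell}$$ is the Jacobi operator with parameter $\kappa=(1/2,\dots,1/2)$.
   Context: Brownian motion on $\mathbf{U}(n)$ is the solution of $dU(t)=U(t)\circ dA(t)$ (Stratonovich), where $$A(t)=\sum_{1\le\ell<j\le n}(E_{\ell j}-E_{j\ell})B_{\ell j}(t)+i\sum_{1\le\ell<j\le n}(E_{\ell j}+E_{j\ell})\tilde B_{\ell j}(t)+\sum_{j=1}^n\sqrt2\,iE_{jj}B_j(t)$$ with $E_{\ell j}$ the elementary matrices and $B_{\ell j},\tilde B_{\ell j},B_j$ independent standard real Brownian motions. $\mathcal{D}=\{(a_{kj})\in\mathbf{U}(n):a_{n1}\ne0,\dots,a_{nn}\ne0\}$; almost surely $U(t)\in\mathcal{D}$ for all $t\ge0$. For $\kappa=(\kappa_1,\dots,\kappa_n)$ with all $\kappa_j>-1/2$ and $|\kappa|=\kappa_1+\dots+\kappa_n$, a Jacobi process (Jacobi diffusion) in $\mathcal{T}_n$ with parameter $\kappa$ is a diffusion in $\mathcal{T}_n$ with generator (up to the constant time scaling factor indicated) $$\widehat{\mathcal{G}}_\kappa=\sum_{j=1}^n\lambda_j(1-\lambda_j)\frac{\partial^2}{\partial\lambda_j^2}+\sum_{j=1}^n\left[\left(\kappa_j+\tfrac12\right)-\left(|\kappa|+\tfrac n2\right)\lambda_j\right]\frac{\partial}{\partial\lambda_j}-\sum_{1\le j\ne\ell\le n}\lambda_j\lambda_\ell\frac{\partial^2}{\partial\lambda_j\partial\lambda_\ell}.$$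 *)

(* Defs.v *)
From HB Require Import structures.
From mathcomp Require Import all_boot all_order all_algebra.
From mathcomp.real_closed Require Export complex.
From mathcomp Require Import all_classical all_reals all_analysis.
Import Order.TTheory GRing.Theory Num.Theory numFieldNormedType.Exports.

Set Implicit Arguments.
Unset Strict Implicit.
Unset Printing Implicit Defensive.

Local Open Scope classical_set_scope.
Local Open Scope ring_scope.
Local Open Scope complex_scope.

(** Time is a real parameter; only the values at times [t >= 0] of a process or
    of a filtration are ever used. *)

Section stochastic_calculus.
Context {d : measure_display} {T : measurableType d} {R : realType}.
Implicit Types (P : probability T R) (F : R -> set (set T)).
Implicit Types (X Y H S : R -> T -> R).

(* Right-continuity of the filtration plays no role below; completeness is what
   makes limits in probability of adapted processes adapted again. *)
Definition complete_filtration P F : Prop :=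
  [/\ forall t, 0 <= t -> sigma_algebra setT (F t),
      forall t, 0 <= t -> F t `<=` measurable,
      forall s t, 0 <= s -> s <= t -> F s `<=` F t
    & forall A : set T, measurable A -> P A = 0%E -> F 0 A].

Definition adapted F X : Prop :=
  forall t, 0 <= t -> forall B : set R, measurable B -> F t (X t @^-1` B).

Definition as_continuous P X : Prop :=
  {ae P, forall w, {within `[0, +oo[, continuous (X ^~ w)}}.

Definition continuous_adapted P F X : Prop := adapted F X /\ as_continuous P X.

(** [(W i)_{i in I}] is a standard [F]-Brownian motion on [R^I]: the increments
    are independent of the past and have independent [N(0, t - s)] components
    (the second parameter of [normal_prob] is the standard deviation). *)
Definition brownian_motion P F (I : finType) (W : I -> R -> T -> R) : Prop :=
  [/\ forall i, continuous_adapted P F (W i),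
      forall i, {ae P, forall w, W i 0 w = 0}
    & forall s t, 0 <= s -> s < t ->
      forall A, F s A -> forall B : I -> set R, (forall i, measurable (B i)) ->
        P (A `&` [set w | forall i, B i (W i t w - W i s w)]) =
        (P A * \prod_(i in I) normal_prob 0 (Num.sqrt (t - s)) (B i))%E].

(** [Sum N s] is a random variable attached to the subdivision
    [0 = s_0 <= s_1 <= ... <= s_N = t]; it converges in probability to [Y] as
    the mesh tends to [0]. *)
Definition subdivision_limit P (Sum : nat -> (nat -> R) -> T -> R)
    (t : R) (Y : T -> R) : Prop :=
  forall e eta : R, 0 < e -> 0 < eta ->
  exists2 delta : R, 0 < delta &
  forall (N : nat) (s : nat -> R), s 0%N = 0 -> s N = t ->
    (forall i, (i < N)%N -> 0 <= s i.+1 - s i <= delta) ->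
    (P [set w | (e <= `|Sum N s w - Y w|)%R] <= eta%:E)%E.

(** [Y_t = \int_0^t H dX] (Itô) for a continuous adapted integrand [H]: the limit
    in probability of the left-endpoint sums, as in Kunita, Stochastic flows
    and stochastic differential equations. *)
Definition ito_integral P F H X Y : Prop :=
  [/\ continuous_adapted P F H, continuous_adapted P F X,
      continuous_adapted P F Y
    & forall t, 0 <= t -> subdivision_limit P
        (fun N s w => \sum_(i < N) H (s i) w * (X (s i.+1) w - X (s i) w))
        t (Y t)].

(* The bracket [H, X] of continuous semimartingales.  Finite variation has to be
   required: it makes the solution of a Stratonovich equation a semimartingale. *)
Definition covariation P F H X Y : Prop :=
  [/\ continuous_adapted P F Y,
      {ae P, forall w, forall t, 0 <= t -> bounded_variation 0 t (Y ^~ w)}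
    & forall t, 0 <= t -> subdivision_limit P
        (fun N s w => \sum_(i < N)
           (H (s i.+1) w - H (s i) w) * (X (s i.+1) w - X (s i) w))
        t (Y t)].

(** [S_t = \int_0^t H \circ dX = \int_0^t H dX + 1/2 [H, X]_t]. *)
Definition stratonovich_integral P F H X S : Prop :=
  exists I C : R -> T -> R,
    [/\ ito_integral P F H X I, covariation P F H X C
      & forall t w, S t w = I t w + 2^-1 * C t w].

Definition complex_stratonovich_integral P F (H X S : R -> T -> R[i]) : Prop :=
  exists Srr Sii Sri Sir : R -> T -> R,
    let ReH t w := complex.Re (H t w) in let ImH t w := complex.Im (H t w) in
    let ReX t w := complex.Re (X t w) in let ImX t w := complex.Im (X t w) in
    [/\ stratonovich_integral P F ReH ReX Srr,
        stratonovich_integral P F ImH ImX Sii,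
        stratonovich_integral P F ReH ImX Sri,
        stratonovich_integral P F ImH ReX Sir
      & forall t w, S t w = (Srr t w - Sii t w) +i* (Sri t w + Sir t w)].

End stochastic_calculus.

Notation upper_pair n := {p : 'I_n * 'I_n | (p.1 < p.2)%N}.

(* The indices of, respectively, B_{lj} and \tilde B_{lj} (l < j), and B_j. *)
Notation unitary_index n := (upper_pair n + upper_pair n + 'I_n)%type.

Section unitary_brownian_motion.
Context {d : measure_display} {T : measurableType d} {R : realType}.
Implicit Types (P : probability T R) (F : R -> set (set T)).

Definition unitary_driver n (W : unitary_index n -> R -> T -> R)
    (t : R) (w : T) : 'M[R[i]]_n :=
  \sum_(p : upper_pair n) (W (inl (inl p)) t w)%:C *:
     (delta_mx (val p).1 (val p).2 - delta_mx (val p).2 (val p).1)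
  + ('i%C : R[i]) *: \sum_(p : upper_pair n) (W (inl (inr p)) t w)%:C *:
     (delta_mx (val p).1 (val p).2 + delta_mx (val p).2 (val p).1)
  + \sum_(j < n) ((Num.sqrt 2 * W (inr j) t w)%:C * 'i%C) *: delta_mx j j.

(** [U] solves [dU = U \circ dA].  That [U t] stays unitary is a consequence of
    [U 0] being unitary, hence is not required here. *)
Definition unitary_sde P F n (W : unitary_index n -> R -> T -> R)
    (U : R -> T -> 'M[R[i]]_n) : Prop :=
  (forall k j : 'I_n,
     continuous_adapted P F (fun t w => complex.Re (U t w k j)) /\
     continuous_adapted P F (fun t w => complex.Im (U t w k j))) /\
  exists S : 'I_n -> 'I_n -> 'I_n -> R -> T -> R[i],
    (forall k l j : 'I_n, complex_stratonovich_integral P F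
       (fun t w => U t w k l) (fun t w => unitary_driver W t w l j) (S k l j)) /\
    {ae P, forall w, forall t, 0 <= t -> forall k j : 'I_n,
       U t w k j = U 0 w k j + \sum_(l < n) S k l j t w}.

(** A Brownian motion on [U(n)], driven by the standard Brownian motion [W]. *)
Definition unitary_brownian_motion P F n (W : unitary_index n -> R -> T -> R)
    (U : R -> T -> 'M[R[i]]_n) : Prop :=
  brownian_motion P F W /\ unitary_sde P F W U.

End unitary_brownian_motion.

Section flag.
Context {R : realType} (m : nat).

(* The set \mathcal D, for n = m + 1. *)
Definition flag_chart : set 'M[R[i]]_m.+1 :=
  [set M | M \is unitarymx /\ forall j, M ord_max j != 0].

Definition flag_coord (M : 'M[R[i]]_m.+1) (k : 'I_m) (j : 'I_m.+1) : R[i] :=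
  M (lift ord_max k) j / M ord_max j.

Definition flag_radius (M : 'M[R[i]]_m.+1) (j : 'I_m.+1) : R :=
  Num.sqrt (\sum_(k < m) Normc.normc (flag_coord M k j) ^+ 2).

Definition flag_lambda (M : 'M[R[i]]_m.+1) : 'rV[R]_m.+1 :=
  \row_j (1 / (1 + flag_radius M j ^+ 2)).

End flag.

Section diffusion.
Context {R : realType} {n : nat}.
Implicit Types (f g : 'rV[R]_n -> R) (K : set 'rV[R]_n).

Definition simplex : set 'rV[R]_n :=
  [set x | (forall j, 0 <= x 0 j) /\ \sum_(j < n) x 0 j = 1].

Definition partial (j : 'I_n) f : 'rV[R]_n -> R :=
  fun x => 'D_(delta_mx 0 j) f x.

Definition has_continuous_partials f : Prop :=
  forall j, (forall x, derivable f x (delta_mx 0 j)) /\ continuous (partial j f).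

Definition C2 f : Prop :=
  has_continuous_partials f /\ forall j, has_continuous_partials (partial j f).

Definition jacobi_operator (kappa : 'I_n -> R) f : 'rV[R]_n -> R :=
  fun x =>
    \sum_(j < n) x 0 j * (1 - x 0 j) * partial j (partial j f) x
    + \sum_(j < n) ((kappa j + 2^-1)
                    - (\sum_(l < n) kappa l + n%:R / 2) * x 0 j) * partial j f x
    - \sum_(j < n) \sum_(l < n | l != j)
        x 0 j * x 0 l * partial j (partial l f) x.

(** A Feller (Markov) semigroup on [C(K)], [K] compact.  Elements of [C(K)] are
    represented by functions on the ambient space, of which only the
    restriction to [K] matters. *)
Definition feller_semigroup K (Q : R -> ('rV[R]_n -> R) -> 'rV[R]_n -> R) : Prop :=
  let CK f := {within K, continuous f} in
  (forall t f, 0 <= t -> CK f -> CK (Q t f)) /\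
  (forall t (a : R) f g, 0 <= t -> CK f -> CK g -> forall x, K x ->
     Q t (fun y => a * f y + g y) x = a * Q t f x + Q t g x) /\
  (forall t f, 0 <= t -> CK f -> (forall y, K y -> 0 <= f y) ->
     forall x, K x -> 0 <= Q t f x) /\
  (forall t, 0 <= t -> forall x, K x -> Q t (fun=> 1) x = 1) /\
  (forall f, CK f -> forall x, K x -> Q 0 f x = f x) /\
  (forall s t f, 0 <= s -> 0 <= t -> CK f -> forall x, K x ->
     Q (s + t) f x = Q s (Q t f) x) /\
  (forall f, CK f -> forall e : R, 0 < e ->
     \forall t \near (0 : R)^'+, forall x, K x -> `|Q t f x - f x| <= e).

(* The infinitesimal generator of Q is defined on the restrictions to K of C^2
   functions, where it is given by G. *)
Definition has_generator K (Q : R -> ('rV[R]_n -> R) -> 'rV[R]_n -> R)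
    (G : ('rV[R]_n -> R) -> 'rV[R]_n -> R) : Prop :=
  forall f, C2 f -> forall e : R, 0 < e ->
    \forall t \near (0 : R)^'+, forall x, K x ->
      `|t^-1 * (Q t f x - f x) - G f x| <= e.

Context {d : measure_display} {T : measurableType d}.
Implicit Types (P : probability T R) (F : R -> set (set T)).

(** [X] is a diffusion in [K] with generator [G]: an a.s. continuous process in
    [K], Markov with respect to [F] (hence strongly Markov) with a Feller
    semigroup whose generator is [G].  The Markov property is
    [E[f (X_{s+t}) | F_s] = Q_t f (X_s)]; restricting to [K] by [\_] only
    matters on the null set where [X] is not in [K]. *)
Definition diffusion P F K (G : ('rV[R]_n -> R) -> 'rV[R]_n -> R)
    (X : R -> T -> 'rV[R]_n) : Prop :=
  (forall j, continuous_adapted P F (fun t w => X t w 0 j)) /\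
  {ae P, forall w, forall t, 0 <= t -> K (X t w)} /\
  exists Q : R -> ('rV[R]_n -> R) -> 'rV[R]_n -> R,
    [/\ feller_semigroup K Q, has_generator K Q G
      & forall s t, 0 <= s -> 0 <= t -> forall A, F s A ->
        forall f, {within K, continuous f} ->
          \int[P]_(w in A) (f \_ K) (X (s + t) w) =
          \int[P]_(w in A) (Q t f \_ K) (X s w)].

(** Jacobi process with parameter [kappa] and time scaling constant [c]. *)
Definition jacobi_process P F (kappa : 'I_n -> R) (c : R)
    (X : R -> T -> 'rV[R]_n) : Prop :=
  (forall j, - 2^-1 < kappa j) /\
  diffusion P F simplex (fun f x => c * jacobi_operator kappa f x) X.

End diffusion.

(* Main.v *)
Require Import Defs.
From HB Require Import structures.
From mathcomp Require Import all_boot all_order all_algebra.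
From mathcomp Require Import all_classical all_reals all_analysis.
From mathcomp Require Import measurable_realfun.
From mathcomp Require Import ring lra.
Import Order.TTheory GRing.Theory Num.Theory numFieldNormedType.Exports.

(** Up to an error o(t - s), the increment over [s, t] of every process below is
   (t - s) b + \sum_v th_v dW_v + m, with coefficients frozen at time s and a small
   martingale increment m.  Such expansions (germs) are stable under products and
   smooth maps, and they yield that U stays unitary, that the squared moduli
   lambda_j of a unit row vector times U have drift 2 (1 - n lambda_j) and brackets
   4 (delta_jl lambda_j - lambda_j lambda_l), and, since - ln (lambda_j + eps) has
   bounded drift, that lambda_j never reaches 0.  Hence the noise of lambda can be
   divided by sqrt (lambda_l lambda_j); the resulting gamma_lj is Gaussian by the
   differential equation for its conditional characteristic function (Levy).
   The monomial moments of lambda solve a closed triangular linear system, with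
   the same equations for every starting row, so Gronwall's lemma gives the Markov
   property; the generator is read off the second order Taylor expansion. *)

Set Implicit Arguments.
Unset Strict Implicit.
Unset Printing Implicit Defensive.

Local Open Scope classical_set_scope.
Local Open Scope ring_scope.
Local Notation measf := (measurable_fun setT).

(** The conclusion concerns the given process, up to null sets, whereas germs need coefficients that
    are bounded for every outcome. [U] is not known to be bounded before it is known to be unitary:
    its equation is first rewritten with integrands clipped at a level [K], and the conserved
    quantities are read on each path until it leaves [[-K, K]]. Completeness of the filtration then
    allows the components to be redefined on a null event, so that unitarity and positivity on the
    last row hold everywhere. Conditional expectations are never formed. A martingale increment is a
    square integrable variable orthogonal to the indicators of past events, and the evolution of
    means is obtained by testing germs against bounded variables of the past. A semigroup on the
    simplex needs a process from each point [x], the boundary included. The row [sqrt x] times the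
    adjoint of [U 0], multiplied by [U t], provides one on the same space, and its uniform
    continuity in [x] yields the Feller property. Positivity serves only the division in the
    stochastic equation. *)

Lemma eq_ler (R : numDomainType) (x y : R) : x = y -> x <= y.
Proof. by move->. Qed.

Lemma sum_fun_ind (A I : Type) (V : nmodType) (K : (A -> V) -> Prop) (r : seq I)
    (Q : pred I) (f : I -> A -> V) : K (fun=> 0) ->
  (forall g h, K g -> K h -> K (fun w => g w + h w)) -> (forall i, Q i -> K (f i)) ->
  K (fun w => \sum_(i <- r | Q i) f i w).
Proof.
move=> K0 KD Kf; rewrite (_ : (fun w => _) =
  \big[(fun g h w => g w + h w)/fun=> 0]_(i <- r | Q i) f i); first exact: big_ind.
by apply/funext => w; apply/esym/(big_morph (fun g : A -> V => g w)).
Qed.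

(** * Expectations, square integrable variables, orthogonality to a sub-sigma-algebra *)

Section expectation.
Context {d} {T : measurableType d} {R : realType} (P : probability T R).
Implicit Types (X Y Z : T -> R) (K a b c e : R).

Definition Ex X : R := \int[P]_w X w.
Definition L1 X := P.-integrable setT (EFin \o X).
Definition L2 X := measf X /\ L1 (fun w => X w ^+ 2).

Lemma L1_meas X : L1 X -> measf X.
Proof. by move=> h; apply/measurable_EFinP; exact: measurable_int h. Qed.

Lemma L1_bounded X K : measf X -> (forall w, `|X w| <= K) -> L1 X.
Proof.
move=> mX XK; apply: measurable_bounded_integrable => //.
 by rewrite (le_lt_trans (probability_le1 _ _))// ltry.
exists K; split; first exact: num_real.
by move=> M KM w _; apply: le_trans (XK w) (ltW KM).
Qed.

Lemma L1_cst c : L1 (fun=> c).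
Proof. by apply: (@L1_bounded _ `|c|). Qed.

Lemma L1D X Y : L1 X -> L1 Y -> L1 (fun w => X w + Y w).
Proof. by move=> hX hY; have := integrableD measurableT hX hY. Qed.

Lemma L1Z c X : L1 X -> L1 (fun w => c * X w).
Proof. by move=> hX; have := integrableZl measurableT c hX. Qed.

Lemma L1N X : L1 X -> L1 (fun w => - X w).
Proof. by move=> hX; have := integrableN hX. Qed.

Lemma L1B X Y : L1 X -> L1 Y -> L1 (fun w => X w - Y w).
Proof. by move=> hX hY; apply: (L1D hX); exact: L1N. Qed.

Lemma L1_le X Y : measf X -> (forall w, `|X w| <= Y w) ->
 L1 Y -> L1 X.
Proof.
move=> mX XY hY; apply: le_integrable hY => //; first exact/measurable_EFinP.
by move=> w _ /=; rewrite lee_fin (le_trans (XY w))// ler_norm.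
Qed.

Lemma L1_abs X : L1 X -> L1 (fun w => `|X w|).
Proof. by move=> hX; have := integrable_abse hX. Qed.

Lemma L1_sum (I : Type) (r : seq I) (Q : pred I) (X : I -> T -> R) :
 (forall i, Q i -> L1 (X i)) -> L1 (fun w => \sum_(i <- r | Q i) X i w).
Proof. by move=> h; apply: (sum_fun_ind (K := L1)) h; [exact: L1_cst|exact: L1D]. Qed.

Lemma Ex_cst c : Ex (fun=> c) = c.
Proof. rewrite /Ex Rintegral_cst// -[RHS]mulr1; congr (_ * _).
by rewrite -[RHS]/(fine 1%E); congr fine; exact: probability_setT. Qed.

Lemma ExD X Y : L1 X -> L1 Y -> Ex (fun w => X w + Y w) = Ex X + Ex Y.
Proof. by move=> hX hY; rewrite /Ex RintegralD. Qed.

Lemma ExB X Y : L1 X -> L1 Y -> Ex (fun w => X w - Y w) = Ex X - Ex Y.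
Proof. by move=> hX hY; rewrite /Ex RintegralB. Qed.

Lemma ExZ c X : L1 X -> Ex (fun w => c * X w) = c * Ex X.
Proof. by move=> hX; rewrite /Ex RintegralZl. Qed.

Lemma Ex_sum (I : Type) (r : seq I) (Q : pred I) (X : I -> T -> R) :
 (forall i, Q i -> L1 (X i)) ->
 Ex (fun w => \sum_(i <- r | Q i) X i w) = \sum_(i <- r | Q i) Ex (X i).
Proof.
move=> h; elim: r => [|i r IH].
 by rewrite big_nil -[RHS](Ex_cst 0); congr Ex; apply/funext => w; rewrite big_nil.
rewrite big_cons; under eq_fun do rewrite big_cons; case: ifP => // Qi.
by rewrite ExD ?IH//; [exact: h|exact: L1_sum].
Qed.

Lemma Ex_le X Y : L1 X -> L1 Y -> (forall w, X w <= Y w) -> Ex X <= Ex Y.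
Proof. by move=> hX hY XY; apply: le_Rintegral. Qed.

Lemma Ex_ge0 X : (forall w, 0 <= X w) -> 0 <= Ex X.
Proof. by move=> X0; apply: Rintegral_ge0. Qed.

Lemma Ex_norm X : L1 X -> `|Ex X| <= Ex (fun w => `|X w|).
Proof. by move=> hX; apply: le_normr_Rintegral. Qed.

Lemma Ex_normD X Y : L1 X -> L1 Y ->
 Ex (fun w => `|X w + Y w|) <= Ex (fun w => `|X w|) + Ex (fun w => `|Y w|).
Proof.
move=> hX hY; rewrite -ExD; [|exact: L1_abs..].
apply: Ex_le => [||w]; last exact: ler_normD.
- exact/L1_abs/L1D.
- by apply: L1D; exact: L1_abs.
Qed.

Lemma Ex_ae X Y : measf X -> measf Y ->
 {ae P, forall w, X w = Y w} -> Ex X = Ex Y.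
Proof.
move=> mX mY h; rewrite /Ex /Rintegral; congr fine.
apply: ae_eq_integral => //; [exact/measurable_EFinP..|].
by apply: filterS h => w /= ->.
Qed.

Lemma L1_ae X Y : measf Y -> {ae P, forall w, X w = Y w} -> L1 X -> L1 Y.
Proof.
move=> mY h hX; have mX := L1_meas hX.
move/integrableP: hX => [_ hX]; apply/integrableP; split; first exact/measurable_EFinP.
rewrite -(@ae_eq_integral _ _ _ _ _ _ (fun w => `|(X w)%:E|%E))//.
- by apply: measurableT_comp => //; exact/measurable_EFinP.
- by apply: measurableT_comp => //; exact/measurable_EFinP.
- by apply: filterS h => w /= ->.
Qed.

Lemma L2_meas X : L2 X -> measf X. Proof. by case. Qed.

Lemma L2_mul X Y : L2 X -> L2 Y -> L1 (fun w => X w * Y w).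
Proof.
move=> [mX hX] [mY hY]; apply: (L1_le _ _ (L1D hX hY)).
 exact: measurable_funM.
move=> w; rewrite normrM -(real_normK (num_real (X w))) -(real_normK (num_real (Y w))).
by have := normr_ge0 (X w); have := normr_ge0 (Y w); nra.
Qed.

Lemma L2_bounded X K : measf X -> (forall w, `|X w| <= K) -> L2 X.
Proof.
move=> mX XK; split => //; apply: (@L1_bounded _ (K ^+ 2)).
 exact: measurable_funX.
by move=> w; rewrite normrX lerXn2r// ?nnegrE// (le_trans _ (XK w)).
Qed.

Lemma L2_cst c : L2 (fun=> c).
Proof. by apply: (@L2_bounded _ `|c|). Qed.

Lemma L2_L1 X : L2 X -> L1 X.
Proof.
move=> hX; rewrite (_ : X = (fun w => X w * 1)); first exact: L2_mul (L2_cst _).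
by apply/funext => w; rewrite mulr1.
Qed.

Lemma L2Mb X Y K : L2 X -> measf Y -> (forall w, `|Y w| <= K) ->
 L2 (fun w => Y w * X w).
Proof.
move=> [mX hX] mY YK; split; first exact: measurable_funM.
apply: (L1_le _ _ (L1Z (K ^+ 2) hX)).
 by apply: measurable_funX; exact: measurable_funM.
move=> w; rewrite exprMn normrM !normrX (real_normK (num_real (X w))).
by rewrite ler_wpM2r// ?sqr_ge0// lerXn2r// ?nnegrE// (le_trans _ (YK w)).
Qed.

Lemma L2Z c X : L2 X -> L2 (fun w => c * X w).
Proof. by move=> hX; apply: (@L2Mb X (fun=> c) `|c|). Qed.

Lemma L2D X Y : L2 X -> L2 Y -> L2 (fun w => X w + Y w).
Proof.
move=> hX hY; split; first by apply: measurable_funD; [case: hX|case: hY].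
rewrite (_ : (fun w => _) =
 (fun w => (X w ^+ 2 + Y w ^+ 2) + 2 * (X w * Y w))).
 apply: L1D; first by apply: L1D; [case: hX|case: hY].
 by apply: L1Z; exact: L2_mul.
by apply/funext => w; ring.
Qed.

Lemma L2N X : L2 X -> L2 (fun w => - X w).
Proof. by move=> hX; under eq_fun do rewrite -mulN1r; exact: L2Z. Qed.

Lemma L2B X Y : L2 X -> L2 Y -> L2 (fun w => X w - Y w).
Proof. by move=> hX hY; apply: L2D => //; exact: L2N. Qed.

Lemma L2_sum (I : Type) (r : seq I) (Q : pred I) (X : I -> T -> R) :
 (forall i, Q i -> L2 (X i)) -> L2 (fun w => \sum_(i <- r | Q i) X i w).
Proof. by move=> h; apply: (sum_fun_ind (K := L2)) h; [exact: L2_cst|exact: L2D]. Qed.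

Lemma L2_abs X : L2 X -> L2 (fun w => `|X w|).
Proof.
move=> [mX hX]; split; first exact: measurableT_comp.
by under eq_fun do rewrite real_normK ?num_real//.
Qed.

(** The quadratic [a * r ^+ 2 - 2 * e * r + b] dominates the second moment of [r |X| - |Y|], so its
    discriminant is nonpositive. Upper bounds [a] and [b] replace the exact second moments so that
    estimates can be inserted directly. *)
Lemma Ex_CS X Y a b : L2 X -> L2 Y -> Ex (fun w => X w ^+ 2) <= a ->
 Ex (fun w => Y w ^+ 2) <= b ->
 Ex (fun w => `|X w * Y w|) <= Num.sqrt (a * b).
Proof.
move=> hX hY ha hb; have [[mX h1] [mY h2]] := (hX, hY).
have h12 : L1 (fun w => `|X w * Y w|) by exact/L1_abs/L2_mul.
set e := Ex _; have e0 : 0 <= e by apply: Ex_ge0.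
have : (- 2 * e) ^+ 2 - 4 * a * b <= 0.
 have := @deg_le2_poly_ge0 R (Poly [:: b; - 2 * e; a]) (size_Poly _).
 rewrite !coef_Poly; apply=> r; rewrite horner_Poly /= mul0r add0r mulrDl -mulrA -expr2.
 apply: (@le_trans _ _ (Ex (fun w => (r * `|X w| - `|Y w|) ^+ 2))).
  by apply: Ex_ge0 => w; exact: sqr_ge0.
 rewrite (_ : (fun w => _) =
  (fun w => r ^+ 2 * X w ^+ 2 + Y w ^+ 2 - 2 * r * `|X w * Y w|)).
  rewrite ExB; [|by apply: L1D => //; exact: L1Z|exact: L1Z].
  rewrite ExD//; last exact: L1Z.
  by rewrite !ExZ// -/e; have := ler_wpM2l (sqr_ge0 r) ha; nra.
 by apply/funext => w; rewrite normrM sqrrB exprMn !real_normK ?num_real//; ring.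
by move=> h; rewrite -[e]ger0_norm// -sqrtr_sqr ler_wsqrtr//; lra.
Qed.

Lemma Ex_CS1 X b : L2 X -> Ex (fun w => X w ^+ 2) <= b ->
 Ex (fun w => `|X w|) <= Num.sqrt b.
Proof.
move=> hX hb; have := @Ex_CS X (fun=> 1) b 1 hX (L2_cst _) hb.
by rewrite mulr1 expr1n Ex_cst => /(_ (lexx _)); under eq_fun do rewrite mulr1.
Qed.

Lemma Ex_sqrD X Y : L2 X -> L2 Y ->
 Ex (fun w => (X w + Y w) ^+ 2) <=
 2 * Ex (fun w => X w ^+ 2) + 2 * Ex (fun w => Y w ^+ 2).
Proof.
move=> hX hY; have [_ h] := L2D hX hY.
have [[_ h1] [_ h2]] := (hX, hY).
rewrite -!ExZ// -ExD; [|exact: L1Z..].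
apply: Ex_le => //; first by apply: L1D; exact: L1Z.
by move=> w; have := sqr_ge0 (X w - Y w); nra.
Qed.

Lemma indic01 (A : set T) w : \1_A w = 1 :> R \/ \1_A w = 0 :> R.
Proof. by rewrite indicE; case: (_ \in _); [left|right]. Qed.

Lemma indic_le1 (A : set T) w : `|\1_A w : R| <= 1.
Proof. by have [->|->] := indic01 A w; rewrite ?normr1 ?normr0. Qed.

Lemma L1_indic (A : set T) : measurable A -> L1 (\1_A : T -> R).
Proof.
move=> mA; by apply: (@L1_bounded _ 1); [exact: measurable_indic|exact: indic_le1].
Qed.

Lemma L1_indicM (A : set T) X : measurable A -> L1 X -> L1 (fun w => \1_A w * X w).
Proof.
move=> mA hX; apply: (L1_le _ _ (L1_abs hX)) => [|w].
 by apply: measurable_funM; [exact: measurable_indic|exact: L1_meas].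
by rewrite normrM ler_piMl// indic_le1.
Qed.

Lemma L2_indicM (A : set T) X : measurable A -> L2 X -> L2 (fun w => \1_A w * X w).
Proof.
by move=> mA hX; apply: (L2Mb (K := 1) hX); [exact: measurable_indic|exact: indic_le1].
Qed.

Lemma Ex_indic (A : set T) : measurable A -> Ex (\1_A : T -> R) = fine (P A).
Proof.
move=> mA; rewrite -[RHS]mul1r -(Rintegral_cst P mA 1) Rintegral_mkcond.
by rewrite patch_indic; congr Ex; apply/funext => w /=; rewrite mul1r.
Qed.

Lemma measurable_ge X e : measf X -> measurable [set w | e <= X w].
Proof.
move=> mX; rewrite -[X in measurable X]setTI.
have := mX measurableT `[e, +oo[%classic (measurable_itv _).
by congr (measurable (_ `&` _)); apply/seteqP; split => w /=; rewrite in_itv/= andbT.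
Qed.

Lemma chebyshev1 X e : L1 X -> 0 < e ->
 (P [set w | (e <= `|X w|)%R] <= (Ex (fun w => `|X w|) / e)%:E)%E.
Proof.
move=> hX e0; have mX := L1_meas hX.
have mA : measurable [set w | e <= `|X w|].
 by apply: measurable_ge; exact: measurableT_comp.
have fA : P [set w | e <= `|X w|] \is a fin_num by exact: fin_num_measure.
rewrite -(fineK fA) lee_fin ler_pdivlMr// mulrC -Ex_indic// -ExZ; last exact: L1_indic.
apply: Ex_le; [exact/L1Z/L1_indic|exact: L1_abs|move=> w].
rewrite indicE; have [|_] := boolP (_ \in _); last by rewrite mulr0.
by rewrite inE /= mulr1.
Qed.

Lemma Ex_DCT (X : nat -> T -> R) (Y g : T -> R) :
 (forall n, measf (X n)) -> measf Y -> L1 g ->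
 (forall n w, `|X n w| <= g w) ->
 {ae P, forall w, X n w @[n --> \oo] --> Y w} ->
 L1 Y /\ Ex (X n) @[n --> \oo] --> Ex Y.
Proof.
move=> mX mY hg Xg h.
have [] := @dominated_convergence _ _ _ P setT measurableT (fun n => EFin \o X n)
 (EFin \o Y) (EFin \o g) _ _ _ _ _.
- by move=> n; exact/measurable_EFinP.
- exact/measurable_EFinP.
- by apply: filterS h => w h _; apply: cvg_EFin => //; exact: nearW.
- exact: hg.
- by apply: aeW => w n _ /=; rewrite lee_fin.
move=> hY _ h3; split => //.
by apply: fine_cvg; rewrite fineK//; exact: (integrable_fin_num measurableT hY).
Qed.

Lemma Ex_DCT0 (X : nat -> T -> R) (g : T -> R) :
 (forall n, measf (X n)) -> L1 g ->
 (forall n w, `|X n w| <= g w) ->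
 {ae P, forall w, X n w @[n --> \oo] --> 0} ->
 Ex (X n) @[n --> \oo] --> 0.
Proof.
move=> mX hg Xg h.
have [_] := @Ex_DCT X (fun=> 0) g mX (measurable_cst _) hg Xg h.
by rewrite Ex_cst.
Qed.

Import HBNNSimple.

(** Orthogonality to the events determined by [Y] extends to simple functions of [Y], then to [Y] by
    dominated convergence with bound [|Y Z|]. The auxiliary [key] treats the positive and the
    negative part of [Y] alike. *)
Lemma Ex_orthogonal Y Z : L2 Y -> L2 Z ->
 (forall B, measurable B -> Ex (fun w => \1_(Y @^-1` B) w * Z w) = 0) ->
 Ex (fun w => Y w * Z w) = 0.
Proof.
move=> hY hZ h; have mY := L2_meas hY; have mZ := L2_meas hZ.
have key (f : R -> R) : measf f -> (forall y, 0 <= f y <= `|y|) ->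
  L1 (fun w => f (Y w) * Z w) /\ Ex (fun w => f (Y w) * Z w) = 0.
 move=> mf f0; have mEf : measf (EFin \o f) by exact/measurable_EFinP.
 pose s := nnsfun_approx measurableT mEf.
 have sc y : s n y @[n --> \oo] --> f y.
  suff h1 : (s n y)%:E @[n --> \oo] --> (f y)%:E by exact: fine_cvg h1.
  by apply: cvg_nnsfun_approx => // *; rewrite lee_fin; exact: (andP (f0 _)).1.
 have sf n y : s n y <= f y.
  rewrite -(cvg_lim _ (sc y))//.
  apply: (@nondecreasing_cvgn_le _ (fun n => s n y)); last by apply/cvg_ex; exists (f y).
  by move=> ? ? ?; exact/lefP/nd_nnsfun_approx.
 have ES n : Ex (fun w => s n (Y w) * Z w) = 0.
  pose B r : set R := s n @^-1` [set r].
  have mB r : measurable (B r) by exact: (measurable_sfunP (s n)).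
  have L r : L1 (fun w => \1_(Y @^-1` B r) w * Z w).
   by apply/L1_indicM/L2_L1 => //; rewrite -[X in measurable X]setTI; apply: mY.
  under eq_fun do rewrite fimfunEord mulr_suml.
  under eq_fun do under eq_bigr do rewrite -mulrA.
  rewrite Ex_sum => [|i _]; last exact: L1Z (L _).
  apply: big1 => i _; rewrite (ExZ _ (L _)) h ?mulr0//.
 have [|||||L E] := @Ex_DCT (fun n w => s n (Y w) * Z w)
  (fun w => f (Y w) * Z w) (fun w => `|Y w * Z w|).
 - by move=> n; apply: measurable_funM => //; exact: measurableT_comp.
 - by apply: measurable_funM => //; exact: measurableT_comp.
 - exact/L1_abs/L2_mul.
 - move=> n w; rewrite !normrM ler_wpM2r// ger0_norm//.
  by apply: le_trans (sf n _) _; exact: (andP (f0 _)).2.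
 - apply: aeW => w; apply: cvgM; last exact: cvg_cst.
  exact: sc.
 split => //; move: E; under eq_fun do rewrite ES.
 by move=> /cvg_lim <-//; rewrite lim_cst.
have [||Lp Ep] := key (fun y => Num.max y 0).
- by apply: measurable_maxr.
- by move=> y; rewrite le_max lexx orbT ge_max ler_norm normr_ge0.
have [||Ln En] := key (fun y => Num.max (- y) 0).
- by apply: measurable_maxr => //; exact: measurableT_comp.
- by move=> y; rewrite le_max lexx orbT ge_max normr_ge0 -normrN ler_norm.
have := ExB Lp Ln; rewrite Ep En subrr => <-; congr Ex; apply/funext => w.
by rewrite -mulrBl; congr (_ * _); have [h1|h1] := leP (Y w) 0; have [h2|h2] := leP (- Y w) 0; lra.
Qed.

Section subalgebra.
Implicit Types (G : set (set T)).

Definition msr G X := forall B, measurable B -> G (X @^-1` B).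

Definition subalg G := sigma_algebra setT G /\ G `<=` measurable.

(** This says that the conditional expectation of [Z] given [G] is zero, without constructing that
    conditional expectation. *)
Definition perp G Z := forall A, G A -> Ex (fun w => \1_A w * Z w) = 0.

(** A sigma-algebra given as a plain set of sets is the one it generates; this gives access to the
    closure properties of measurable functions. *)
Lemma msrP G X : sigma_algebra setT G ->
 msr G X <-> measurable_fun (setT : set (g_sigma_algebraType G)) X.
Proof.
move=> sG; have e : G.-sigma.-measurable = G by exact: sigma_algebra_id.
split=> [h _ B mB|h B mB].
 by rewrite setTI; have := h B mB; rewrite -[in G _]e.
by rewrite -e -[_ @^-1` _]setTI; exact: h.
Qed.

Lemma msr_meas G X : subalg G -> msr G X -> measf X.
Proof. by move=> [_ sG] h _ B mB; rewrite setTI; apply/sG/h. Qed.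

Lemma msr_sub G H X : G `<=` H -> msr G X -> msr H X.
Proof. by move=> GH h B mB; apply/GH/h. Qed.

Lemma msr_comp G X (f : R -> R) : measf f -> msr G X ->
 msr G (fun w => f (X w)).
Proof.
move=> mf h B mB; rewrite (_ : _ @^-1` _ = X @^-1` (f @^-1` B))//.
by apply: h; rewrite -[X in measurable X]setTI; exact: mf.
Qed.

Variable G : set (set T).
Hypothesis sG : sigma_algebra setT G.

Lemma msr_cst c : msr G (fun=> c).
Proof. by apply/(msrP _ sG); exact: measurable_cst. Qed.

Lemma msrD X Y : msr G X -> msr G Y -> msr G (fun w => X w + Y w).
Proof. by move=> /(msrP _ sG) h1 /(msrP _ sG) h2; apply/(msrP _ sG)/measurable_funD. Qed.

Lemma msrM X Y : msr G X -> msr G Y -> msr G (fun w => X w * Y w).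
Proof. by move=> /(msrP _ sG) h1 /(msrP _ sG) h2; apply/(msrP _ sG)/measurable_funM. Qed.

Lemma msrN X : msr G X -> msr G (fun w => - X w).
Proof.
by move=> h; under eq_fun do rewrite -mulN1r; apply: msrM => //; exact: msr_cst.
Qed.

Lemma msrB X Y : msr G X -> msr G Y -> msr G (fun w => X w - Y w).
Proof. by move=> h1 h2; apply: msrD => //; exact: msrN. Qed.

Lemma msr_sum (I : Type) (r : seq I) (Q : pred I) (X : I -> T -> R) :
 (forall i, msr G (X i)) -> msr G (fun w => \sum_(i <- r | Q i) X i w).
Proof. by move=> h; apply: (sum_fun_ind (K := msr G)) => //; [exact: msr_cst|exact: msrD]. Qed.

Lemma msr_prod (I : Type) (r : seq I) (Q : pred I) (X : I -> T -> R) :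
 (forall i, msr G (X i)) -> msr G (fun w => \prod_(i <- r | Q i) X i w).
Proof.
move=> h; rewrite (_ : (fun w => _) =
 \big[(fun g h w => g w * h w)/fun=> 1]_(i <- r | Q i) X i).
 by apply: big_ind => //; [exact: msr_cst|exact: msrM].
by apply/funext => w; apply/esym/(big_morph (fun g : T -> R => g w)).
Qed.

Lemma msr_indic A : G A -> msr G (\1_A : T -> R).
Proof.
move=> GA; apply/(msrP _ sG); apply: measurable_indic.
by rewrite /measurable/= sigma_algebra_id.
Qed.

Lemma msr_cvg (X : nat -> T -> R) Y : (forall n, msr G (X n)) ->
 (forall w, X n w @[n --> \oo] --> Y w) -> msr G Y.
Proof.
move=> h c; apply/(msrP _ sG).
apply: (@measurable_fun_cvg _ (g_sigma_algebraType G) _ _ X) => [m|x _]; last exact: c.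
by apply/(msrP _ sG).
Qed.

Lemma subalgT : G setT.
Proof. by case: sG => G0 GC _; have := GC _ G0; rewrite setD0. Qed.

Lemma subalgC A : G A -> G (~` A).
Proof. by case: sG => _ GC _ /GC; rewrite setTD. Qed.

Lemma subalg_bigcup (A : nat -> set T) : (forall n, G (A n)) -> G (\bigcup_n A n).
Proof. by case: sG => _ _; apply. Qed.

Lemma subalgI A B : G A -> G B -> G (A `&` B).
Proof.
move=> hA hB; rewrite -[A]setCK -[B]setCK -setCU -bigcup2E.
apply: subalgC => //; apply: subalg_bigcup => -[|[|n]] /=; [exact: subalgC..|].
by case: sG.
Qed.

End subalgebra.

Lemma perp_mul G Y Z : subalg G -> L2 Y -> msr G Y -> L2 Z -> perp G Z ->
 Ex (fun w => Y w * Z w) = 0.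
Proof.
by move=> sG hY mY hZ h; apply: Ex_orthogonal => // B mB; exact/h/mY.
Qed.

(** Pythagoras' theorem: second moments of martingale increments add up along a subdivision. *)
Lemma Ex_sqrD_perp G Y Z : subalg G -> L2 Y -> msr G Y -> L2 Z -> perp G Z ->
 Ex (fun w => (Y w + Z w) ^+ 2) = Ex (fun w => Y w ^+ 2) + Ex (fun w => Z w ^+ 2).
Proof.
move=> sG hY mY hZ pZ; have [_ LY] := hY; have [_ LZ] := hZ; have LYZ := L2_mul hY hZ.
rewrite (_ : (fun w => _) = (fun w => Y w ^+ 2 + Z w ^+ 2 + 2 * (Y w * Z w))); last by apply/funext => w; ring.
rewrite ExD; [|exact: L1D|exact: L1Z].
by rewrite ExD// ExZ// (perp_mul sG hY mY hZ pZ) mulr0 addr0.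
Qed.

Lemma perp_mulb G Y Z K : subalg G -> msr G Y -> (forall w, `|Y w| <= K) ->
 L2 Z -> perp G Z -> perp G (fun w => Y w * Z w).
Proof.
move=> sG mY YK hZ h A GA.
rewrite -[RHS](@perp_mul G (fun w => \1_A w * Y w) Z)//.
- by congr Ex; apply/funext => w; rewrite mulrA.
- have m : measf (fun w => \1_A w * Y w).
  apply: (msr_meas sG); apply: msrM => //; first by case: sG.
  by apply: msr_indic => //; case: sG.
 apply: (L2_bounded (K := K) m) => w; rewrite normrM indicE.
 by case: (_ \in _); rewrite ?normr1 ?normr0 ?mul1r// mul0r (le_trans _ (YK w)).
- by apply: msrM => //; [case: sG|apply: msr_indic => //; case: sG].
Qed.

Lemma perpD G Y Z : subalg G -> L2 Y -> L2 Z -> perp G Y -> perp G Z ->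
 perp G (fun w => Y w + Z w).
Proof.
move=> sG hY hZ pY pZ A GA.
have hi X : L2 X -> L1 (fun w => \1_A w * X w).
 by move=> /L2_L1; apply: L1_indicM; case: sG => _; exact.
rewrite (_ : (fun w => _) = (fun w => \1_A w * Y w + \1_A w * Z w)).
 by rewrite ExD ?pY ?pZ ?addr0//; exact: hi.
by apply/funext => w; rewrite mulrDr.
Qed.

Lemma perp0 G : perp G (fun=> 0).
Proof. by move=> A _; under eq_fun do rewrite mulr0; rewrite Ex_cst. Qed.

Lemma perp_sum G (I : Type) (r : seq I) (Q : pred I) (X : I -> T -> R) :
 subalg G -> (forall i, L2 (X i)) -> (forall i, perp G (X i)) ->
 perp G (fun w => \sum_(i <- r | Q i) X i w).
Proof.
move=> sG h p; suff : L2 (fun w => \sum_(i <- r | Q i) X i w) /\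
 perp G (fun w => \sum_(i <- r | Q i) X i w) by case.
apply: (sum_fun_ind (K := fun f => L2 f /\ perp G f)) => //.
 by split; [exact: L2_cst|exact: perp0].
by move=> f g [? ?] [? ?]; split; [exact: L2D|exact: perpD].
Qed.

Lemma perp_sub G H Z : G `<=` H -> perp H Z -> perp G Z.
Proof. by move=> GH h A /GH; exact: h. Qed.

End expectation.

(** The inequality at [e] and at [- e] compares the slopes in both directions up to an error of
    second order. It extracts moments from exponential integrals without differentiation under the
    integral sign. *)
Lemma tangent_eq (R : realFieldType) (x y c dl : R) : 0 < dl ->
 (forall e : R, `|e| <= dl -> e * x <= e * y + e ^+ 2 * c) -> x = y.
Proof.
move=> dl0 h; apply/eqP; rewrite -subr_eq0 -normr_eq0 eq_le normr_ge0 andbT.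
apply/ler_addgt0Pr => e e0; rewrite add0r.
have c0 : 0 < `|c| + 1 by rewrite ltr_wpDl.
pose b := Num.min dl (e / (`|c| + 1)).
have b0 : 0 < b by rewrite lt_min dl0 divr_gt0.
have bd : `|b| <= dl by rewrite gtr0_norm// ge_min lexx.
have bc : b * c <= e.
 have : b <= e / (`|c| + 1) by rewrite ge_min lexx orbT.
 by rewrite ler_pdivlMr//; have := ler_norm c; nra.
have := h b bd; have := h (- b); rewrite normrN => /(_ bd) h1 h2.
by rewrite ler_norml; apply/andP; split; rewrite -(ler_pM2l b0); nra.
Qed.

(** * Integration against a measure given by a density *)

Section density.
Context {d} {T : measurableType d} {R : realType}.
Variables (mu nu : {measure set T -> \bar R}) (g : T -> R).
Hypotheses (mg : measf g) (g0 : forall x, 0 <= g x).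
Hypothesis nuE : forall A, measurable A -> nu A = (\int[mu]_(x in A) (g x)%:E)%E.

Import HBNNSimple.

Let density_nnsfun (f : {nnsfun T >-> R}) :
 (\int[nu]_x (f x)%:E = \int[mu]_x (f x * g x)%:E)%E.
Proof.
under [LHS]eq_integral do rewrite fimfunE -fsumEFin//.
rewrite [LHS]ge0_integral_fsum//; last 2 first.
 - by move=> r; exact/measurable_EFinP/measurableT_comp.
 - by move=> n x _; rewrite EFinM nnfun_muleindic_ge0.
under [RHS]eq_integral.
 move=> x xD; rewrite EFinM fimfunE -fsumEFin// ge0_mule_fsuml; last by move=> r; rewrite EFinM nnfun_muleindic_ge0.
 over.
rewrite [RHS]ge0_integral_fsum//; last 2 first.
 - move=> r; rewrite -[X in measurable_fun _ X]/(fun x => (_ * _)%:E).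
  by apply/measurable_EFinP/measurable_funM => //; exact/measurableT_comp.
 - move=> n x _; apply: mule_ge0; last by rewrite lee_fin.
  by rewrite EFinM nnfun_muleindic_ge0.
apply: eq_fsbigr => r _.
rewrite integralZl_indic_nnsfun//= integral_indic//= setIT nuE//.
under [RHS]eq_integral do rewrite -EFinM -mulrA EFinM.
have [->|r0] := eqVneq r 0.
 by rewrite mul0e; under eq_integral do rewrite mul0e; rewrite integral0.
have [fr0|] := eqVneq (f @^-1` [set r]) set0.
 rewrite fr0 integral_set0 mule0; under eq_integral do rewrite indicE in_set0 mul0r mule0.
 by rewrite integral0.
move=> /set0P[x0 /= fx0]; have rp : 0 <= r by rewrite -fx0.
rewrite ge0_integralZl//; last 2 first.
 - by apply/measurable_EFinP/measurable_funM => //; exact/measurable_indic.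
 - by move=> x _; rewrite lee_fin mulr_ge0// indicE.
congr (_ * _)%E; rewrite integral_mkcond; apply: eq_integral => x _.
by rewrite patchE indicE; case: (_ \in _); rewrite ?mul1r ?mul0r.
Qed.

Lemma ge0_integral_density (f : T -> R) :
 measf f -> (forall x, 0 <= f x) ->
 (\int[nu]_x (f x)%:E = \int[mu]_x (f x * g x)%:E)%E.
Proof.
move=> mf f0.
have mEf : measf (EFin \o f) by exact/measurable_EFinP.
pose f_ := nnsfun_approx measurableT mEf.
have fc x : (f_ n x)%:E @[n --> \oo] --> (f x)%:E.
 by apply: cvg_nnsfun_approx => // *; rewrite lee_fin.
transitivity (lim (\int[nu]_x (f_ n x)%:E @[n --> \oo])%E).
 rewrite -monotone_convergence//=.
 - by apply: eq_integral => x _; apply/esym/cvg_lim => //=.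
 - by move=> n; exact/measurable_EFinP/measurable_funTS.
 - by move=> n ? _; rewrite lee_fin.
 - by move=> ? _ ? ? mn; rewrite lee_fin; exact/lefP/nd_nnsfun_approx.
under eq_fun do rewrite density_nnsfun.
rewrite -monotone_convergence//=.
- apply: eq_integral => x _; apply/cvg_lim => //.
 rewrite EFinM; under eq_fun do rewrite EFinM.
 by apply: cvgeZr => //; exact: fc.
- by move=> n; apply/measurable_EFinP/measurable_funM => //; exact/measurable_funTS.
- by move=> n ? _; rewrite lee_fin mulr_ge0.
- move=> ? _ ? ? mn; rewrite lee_fin ler_wpM2r//; exact/lefP/nd_nnsfun_approx.
Qed.

End density.

(** * Exponential integrals and low moments of an independent Gaussian variable *)

Section gaussian.
Context {R : realType}.
Implicit Types (a b s x : R).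

(** Completing the square: with [r] the inverse square root of [1 + 2 a s^2], the integrand times
    the density of [N(0, s)] is a constant times the normal density of mean [b (r s)^2] and standard
    deviation [r s]. *)
Lemma integral_normal_expR a b s : 0 < s -> 0 < 1 + 2 * a * s ^+ 2 ->
 exists r : R, [/\ 0 < r, r ^+ 2 * (1 + 2 * a * s ^+ 2) = 1 &
  (\int[normal_prob 0 s]_x (expR (b * x - a * x ^+ 2))%:E =
   (r * expR (b ^+ 2 * (r * s) ^+ 2 / 2))%:E)%E].
Proof.
move=> s0 q0; set q := 1 + _ in q0 *.
pose r : R := (Num.sqrt q)^-1; have r0 : 0 < r by rewrite invr_gt0 sqrtr_gt0.
have rq : r ^+ 2 * q = 1.
 by rewrite /r exprVn sqr_sqrtr ?ltW// mulVf// gt_eqF.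
exists r; split => //.
have sn0 : s != 0 by rewrite gt_eqF.
have rn0 : r != 0 by rewrite gt_eqF.
have rs0 : r * s != 0 by rewrite mulf_neq0.
have mE : measf (fun x : R => expR (b * x - a * x ^+ 2)).
 apply: measurableT_comp => //; apply: measurable_funB; apply: measurable_funM => //.
transitivity (\int[lebesgue_measure]_x
  (expR (b * x - a * x ^+ 2) * normal_pdf 0 s x)%:E)%E.
 apply: ge0_integral_density => //; first exact: measurable_normal_pdf.
 by move=> x; exact: normal_pdf_ge0.
transitivity (\int[lebesgue_measure]_x ((r * expR (b ^+ 2 * (r * s) ^+ 2 / 2))%:E *
   (normal_pdf (b * (r * s) ^+ 2) (r * s) x)%:E))%E; last first.
 rewrite ge0_integralZl//= ?integral_normal_pdf ?mule1//.
 - by apply/measurable_EFinP; exact: measurable_normal_pdf.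
 - by move=> x _; rewrite lee_fin normal_pdf_ge0.
 - by rewrite lee_fin mulr_ge0// ltW.
apply: eq_integral.
 move=> x _; rewrite -EFinM; congr EFin.
 rewrite !normal_pdfE// /normal_fun subr0.
 have -> : normal_peak s = r * normal_peak (r * s).
  have e : Num.sqrt ((r * s) ^+ 2 * pi *+ 2) = r * Num.sqrt (s ^+ 2 * pi *+ 2).
   by rewrite exprMn -mulrA -mulrnAr sqrtrM ?sqr_ge0// sqrtr_sqr gtr0_norm.
  by rewrite /normal_peak e invfM mulrA mulfV// mul1r.
 suff H : expR (b * x - a * x ^+ 2) * expR (- x ^+ 2 / (s ^+ 2 *+ 2)) =
  expR (b ^+ 2 * (r * s) ^+ 2 / 2) *
  expR (- (x - b * (r * s) ^+ 2) ^+ 2 / ((r * s) ^+ 2 *+ 2)).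
  by rewrite mulrCA H mulrACA.
 rewrite -!expRD; congr expR.
 have -> : a = (r ^- 2 - 1) / (2 * s ^+ 2).
  have -> : r ^- 2 = q by rewrite -[RHS]mul1r -(mulVf (expf_neq0 2 rn0)) -mulrA rq mulr1.
  by rewrite /q; field.
by field; rewrite sn0 rn0.
Qed.

End gaussian.

Section independent_gaussian.
Context {d} {T : measurableType d} {R : realType} (P : probability T R).
Local Notation Ex := (Ex P).
Variables (A : set T) (X : T -> R) (s : R).
Hypotheses (mA : measurable A) (mX : measf X) (s0 : 0 < s).
Hypothesis indep : forall B, measurable B ->
 P (A `&` X @^-1` B) = (P A * normal_prob 0 s B)%E.

Let p := fine (P A).

(** By [indep], the image under [X] of [P] restricted to [A] is [P A] times the normal law. *)
Lemma indep_integral (f : R -> R) : measf f -> (forall x, 0 <= f x) ->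
 (\int[P]_w (\1_A w * f (X w))%:E = P A * \int[normal_prob 0 s]_x (f x)%:E)%E.
Proof.
move=> mf f0.
have pE : P A = p%:E by rewrite fineK// fin_num_measure.
have p0 : 0 <= p by rewrite fine_ge0.
pose Rm := measurableTypeR R.
pose X' : T -> Rm := X; have mX' : measf X' by exact: mX.
pose f' : Rm -> R := f; have mf' : measf f' by exact: mf.
have mEf := (@measurable_EFinP _ Rm R setT f').2 mf'.
transitivity (\int[mrestr P mA]_w (f' (X' w))%:E)%E.
 rewrite (@ge0_integral_density _ _ _ P (mrestr P mA) (\1_A : T -> R)).
 - by apply: eq_integral => w _; rewrite mulrC.
 - exact: measurable_indic.
 - by move=> x; rewrite indicE.
 - by move=> B mB; rewrite integral_indic//= /mrestr setIC.
 - exact: (measurableT_comp mf' mX').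
 - by move=> x; exact: f0.
transitivity (\int[pushforward (mrestr P mA) X']_x (f' x)%:E)%E.
 by rewrite ge0_integral_pushforward// => x _; rewrite lee_fin f0.
transitivity (\int[mscale (NngNum p0) (normal_prob 0 s)]_x (f' x)%:E)%E; last by rewrite ge0_integral_mscale// ?pE// => x _; rewrite lee_fin f0.
apply: eq_measure_integral => B mB _.
by rewrite /= /pushforward /mrestr /mscale/= setIC indep// pE.
Qed.

Lemma indep_exp a b : 0 < 1 + 2 * a * s ^+ 2 ->
 exists r : R, [/\ 0 < r, r ^+ 2 * (1 + 2 * a * s ^+ 2) = 1,
  L1 P (fun w => \1_A w * expR (b * X w - a * X w ^+ 2)) &
  Ex (fun w => \1_A w * expR (b * X w - a * X w ^+ 2)) =
  p * (r * expR (b ^+ 2 * (r * s) ^+ 2 / 2))].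
Proof.
move=> q0; have [r [r0 rq h]] := integral_normal_expR b s0 q0.
exists r; have mE : measf (fun x : R => expR (b * x - a * x ^+ 2)).
 apply: measurableT_comp => //; apply: measurable_funB; apply: measurable_funM => //.
have pE : P A = p%:E by rewrite fineK// fin_num_measure.
have := indep_integral mE (fun x => expR_ge0 _); rewrite h pE -EFinM => e.
split => //; last by rewrite /Ex /Rintegral e.
apply/integrableP; split.
 apply/measurable_EFinP/measurable_funM; first exact: measurable_indic.
 exact: (measurableT_comp mE mX).
rewrite (eq_integral (fun w => (\1_A w * expR (b * X w - a * X w ^+ 2))%:E)).
 by rewrite e ltry.
by move=> w _; rewrite /= ger0_norm// mulr_ge0// ?indicE// expR_ge0.
Qed.

Let mIX (f : R -> R) : measf f ->
 measf (fun w => \1_A w * f (X w)).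
Proof.
by move=> mf; apply: measurable_funM; [exact: measurable_indic|exact: measurableT_comp].
Qed.

Lemma expR_ge_sqr (y : R) : 0 <= y -> y ^+ 2 <= 4 * expR y.
Proof.
move=> y0; have h : 1 + y / 2 <= expR (y / 2) by exact: expR_ge1Dx.
have -> : expR y = expR (y / 2) ^+ 2.
 by rewrite expr2 -expRD; congr expR; field.
have : 0 <= y / 2 by rewrite divr_ge0.
by nra.
Qed.

(** The choice [a = - 1 / (4 s^2)] gives [1 + 2 a s^2 = 1 / 2], so that [y = X^2 / (4 s^2)] has an
    exponential moment. From [y^2 <= 4 exp y] follows [X^4 <= 64 s^4 exp y], and [r <= 2] turns [64]
    into [128]. *)
Lemma indep_moment4 : L1 P (fun w => \1_A w * X w ^+ 4) /\
 Ex (fun w => \1_A w * X w ^+ 4) <= p * (128 * s ^+ 4).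
Proof.
have sn0 : s != 0 by rewrite gt_eqF.
pose a := - (4 * s ^+ 2)^-1.
have q : 1 + 2 * a * s ^+ 2 = 2^-1 by rewrite /a; field.
have [|r [r0 rq hL hE]] := @indep_exp a 0; first by rewrite q invr_gt0.
have le w : `|\1_A w * X w ^+ 4| <=
  64 * s ^+ 4 * (\1_A w * expR (0 * X w - a * X w ^+ 2)).
 rewrite (mulrCA _ (\1_A w)); have [->|->] := @indic01 _ _ R A w; rewrite ?mul1r ?mul0r ?mulr0 ?normr0//.
 rewrite ger0_norm; last by rewrite (exprM _ 2 2) sqr_ge0.
 have y0 : 0 <= X w ^+ 2 / (4 * s ^+ 2).
  by rewrite divr_ge0 ?sqr_ge0// mulr_ge0// sqr_ge0.
 have := expR_ge_sqr y0.
 have -> : X w ^+ 2 / (4 * s ^+ 2) = 0 * X w - a * X w ^+ 2 by rewrite /a; field.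
 move=> h; have : 16 * s ^+ 4 * (0 * X w - a * X w ^+ 2) ^+ 2 <=
  16 * s ^+ 4 * (4 * expR (0 * X w - a * X w ^+ 2)).
  by rewrite ler_wpM2l// mulr_ge0// (exprM _ 2 2) sqr_ge0.
 have -> : 16 * s ^+ 4 * (0 * X w - a * X w ^+ 2) ^+ 2 = X w ^+ 4.
  by rewrite /a; field.
 by move/le_trans; apply; rewrite mul0r; apply: eq_ler; ring.
have h4 : L1 P (fun w => \1_A w * X w ^+ 4).
 by apply: (L1_le _ le); [apply: (mIX (f := fun x => x ^+ 4)); exact: measurable_funX|exact: L1Z].
split => //.
apply: (@le_trans _ _ (64 * s ^+ 4 * (p * (r * expR (0 ^+ 2 * (r * s) ^+ 2 / 2))))).
 rewrite -hE -ExZ//; apply: Ex_le => //; first exact: L1Z.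
 by move=> w; exact: le_trans (ler_norm _) (le w).
rewrite expr0n/= !mul0r expR0 mulr1 mulrCA ler_wpM2l ?fine_ge0//.
have r2 : r <= 2 by rewrite q in rq; nra.
have : 0 <= s ^+ 4 by rewrite (exprM _ 2 2) sqr_ge0.
by nra.
Qed.

(** The bound [1 - a X^2 <= exp (- a X^2)], integrated over [A], has the right slope at [a = 0] and
    an error of order [a^2]; [tangent_eq] then yields an equality. *)
Lemma indep_moment2 : L1 P (fun w => \1_A w * X w ^+ 2) /\
 Ex (fun w => \1_A w * X w ^+ 2) = p * s ^+ 2.
Proof.
have hA := L1_indic P mA; have p0 : 0 <= p by rewrite fine_ge0.
have h2 : L1 P (fun w => \1_A w * X w ^+ 2).
 apply: (L1_le _ _ (L1D hA indep_moment4.1)).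
  by apply: (mIX (f := fun x => x ^+ 2)); exact: measurable_funX.
 move=> w; have [->|->] := @indic01 _ _ R A w; rewrite ?mul1r ?mul0r ?addr0 ?normr0//.
 by rewrite ger0_norm ?sqr_ge0// (exprM _ 2 2); nra.
split => //; have s2 : 0 < s ^+ 2 by rewrite exprn_gt0.
have dl0 : 0 < (4 * s ^+ 2)^-1 by rewrite invr_gt0 mulr_gt0.
apply: (tangent_eq (c := 4 * p * s ^+ 4) dl0) => e.
rewrite ler_norml -div1r ler_pdivlMr ?mulr_gt0// => /andP[_ e1].
set a := - e; have q2 : 2^-1 <= 1 + 2 * a * s ^+ 2 by rewrite /a; lra.
have [|r [r0 rq hL hE]] := @indep_exp a 0; first by lra.
apply: (@le_trans _ _ (p * (r - 1))).
 rewrite mulrBr mulr1 -[X in _ - X](Ex_indic P mA).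
 have -> : p * r = Ex (fun w => \1_A w * expR (0 * X w - a * X w ^+ 2)).
  by rewrite hE expr0n/= !mul0r expR0 mulr1.
 rewrite -ExZ// -ExB//; apply: Ex_le; [exact: L1Z|exact: L1B|move=> w].
 have [->|->] := @indic01 _ _ R A w; rewrite ?mul1r ?mul0r ?mulr0 ?subr0//.
 rewrite lerBrDl; have := expR_ge1Dx (0 * X w - a * X w ^+ 2).
 by rewrite mul0r sub0r /a mulNr opprK.
have -> : e * (p * s ^+ 2) + e ^+ 2 * (4 * p * s ^+ 4) =
 p * (- (2 * a * s ^+ 2) / 2 + (2 * a * s ^+ 2) ^+ 2) by rewrite /a; field.
(* What is left is [r <= 1 - t / 2 + t ^+ 2], where [r] is the inverse square root of [1 + t] and
   [t >= - 1 / 2]. Squaring makes it a polynomial inequality. *)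
rewrite ler_wpM2l// lerBlDl; move: rq q2; set t := 2 * a * s ^+ 2 => rq q2.
rewrite -(ler_pXn2r (ltn0Sn 1)) ?nnegrE ?(ltW r0)//; last by nra.
have z0 : 0 < 1 + t by lra.
rewrite -(ler_pM2r z0) rq.
have -> : (1 + (- t / 2 + t ^+ 2)) ^+ 2 * (1 + t) =
 1 + t ^+ 2 * (5 / 4 + 5 / 4 * t + t ^+ 3) by field.
rewrite lerDl mulr_ge0 ?sqr_ge0//.
have [t0|t0] := leP 0 t; first by rewrite addr_ge0 ?exprn_ge0//; lra.
have : t ^+ 2 <= 4^-1 by nra.
by rewrite exprS; nra.
Qed.

(** The same tangent argument in the parameter [b], starting from [1 + b X <= exp (b X)]. *)
Lemma indep_moment1 : L1 P (fun w => \1_A w * X w) /\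
 Ex (fun w => \1_A w * X w) = 0.
Proof.
have hA := L1_indic P mA; have p0 : 0 <= p by rewrite fine_ge0.
have h1 : L1 P (fun w => \1_A w * X w).
 apply: (L1_le _ _ (L1D hA indep_moment2.1)); first exact: (mIX (f := id)).
 move=> w; have [->|->] := @indic01 _ _ R A w; rewrite ?mul1r ?mul0r ?addr0 ?normr0//.
 by rewrite -(real_normK (num_real (X w))); nra.
split => //; apply: (tangent_eq (c := p * (s ^+ 2 * expR (s ^+ 2))) ltr01) => b b1.
have [|r [r0 rq hL hE]] := @indep_exp 0 b; first by rewrite mulr0 mul0r addr0.
have r1 : r = 1 by move: rq; rewrite mulr0 mul0r addr0 mulr1 => rq; nra.
rewrite r1 !mul1r in hE.
have b2 : b ^+ 2 <= 1 by rewrite -(real_normK (num_real b)) expr_le1.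
have e1 : expR (b ^+ 2 * s ^+ 2 / 2) - 1 <= b ^+ 2 * (s ^+ 2 * expR (s ^+ 2)).
 have y0 : 0 <= b ^+ 2 * s ^+ 2 / 2 by rewrite divr_ge0// mulr_ge0 ?sqr_ge0.
 have := expR_ge1Dx (- (b ^+ 2 * s ^+ 2 / 2)); rewrite expRN.
 set y := b ^+ 2 * s ^+ 2 / 2 in y0 *.
 have ep := expR_gt0 y; rewrite -(ler_pM2r ep) mulVf ?gt_eqF// => h.
 apply: (@le_trans _ _ (y * expR y)); first by lra.
 have h2 : expR y <= expR (s ^+ 2) by rewrite ler_expR /y; have := sqr_ge0 s; nra.
 apply: (le_trans (ler_wpM2l y0 h2)).
 rewrite mulrA ler_wpM2r ?expR_ge0// /y ler_pdivrMr// ler_peMr ?ler1n//.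
 by rewrite mulr_ge0 ?sqr_ge0.
rewrite mulr0 add0r (mulrCA _ p); apply: le_trans (ler_wpM2l p0 e1).
rewrite mulrBr mulr1 -hE -[X in _ - X](Ex_indic P mA) -ExZ// -ExB//.
apply: Ex_le; [exact: L1Z|exact: L1B|move=> w].
have [->|->] := @indic01 _ _ R A w; rewrite ?mul1r ?mul0r ?mulr0 ?subr0//.
by rewrite lerBrDl expR_ge1Dx.
Qed.

End independent_gaussian.

(** * Elementary quadratic inequalities *)

Lemma sqr_sum_le (R : realFieldType) (I : finType) (a : I -> R) :
 (\sum_i a i) ^+ 2 <= #|I|%:R * \sum_i a i ^+ 2.
Proof.
rewrite expr2 big_distrlr /=.
have -> : #|I|%:R * \sum_i a i ^+ 2 =
  \sum_i \sum_j (a i ^+ 2 / 2 + a j ^+ 2 / 2).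
 under [RHS]eq_bigr => i _ do rewrite big_split/= sumr_const.
 rewrite big_split/= sumrMnl sumr_const -mulrnDl -big_split/= mulr_natl.
 by congr (_ *+ _); apply: eq_bigr => i _; field.
apply: ler_sum => i _; apply: ler_sum => j _.
by have := sqr_ge0 (a i - a j); nra.
Qed.

Section real_inequalities.
Variable R : realFieldType.
Implicit Types a b p r m M L : R.

Lemma sqr_mulB_le a b p :
 (a * b - p) ^+ 2 <= (a ^+ 2) ^+ 2 + (b ^+ 2) ^+ 2 + 2 * p ^+ 2.
Proof.
have := sqr_ge0 (a ^+ 2 - b ^+ 2); have := sqr_ge0 (a * b + p).
have -> : (a * b + p) ^+ 2 = 2 * (a ^+ 2 * b ^+ 2) + 2 * p ^+ 2 - (a * b - p) ^+ 2 by ring.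
have -> : (a ^+ 2 - b ^+ 2) ^+ 2 = (a ^+ 2) ^+ 2 + (b ^+ 2) ^+ 2 - 2 * (a ^+ 2 * b ^+ 2) by ring.
lra.
Qed.

Lemma sqr_add3_le a b p : (a + b + p) ^+ 2 <= 3 * (a ^+ 2 + b ^+ 2 + p ^+ 2).
Proof.
have := sqr_ge0 (a - b); have := sqr_ge0 (a - p); have := sqr_ge0 (b - p).
nra.
Qed.

(** If [|M + m| <= L] then [|r| <= 2 L]. Otherwise [|r|] is at most four times the larger of [|M|]
    and [|m|]; when this is [|M|], then [L < 2 |M|], and [16 M^2] is at most [64 M^4 / L^2]. So a
    remainder small in L1 becomes small in L2 when the whole increment is bounded. *)
Lemma sqr_remainder_le r M m L : 0 < L -> `|r + M + m| <= L ->
 r ^+ 2 <= 2 * L * `|r| + 64 / L ^+ 2 * M ^+ 4 + 16 * m ^+ 2.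
Proof.
move=> L0 zL; rewrite -(real_normK (num_real r)) -(real_normK (num_real m)).
have -> : M ^+ 4 = (`|M| ^+ 2) ^+ 2 by rewrite real_normK ?num_real// -exprM.
have n0 := normr_ge0 r; have m0 := normr_ge0 m; have M0 := normr_ge0 M.
have q0 : 0 <= 64 / L ^+ 2 * (`|M| ^+ 2) ^+ 2 by rewrite mulr_ge0 ?divr_ge0 ?sqr_ge0.
have m20 := sqr_ge0 `|m|.
have Ln := mulr_ge0 (ltW L0) n0.
have rl : `|r| <= L + `|M + m|.
 rewrite -[in leLHS](addrK (M + m) r) (le_trans (ler_normB _ _))// addrA.
 by rewrite lerD2r.
have [le|gt] := leP `|M + m| L.
 have : `|r| * `|r| <= 2 * L * `|r| by rewrite ler_wpM2r//; lra.
 by rewrite -expr2; lra.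
have MmL := ler_normD M m.
have [Mm|mM] := leP `|m| `|M|.
 have h : `|r| <= 4 * `|M| by lra.
 have : `|r| ^+ 2 <= 64 / L ^+ 2 * (`|M| ^+ 2) ^+ 2.
  apply: (@le_trans _ _ (16 * `|M| ^+ 2)).
   rewrite (_ : 16 = 4 ^+ 2) -?exprMn ?lerXn2r ?nnegrE ?mulr_ge0//.
   by rewrite -natrX.
  have q1 := sqr_ge0 `|M|; set q := `|M| ^+ 2 in q1 *.
  rewrite (_ : 64 / L ^+ 2 * q ^+ 2 = 64 / L ^+ 2 * q * q); last by rewrite expr2 mulrA.
  rewrite ler_wpM2r// /q mulrAC ler_pdivlMr ?exprn_gt0//.
  have : L ^+ 2 <= (2 * `|M|) ^+ 2.
   by rewrite lerXn2r ?nnegrE ?(ltW L0) ?mulr_ge0//; lra.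
  by rewrite exprMn; lra.
 by lra.
have h : `|r| <= 4 * `|m| by lra.
have : `|r| ^+ 2 <= 16 * `|m| ^+ 2.
 rewrite (_ : 16 = 4 ^+ 2) -?exprMn ?lerXn2r ?nnegrE ?mulr_ge0//.
 by rewrite -natrX.
by lra.
Qed.

End real_inequalities.

(** * Brownian increments: independence of the past and moments *)

Section brownian.
Context {d} {T : measurableType d} {R : realType} (P : probability T R)
 (F : R -> set (set T)) (hF : complete_filtration P F)
 (Iw : finType) (W : Iw -> R -> T -> R) (hW : brownian_motion P F W).
Local Notation Ex := (Ex P).
Local Notation L1 := (L1 P).
Local Notation L2 := (L2 P).
Local Notation perp := (perp P).

Lemma filt_alg t : 0 <= t -> subalg (F t).
Proof. by move=> t0; case: hF => h1 h2 _ _; split; [exact: h1|exact: h2]. Qed.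

Lemma filt_sa t : 0 <= t -> sigma_algebra setT (F t).
Proof. by move=> /filt_alg[]. Qed.

Lemma filt_le s t : 0 <= s -> s <= t -> F s `<=` F t.
Proof. by case: hF => _ _ h _; exact: h. Qed.

Definition dW (v : Iw) (s t : R) (w : T) : R := W v t w - W v s w.

Lemma W_msr v t : 0 <= t -> msr (F t) (W v t).
Proof. by move=> t0; case: hW => h _ _; have [h1 _] := h v; exact: h1. Qed.

Lemma dW_msr v s t : 0 <= s -> s <= t -> msr (F t) (dW v s t).
Proof.
move=> s0 st; have t0 := le_trans s0 st.
apply: msrB; [exact: filt_sa|exact: W_msr|].
exact: msr_sub (filt_le s0 st) (W_msr _ s0).
Qed.

Lemma dW_meas v s t : 0 <= s -> s <= t -> measf (dW v s t).
Proof.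
move=> s0 st; apply: (msr_meas (filt_alg (le_trans s0 st))).
exact: dW_msr.
Qed.

Lemma measurable_dW_preimage v s t B : 0 <= s -> s <= t -> measurable B ->
 measurable (dW v s t @^-1` B).
Proof.
by move=> s0 st mB; rewrite -[X in measurable X]setTI; exact: dW_meas.
Qed.

Let Nst (s t : R) : set R -> \bar R := normal_prob 0 (Num.sqrt (t - s)).

Let NT s t : Nst s t setT = 1%E.
Proof. by have := @probability_setT _ _ _ (normal_prob 0 (Num.sqrt (t - s))). Qed.

Lemma dW_indep v s t A B : 0 <= s -> s < t -> F s A -> measurable B ->
 P (A `&` dW v s t @^-1` B) = (P A * normal_prob 0 (Num.sqrt (t - s)) B)%E.
Proof.
move=> s0 st FA mB; case: hW => _ _ h.
have := h s t s0 st A FA (fun i => if i == v then B else setT).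
rewrite (bigD1 v)//= eqxx big1 ?mule1 => [<-|i /negbTE ->]; last exact: NT.
- congr (P (_ `&` _)); apply/seteqP; split => w /=.
  by move=> hw i; case: eqP => [->|].
 by move=> /(_ v); rewrite eqxx.
- by move=> i; case: ifP.
Qed.

(** The condition on the increment of [v'] is moved into the event [A], so that the lemmas on one
    Gaussian variable apply to [v] given the increment of [v']. *)
Lemma dW_indep2 v v' s t A B B' : v != v' -> 0 <= s -> s < t -> F s A ->
 measurable B -> measurable B' ->
 P ((A `&` dW v' s t @^-1` B') `&` dW v s t @^-1` B) =
 (P (A `&` dW v' s t @^-1` B') * normal_prob 0 (Num.sqrt (t - s)) B)%E.
Proof.
move=> vv' s0 st FA mB mB'; rewrite [X in _ = (X * _)%E]dW_indep//; case: hW => _ _ h.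
have := h s t s0 st A FA (fun i => if i == v then B else if i == v' then B' else setT).
have v'v : (v' == v) = false by rewrite eq_sym (negbTE vv').
rewrite (bigD1 v)//= eqxx (bigD1 v')/= ?v'v// eqxx.
rewrite big1 ?mule1 => [|i /andP[/negbTE -> /negbTE ->]]; last exact: NT.
rewrite -muleA [(normal_prob _ _ B' * _)%E]muleC => <-.
- congr (P _); apply/seteqP; split => w /=.
  by move=> [[hA h1] h2]; split => // i; case: eqP => [->//|_]; case: eqP => [->|].
 move=> [hA h1]; split; last by have := h1 v; rewrite eqxx.
 by split => //; have := h1 v'; rewrite eq_sym (negbTE vv') eqxx.
- by move=> i; case: ifP => // _; case: ifP.
Qed.

Lemma dW0 v s : dW v s s = fun=> 0.
Proof. by apply/funext => w; rewrite /dW subrr. Qed.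

Let sq4 (h : R) : 0 <= h -> Num.sqrt h ^+ 4 = h ^+ 2.
Proof. by move=> h0; rewrite (exprM _ 2 2) sqr_sqrtr. Qed.

Lemma dW_moment4 v s t : 0 <= s -> s <= t ->
 L1 (fun w => dW v s t w ^+ 4) /\ Ex (fun w => dW v s t w ^+ 4) <= 128 * (t - s) ^+ 2.
Proof.
move=> s0; rewrite le_eqVlt => /predU1P[<-|st].
 rewrite dW0 subrr [in leRHS]expr0n/= mulr0.
 have -> : (fun w : T => (0 : R) ^+ 4) = fun=> 0 by apply/funext => w; rewrite expr0n.
 by rewrite Ex_cst; split => //; exact: L1_cst.
have FT : F s setT by apply: subalgT; exact: filt_sa.
have h0 : 0 < t - s by rewrite subr_gt0.
have := @indep_moment4 _ _ _ P setT (dW v s t) (Num.sqrt (t - s)) measurableT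
 (dW_meas v s0 (ltW st)) _ _.
rewrite sqrtr_gt0 => /(_ h0) [B mB|]; first exact: dW_indep.
have -> : (fun w => \1_setT w * dW v s t w ^+ 4) = (fun w => dW v s t w ^+ 4).
 by apply/funext => w; rewrite indicT mul1r.
rewrite sq4 ?(ltW h0)// => h1 h2; split => //.
apply: (le_trans h2); rewrite ler_piMl//; first by rewrite mulr_ge0// sqr_ge0.
by rewrite -lee_fin fineK ?fin_num_measure// probability_le1.
Qed.

Lemma dW2_L2 v v' s t : 0 <= s -> s <= t -> L2 (fun w => dW v s t w * dW v' s t w).
Proof.
move=> s0 st; have [h _] := dW_moment4 v s0 st; have [h' _] := dW_moment4 v' s0 st.
have m : measf (fun w => dW v s t w * dW v' s t w).
 by apply: measurable_funM; exact: dW_meas.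
split => //; apply: (L1_le _ _ (L1D h h')); first exact: measurable_funX.
move=> w; rewrite ger0_norm ?sqr_ge0// exprMn !(exprM _ 2 2).
by have := sqr_ge0 (dW v s t w ^+ 2 - dW v' s t w ^+ 2); have := sqr_ge0 (dW v s t w ^+ 2 + dW v' s t w ^+ 2); nra.
Qed.

Lemma dW_L2 v s t : 0 <= s -> s <= t -> L2 (dW v s t).
Proof.
move=> s0 st; split; first exact: dW_meas.
by rewrite (_ : (fun w => _) = (fun w => dW v s t w * dW v s t w));
 [exact: L2_L1 (dW2_L2 v v s0 st)|apply/funext => w; rewrite expr2].
Qed.

Lemma dW_perp v s t : 0 <= s -> s <= t -> perp (F s) (dW v s t).
Proof.
move=> s0; rewrite le_eqVlt => /predU1P[<-|st]; first by rewrite dW0; exact: perp0.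
move=> A FA; have mA : measurable A by apply: (filt_alg s0).2.
have h0 : 0 < Num.sqrt (t - s) by rewrite sqrtr_gt0 subr_gt0.
by have [] := indep_moment1 mA (dW_meas v s0 (ltW st)) h0 (fun B => dW_indep v s0 st FA).
Qed.

Lemma dW2_perp v v' s t : 0 <= s -> s <= t ->
 perp (F s) (fun w => dW v s t w * dW v' s t w - (v == v')%:R * (t - s)).
Proof.
move=> s0; rewrite le_eqVlt => /predU1P[<-|st].
 rewrite !dW0 subrr mulr0; rewrite (_ : (fun w => _) = fun=> 0); first exact: perp0.
 by apply/funext => w; rewrite mulr0 subr0.
move=> A FA; have mA : measurable A by apply: (filt_alg s0).2.
have h0 : 0 < Num.sqrt (t - s) by rewrite sqrtr_gt0 subr_gt0.
have st' := ltW st.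
have iA : L1 (fun w => \1_A w * (dW v s t w * dW v' s t w)).
 by apply/L1_indicM/L2_L1/dW2_L2.
rewrite (_ : (fun w => _) = (fun w => \1_A w * (dW v s t w * dW v' s t w) -
  (v == v')%:R * (t - s) * \1_A w)); last by apply/funext => w; ring.
rewrite ExB//; last exact/L1Z/L1_indic.
rewrite ExZ; last exact: L1_indic.
rewrite Ex_indic//; have [<-|vv'] := eqVneq v v'.
 have [_] := indep_moment2 mA (dW_meas v s0 st') h0 (fun B => dW_indep v s0 st FA).
 rewrite sqr_sqrtr ?subr_ge0// => e; rewrite mul1r.
 rewrite (_ : (fun w => _) = (fun w => \1_A w * dW v s t w ^+ 2)) ?e; first by ring.
 by apply/funext => w; rewrite expr2.
rewrite mul0r mul0r subr0.
(* For distinct coordinates, [dW v'] is tested through its preimages, which [dW_indep2] counts among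
   the events independent of [dW v]. *)
rewrite (_ : (fun w => _) = (fun w => dW v' s t w * (\1_A w * dW v s t w))); last by apply/funext => w; ring.
apply: (@Ex_orthogonal _ _ _ P).
- exact: dW_L2.
- by apply: L2_indicM => //; exact: dW_L2.
move=> B mB; have mB' := measurable_dW_preimage v' s0 st' mB.
have [_ <-] := @indep_moment1 _ _ _ P (A `&` dW v' s t @^-1` B) _ _ (measurableI _ _ mA mB')
 (dW_meas v s0 st') h0 (fun B1 mB1 => dW_indep2 vv' s0 st FA mB1 mB).
by congr Ex; apply/funext => w; rewrite indicI mulrCA mulrA.
Qed.

Lemma dW_moment2 v s t : 0 <= s -> s <= t -> Ex (fun w => dW v s t w ^+ 2) = t - s.
Proof.
move=> s0 st; have := dW2_perp v v s0 st (subalgT (filt_sa s0)).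
rewrite eqxx mul1r.
rewrite (_ : (fun w => _) = (fun w => dW v s t w ^+ 2 - (t - s))); last by apply/funext => w; rewrite indicT mul1r expr2.
rewrite ExB ?Ex_cst; [|exact: (dW_L2 v s0 st).2|exact: L1_cst].
by move/eqP; rewrite subr_eq0 => /eqP.
Qed.

(** * The calculus of germs *)

Section germs.
Variable Th : Type.
Implicit Types (Z : Th -> R -> R -> T -> R) (b Y : Th -> R -> T -> R).
Implicit Types (th : Th -> Iw -> R -> T -> R).

(** Bounded adapted processes with a parameter. One bound [K] serves all parameters and times, which
    keeps every later estimate uniform in the starting point. *)
Definition bap Y := exists2 K : R, 0 < K &
 forall x t, 0 <= t -> msr (F t) (Y x t) /\ (forall w, `|Y x t w| <= K).

Definition bapI th := forall v, bap (fun x => th x v).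

Definition stoch th x s t w := \sum_v th x v s w * dW v s t w.

(* [Z x s t = (t - s) b x s + \sum_v th x v s dW_v + m + r] with a martingale
   increment [m] and a remainder [r], both negligible as t - s tends to 0, uniformly
   in the parameter x and locally uniformly in time. *)
Definition germ Z b th := forall T0 e : R, 0 < e -> exists2 dl : R, 0 < dl &
 forall x s t, 0 <= s -> s <= t -> t <= T0 -> t - s <= dl ->
 exists m, [/\ L2 m, msr (F t) m, perp (F s) m,
  Ex (fun w => m w ^+ 2) <= e * (t - s) &
  L1 (fun w => Z x s t w - (t - s) * b x s w - stoch th x s t w - m w) /\
  Ex (fun w => `|Z x s t w - (t - s) * b x s w - stoch th x s t w - m w|)
   <= e * (t - s)].

(** The L2 companion of [germ]. The drift is invisible here, its square being of order
    [(t - s) ^+ 2]. Products require it, since an L1 bound on a remainder says nothing about its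
    product with another increment. *)
Definition germ2 Z th := forall T0 e : R, 0 < e -> exists2 dl : R, 0 < dl &
 forall x s t, 0 <= s -> s <= t -> t <= T0 -> t - s <= dl ->
 L2 (Z x s t) /\
 Ex (fun w => (Z x s t w - stoch th x s t w) ^+ 2) <= e * (t - s).

Lemma bap_bound Y : bap Y -> exists2 K : R, 0 < K &
 forall x t w, 0 <= t -> `|Y x t w| <= K.
Proof. by move=> [K K0 h]; exists K => // x t w t0; have [_] := h x t t0. Qed.

Lemma bapD Y Y' : bap Y -> bap Y' -> bap (fun x t w => Y x t w + Y' x t w).
Proof.
move=> [K K0 h] [K' K'0 h']; exists (K + K'); first exact: addr_gt0.
move=> x t t0; have [m1 b1] := h x t t0; have [m2 b2] := h' x t t0; split.
 by apply: msrD => //; exact: filt_sa.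
by move=> w; rewrite (le_trans (ler_normD _ _))// lerD.
Qed.

Lemma bapM Y Y' : bap Y -> bap Y' -> bap (fun x t w => Y x t w * Y' x t w).
Proof.
move=> [K K0 h] [K' K'0 h']; exists (K * K'); first exact: mulr_gt0.
move=> x t t0; have [m1 b1] := h x t t0; have [m2 b2] := h' x t t0; split.
 by apply: msrM => //; exact: filt_sa.
by move=> w; rewrite normrM ler_pM.
Qed.

Lemma bap_cst c : bap (fun _ _ _ => c).
Proof.
exists (`|c| + 1); first by rewrite ltr_wpDl.
by move=> x t t0; split => [|w]; [apply: msr_cst; exact: filt_sa|rewrite lerDl].
Qed.

Lemma bapN Y : bap Y -> bap (fun x t w => - Y x t w).
Proof.
move=> [K K0 h]; exists K => // x t t0; have [m1 b1] := h x t t0.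
by split => [|w]; [apply: msrN => //; exact: filt_sa|rewrite normrN].
Qed.

Lemma bapB Y Y' : bap Y -> bap Y' -> bap (fun x t w => Y x t w - Y' x t w).
Proof. by move=> h h'; apply: bapD => //; exact: bapN. Qed.

Lemma bapX Y n : bap Y -> bap (fun x t w => Y x t w ^+ n).
Proof.
move=> h; elim: n => [|n IH]; first exact: (bap_cst 1).
rewrite (_ : (fun x t w => _) = (fun x t w => Y x t w * Y x t w ^+ n)).
 exact: bapM.
by do 3 apply/funext => ?; rewrite exprS.
Qed.

Lemma bap_sum (J : Type) (r : seq J) (Q : pred J) (Y : J -> Th -> R -> T -> R) :
 (forall j, bap (Y j)) -> bap (fun x t w => \sum_(j <- r | Q j) Y j x t w).
Proof.
move=> h; rewrite (_ : (fun x t w => _) = \sum_(j <- r | Q j) Y j); last by do 3 apply/funext => ?; rewrite !fct_sumE.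
by apply: big_ind => [|Y1 Y2 h1 h2|j _]; [exact: (bap_cst 0)|exact: bapD|exact: h].
Qed.

Lemma bap_comp Y (f : R -> R) : measf f ->
 (exists2 K : R, 0 < K & forall y, `|f y| <= K) ->
 (forall x t, 0 <= t -> msr (F t) (Y x t)) ->
 bap (fun x t w => f (Y x t w)).
Proof.
move=> mf [K K0 fK] h; exists K => // x t t0; split => [|w]; last exact: fK.
by apply: msr_comp => //; exact: h.
Qed.

Section stoch.
Variable th : Th -> Iw -> R -> T -> R.
Hypothesis hth : bapI th.

Lemma bapI_bound : exists2 K : R, 0 < K &
 forall x v t w, 0 <= t -> `|th x v t w| <= K.
Proof.
have h v : exists K : R, 0 < K /\ forall x t w, 0 <= t -> `|th x v t w| <= K.
 by have [K K0 hK] := bap_bound (hth v); exists K.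
have [K hK] := boolp.choice h.
exists (1 + \sum_v K v).
 by rewrite ltr_wpDr// sumr_ge0// => v _; rewrite ltW//; case: (hK v).
move=> x v t w t0; rewrite (bigD1 v)//= addrCA.
apply: (le_trans ((hK v).2 x t w t0)); rewrite lerDl addr_ge0// sumr_ge0// => i _.
by rewrite ltW//; case: (hK i).
Qed.

Lemma thdW_L2 x v s t : 0 <= s -> s <= t -> L2 (fun w => th x v s w * dW v s t w).
Proof.
move=> s0 st; have [K K0 h] := hth v; have [m1 b1] := h x s s0.
apply: (L2Mb _ _ b1); first exact: dW_L2.
by apply: msr_meas m1; exact: filt_alg.
Qed.

Lemma stoch_L2 x s t : 0 <= s -> s <= t -> L2 (stoch th x s t).
Proof. by move=> s0 st; apply: L2_sum => v _; exact: thdW_L2. Qed.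

Lemma stoch_perp x s t : 0 <= s -> s <= t -> perp (F s) (stoch th x s t).
Proof.
move=> s0 st; apply: perp_sum.
- exact: filt_alg.
- by move=> v; exact: thdW_L2.
- move=> v; have [K K0 h] := hth v; have [m1 b1] := h x s s0.
 apply: (perp_mulb (filt_alg s0) m1 b1); first exact: dW_L2.
 exact: dW_perp.
Qed.

Lemma stoch_moment4 : exists2 C : R, 0 < C & forall x s t, 0 <= s -> s <= t ->
 [/\ L1 (fun w => stoch th x s t w ^+ 4),
   Ex (fun w => stoch th x s t w ^+ 2) <= C * (t - s) &
   Ex (fun w => stoch th x s t w ^+ 4) <= C * (t - s) ^+ 2].
Proof.
have [K K0 hK] := bapI_bound.
pose n : R := #|Iw|%:R.
pose C1 := n * n * K ^+ 2; pose C2 := n ^+ 4 * K ^+ 4 * 128.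
have n0 : 0 <= n by [].
have K0' := ltW K0.
have C10 : 0 <= C1 by rewrite !mulr_ge0// exprn_ge0.
have C20 : 0 <= C2 by rewrite !mulr_ge0// exprn_ge0.
exists (1 + C1 + C2); first by rewrite !ltr_wpDr.
move=> x s t s0 st; have h0 : 0 <= t - s by rewrite subr_ge0.
have th2 v w : (th x v s w * dW v s t w) ^+ 2 <= K ^+ 2 * dW v s t w ^+ 2.
 rewrite exprMn ler_wpM2r ?sqr_ge0//.
 by rewrite -(real_normK (num_real (th x v s w))) lerXn2r ?nnegrE ?hK// ltW.
have b2 w : stoch th x s t w ^+ 2 <= n * K ^+ 2 * \sum_v dW v s t w ^+ 2.
 apply: (le_trans (sqr_sum_le _)); rewrite -mulrA ler_wpM2l// mulr_sumr.
 exact: ler_sum.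
have b4 w : stoch th x s t w ^+ 4 <= n ^+ 3 * K ^+ 4 * \sum_v dW v s t w ^+ 4.
 rewrite (exprM _ 2 2).
 have := b2 w; rewrite -(ler_pXn2r (ltn0Sn 1)) ?nnegrE ?sqr_ge0//; last by rewrite !mulr_ge0// ?exprn_ge0// sumr_ge0// => v _; exact: sqr_ge0.
 move/le_trans; apply; rewrite exprMn.
 have : n ^+ 3 * K ^+ 4 * \sum_v dW v s t w ^+ 4 =
  (n * K ^+ 2) ^+ 2 * (n * \sum_v (dW v s t w ^+ 2) ^+ 2).
  under [in RHS]eq_bigr do rewrite -exprM.
  by ring.
 move=> ->; rewrite ler_wpM2l ?sqr_ge0//; exact: sqr_sum_le.
have s2 : L1 (fun w => \sum_v dW v s t w ^+ 2).
 by apply: L1_sum => v _; exact: (dW_L2 v s0 st).2.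
have s4 : L1 (fun w => \sum_v dW v s t w ^+ 4).
 by apply: L1_sum => v _; exact: (dW_moment4 v s0 st).1.
have m4 : L1 (fun w => stoch th x s t w ^+ 4).
 apply: (L1_le _ _ (L1Z (n ^+ 3 * K ^+ 4) s4)).
  by apply: measurable_funX; exact: (stoch_L2 x s0 st).1.
 by move=> w; rewrite ger0_norm// (exprM _ 2 2) sqr_ge0.
split => //.
 apply: (@le_trans _ _ (C1 * (t - s))); last by rewrite ler_wpM2r// -addrA addrCA lerDl addr_ge0.
 have := Ex_le (stoch_L2 x s0 st).2 (L1Z (n * K ^+ 2) s2) b2.
 move/le_trans; apply; rewrite ExZ// Ex_sum => [|v _]; last exact: (dW_L2 v s0 st).2.
 under eq_bigr do rewrite dW_moment2//.
 by rewrite sumr_const -mulr_natl -/n /C1; apply: eq_ler; ring.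
apply: (@le_trans _ _ (C2 * (t - s) ^+ 2)); last by rewrite ler_wpM2r ?sqr_ge0// lerDr addr_ge0.
have := Ex_le m4 (L1Z (n ^+ 3 * K ^+ 4) s4) b4.
move/le_trans; apply; rewrite ExZ// Ex_sum => [|v _]; last exact: (dW_moment4 v s0 st).1.
have -> : C2 * (t - s) ^+ 2 = n ^+ 3 * K ^+ 4 * (n * (128 * (t - s) ^+ 2)).
 by rewrite /C2; ring.
rewrite ler_wpM2l ?mulr_ge0 ?exprn_ge0//.
have -> : n * (128 * (t - s) ^+ 2) = \sum_(v : Iw) 128 * (t - s) ^+ 2.
 by rewrite sumr_const -[RHS]mulr_natl.
by apply: ler_sum => v _; exact: (dW_moment4 v s0 st).2.
Qed.

End stoch.

Lemma L1_norm_eq (X Y : T -> R) e : (forall w, X w = Y w) ->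
 L1 Y /\ Ex (fun w => `|Y w|) <= e -> L1 X /\ Ex (fun w => `|X w|) <= e.
Proof. by move=> /funext ->. Qed.

Lemma germ_eq Z Z' b b' th th' : germ Z b th ->
 (forall x s t w, 0 <= s -> s <= t -> Z x s t w = Z' x s t w) ->
 (forall x t w, 0 <= t -> b x t w = b' x t w) ->
 (forall x v t w, 0 <= t -> th x v t w = th' x v t w) -> germ Z' b' th'.
Proof.
move=> g hZ hb hth T0 e e0; have [dl dl0 H] := g T0 e e0.
exists dl => // x s t s0 st tT ts; have [m [? ? ? ? h]] := H x s t s0 st tT ts.
exists m; split => //; apply: L1_norm_eq h => w; rewrite -hZ// -hb// /stoch.
by under eq_bigr do rewrite -hth//.
Qed.

Lemma germ_null Z : (forall T0 e : R, 0 < e -> exists2 dl : R, 0 < dl &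
  forall x s t, 0 <= s -> s <= t -> t <= T0 -> t - s <= dl ->
  L1 (Z x s t) /\ Ex (fun w => `|Z x s t w|) <= e * (t - s)) ->
 germ Z (fun _ _ _ => 0) (fun _ _ _ _ => 0).
Proof.
move=> h T0 e e0; have [dl dl0 H] := h T0 e e0; exists dl => // x s t s0 st tT ts.
exists (fun=> 0); split; [exact: L2_cst| |exact: perp0| |].
- by apply: msr_cst; exact/filt_sa/(le_trans s0).
- by under eq_fun do rewrite expr0n; rewrite Ex_cst mulr_ge0 ?(ltW e0)// subr_ge0.
apply: (@L1_norm_eq _ (Z x s t)) => [w|]; last exact: H.
by rewrite /stoch big1 => [|v _]; rewrite ?mul0r// mulr0 !subr0.
Qed.

(** A bounded factor known at time [s] keeps the martingale increment orthogonal to the past and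
    costs only a power of its bound. *)
Lemma germ_bap Z b th Y : germ Z b th -> bap Y ->
 germ (fun x s t w => Y x s w * Z x s t w) (fun x t w => Y x t w * b x t w)
  (fun x v t w => Y x t w * th x v t w).
Proof.
move=> hZ [K K0 hY] T0 e e0.
have K1 : 0 < 1 + K + K ^+ 2 by rewrite !addr_gt0// exprn_gt0.
have [dl dl0 H] := hZ T0 (e / (1 + K + K ^+ 2)) (divr_gt0 e0 K1).
exists dl => // x s t s0 st tT std.
have [m [L2m mm pm Em [L1b Eb]]] := H x s t s0 st tT std.
have [mY bY] := hY x s s0.
have h0 : 0 <= t - s by rewrite subr_ge0.
have mY' : measf (Y x s) by exact: msr_meas (filt_alg s0) mY.
exists (fun w => Y x s w * m w); split.
- exact: L2Mb bY.
- apply: msrM => //; first exact/filt_sa/(le_trans s0).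
 exact: msr_sub (filt_le s0 st) mY.
- exact: perp_mulb (filt_alg s0) mY bY L2m pm.
- apply: (@le_trans _ _ (K ^+ 2 * Ex (fun w => m w ^+ 2))).
  rewrite -ExZ ?L2m.2//; apply: Ex_le; [exact: (L2Mb L2m mY' bY).2|exact: L1Z L2m.2|].
  move=> w; rewrite exprMn ler_wpM2r ?sqr_ge0//.
  by rewrite -(real_normK (num_real (Y x s w))) lerXn2r ?nnegrE ?bY ?(ltW K0).
 apply: (le_trans (ler_wpM2l (sqr_ge0 _) Em)).
 rewrite mulrA ler_wpM2r// mulrCA ler_piMr ?(ltW e0)// ler_pdivrMr// mul1r.
 by rewrite lerDr addr_ge0// ltW.
have E w : Y x s w * Z x s t w - (t - s) * (Y x s w * b x s w) -
   stoch (fun x v t w => Y x t w * th x v t w) x s t w - Y x s w * m w =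
  Y x s w * (Z x s t w - (t - s) * b x s w - stoch th x s t w - m w).
 rewrite /stoch.
 under eq_bigr do rewrite -mulrA.
 by rewrite -mulr_sumr; ring.
have L1' : L1 (fun w => Y x s w * (Z x s t w - (t - s) * b x s w - stoch th x s t w - m w)).
 apply: (L1_le _ _ (L1Z K (L1_abs L1b))).
  by apply: measurable_funM => //; exact: L1_meas L1b.
 by move=> w; rewrite normrM ler_wpM2r.
apply: (L1_norm_eq E); split => //.
apply: (@le_trans _ _ (K * (e / (1 + K + K ^+ 2) * (t - s)))).
 apply: le_trans (ler_wpM2l (ltW K0) Eb).
 rewrite -ExZ; last exact: L1_abs.
 apply: Ex_le; [exact: L1_abs|exact/L1Z/L1_abs|].
 by move=> w; rewrite normrM ler_wpM2r.
rewrite mulrA ler_wpM2r// mulrCA ler_piMr ?(ltW e0)// ler_pdivrMr// mul1r.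
by rewrite addrAC lerDr addr_ge0// sqr_ge0.
Qed.

Lemma germD Z Z' b b' th th' : germ Z b th -> germ Z' b' th' ->
 germ (fun x s t w => Z x s t w + Z' x s t w) (fun x t w => b x t w + b' x t w)
  (fun x v t w => th x v t w + th' x v t w).
Proof.
move=> hZ hZ' T0 e e0; have e4 : 0 < e / 4 by rewrite divr_gt0.
have [dl dl0 H] := hZ T0 (e / 4) e4; have [dl' dl'0 H'] := hZ' T0 (e / 4) e4.
exists (Num.min dl dl'); first by rewrite lt_min dl0.
move=> x s t s0 st tT; rewrite le_min => /andP[std std'].
have [m [L2m mm pm Em [L1b Eb]]] := H x s t s0 st tT std.
have [m' [L2m' mm' pm' Em' [L1b' Eb']]] := H' x s t s0 st tT std'.
have eh : 0 <= e * (t - s) by rewrite mulr_ge0 ?(ltW e0)// subr_ge0.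
exists (fun w => m w + m' w); split.
- exact: L2D.
- by apply: msrD => //; exact/filt_sa/(le_trans s0).
- by apply: perpD => //; exact: filt_alg.
- apply: (le_trans (Ex_sqrD L2m L2m')); lra.
apply: (@L1_norm_eq _ (fun w => (Z x s t w - (t - s) * b x s w - stoch th x s t w - m w) +
   (Z' x s t w - (t - s) * b' x s w - stoch th' x s t w - m' w))) => [w|].
 by rewrite /stoch; under eq_bigr do rewrite mulrDl; rewrite big_split/=; ring.
split; first exact: L1D.
apply: (@le_trans _ _ (e / 4 * (t - s) + e / 4 * (t - s))); last by lra.
exact: le_trans (Ex_normD L1b L1b') (lerD Eb Eb').
Qed.

Lemma germ_lin (J : finType) (c : J -> R) (Zs : J -> Th -> R -> R -> T -> R)
  (bs : J -> Th -> R -> T -> R) (ths : J -> Th -> Iw -> R -> T -> R) :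
 (forall j, germ (Zs j) (bs j) (ths j)) ->
 germ (fun x s t w => \sum_j c j * Zs j x s t w) (fun x t w => \sum_j c j * bs j x t w)
  (fun x v t w => \sum_j c j * ths j x v t w).
Proof.
move=> h; apply: (@germ_eq (\sum_j (fun x s t w => c j * Zs j x s t w))
 _ (\sum_j (fun x t w => c j * bs j x t w)) _ (\sum_j (fun x v t w => c j * ths j x v t w)));
 try by move=> *; rewrite !fct_sumE.
elim/big_rec3: _ => [|j Z1 b1 t1 _]; last by apply/germD/germ_bap => //; exact: bap_cst.
apply: germ_null => T0 e e0; exists 1 => // x s t s0 st _ _; split; first exact: (L1_cst _ 0).
rewrite (_ : (fun w => _) = fun=> 0) ?Ex_cst; first by rewrite mulr_ge0 ?(ltW e0)// subr_ge0.
by apply/funext => w; rewrite normr0.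
Qed.

(** The centred product is itself the small martingale increment: its second moment is of order
    [(t - s) ^+ 2], so the remainder vanishes. The constant [258 = 128 + 128 + 2] collects two
    fourth moments and the squared mean. *)
Lemma germ_dW2 v u : germ (fun _ s t w => dW v s t w * dW u s t w)
 (fun _ _ _ => (v == u)%:R) (fun _ _ _ _ => 0).
Proof.
move=> T0 e e0; exists (e / 258) => [|x s t s0 st tT ts]; first by rewrite divr_gt0.
have h0 : 0 <= t - s by rewrite subr_ge0.
have ft := filt_sa (le_trans s0 st).
have [L4 E4] := dW_moment4 v s0 st; have [L4' E4'] := dW_moment4 u s0 st.
set m := fun w => dW v s t w * dW u s t w - (v == u)%:R * (t - s).
have L2m : L2 m by apply: L2B; [exact: dW2_L2|exact: L2_cst].
exists m; split => //.
- by apply: msrB => //; [apply: msrM => //; exact: dW_msr|exact: msr_cst].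
- exact: dW2_perp.
- pose D w := dW v s t w ^+ 4 + dW u s t w ^+ 4 + 2 * (t - s) ^+ 2.
 have LD : L1 D by apply: L1D; [exact: L1D|exact: L1_cst].
 apply: (le_trans (Ex_le L2m.2 LD _)) => [w|].
  apply: (le_trans (sqr_mulB_le _ _ _)); rewrite -!exprM lerD2l ler_wpM2l//.
  by case: (v == u); rewrite ?mul1r// mul0r expr0n sqr_ge0.
 rewrite ExD; [|exact: L1D|exact: L1_cst]; rewrite ExD// Ex_cst.
 by move: ts E4 E4'; rewrite ler_pdivlMr// expr2 => /(ler_wpM2r h0); lra.
apply: (@L1_norm_eq _ (fun=> 0)) => [w|].
 by rewrite /m /stoch big1 => [|i _]; [ring|exact: mul0r].
split; first exact: L1_cst.
by under eq_fun do rewrite normr0; rewrite Ex_cst mulr_ge0 ?(ltW e0).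
Qed.

Lemma germ_ext Z Z' b b' th th' : germ Z b th ->
 (forall x s t, 0 <= s -> s <= t -> measf (Z' x s t) /\
   {ae P, forall w, Z x s t w = Z' x s t w}) ->
 (forall x t w, 0 <= t -> b x t w = b' x t w) ->
 (forall x v t w, 0 <= t -> th x v t w = th' x v t w) ->
 (forall x s t, 0 <= s -> s <= t -> measf (b' x s)) -> bapI th' ->
 germ Z' b' th'.
Proof.
move=> hZ hZ' hb hth mb' bth' T0 e e0; have [dl dl0 H] := hZ T0 e e0.
exists dl => // x s t s0 st tT std.
have [m [L2m mm pm Em [L1b Eb]]] := H x s t s0 st tT std.
have [mZ' ZZ'] := hZ' x s t s0 st.
exists m; split => //.
have mE : measf (fun w =>
  Z' x s t w - (t - s) * b' x s w - stoch th' x s t w - m w).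
 apply: measurable_funB; last by case: L2m.
 apply: measurable_funB; last exact: (stoch_L2 bth' x s0 st).1.
 by apply: measurable_funB => //; apply: measurable_funM => //; exact: mb' st.
have aeE : {ae P, forall w,
  Z x s t w - (t - s) * b x s w - stoch th x s t w - m w =
  Z' x s t w - (t - s) * b' x s w - stoch th' x s t w - m w}.
 apply: filterS ZZ' => w ->; rewrite hb// /stoch.
 by under eq_bigr do rewrite hth//.
split; first exact: L1_ae L1b.
apply: le_trans Eb; apply/eq_ler/esym/Ex_ae.
- exact: L1_meas (L1_abs L1b).
- exact: measurableT_comp.
- by apply: filterS aeE => w ->.
Qed.

(** Tested against a variable of the past, the stochastic part and [m] have mean zero, and only the
    drift remains. Every differential equation for an expectation comes from this lemma. *)
Lemma germ_weak Z b th : bap b -> bapI th -> germ Z b th ->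
 forall T0 e : R, 0 < e -> exists2 dl : R, 0 < dl &
 forall x s t, 0 <= s -> s <= t -> t <= T0 -> t - s <= dl ->
 forall Y : T -> R, msr (F s) Y -> (forall w, `|Y w| <= 1) ->
 L1 (fun w => Y w * (Z x s t w - (t - s) * b x s w)) /\
 `|Ex (fun w => Y w * (Z x s t w - (t - s) * b x s w))| <= e * (t - s).
Proof.
move=> hb hth hZ T0 e e0; have [dl dl0 H] := hZ T0 e e0.
exists dl => // x s t s0 st tT std Y mY Y1.
have [m [L2m mm pm Em [L1b Eb]]] := H x s t s0 st tT std.
have mY' : measf Y by exact: msr_meas (filt_alg s0) mY.
have YL2 : L2 Y by exact: L2_bounded Y1.
have L2s := stoch_L2 hth x s0 st.
have LYb : L1 (fun w => Y w * (Z x s t w - (t - s) * b x s w - stoch th x s t w - m w)).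
 apply: (L1_le _ _ (L1_abs L1b)).
  by apply: measurable_funM => //; exact: L1_meas L1b.
 by move=> w; rewrite normrM ler_piMl.
have E : (fun w => Y w * (Z x s t w - (t - s) * b x s w)) =
  (fun w => Y w * (Z x s t w - (t - s) * b x s w - stoch th x s t w - m w) +
   (Y w * stoch th x s t w + Y w * m w)) by apply/funext => w; ring.
have L1s := L2_mul YL2 L2s; have L1m := L2_mul YL2 L2m.
rewrite E; split; first by apply: L1D => //; exact: L1D.
rewrite ExD//; last exact: L1D.
rewrite ExD// (perp_mul (filt_alg s0) YL2 mY L2s (stoch_perp hth x s0 st)).
rewrite (perp_mul (filt_alg s0) YL2 mY L2m pm) !addr0.
apply: (le_trans (Ex_norm LYb)); apply: le_trans Eb.
apply: Ex_le; [exact: L1_abs|exact: L1_abs|].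
by move=> w; rewrite normrM ler_piMl.
Qed.

(** Local errors of size [o (t - s)] add up to a small total: the martingale parts are orthogonal,
    so their second moments add, and the L1 remainders add by the triangle inequality. *)
Lemma germ_sum Z b th : bap b -> bapI th -> germ Z b th ->
 forall T0 e : R, 0 < e -> exists2 dl : R, 0 < dl &
 forall x (N : nat) (s : nat -> R), 0 <= s 0%N -> s N <= T0 ->
  (forall i, (i < N)%N -> 0 <= s i.+1 - s i <= dl) ->
 let S w := \sum_(i < N) (Z x (s i) (s i.+1) w -
   (s i.+1 - s i) * b x (s i) w - stoch th x (s i) (s i.+1) w) in
 L1 S /\ Ex (fun w => `|S w|) <= e.
Proof.
move=> hb hth hZ T0 e e0.
pose T1 : R := 1 + `|T0|.
have T10 : 0 < T1 by rewrite ltr_wpDr.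
(* The two entries give [c * T1 <= e / 2] for the remainders and [sqrt (c * T1) <= e / 2] for the
   martingale part. *)
pose c : R := Num.min (e / (2 * T1)) (e ^+ 2 / (4 * T1)).
have c0 : 0 < c by rewrite lt_min !divr_gt0// ?mulr_gt0// exprn_gt0.
have [dl dl0 H] := hZ T0 c c0.
exists dl => // x N s s00 sNT hs S.
have mono k : (k <= N)%N -> 0 <= s k.
 elim: k => // k IH kN; have /andP[h _] := hs k kN.
 by apply: (le_trans (IH (ltnW kN))); rewrite -subr_ge0.
have monoT k : (k <= N)%N -> s k <= T0.
 move=> kN; have [j ->] : exists j, k = (N - j)%N by exists (N - k)%N; rewrite subKn.
 elim: j => [|j IH]; first by rewrite subn0.
 have [jN|jN] := ltnP j N; last by move: IH; rewrite !(eqP jN) ?subn0//= (eqP (leqW jN)).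
 have kk : (N - j.+1 < N)%N by rewrite ltn_subrL/= (leq_ltn_trans _ jN).
 have := hs _ kk; rewrite subnSK// => /andP[h _].
 by apply: le_trans IH; rewrite -subr_ge0.
suff key k : (k <= N)%N -> exists M : T -> R, exists B : T -> R,
  [/\ L2 M, msr (F (s k)) M, Ex (fun w => M w ^+ 2) <= c * (s k - s 0%N),
   L1 B /\ Ex (fun w => `|B w|) <= c * (s k - s 0%N) &
   forall w, \sum_(i < k) (Z x (s i) (s i.+1) w -
   (s i.+1 - s i) * b x (s i) w - stoch th x (s i) (s i.+1) w) = M w + B w].
 have [M [B [L2M mM EM [L1B EB] SE]]] := key N (leqnn N).
 have -> : S = (fun w => M w + B w) by apply/funext => w; rewrite /S SE.
 have L1M := L2_L1 L2M.
 split; first exact: L1D.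
 apply: (le_trans (Ex_normD L1M L1B)).
 have sT : s N - s 0%N <= T1.
  rewrite (le_trans _ (_ : T0 <= T1))//; first by rewrite lerBlDr ler_wpDr.
  by rewrite (le_trans (ler_norm _))// lerDr.
 have -> : e = e / 2 + e / 2 by field.
 apply: lerD.
  apply: (le_trans (Ex_CS1 L2M EM)).
  have e2 : 0 <= e / 2 by rewrite divr_ge0// ltW.
  rewrite -[leRHS](ger0_norm e2) -sqrtr_sqr ler_wsqrtr//.
  apply: (@le_trans _ _ (c * T1)); first by rewrite ler_wpM2l// ltW.
  have : c <= e ^+ 2 / (4 * T1) by rewrite ge_min lexx orbT.
  rewrite ler_pdivlMr ?mulr_gt0// => h.
  have -> : (e / 2) ^+ 2 = e ^+ 2 / 4 by field.
  by lra.
 apply: (le_trans EB); apply: (@le_trans _ _ (c * T1)); first by rewrite ler_wpM2l// ltW.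
 have : c <= e / (2 * T1) by rewrite ge_min lexx.
 by rewrite ler_pdivlMr ?mulr_gt0// => h; lra.
elim: k => [_|k IH kN].
 exists (fun=> 0), (fun=> 0); rewrite subrr mulr0.
 have E0 : (fun w : T => (0 : R) ^+ 2) = fun=> 0 by apply/funext => w; rewrite expr0n.
 have E1 : (fun w : T => `|0 : R|) = fun=> 0 by apply/funext => w; rewrite normr0.
 rewrite E0 E1 !Ex_cst; split => //.
 - exact: L2_cst.
 - by apply: msr_cst; exact: filt_sa.
 - by split => //; exact: L1_cst.
 - by move=> w; rewrite big_ord0 addr0.
have [M [B [L2M mM EM [L1B EB] SE]]] := IH (ltnW kN).
have sk0 := mono _ (ltnW kN); have /andP[h1 h2] := hs k kN.
have sk1 : s k <= s k.+1 by rewrite -subr_ge0.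
have [m [L2m mm pm Em [L1b Eb]]] := H x _ _ sk0 sk1 (monoT _ kN) h2.
exists (fun w => M w + m w).
exists (fun w => B w + (Z x (s k) (s k.+1) w - (s k.+1 - s k) * b x (s k) w -
  stoch th x (s k) (s k.+1) w - m w)); split.
- exact: L2D.
- apply: msrD => //; first exact/filt_sa/mono.
 exact: msr_sub (filt_le sk0 sk1) mM.
- by rewrite (Ex_sqrD_perp (filt_alg sk0) L2M mM L2m pm); lra.
- split; first exact: L1D.
 apply: (@le_trans _ _ (c * (s k - s 0%N) + c * (s k.+1 - s k))); last by lra.
 exact: le_trans (Ex_normD L1B L1b) (lerD EB Eb).
- by move=> w; rewrite big_ord_recr/= SE; ring.
Qed.

(** Ito's product rule for increments. The product of the stochastic parts is expanded over pairs of
    coordinates by [germ_dW2]; the rest is [Z (Z' - M') + M' (Z - M)], with [M] and [M'] the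
    stochastic parts, and is small by Cauchy-Schwarz. *)
Lemma germ2_prod Z Z' th th' : bapI th -> bapI th' -> germ2 Z th -> germ2 Z' th' ->
 germ (fun x s t w => Z x s t w * Z' x s t w)
  (fun x t w => \sum_v th x v t w * th' x v t w) (fun _ _ _ _ => 0).
Proof.
move=> hth hth' hZ hZ'.
have gM := germ_lin (fun=> 1) (fun p : Iw * Iw =>
 germ_bap (germ_dW2 p.1 p.2) (bapM (hth p.1) (hth' p.2))).
have gR : germ (fun x s t w => Z x s t w * Z' x s t w - stoch th x s t w * stoch th' x s t w)
  (fun _ _ _ => 0) (fun _ _ _ _ => 0).
 apply: germ_null => T0 e e0.
 have [C C0 HC] := stoch_moment4 hth; have [C' C'0 HC'] := stoch_moment4 hth'.
 pose D := 2 * (1 + C) + C'; have D0 : 0 < D by rewrite /D; lra.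
 have e2 : 0 < e / 2 by rewrite divr_gt0.
 pose c := Num.min 1 ((e / 2) ^+ 2 / D).
 have c0 : 0 < c by rewrite lt_min ltr01 divr_gt0// exprn_gt0.
 have c1 : c <= 1 by rewrite ge_min lexx.
 have cD : c * D <= (e / 2) ^+ 2 by rewrite -ler_pdivlMr// ge_min lexx orbT.
 have [dl dl0 H] := hZ T0 c c0; have [dl' dl'0 H'] := hZ' T0 c c0.
 exists (Num.min dl dl') => [|x s t s0 st tT]; first by rewrite lt_min dl0.
 rewrite le_min => /andP[std std'].
 have [L2Z EZ] := H x s t s0 st tT std; have [L2Z' EZ'] := H' x s t s0 st tT std'.
 have h0 : 0 <= t - s by rewrite subr_ge0.
 have [_ EM _] := HC x s t s0 st; have [_ EM' _] := HC' x s t s0 st.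
 have L2M := stoch_L2 hth x s0 st; have L2M' := stoch_L2 hth' x s0 st.
 have L2e := L2B L2Z L2M; have L2e' := L2B L2Z' L2M'.
 apply: (@L1_norm_eq _ (fun w => Z x s t w * (Z' x s t w - stoch th' x s t w) +
  stoch th' x s t w * (Z x s t w - stoch th x s t w))) => [w|]; first by ring.
 have la := L2_mul L2Z L2e'; have lb := L2_mul L2M' L2e.
 split; first exact: L1D.
 have EZ2 : Ex (fun w => Z x s t w ^+ 2) <= 2 * (1 + C) * (t - s).
  have := Ex_sqrD L2e L2M; under eq_fun do rewrite subrK.
  by move/le_trans; apply; nra.
 have sq a : 0 <= a -> a <= D -> Num.sqrt (a * (t - s) * (c * (t - s))) <= e / 2 * (t - s).
  move=> a0 aD; rewrite -(ger0_norm (mulr_ge0 (ltW e2) h0)) -sqrtr_sqr ler_wsqrtr//.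
  rewrite (_ : a * (t - s) * (c * (t - s)) = c * a * (t - s) ^+ 2); last by ring.
  by rewrite exprMn ler_wpM2r ?sqr_ge0// (le_trans _ cD)// ler_wpM2l// ltW.
 apply: (le_trans (Ex_normD la lb)).
 have k1 := le_trans (Ex_CS L2Z L2e' EZ2 EZ') (sq _ _ _).
 have k2 := le_trans (Ex_CS L2M' L2e EM' EZ) (sq _ _ _).
 apply: (le_trans (lerD (k1 _ _) (k2 _ _))); rewrite ?(ltW C'0)//; try by rewrite /D; lra.
apply: (germ_eq (germD gM gR)) => [x s t w s0 st|x t w t0|*]; rewrite ?addr0.
- rewrite [X in X + _](_ : _ = stoch th x s t w * stoch th' x s t w); first by ring.
 rewrite big_distrlr/= pair_bigA /=; apply: eq_bigr => p _; ring.
- rewrite -(pair_bigA _ (fun v u => 1 * (th x v t w * th' x u t w * (v == u)%:R)))/=.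
 apply: eq_bigr => v _; rewrite (bigD1 v)//= eqxx big1 => [|u /negbTE uv]; first by rewrite mul1r mulr1 addr0.
 by rewrite eq_sym uv !mulr0.
- by rewrite big1// => p _; rewrite !mulr0.
Qed.

(** Boundedness upgrades the L1 control of the remainder: [sqr_remainder_le] trades its square for
    its modulus, a fourth moment of the stochastic part, of order [(t - s) ^+ 2], and the second
    moment of [m]. *)
Lemma germ2_bounded Z b th K : bap b -> bapI th -> germ Z b th ->
 (forall x s t, 0 <= s -> s <= t -> measf (Z x s t) /\
   forall w, `|Z x s t w| <= K) -> germ2 Z th.
Proof.
move=> hb hth hZ hK T0 e e0.
have [C C0 HC] := stoch_moment4 hth.
have [B B0 hB] := bap_bound hb.
pose L : R := `|K| + B + 1.
have L0 : 0 < L by rewrite /L; have := normr_ge0 K; lra.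
pose A := 3 * (B ^+ 2 + 64 * C / L ^+ 2) + 1.
have A0 : 0 < A.
 rewrite ltr_wpDl// mulr_ge0// addr_ge0 ?sqr_ge0// divr_ge0 ?sqr_ge0//.
 by rewrite mulr_ge0// ltW.
(* Here [51 = 3 * 17] and [6 * L = 3 * (2 * L)] are the coefficients of the second moment of [m] and
   of the mean of [|r|] in the bound [3 * D] below. *)
pose c := Num.min (e / (4 * 51)) (e / (4 * (6 * L))).
have c0 : 0 < c by rewrite lt_min !divr_gt0// ?mulr_gt0.
have [dl dl0 H] := hZ T0 c c0.
exists (Num.min (Num.min dl 1) (e / (2 * A))).
 by rewrite !lt_min dl0 ltr01 divr_gt0// mulr_gt0.
move=> x s t s0 st tT; rewrite !le_min => /andP[/andP[std st1] stA].
have [m [L2m mm pm Em [L1r Er]]] := H x s t s0 st tT std.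
have h0 : 0 <= t - s by rewrite subr_ge0.
have [M4 EM2 EM4] := HC x s t s0 st.
have L2M := stoch_L2 hth x s0 st.
have [mZ ZK] := hK x s t s0 st.
have L2Z : L2 (Z x s t) by exact: L2_bounded ZK.
split => //.
have mr := L1_meas L1r.
set r := (fun w => Z x s t w - _ - _ - _) in L1r Er mr.
pose D w := (t - s) ^+ 2 * B ^+ 2 + (2 * L * `|r w| + 64 / L ^+ 2 * stoch th x s t w ^+ 4)
  + 17 * m w ^+ 2.
have r2 w : r w ^+ 2 <= 2 * L * `|r w| + 64 / L ^+ 2 * stoch th x s t w ^+ 4 + 16 * m w ^+ 2.
 apply: sqr_remainder_le => //.
 have -> : r w + stoch th x s t w + m w = Z x s t w - (t - s) * b x s w by rewrite /r; ring.
 apply: (le_trans (ler_normB _ _)); rewrite normrM (ger0_norm h0).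
 rewrite /L -addrA lerD//; first exact: le_trans (ZK w) (ler_norm K).
 apply: (@le_trans _ _ (1 * B)); last by rewrite mul1r lerDl.
 by apply: ler_pM => //; exact: hB.
have le w : (Z x s t w - stoch th x s t w) ^+ 2 <= 3 * D w.
 have -> : Z x s t w - stoch th x s t w = (t - s) * b x s w + r w + m w by rewrite /r; ring.
 have := r2 w; rewrite /D.
 have : ((t - s) * b x s w) ^+ 2 <= (t - s) ^+ 2 * B ^+ 2.
  rewrite exprMn ler_wpM2l ?sqr_ge0// -(real_normK (num_real (b x s w))).
  by rewrite lerXn2r ?nnegrE ?(ltW B0)// hB.
 by move=> h1 h2; apply: (le_trans (sqr_add3_le _ _ _)); rewrite ler_wpM2l//; lra.
have L1D' : L1 D.
 apply: L1D; last exact: L1Z L2m.2.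
 apply: L1D; first exact: L1_cst.
 by apply: L1D; apply: L1Z => //; exact: L1_abs.
have L2ZM : L2 (fun w => Z x s t w - stoch th x s t w) by exact: L2B.
apply: (le_trans (Ex_le L2ZM.2 (L1Z 3 L1D') le)).
rewrite ExZ// /D ExD; last 2 first.
- apply: L1D; first exact: L1_cst.
 by apply: L1D; apply: L1Z => //; exact: L1_abs.
- exact: L1Z L2m.2.
rewrite ExD; [|exact: L1_cst|by apply: L1D; apply: L1Z => //; exact: L1_abs].
rewrite ExD; [|by apply: L1Z; exact: L1_abs|exact: L1Z].
rewrite Ex_cst !ExZ//; [|exact: L2m.2|exact: L1_abs].
have c1 : c <= e / (4 * 51) by rewrite ge_min lexx.
have c2 : c <= e / (4 * (6 * L)) by rewrite ge_min lexx orbT.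
have k1 : 3 * (17 * Ex (fun w => m w ^+ 2)) <= e / 4 * (t - s).
 have : Ex (fun w => m w ^+ 2) <= e / (4 * 51) * (t - s).
  by apply: (le_trans Em); rewrite ler_wpM2r.
 by rewrite (_ : e / (4 * 51) = e / 4 / 51); [lra|field].
have k2 : 3 * (2 * L * Ex (fun w => `|r w|)) <= e / 4 * (t - s).
 have : Ex (fun w => `|r w|) <= e / (4 * (6 * L)) * (t - s).
  by apply: (le_trans Er); rewrite ler_wpM2r.
 rewrite (_ : e / (4 * (6 * L)) = e / 4 / (6 * L)); last by field; rewrite gt_eqF.
 rewrite mulrAC ler_pdivlMr ?mulr_gt0// => h; lra.
have k3 : 3 * ((t - s) ^+ 2 * B ^+ 2 + 64 / L ^+ 2 * Ex (fun w => stoch th x s t w ^+ 4))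
  <= e / 2 * (t - s).
 apply: (@le_trans _ _ (A * (t - s) * (t - s))).
  have : 64 / L ^+ 2 * Ex (fun w => stoch th x s t w ^+ 4) <=
   64 / L ^+ 2 * (C * (t - s) ^+ 2) by rewrite ler_wpM2l// divr_ge0// sqr_ge0.
  have -> : A * (t - s) * (t - s) = 3 * ((t - s) ^+ 2 * B ^+ 2 +
   64 / L ^+ 2 * (C * (t - s) ^+ 2)) + (t - s) ^+ 2.
   by rewrite /A; field; rewrite gt_eqF.
  by have := sqr_ge0 (t - s); lra.
 rewrite ler_wpM2r// mulrC; move: stA; rewrite ler_pdivlMr ?mulr_gt0//.
 by move=> h; rewrite ler_pdivlMr//; lra.
by lra.
Qed.

(** A bound by the squared increments alone would only give order [t - s]. The factor [e] for small
    increments, and fourth moments for large ones, make the remainder of a second order expansion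
    negligible. *)
Lemma germ_remainder (J : finType) (Z : J -> Th -> R -> R -> T -> R)
  (th : J -> Th -> Iw -> R -> T -> R) (Rm : Th -> R -> R -> T -> R) (C0 : R) :
 (forall j, bapI (th j)) -> (forall j, germ2 (Z j) (th j)) ->
 (forall x s t, 0 <= s -> s <= t -> measf (Rm x s t)) ->
 (forall x s t w, 0 <= s -> s <= t ->
   `|Rm x s t w| <= C0 * \sum_j Z j x s t w ^+ 2) ->
 (forall e : R, 0 < e -> exists2 dl : R, 0 < dl & forall x s t w, 0 <= s -> s <= t ->
   (forall j, `|Z j x s t w| <= dl) -> `|Rm x s t w| <= e * \sum_j Z j x s t w ^+ 2) ->
 germ Rm (fun _ _ _ => 0) (fun _ _ _ _ => 0).
Proof.
move=> hth hZ mR RC Re; apply: germ_null => T0 e e0.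
have [C hC] := boolp.choice (fun j => let: ex_intro2 c c0 hc := stoch_moment4 (hth j) in
 ex_intro (fun C => 0 < C /\ forall x s t, 0 <= s -> s <= t ->
 [/\ L1 (fun w => stoch (th j) x s t w ^+ 4),
   Ex (fun w => stoch (th j) x s t w ^+ 2) <= C * (t - s) &
   Ex (fun w => stoch (th j) x s t w ^+ 4) <= C * (t - s) ^+ 2]) c (conj c0 hc)).
pose SC := 1 + \sum_j C j.
have SC0 : 0 < SC by rewrite ltr_wpDr// sumr_ge0// => j _; rewrite ltW//; case: (hC j).
pose n : R := 1 + #|J|%:R.
have n0 : 0 < n by rewrite ltr_wpDr.
pose c0 : R := 1 + `|C0|.
have c00 : 0 < c0 by rewrite ltr_wpDr.
pose e1 := e / (8 * SC).
have e10 : 0 < e1 by rewrite divr_gt0// mulr_gt0.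
have [r r0 hr] := Re e1 e10.
pose e2 := e / (4 * (n * (2 * e1 + 4 * c0))).
have q0 : 0 < 2 * e1 + 4 * c0 by lra.
have e20 : 0 < e2 by rewrite divr_gt0// !mulr_gt0.
have hZ' : exists2 dl : R, 0 < dl & forall j x s t, 0 <= s -> s <= t -> t <= T0 -> t - s <= dl ->
 L2 (Z j x s t) /\ Ex (fun w => (Z j x s t w - stoch (th j) x s t w) ^+ 2) <= e2 * (t - s).
 have [dl hdl] := boolp.choice (fun j => let: ex_intro2 dl dl0 h := hZ j T0 e2 e20 in
  ex_intro (fun dl => 0 < dl /\ forall x s t, 0 <= s -> s <= t -> t <= T0 -> t - s <= dl ->
   L2 (Z j x s t) /\ Ex (fun w => (Z j x s t w - stoch (th j) x s t w) ^+ 2) <= e2 * (t - s))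
  dl (conj dl0 h)).
 exists (\big[Num.min/1]_j dl j).
  by apply: lt_bigmin => // j _; case: (hdl j).
 move=> j x s t s0 st tT h; apply: (hdl j).2 => //.
 by apply: (le_trans h); exact: bigmin_le.
have [dl dl0 H] := hZ'.
pose A := 16 * c0 * n * SC / r ^+ 2 + 1.
have A0 : 0 < A.
 by rewrite ltr_wpDl// divr_ge0 ?sqr_ge0// !mulr_ge0 ?(ltW c00) ?(ltW n0) ?(ltW SC0).
exists (Num.min dl (e / (4 * A))); first by rewrite lt_min dl0 divr_gt0// mulr_gt0.
move=> x s t s0 st tT; rewrite le_min => /andP[std stA].
have h0 : 0 <= t - s by rewrite subr_ge0.
have L2M j := stoch_L2 (hth j) x s0 st.
have L2Z j := (H j x s t s0 st tT std).1.
have L2e j : L2 (fun w => Z j x s t w - stoch (th j) x s t w) by exact: L2B.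
pose S w := \sum_j Z j x s t w ^+ 2.
pose M2 w := \sum_j stoch (th j) x s t w ^+ 2.
pose E2 w := \sum_j (Z j x s t w - stoch (th j) x s t w) ^+ 2.
pose M4 w := \sum_j stoch (th j) x s t w ^+ 4.
have M20 w : 0 <= M2 w by apply: sumr_ge0 => j _; exact: sqr_ge0.
have E20 w : 0 <= E2 w by apply: sumr_ge0 => j _; exact: sqr_ge0.
have M40 w : 0 <= M4 w by apply: sumr_ge0 => j _; rewrite (exprM _ 2 2) sqr_ge0.
have S0 w : 0 <= S w by apply: sumr_ge0 => j _; exact: sqr_ge0.
have SME w : S w <= 2 * M2 w + 2 * E2 w.
 rewrite /S /M2 /E2 !mulr_sumr -big_split/=; apply: ler_sum => j _.
 by have := sqr_ge0 (Z j x s t w - 2 * stoch (th j) x s t w); nra.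
have MM w : M2 w ^+ 2 <= n * M4 w.
 apply: (@le_trans _ _ (#|J|%:R * M4 w)); last by rewrite ler_wpM2r// /n lerDr.
 rewrite /M4; under eq_bigr do rewrite (exprM _ 2 2).
 exact: sqr_sum_le.
have le w : `|Rm x s t w| <= 2 * e1 * M2 w + (2 * e1 + 4 * c0) * E2 w +
  16 * c0 * n / r ^+ 2 * M4 w.
 have p1 : 0 <= 16 * c0 * n / r ^+ 2 * M4 w.
  by rewrite mulr_ge0// divr_ge0 ?sqr_ge0// !mulr_ge0 ?(ltW c00) ?(ltW n0).
 have e1M := mulr_ge0 (ltW e10) (M20 w); have c0E := mulr_ge0 (ltW c00) (E20 w).
 have e1E := mulr_ge0 (ltW e10) (E20 w).
 have [|] := boolP [forall j, `|Z j x s t w| <= r].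
  move=> /forallP hj; apply: (le_trans (hr x s t w s0 st hj)).
  by have := SME w; rewrite -/(S w); nra.
 (* Some increment exceeds [r], so [r ^+ 2 <= S]. If the errors [E2] dominate they absorb [S];
    otherwise [S <= 4 M2], and [S <= S ^+ 2 / r ^+ 2] is bounded by the fourth powers [M4]. *)
 rewrite negb_forall => /existsP[j]; rewrite -ltNge => rj.
 have Sr : r ^+ 2 <= S w.
  rewrite /S (bigD1 j)//= -[leLHS]addr0 lerD ?sumr_ge0// => [|i _]; last exact: sqr_ge0.
  by rewrite -(real_normK (num_real (Z j x s t w))) lerXn2r ?nnegrE ?(ltW r0)// ltW.
 have RS : `|Rm x s t w| <= c0 * S w.
  apply: (le_trans (RC x s t w s0 st)); apply: ler_wpM2r; first exact: S0.
  by rewrite (le_trans (ler_norm _))// lerDr.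
 apply: (le_trans RS).
 have [ME|EM] := leP (E2 w) (M2 w); last by have := SME w; nra.
 have SM : S w <= 4 * M2 w by have := SME w; lra.
 have : c0 * S w <= 16 * c0 * n / r ^+ 2 * M4 w.
  have -> : 16 * c0 * n / r ^+ 2 * M4 w = c0 * (16 * (n * M4 w) / r ^+ 2).
   by field; rewrite gt_eqF.
  rewrite ler_wpM2l ?(ltW c00)// ler_pdivlMr ?exprn_gt0//.
  by have := MM w; have := S0 w; have := M20 w; have := sqr_ge0 r; nra.
 by lra.
have L1M2 : L1 M2 by apply: L1_sum => j _; exact: (L2M j).2.
have L1E2 : L1 E2 by apply: L1_sum => j _; exact: (L2e j).2.
have L1M4 : L1 M4.
 by apply: L1_sum => j _; have [h _ _] := (hC j).2 x s t s0 st.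
have L1le : L1 (fun w => 2 * e1 * M2 w + (2 * e1 + 4 * c0) * E2 w +
  16 * c0 * n / r ^+ 2 * M4 w).
 by apply: L1D; [apply: L1D|]; exact: L1Z.
have L1R : L1 (Rm x s t) by apply: (L1_le _ le L1le); exact: mR.
split => //.
apply: (le_trans (Ex_le (L1_abs L1R) L1le le)).
rewrite ExD; [|by apply: L1D; exact: L1Z|exact: L1Z].
rewrite ExD; [|exact: L1Z|exact: L1Z].
rewrite !ExZ//.
have k1 : Ex M2 <= SC * (t - s).
 rewrite Ex_sum => [|j _]; last exact: (L2M j).2.
 apply: (@le_trans _ _ (\sum_j C j * (t - s))).
  by apply: ler_sum => j _; have [_ h _] := (hC j).2 x s t s0 st.
 by rewrite -mulr_suml ler_wpM2r// /SC lerDr.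
have k4 : Ex M4 <= SC * (t - s) ^+ 2.
 rewrite Ex_sum => [|j _]; last by have [h _ _] := (hC j).2 x s t s0 st.
 apply: (@le_trans _ _ (\sum_j C j * (t - s) ^+ 2)).
  by apply: ler_sum => j _; have [_ _ h] := (hC j).2 x s t s0 st.
 by rewrite -mulr_suml ler_wpM2r ?sqr_ge0// /SC lerDr.
have k2 : Ex E2 <= n * (e2 * (t - s)).
 rewrite Ex_sum => [|j _]; last exact: (L2e j).2.
 apply: (@le_trans _ _ (\sum_(j : J) e2 * (t - s))).
  by apply: ler_sum => j _; have [_ h] := H j x s t s0 st tT std.
 rewrite sumr_const -[leLHS]mulr_natl ler_wpM2r ?(mulr_ge0 (ltW e20))//.
 by rewrite /n lerDr.
have j1 : 2 * e1 * Ex M2 <= e / 4 * (t - s).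
 apply: (@le_trans _ _ (2 * e1 * (SC * (t - s)))).
  by rewrite ler_wpM2l// mulr_ge0// ltW.
 by apply: eq_ler; rewrite /e1; field; rewrite gt_eqF.
have j2 : (2 * e1 + 4 * c0) * Ex E2 <= e / 4 * (t - s).
 apply: (@le_trans _ _ ((2 * e1 + 4 * c0) * (n * (e2 * (t - s))))).
  by rewrite ler_wpM2l// ltW.
 by apply: eq_ler; rewrite /e2; field; rewrite !gt_eqF.
have j3 : 16 * c0 * n / r ^+ 2 * Ex M4 <= e / 4 * (t - s).
 apply: (@le_trans _ _ (A * (t - s) * (t - s))).
  apply: (@le_trans _ _ (16 * c0 * n / r ^+ 2 * (SC * (t - s) ^+ 2))).
   rewrite ler_wpM2l// divr_ge0 ?sqr_ge0// !mulr_ge0 ?(ltW c00) ?(ltW n0)//.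
  have -> : A * (t - s) * (t - s) = 16 * c0 * n / r ^+ 2 * (SC * (t - s) ^+ 2) + (t - s) ^+ 2.
   by rewrite /A; field; rewrite gt_eqF.
  by rewrite lerDl sqr_ge0.
 rewrite ler_wpM2r// mulrC; move: stA; rewrite ler_pdivlMr ?mulr_gt0//.
 by move=> h; rewrite ler_pdivlMr//; lra.
have : 0 <= e * (t - s) by rewrite mulr_ge0// ltW.
by lra.
Qed.

End germs.
End brownian.

(** * Continuous paths: uniform continuity, dyadic times, Riemann sums *)

Section paths.
Context {R : realType}.
Implicit Types (f g : R -> R) (s t p q e : R).

(** Heine-Cantor theorem, for a function that is continuous only relative to [K]. *)
Lemma compact_unif (V : normedModType R) (K : set V) (f : V -> R) :
 compact K -> {within K, continuous f} -> forall e : R, 0 < e ->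
 exists2 dl : R, 0 < dl & forall x y, K x -> K y -> `|x - y| <= dl -> `|f x - f y| <= e.
Proof.
move=> /compact_near_coveringP/near_covering_withinP cpt /subspace_continuousP cf e e0.
pose Q (dl : R) (x : V) := forall y, K y -> `|x - y| <= dl -> `|f x - f y| <= e.
have e2 : 0 < e / 2 by rewrite divr_gt0.
have H : \forall dl \near (0 : R)^'+, K `<=` Q dl.
 apply: cpt => x Kx.
 have := cf x Kx => /cvgrPdist_le/(_ _ e2).
 rewrite near_withinE => /nbhs_ballP[r/= r0 hr].
 have r2 : 0 < r / 2 by rewrite divr_gt0.
 exists (ball x (r / 2), [set dl | dl < r / 2]) => /=.
  by split; [exact: nbhsx_ballx|exact: nbhs_right_lt].
 move=> [x' dl]/= [xx' dlr] Kx' y Ky x'y.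
 have xx'' : `|x - x'| < r / 2 by move: xx'; rewrite -ball_normE.
 have h1 : `|f x - f x'| <= e / 2.
  by apply: hr => //; rewrite -ball_normE/=; lra.
 have h2 : `|f x - f y| <= e / 2.
  apply: hr => //; rewrite -ball_normE/= -(subrK x' x) -addrA.
  by apply: (le_lt_trans (ler_normD _ _)); lra.
 have -> : f x' - f y = (f x - f y) - (f x - f x') by ring.
 by apply: (le_trans (ler_normB _ _)); lra.
have [dl [dl0 hdl]] : exists dl : R, 0 < dl /\ K `<=` Q dl.
 have [dl [h1 h2]] := @filter_ex _ _ (at_right_proper_filter (0 : R)) _
  (filterI (nbhs_right_gt (0 : R)) H).
 by exists dl.
by exists dl => // x y Kx Ky; exact: hdl.
Qed.

(* Continuity on [0, +oo[, in its uniform form on bounded intervals. *)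
Definition pcont f := forall T0 e : R, 0 < e -> exists2 dl : R, 0 < dl &
 forall s t, 0 <= s -> s <= T0 -> 0 <= t -> t <= T0 -> `|s - t| <= dl ->
 `|f s - f t| <= e.

Lemma within_pcont f : {within `[0, +oo[, continuous f} <-> pcont f.
Proof.
split=> [cf T0 e e0|pf].
 have cf' : {within `[0, T0], continuous f}.
  apply: continuous_subspaceW cf => x /=.
  by rewrite !in_itv/= andbT => /andP[].
 have [dl dl0 h] := compact_unif (@segment_compact R 0 T0) cf' e0.
 exists dl => // s t s0 sT t0 tT st; apply: h => //=.
  by rewrite in_itv/= s0.
 by rewrite in_itv/= t0.
apply/subspace_continuousP => x; rewrite /= in_itv/= andbT => x0.
apply/cvgrPdist_le => e e0; rewrite near_withinE.
have [dl dl0 h] := pf (x + 1) e e0.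
apply/nbhs_ballP; exists (Num.min dl 1) => /=; first by rewrite lt_min dl0 ltr01.
move=> y; rewrite -ball_normE/= lt_min => /andP[xy xy1]; rewrite in_itv/= andbT => y0.
apply: h => //; [by rewrite lerDl| |exact: ltW].
by move: xy1; rewrite ltr_norml => /andP[? _]; lra.
Qed.

Lemma pcont_cst c : pcont (fun=> c).
Proof. by move=> T0 e e0; exists 1 => // *; rewrite subrr normr0 ltW. Qed.

Lemma pcontD f g : pcont f -> pcont g -> pcont (fun t => f t + g t).
Proof.
move=> /within_pcont/subspace_continuousP cf /within_pcont/subspace_continuousP cg.
by apply/within_pcont/subspace_continuousP => x hx; apply: cvgD; [exact: cf|exact: cg].
Qed.

Lemma pcontM f g : pcont f -> pcont g -> pcont (fun t => f t * g t).
Proof.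
move=> /within_pcont/subspace_continuousP cf /within_pcont/subspace_continuousP cg.
by apply/within_pcont/subspace_continuousP => x hx; apply: cvgM; [exact: cf|exact: cg].
Qed.

Lemma pcontZ c f : pcont f -> pcont (fun t => c * f t).
Proof. by move=> hf; apply: pcontM => //; exact: pcont_cst. Qed.

Lemma pcontN f : pcont f -> pcont (fun t => - f t).
Proof. by move=> hf; under eq_fun do rewrite -mulN1r; exact: pcontZ. Qed.

Lemma pcontB f g : pcont f -> pcont g -> pcont (fun t => f t - g t).
Proof. by move=> hf hg; apply: pcontD => //; exact: pcontN. Qed.

Lemma pcont_bounded f T0 : pcont f -> exists2 K : R, 0 < K &
 forall t, 0 <= t -> t <= T0 -> `|f t| <= K.
Proof.
move=> /within_pcont cf.
have cf' : {within `[0, T0], continuous f}.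
 apply: continuous_subspaceW cf => x /=.
 by rewrite !in_itv/= andbT => /andP[].
have := compact_bounded (continuous_compact cf' (@segment_compact R 0 T0)).
move=> [M [_ hM]]; exists (`|M| + 1); first by rewrite ltr_wpDl.
move=> t t0 tT; apply: (hM (`|M| + 1)).
 by rewrite (le_lt_trans (ler_norm M))// ltrDl.
by exists t => //=; rewrite in_itv/= t0.
Qed.

Lemma pcont_comp f (h : R -> R) : continuous h -> pcont f -> pcont (fun t => h (f t)).
Proof.
move=> ch /within_pcont/subspace_continuousP cf.
by apply/within_pcont/subspace_continuousP => x hx; apply: cvg_comp (cf x hx) (ch _).
Qed.

Lemma pcont_sum (J : Type) (r : seq J) (Q : pred J) (f : J -> R -> R) :
 (forall j, pcont (f j)) -> pcont (fun t => \sum_(j <- r | Q j) f j t).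
Proof.
by move=> h; apply: (sum_fun_ind (K := pcont)) => //; [exact: pcont_cst|exact: pcontD].
Qed.

Lemma pcont_inv f : pcont f -> (forall t, 0 <= t -> 0 < f t) ->
 pcont (fun t => (f t)^-1).
Proof.
move=> /within_pcont/subspace_continuousP cf f0.
apply/within_pcont/subspace_continuousP => x hx.
have x0 : 0 <= x by move: hx; rewrite /= in_itv/= andbT.
by apply: cvgV; [rewrite gt_eqF// f0|exact: cf].
Qed.

Definition dyad (L k : nat) : R := k%:R / 2 ^+ L.

Lemma dyad_ge0 L k : 0 <= dyad L k.
Proof. by rewrite divr_ge0// exprn_ge0. Qed.

Lemma invr_exp2_small (e : R) : 0 < e ->
 exists L : nat, forall M, (L <= M)%N -> (2 ^+ M)^-1 <= e.
Proof.
move=> e0; have : (fun n => (2 ^+ n)^-1 : R) @ \oo --> 0.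
 have h : `|2^-1| < 1 :> R by rewrite ger0_norm ?invr_ge0// invf_lt1// ltr1n.
 apply: cvg_trans (cvg_geometric 1 h); apply: near_eq_cvg; apply: nearW => n.
 by rewrite /geometric /= mul1r exprVn.
move=> /cvgrPdist_le/(_ _ e0)[L _ hL]; exists L => M LM.
by have := hL M LM; rewrite sub0r normrN ger0_norm// invr_ge0 exprn_ge0.
Qed.

Lemma dyad_approx (dl t : R) : 0 < dl -> 0 <= t ->
 exists L, forall M, (L <= M)%N -> exists k, dyad M k <= t /\ t - dyad M k <= dl.
Proof.
move=> d0 t0; have [L hL] := invr_exp2_small d0.
exists L => M LM; exists (Num.truncn (t * 2 ^+ M)).
have M0 : 0 < 2 ^+ M :> R by rewrite exprn_gt0.
have q0 : 0 <= t * 2 ^+ M by rewrite mulr_ge0// ltW.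
have := truncn_itv q0; rewrite /dyad => /andP[a b]; split.
 by rewrite ler_pdivrMr.
apply: le_trans (hL M LM); rewrite lerBlDr.
rewrite -(ler_pM2r M0) mulrDl divfK ?gt_eqF// mulVf ?gt_eqF//.
by rewrite addrC natr1 ltW.
Qed.

(** Statements proved almost surely at countably many dyadic times pass in this way to all times,
    with no union of uncountably many null sets. *)
Lemma pcont_dyad_le f g (T0 c : R) : pcont f ->
 (forall L k, dyad L k <= T0 -> `|f (dyad L k)| <= c) ->
 forall t, 0 <= t -> t <= T0 -> `|f t| <= c.
Proof.
move=> hf h t t0 tT; apply/ler_addgt0Pr => e e0.
have [dl dl0 hd] := hf T0 e e0.
have [L /(_ L (leqnn L))[k [k1 k2]]] := dyad_approx dl0 t0.
have kT := le_trans k1 tT.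
have := hd t (dyad L k) t0 tT (dyad_ge0 _ _) kT.
rewrite ger0_norm ?subr_ge0// => /(_ k2) a.
rewrite -[f t](subrK (f (dyad L k))) (le_trans (ler_normD _ _))//.
by have := h L k kT; lra.
Qed.

Local Notation mu := (@lebesgue_measure R).

Lemma pcont_integrable f s t : pcont f -> 0 <= s ->
 mu.-integrable `[s, t] (EFin \o f).
Proof.
move=> /within_pcont cf s0; apply: continuous_compact_integrable.
 exact: segment_compact.
apply: continuous_subspaceW cf => x /=.
by rewrite !in_itv/= andbT => /andP[/(le_trans s0)].
Qed.

Lemma pcont_integralD f s p t : pcont f -> 0 <= s -> s <= p -> p <= t ->
 \int[mu]_(x in `[s, t]) f x = \int[mu]_(x in `[s, p]) f x + \int[mu]_(x in `[p, t]) f x.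
Proof.
move=> hf s0 sp pt.
have := @Rintegral_itvB R f (BLeft s) (BRight t) p (pcont_integrable t hf s0).
rewrite !bnd_simp => /(_ sp pt) /eqP; rewrite subr_eq => /eqP ->.
rewrite addrC; congr (_ + _); apply: Rintegral_itv_obnd_cbnd.
apply: integrableS (pcont_integrable t hf s0) => // x /=.
by rewrite !in_itv/= => /andP[/ltW/(le_trans sp) -> ->].
Qed.

Lemma pcont_integral_near f s t e : pcont f -> 0 <= s -> s <= t ->
 (forall r, s <= r -> r <= t -> `|f r - f s| <= e) ->
 `|\int[mu]_(x in `[s, t]) f x - (t - s) * f s| <= e * (t - s).
Proof.
move=> hf s0 st he.
have fi := pcont_integrable t hf s0.
have ms : measurable (`[s, t]%classic : set (measurableTypeR R)) by exact: measurable_itv.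
have mst : fine (mu `[s, t]%classic) = t - s.
 rewrite lebesgue_measure_itv/= lte_fin; move: st; rewrite le_eqVlt => /predU1P[->|->//].
 by rewrite ltxx subrr.
have cint c : mu.-integrable `[s, t] (EFin \o (fun=> c : R)) .
 exact: (pcont_integrable t (pcont_cst c) s0).
rewrite -mst mulrC -(Rintegral_cst mu ms) -RintegralB//.
have fsi : mu.-integrable `[s, t] (EFin \o (fun x => f x - f s)).
 have := integrableB ms fi (cint (f s)).
 by apply: eq_integrable => // x _; rewrite /= EFinB.
apply: le_trans (le_normr_Rintegral ms fsi) _.
rewrite -(Rintegral_cst mu ms); apply: le_Rintegral => //.
- have := integrable_abse fsi.
 by apply: eq_integrable.
- by move=> x; rewrite /= in_itv/= => /andP[sx xt]; exact: he.
Qed.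

Lemma riemann_sum f (N : nat) (s : nat -> R) (e dl : R) : pcont f -> 0 <= s 0%N ->
 (forall i, (i < N)%N -> 0 <= s i.+1 - s i <= dl) ->
 (forall p q, s 0%N <= p -> p <= s N -> s 0%N <= q -> q <= s N -> `|p - q| <= dl ->
  `|f p - f q| <= e) ->
 `|\int[mu]_(x in `[s 0%N, s N]) f x - \sum_(i < N) (s i.+1 - s i) * f (s i)| <=
 e * (s N - s 0%N).
Proof.
move=> hf s0 hs hu.
have mono i j : (i <= j)%N -> (j <= N)%N -> s i <= s j.
 elim: j => [|j IH]; first by rewrite leqn0 => /eqP ->.
 rewrite leq_eqVlt => /predU1P[->//|ij] jN.
 by apply: (le_trans (IH ij (ltnW jN))); rewrite -subr_ge0; have /andP[] := hs j jN.
have key k : (k <= N)%N -> `|\int[mu]_(x in `[s 0%N, s k]) f x -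
  \sum_(i < k) (s i.+1 - s i) * f (s i)| <= e * (s k - s 0%N).
 elim: k => [_|k IH kN].
  rewrite big_ord0 !subrr mulr0 set_itv1 Rintegral_set1 subr0 normr0//.
 have sk := mono 0%N k (leq0n _) (ltnW kN); have sk1 := mono k k.+1 (leqnSn _) kN.
 rewrite (pcont_integralD hf s0 sk sk1) big_ord_recr/= opprD addrACA.
 have -> : e * (s k.+1 - s 0%N) = e * (s k - s 0%N) + e * (s k.+1 - s k) by ring.
 apply: (le_trans (ler_normD _ _)); apply: lerD; first exact: IH (ltnW kN).
 apply: pcont_integral_near => //; first exact: le_trans s0 sk.
 have kN' := mono k.+1 N kN (leqnn _).
 move=> r r1 r2; apply: hu.
 - exact: le_trans sk r1.
 - exact: le_trans r2 kN'.
 - exact: sk.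
 - exact: le_trans sk1 kN'.
 - rewrite ger0_norm ?subr_ge0//; have /andP[_] := hs k kN.
  by apply: le_trans; rewrite lerB.
exact: key.
Qed.

End paths.

(** * The maximal inequality and almost sure limits of martingales *)

Section ito.
Context {d} {T : measurableType d} {R : realType} (P : probability T R)
 (F : R -> set (set T)) (hF : complete_filtration P F)
 (Iw : finType) (W : Iw -> R -> T -> R) (hW : brownian_motion P F W).
Local Notation Ex := (Ex P).
Local Notation L1 := (L1 P).
Local Notation L2 := (L2 P).

Definition mart_inc s t (Z : T -> R) e :=
 [/\ L2 Z, msr (F t) Z, perp P (F s) Z & Ex (fun w => Z w ^+ 2) <= e * (t - s)].

Lemma mart_incD s p t Z Z' e : 0 <= s -> s <= p -> p <= t ->
 mart_inc s p Z e -> mart_inc p t Z' e -> mart_inc s t (fun w => Z w + Z' w) e.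
Proof.
move=> s0 sp pt [L2Z mZ pZ EZ] [L2Z' mZ' pZ' EZ'].
have p0 := le_trans s0 sp.
split.
- exact: L2D.
- apply: msrD => //; first exact: (filt_sa hF (le_trans p0 pt)).
 exact: msr_sub (filt_le hF p0 pt) mZ.
- apply: perpD => //; first exact: filt_alg hF s s0.
 exact: perp_sub (filt_le hF s0 sp) pZ'.
rewrite (Ex_sqrD_perp (filt_alg hF p0) L2Z mZ L2Z' pZ').
by have -> : e * (t - s) = e * (p - s) + e * (t - p); [ring|exact: lerD].
Qed.

Lemma mart_inc0 s t e : 0 <= s -> s <= t -> 0 <= e -> mart_inc s t (fun=> 0) e.
Proof.
move=> s0 st e0; split; [exact: L2_cst| |exact: perp0|].
 by apply: msr_cst; exact: filt_sa hF t (le_trans s0 st).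
by under eq_fun do rewrite expr0n; rewrite Ex_cst mulr_ge0// subr_ge0.
Qed.

Lemma mart_inc_dW v s t xi (K e : R) : 0 <= s -> s <= t -> msr (F s) xi ->
 (forall w, `|xi w| <= K) -> Ex (fun w => xi w ^+ 2) <= e ->
 mart_inc s t (fun w => xi w * dW W v s t w) e.
Proof.
move=> s0 st mxi bxi Exi; have fs := filt_alg hF s0.
have mxi' := msr_meas fs mxi.
split.
- by apply: (L2Mb _ mxi' bxi); exact: (dW_L2 hF hW v s0 st).
- apply: msrM; first exact: filt_sa hF t (le_trans s0 st).
  exact: msr_sub (filt_le hF s0 st) mxi.
 exact: (dW_msr hF hW v s0 st).
- by apply: (perp_mulb fs mxi bxi); [exact: (dW_L2 hF hW v s0 st)|exact: (dW_perp hF hW v s0 st)].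
have L2x : L2 xi by exact: L2_bounded bxi.
have bx2 w : `|xi w ^+ 2| <= K ^+ 2.
 by rewrite normrX lerXn2r ?nnegrE// (le_trans _ (bxi w)).
have L2x2 : L2 (fun w => xi w ^+ 2).
 by apply: L2_bounded bx2; exact: measurable_funX.
have L2d : L2 (fun w => dW W v s t w * dW W v s t w - (v == v)%:R * (t - s)).
 by apply: L2B; [exact: (dW2_L2 hF hW v v s0 st)|exact: L2_cst].
have := perp_mul fs L2x2 _ L2d (dW2_perp hF hW v v s0 st).
have mx2 : msr (F s) (fun w => xi w ^+ 2).
 by under eq_fun do rewrite expr2; apply: msrM => //; case: fs.
move=> /(_ mx2) h.
have -> : (fun w => (xi w * dW W v s t w) ^+ 2) = (fun w =>
  xi w ^+ 2 * (dW W v s t w * dW W v s t w - (v == v)%:R * (t - s)) +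
  (t - s) * xi w ^+ 2).
 by apply/funext => w; rewrite eqxx mul1r; ring.
rewrite ExD; [|exact: L2_mul|by apply: L1Z; exact: L2x.2].
by rewrite h add0r ExZ ?L2x.2// mulrC ler_wpM2r// subr_ge0.
Qed.

(** Kolmogorov's inequality. By induction, [a^2] times the probability of [A k] is at most the mean
    of [D k ^+ 2] on [A k]: on the old event an orthogonal increment only adds to the second moment,
    and on the new part [|D k.+1| >= a]. *)
Lemma maximal_inequality (n : nat) (s : nat -> R) (D : nat -> T -> R) (e a : R) :
 0 <= s 0%N -> (forall k, s k <= s k.+1) -> (forall w, D 0%N w = 0) ->
 (forall k, (k < n)%N -> mart_inc (s k) (s k.+1) (fun w => D k.+1 w - D k w) e) ->
 0 < a ->
 measurable [set w | exists2 k, (k <= n)%N & a <= `|D k w|] /\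
 (P [set w | exists2 k, (k <= n)%N & (a <= `|D k w|)%R] <=
  (e * (s n - s 0%N) / a ^+ 2)%:E)%E.
Proof.
move=> s0 smono D0 hD a0.
have sk k : 0 <= s k by elim: k => // k IH; exact: le_trans IH (smono k).
have Dk k : (k <= n)%N -> mart_inc (s 0%N) (s k) (D k) e.
 elim: k => [_|k IH kn].
  rewrite (_ : D 0%N = fun=> 0); last by apply/funext => w; rewrite D0.
  split; [exact: L2_cst|by apply: msr_cst; exact: filt_sa hF _ s0|exact: perp0|].
  by under eq_fun do rewrite expr0n; rewrite Ex_cst subrr mulr0.
 have -> : D k.+1 = (fun w => D k w + (D k.+1 w - D k w)) by apply/funext => w; ring.
 apply: (mart_incD s0 _ (smono k) (IH (ltnW kn)) (hD k kn)).
 by elim: (k) => // j IHj; exact: le_trans IHj (smono j).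
pose A k := [set w | exists2 i, (i <= k)%N & a <= `|D i w|].
have A0 : A 0%N = set0.
 rewrite -subset0 => w; case=> i; rewrite leqn0 => /eqP i0; rewrite {i}i0.
 by rewrite D0 normr0 => /(lt_le_trans a0); rewrite ltxx.
have FA k : (k <= n)%N -> F (s k) (A k).
 elim: k => [_|k IH kn].
  by rewrite A0; have [] := filt_sa hF s0.
 rewrite (_ : A k.+1 = ~` (~` A k `&` ~` [set w | a <= `|D k.+1 w|])); last first.
  apply/seteqP; split => w /=.
   move=> -[i ]; rewrite leq_eqVlt => /predU1P[->|ik] h [h1 h2]; first by [].
   by apply: h1; exists i.
  move=> /not_andP[] /contrapT; first by move=> [i ik h]; exists i => //; exact: leqW.
  by exists k.+1.
 have fs := filt_sa hF (sk k.+1).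
 apply: subalgC => //; apply: subalgI => //.
  by apply: subalgC => //; exact: filt_le hF _ _ (sk k) (smono k) _ (IH (ltnW kn)).
 apply: subalgC => //.
 have [_ mD _ _] := Dk _ kn.
 have := mD [set x | a <= `|x|]; apply.
 rewrite -[X in measurable X]setTI.
 have /= := @measurable_ge _ R R (fun x => `|x|) a.
 rewrite setTI; apply; exact: measurableT_comp.
have mA k : (k <= n)%N -> measurable (A k).
 by move=> kn; apply: (filt_alg hF (sk k)).2; exact: FA.
split; first exact: mA.
have L1A k B : (k <= n)%N -> measurable B -> L1 (fun w => \1_B w * D k w ^+ 2).
 by move=> kn mB; have [[_ L2D'] _ _ _] := Dk k kn; exact: L1_indicM.
have key k : (k <= n)%N -> a ^+ 2 * fine (P (A k)) <= Ex (fun w => \1_(A k) w * D k w ^+ 2).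
 elim: k => [_|k IH kn].
  by rewrite A0 measure0/= mulr0; apply: Ex_ge0 => w; rewrite mulr_ge0// ?sqr_ge0 ?indicE.
 have kn' := ltnW kn.
 have mB : measurable (A k.+1 `\` A k) by apply: measurableD; exact: mA.
 have AkS : A k `<=` A k.+1 by move=> w [i ik h]; exists i => //; exact: leqW.
 have -> : fine (P (A k.+1)) = fine (P (A k)) + fine (P (A k.+1 `\` A k)).
  rewrite -fineD ?fin_num_measure//; try exact: mA.
  rewrite -measureU ?setDIK//; last exact: mA.
  by rewrite setDUK.
 have -> : (fun w => \1_(A k.+1) w * D k.+1 w ^+ 2) =
   (fun w => \1_(A k) w * D k.+1 w ^+ 2 + \1_(A k.+1 `\` A k) w * D k.+1 w ^+ 2).
  apply/funext => w; rewrite -mulrDl; congr (_ * _).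
  rewrite !indicE in_setD; have [wA|wA] := boolP (w \in A k).
   by rewrite (mem_set (AkS _ (set_mem wA))) andbF addr0.
  by rewrite andbT add0r.
 have [L2k mDk _ _] := Dk k kn'; have [L2m mm pm _] := hD k kn.
 rewrite ExD; [|apply: L1A => //; exact: mA|exact: L1A].
 rewrite mulrDr; apply: lerD.
  apply: (le_trans (IH kn')).
  pose m w := D k.+1 w - D k w.
  have fk := filt_alg hF (sk k).
  have L2AD := L2_indicM (mA k kn') L2k.
  have mAD : msr (F (s k)) (fun w => \1_(A k) w * D k w).
   apply: msrM => //; first by case: fk.
   by apply: msr_indic; [case: fk|exact: FA].
  have h0 := perp_mul fk L2AD mAD L2m pm.
  have L1p := L2_mul L2AD L2m.
  have L1m := L1_indicM (mA k kn') L2m.2.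
  have -> : (fun w => \1_(A k) w * D k.+1 w ^+ 2) = (fun w =>
   \1_(A k) w * D k w ^+ 2 + (2 * (\1_(A k) w * D k w * (D k.+1 w - D k w)) +
    \1_(A k) w * m w ^+ 2)) by apply/funext => w; rewrite /m; ring.
  rewrite ExD; [|by apply: L1A => //; exact: mA|by apply: L1D => //; exact: L1Z].
  rewrite ExD//; last exact: L1Z.
  rewrite ExZ// h0 mulr0 add0r lerDl; apply: Ex_ge0 => w.
  by rewrite mulr_ge0 ?sqr_ge0// indicE.
 rewrite -Ex_indic// -ExZ; last exact: L1_indic.
 apply: Ex_le; [exact/L1Z/L1_indic|exact: L1A|move=> w].
 rewrite indicE; have [|_] := boolP (w \in _); last by rewrite mulr0 mul0r.
 rewrite inE => -[[i ]]; rewrite leq_eqVlt => /predU1P[->|ik] h nA; last by exfalso; apply: nA; exists i.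
 rewrite mulr1 mul1r -(real_normK (num_real (D k.+1 w))).
 by rewrite lerXn2r ?nnegrE// ltW.
rewrite -(fineK (fin_num_measure _ _ (mA n (leqnn n)))) lee_fin.
rewrite ler_pdivlMr ?exprn_gt0// mulrC (le_trans (key n (leqnn n)))//.
have [L2n _ _ En] := Dk n (leqnn n).
apply: le_trans En; apply: Ex_le; [by apply: L1A => //; exact: mA|exact: L2n.2|].
move=> w; have [->|->] := @indic01 _ _ R (A n) w; rewrite ?mul1r ?mul0r//.
exact: sqr_ge0.
Qed.

(** Fatou's lemma stands in for the completeness of L2: the limit is already known almost surely,
    and inherits the bound. *)
Lemma Ex_fatou (X : nat -> T -> R) (Y : T -> R) (c : R) :
 (forall n, L2 (X n)) -> measf Y ->
 {ae P, forall w, X n w @[n --> \oo] --> Y w} ->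
 (forall n, Ex (fun w => X n w ^+ 2) <= c) ->
 L2 Y /\ Ex (fun w => Y w ^+ 2) <= c.
Proof.
move=> L2X mY XY Xc.
have mX2 n : measf (EFin \o (fun w => X n w ^+ 2)).
 by apply/measurable_EFinP; exact: L1_meas (L2X n).2.
have mY2 : measf (EFin \o (fun w => Y w ^+ 2)).
 by apply/measurable_EFinP; exact: measurable_funX.
have eX n : (\int[P]_w (X n w ^+ 2)%:E)%E = (Ex (fun w => X n w ^+ 2))%:E.
 rewrite /Ex /Rintegral fineK//.
 exact: (integrable_fin_num measurableT (L2X n).2).
have h := @fatou _ _ _ P setT measurableT (fun n w => (X n w ^+ 2)%:E) mX2
 (fun n w _ => sqr_ge0 _).
have le : (\int[P]_w (Y w ^+ 2)%:E <= c%:E)%E.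
 apply: (@le_trans _ _ (\int[P]_w limn_einf (fun n => (X n w ^+ 2)%:E))%E).
  rewrite le_eqVlt; apply/orP; left; apply/eqP; apply: ae_eq_integral => //.
   have := @measurable_fun_limn_esup _ T R setT (fun n => -%E \o (fun w => (X n w ^+ 2)%:E)).
   move=> /(_ _) mm; rewrite /limn_einf; apply: measurableT_comp => //; apply: mm => n.
   by apply: measurableT_comp => //; exact: mX2.
  apply: filterS XY => w XYw _.
  have : (X n w ^+ 2)%:E @[n --> \oo] --> (Y w ^+ 2)%:E.
   apply: cvg_EFin; first exact: nearW.
   by rewrite expr2; under eq_fun do rewrite expr2; exact: cvgM.
  by move=> /cvg_limn_einf_sup[->].
 apply: (le_trans h); rewrite limn_einf_lim; apply: lime_le.
  exact: is_cvg_einfs.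
 apply: nearW => n; apply: (@le_trans _ _ (\int[P]_w (X n w ^+ 2)%:E)%E).
  by apply: ereal_inf_lbound; exists n => /=.
 by rewrite eX lee_fin.
have hY : L1 (fun w => Y w ^+ 2).
 apply/integrableP; split => //.
 rewrite (eq_integral (fun w => (Y w ^+ 2)%:E)) ?(le_lt_trans le) ?ltry// => w _.
 by rewrite /= ger0_norm ?sqr_ge0.
split; first by split.
rewrite -lee_fin /Ex /Rintegral fineK//.
exact: (integrable_fin_num measurableT hY).
Qed.

End ito.

Section sequences_of_reals.
Context {R : realType}.

Lemma cauchy_seq_cvg (u : nat -> R) :
 (forall e : R, 0 < e -> exists N, forall i, (N <= i)%N -> `|u i - u N| <= e) ->
 u n @[n --> \oo] --> lim (u n @[n --> \oo]).
Proof.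
move=> h; apply: cauchy_cvg; apply: cauchy_exP => e e0.
have e2 : 0 < e / 2 by rewrite divr_gt0.
have [N hN] := h _ e2; exists (u N), N => // i /= Ni.
rewrite -ball_normE /= distrC (le_lt_trans (hN i Ni))//.
by rewrite ltr_pdivrMr// mulr_natr mulr2n ltrDl.
Qed.

Lemma geometric_tail (u : nat -> R) m i : (m <= i)%N ->
 (forall j, (m <= j)%N -> `|u j.+1 - u j| <= (2 ^+ j)^-1) ->
 `|u i - u m| <= 2 * (2 ^+ m)^-1 - 2 * (2 ^+ i)^-1.
Proof.
move=> mi h; elim: i mi => [|i IH].
 by rewrite leqn0 => /eqP ->; rewrite !subrr normr0.
rewrite leq_eqVlt => /predU1P[->|]; first by rewrite !subrr normr0.
rewrite ltnS => mi; have a := IH mi; have b := h i mi.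
have -> : u i.+1 - u m = (u i.+1 - u i) + (u i - u m) by rewrite addrA subrK.
apply: le_trans (ler_normD _ _) _; rewrite exprS invfM.
set z := (2 ^+ i)^-1 in a b *; lra.
Qed.

(** The bound at step [j] is required on [[0, j]] only, which still gives uniform convergence on
    every bounded interval. *)
Lemma pcont_geometric_limit (u : nat -> R -> R) (f : R -> R) m :
 (forall j, pcont (u j)) ->
 (forall j t, (m <= j)%N -> 0 <= t -> t <= j%:R ->
   `|u j.+1 t - u j t| <= (2 ^+ j)^-1) ->
 (forall t, 0 <= t -> f t = lim (u n t @[n --> \oo])) ->
 pcont f /\ (forall t, 0 <= t -> u n t @[n --> \oo] --> f t).
Proof.
move=> uc uh fl.
have tail j i t : (m <= j)%N -> (j <= i)%N -> 0 <= t -> t <= j%:R ->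
  `|u i t - u j t| <= 2 * (2 ^+ j)^-1.
 move=> mj ji t0 tj; have /(_ _)h := @geometric_tail (fun k => u k t) j i ji.
 apply: (le_trans (h _)); last by rewrite gerBl mulr_ge0// invr_ge0 exprn_ge0.
 move=> k jk; apply: uh => //; first exact: leq_trans jk.
 by rewrite (le_trans tj)// ler_nat.
have big (T0 e : R) : 0 < e -> exists j, [/\ (m <= j)%N, T0 <= j%:R & 2 * (2 ^+ j)^-1 <= e :> R].
 move=> e0; have e2 : 0 < e / 2 by rewrite divr_gt0.
 have [N hN] := invr_exp2_small e2.
 exists (maxn m (maxn N (Num.truncn T0).+1)); split; first exact: leq_maxl.
  have [T00|T00] := leP 0 T0; last by rewrite (le_trans (ltW T00)).
  rewrite (le_trans (ltW (truncnS_gt T0)))// ler_nat.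
  by rewrite (leq_trans _ (leq_maxr _ _))// leq_maxr.
 rewrite mulrC -ler_pdivlMr// hN//.
 by rewrite (leq_trans _ (leq_maxr _ _))// leq_maxl.
have cv t : 0 <= t -> u n t @[n --> \oo] --> f t.
 move=> t0; rewrite fl//; apply: cauchy_seq_cvg => e e0.
 have [j [mj tj je]] := big t e e0; exists j => i ji.
 exact: le_trans (tail j i t mj ji t0 tj) je.
split=> // T0 e e0.
have e3 : 0 < e / 3 by rewrite divr_gt0.
have [j [mj tj je]] := big T0 _ e3.
have near_f t : 0 <= t -> t <= T0 -> `|f t - u j t| <= e / 3.
 move=> t0 tT; apply: le_trans je.
 have /cvg_norm h : u n t - u j t @[n --> \oo] --> f t - u j t.
  by apply: cvgB; [exact: cv|exact: cvg_cst].
 rewrite -(cvg_lim _ h)//; apply: limr_le; first by apply/cvg_ex; eexists; exact: h.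
 by exists j => // i /= ji; apply: tail => //; exact: le_trans tT tj.
have [dl dl0 hd] := uc j T0 _ e3; exists dl => // s t s0 sT t0 tT st.
have a := hd s t s0 sT t0 tT st; have b := near_f s s0 sT; have c' := near_f t t0 tT.
have -> : f s - f t = (f s - u j s) + ((u j s - u j t) - (f t - u j t)) by ring.
apply: le_trans (ler_normD _ _) _; apply: le_trans (lerD (lexx _) (ler_normB _ _)) _; lra.
Qed.

End sequences_of_reals.

Section martingale_limits.
Context {d} {T : measurableType d} {R : realType} (P : probability T R)
 (F : R -> set (set T)) (hF : complete_filtration P F).
Local Notation Ex := (Ex P).
Local Notation L2 := (L2 P).
Local Notation mart_inc := (mart_inc P F).

(** Completeness puts the exceptional event in every [F t], so that a process redefined on it
    remains adapted. *)
Lemma ae_measurable_null (Q : T -> Prop) : {ae P, forall w, Q w} ->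
 exists N : set T, [/\ measurable N, P N = 0%E, forall t, 0 <= t -> F t N &
  forall w, ~ N w -> Q w].
Proof.
move=> [N [mN PN sN]]; exists N; split => //.
 have [_ _ _ h] := hF; move=> t t0; apply: (filt_le hF (lexx 0) t0); exact: h.
by move=> w nN; apply: contrapT => nQ; apply: nN; apply: sN.
Qed.

Lemma borel_cantelli_dyadic (A : nat -> set T) : (forall j, measurable (A j)) ->
 (forall j, (P (A j) <= ((2 ^+ j)^-1)%:E)%E) ->
 {ae P, forall w, exists m, forall j, (m <= j)%N -> ~ A j w}.
Proof.
move=> mA PA.
have A0 : P (lim_sup_set A) = 0%E.
 apply: lim_sup_set_cvg0 => //.
 apply: (@le_lt_trans _ _ (\sum_(0 <= j <oo) ((2 : R) / (2 ^ (j + 1))%:R)%:E)%E); last first.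
  have := @cvg_geometric_eseries_half R 2 0 => /cvg_lim h.
  by rewrite /= in h; rewrite h// ltry.
 apply: lee_nneseries => // j _; apply: (le_trans (PA j)).
 by rewrite lee_fin natrX exprD expr1 invfM mulrCA divff// mulr1.
have mS : measurable (lim_sup_set A).
 by apply: bigcap_measurable => // k _; apply: bigcup_measurable => j _; exact: mA.
exists (lim_sup_set A); split => // w /= nw m _; apply: contrapT => h; apply: nw; exists m => j mj Aj.
by apply: h; exists j.
Qed.

Lemma ae_forallC (I : countType) (Q : I -> T -> Prop) :
 (forall i, {ae P, forall w, Q i w}) -> {ae P, forall w, forall i, Q i w}.
Proof.
move=> h; have := @ae_foralln _ _ _ P (fun n w => if unpickle n is Some i then Q i w else True).
move=> /(_ _)h'; have {}h' : {ae P, forall w, forall n, if @unpickle I n is Some i then Q i w else True}.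
 by apply: h' => n; case: unpickle => [i|]; [exact: h|exact: aeW].
by apply: filterS h' => w hw i; have := hw (pickle i); rewrite pickleK.
Qed.

(** The Cauchy condition and Fatou's lemma bring [Z j] close to [Y] in L2, which carries
    orthogonality to the past over to the limit. *)
Lemma mart_inc_cvg s t (Z : nat -> T -> R) (Y : T -> R) e : 0 <= s -> s <= t ->
 (forall j, mart_inc s t (Z j) e) ->
 (forall eps : R, 0 < eps -> exists j, forall i, (j <= i)%N ->
   Ex (fun w => (Z i w - Z j w) ^+ 2) <= eps) ->
 msr (F t) Y -> {ae P, forall w, Z n w @[n --> \oo] --> Y w} ->
 mart_inc s t Y e.
Proof.
move=> s0 st hZ cau mY ZY; have t0 := le_trans s0 st.
have mY' := msr_meas (filt_alg hF t0) mY.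
have L2Z j : L2 (Z j) by case: (hZ j).
have [L2Y EY] : L2 Y /\ Ex (fun w => Y w ^+ 2) <= e * (t - s).
 by apply: Ex_fatou L2Z mY' ZY _ => j; case: (hZ j).
split => // A FA.
have mA : measurable A by apply: (filt_alg hF s0).2.
apply/eqP; rewrite -normr_eq0; apply/eqP/le_anti; rewrite normr_ge0 andbT.
apply/ler_addgt0Pr => eps eps0; rewrite add0r.
have e2 : 0 < eps ^+ 2 by rewrite exprn_gt0.
have [j hj] := cau _ e2.
have [L2d Ed] : L2 (fun w => Y w - Z j w) /\ Ex (fun w => (Y w - Z j w) ^+ 2) <= eps ^+ 2.
 apply: (@Ex_fatou _ _ _ P (fun i w => Z (i + j)%N w - Z j w)).
 - by move=> i; exact: L2B.
 - by apply: measurable_funB => //; case: (L2Z j).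
 - apply: filterS ZY => w h; apply: cvgB; last exact: cvg_cst.
  by rewrite (cvg_shiftn j (fun n => Z n w) (nbhs (Y w))).
 - by move=> i; apply: hj; exact: leq_addl.
have pZ : Ex (fun w => \1_A w * Z j w) = 0 by have [_ _ + _] := hZ j; exact.
have L1A X : L2 X -> L1 P (fun w => \1_A w * X w) by move=> /L2_L1; exact: L1_indicM.
rewrite (_ : (fun w => \1_A w * Y w) = (fun w => \1_A w * Z j w + \1_A w * (Y w - Z j w))); last by apply/funext => w; ring.
rewrite ExD ?pZ ?add0r; [|exact: L1A|exact: L1A].
apply: le_trans (Ex_norm (L1A _ L2d)) _.
have := Ex_CS1 L2d Ed; rewrite sqrtr_sqr ger0_norm ?(ltW eps0)//; apply: le_trans.
apply: Ex_le; [exact/L1_abs/L1A|exact/L2_L1/L2_abs|move=> w].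
rewrite normrM; have [->|->] := @indic01 _ _ R A w; rewrite ?normr1 ?mul1r ?normr0 ?mul0r//.
Qed.

(** On [[0, j]] at height [2^-j], the maximal inequality divides [e j * j] by the square of the
    height; the cube in the hypothesis leaves a probability [2^-j], and Borel-Cantelli applies. On
    the exceptional event the limit is set to zero, so continuity holds for every outcome. *)
Lemma martingale_limit (X : nat -> R -> T -> R) (e : nat -> R) :
 (forall j t, 0 <= t -> msr (F t) (X j t)) ->
 (forall j w, X j 0 w = 0) ->
 {ae P, forall w, forall j, pcont (X j ^~ w)} ->
 (forall j s t, 0 <= s -> s <= t -> t <= j%:R ->
  mart_inc s t (fun w => (X j.+1 t w - X j t w) - (X j.+1 s w - X j s w)) (e j)) ->
 (forall j, e j * j%:R <= (2 ^+ j)^-1 ^+ 3) ->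
 exists J : R -> T -> R, [/\ forall t, 0 <= t -> msr (F t) (J t),
  forall w, pcont (J ^~ w), forall w, J 0 w = 0 &
  {ae P, forall w, forall t, 0 <= t -> X n t w @[n --> \oo] --> J t w}].
Proof.
move=> mX X0 cX hX he.
pose D j t w := X j.+1 t w - X j t w.
pose B j L := [set w | exists2 k, (k <= j * 2 ^ L)%N & (2 ^+ j)^-1 <= `|D j (dyad L k) w|].
have dj j L : dyad L (j * 2 ^ L) = j%:R :> R.
 by rewrite /dyad natrM natrX mulfK// expf_neq0.
have two (j : nat) : 0 < 2 ^+ j :> R by rewrite exprn_gt0.
have mono L k : dyad L k <= dyad L k.+1 :> R.
 by rewrite /dyad ler_pM2r ?invr_gt0// ler_nat.
have dle L k k' : (k <= k')%N -> dyad L k <= dyad L k' :> R.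
 by move=> kk; rewrite /dyad ler_pM2r ?invr_gt0// ler_nat.
have BL j L : measurable (B j L) /\ (P (B j L) <= ((2 ^+ j)^-1)%:E)%E.
 have z0 : 0 < (2 ^+ j)^-1 :> R by rewrite invr_gt0.
 have mi k : (k < j * 2 ^ L)%N -> mart_inc (dyad L k) (dyad L k.+1)
   (fun w => D j (dyad L k.+1) w - D j (dyad L k) w) (e j).
  move=> kn; apply: hX; [exact: dyad_ge0|exact: mono|].
  by rewrite -(dj j L); exact: dle.
 have [|h1 h2] := maximal_inequality hF (dyad_ge0 L 0) (mono L) _ mi z0.
  by move=> w; rewrite /D /dyad mul0r !X0 subrr.
 split => //; apply: (le_trans h2); rewrite lee_fin dj [dyad L 0]/dyad mul0r subr0.
 rewrite ler_pdivrMr ?exprn_gt0// (le_trans (he j))//.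
pose A j := \bigcup_L B j L.
have mA j : measurable (A j) by apply: bigcup_measurable => L _; case: (BL j L).
(* The events [B j L] increase as the dyadic grid is refined, so their union inherits the bound,
   which does not depend on [L]. *)
have PA j : (P (A j) <= ((2 ^+ j)^-1)%:E)%E.
 have nd : nondecreasing_seq (B j).
  apply/nondecreasing_seqP => L; apply/subsetPset => w [k kj h].
  exists (k * 2)%N; first by rewrite expnSr mulnA leq_mul2r kj orbT.
  by rewrite (_ : dyad L.+1 _ = dyad L k)// /dyad natrM exprSr -mulf_div divff// mulr1.
 have h := @nondecreasing_cvg_mu _ _ _ P (B j) (fun L => (BL j L).1) (mA j) nd.
 rewrite -(cvg_lim _ h)//; apply: lime_le; first by apply/cvg_ex; eexists; exact: h.
 by apply: nearW => L; case: (BL j L).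
have nS := borel_cantelli_dyadic mA PA.
have [N [mN PN FN hN]] := ae_measurable_null (filterI cX nS).
pose J t w := if w \in N then 0 else lim (X n t w @[n --> \oo]).
have good w : ~ N w -> pcont (J ^~ w) /\ (forall t, 0 <= t -> X n t w @[n --> \oo] --> J t w).
 move=> wN; have [cw [m hm]] := hN w wN.
 apply: (@pcont_geometric_limit _ (fun j => X j ^~ w) (J ^~ w) m) => //; last by move=> t t0; rewrite /J; case: ifPn => //; rewrite inE.
 move=> j t mj t0 tj.
 apply: (@pcont_dyad_le R (D j ^~ w) (fun=> 0) j%:R) => //; first exact: pcontB.
 move=> L k kj; apply: ltW; rewrite ltNge; apply/negP => h; apply: (hm j mj).
 exists L => //; exists k => //.
 by move: kj; rewrite /dyad ler_pdivrMr// -natrX -natrM ler_nat.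
exists J; split.
- move=> t t0; have sa := filt_sa hF t0.
 apply: (@msr_cvg _ _ _ (F t) sa (fun j w => \1_(~` N) w * X j t w)).
  move=> j; apply: msrM => //; last exact: mX.
  by apply: msr_indic => //; apply: subalgC => //; exact: FN.
 move=> w; rewrite indicE in_setC; have [wN|wN] := boolP (w \in N).
  by rewrite /J wN /=; under eq_fun do rewrite mul0r; exact: cvg_cst.
 rewrite /=; under eq_fun do rewrite mul1r.
 by apply: (good w _).2 => // /mem_set; exact/negP.
- move=> w; have [wN|wN] := boolP (w \in N).
  by rewrite /J wN; exact: pcont_cst.
 by apply: (good w _).1 => /mem_set; exact/negP.
- move=> w; rewrite /J; case: ifP => // _.
 by under eq_fun do rewrite X0; exact: lim_cst.
- exists N; split => // w; rewrite /= => /existsNP[t] /not_implyP[t0 h].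
 by apply: contrapT => wN; apply: h; apply: (good w wN).2.
Qed.

End martingale_limits.

Section dyadic.
Context {R : realType}.

Lemma dyad_le L k k' : (k <= k')%N -> dyad L k <= dyad L k' :> R.
Proof. by move=> kk; rewrite /dyad ler_pM2r ?invr_gt0 ?exprn_gt0// ler_nat. Qed.

Lemma dyadS L k : dyad L k.+1 = dyad L k + (2 ^+ L)^-1 :> R.
Proof. by rewrite /dyad -natr1 mulrDl mul1r. Qed.

Lemma dyad_coarse L M k : (L <= M)%N ->
 dyad L (k %/ 2 ^ (M - L)) <= dyad M k :> R /\
 dyad M k.+1 <= dyad L (k %/ 2 ^ (M - L)).+1 :> R.
Proof.
move=> LM; have E : 2 ^+ M = 2 ^+ L * (2 ^ (M - L))%:R :> R.
 by rewrite natrX -exprD subnKC.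
have p0 : 0 < 2 ^+ L :> R by rewrite exprn_gt0.
have q0 : (0 < 2 ^ (M - L))%N by rewrite expn_gt0.
have q0' : 0 < (2 ^ (M - L))%:R :> R by rewrite ltr0n.
rewrite /dyad E invfM; split.
 rewrite mulrA [leRHS]mulrAC ler_pM2r ?invr_gt0// ler_pdivlMr// -natrM ler_nat.
 exact: leq_divM.
rewrite mulrA [leLHS]mulrAC ler_pM2r ?invr_gt0// ler_pdivrMr// -natrM ler_nat.
exact: ltn_ceil.
Qed.

Lemma dyad_lt_bound (L k : nat) (j : nat) : (j <= L)%N -> dyad L k < j%:R :> R ->
 (k < L * 2 ^ L)%N.
Proof.
move=> jL; rewrite /dyad ltr_pdivrMr ?exprn_gt0// -natrX -natrM ltr_nat.
by move=> /leq_trans; apply; rewrite leq_mul2r jL orbT.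
Qed.

Lemma pcont_min (f : R -> R) c : 0 <= c -> pcont f -> pcont (fun t => f (Num.min t c)).
Proof.
move=> c0 hf T0 e e0; have [dl dl0 hd] := hf T0 e e0; exists dl => // s t s0 sT t0 tT st.
have m0 x : 0 <= x -> 0 <= Num.min x c by move=> x0; rewrite le_min x0 c0.
have mT x : x <= T0 -> Num.min x c <= T0 by move=> xT; rewrite ge_min xT.
apply: hd; [exact: m0|exact: mT|exact: m0|exact: mT|].
apply: le_trans st.
by rewrite /Num.min; case: ltP => sc; case: ltP => tc//; rewrite ?subrr ?normr0//;
  rewrite ler_norml; have := ler_norm (s - t); have := ler_norm (t - s); rewrite distrC => h1 h2; apply/andP; split; lra.
Qed.

End dyadic.

(** * Construction of the Ito integral of a bounded continuous adapted integrand *)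

Section ito_integral.
Context {d} {T : measurableType d} {R : realType} (P : probability T R)
 (F : R -> set (set T)) (hF : complete_filtration P F)
 (Iw : finType) (W : Iw -> R -> T -> R) (hW : brownian_motion P F W).
Local Notation Ex := (Ex P).
Local Notation mart_inc := (mart_inc P F).

(** An arbitrary interval is cut at the grid points inside it, and orthogonality adds the second
    moments of the pieces. *)
Lemma mart_inc_cells L (Xi : R -> T -> R) s t e : 0 <= s -> s <= t -> 0 <= e ->
 (forall k p q, s <= p -> p < q -> q <= t -> dyad L k <= p -> q <= dyad L k.+1 ->
   mart_inc p q (fun w => Xi q w - Xi p w) e) ->
 mart_inc s t (fun w => Xi t w - Xi s w) e.
Proof.
move=> s0 st e0 h.
(* Grid points projected onto [[s, t]]: a cell that misses the interval collapses to a point and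
   contributes nothing. *)
pose c k := Num.max s (Num.min t (dyad L k)).
have cs k : s <= c k by rewrite le_max lexx.
have ct k : c k <= t by rewrite ge_max st ge_min lexx.
have cc k : c k <= c k.+1.
 rewrite ge_max cs/= /c le_max; apply/orP; right.
 by rewrite le_min !ge_min lexx/= dyad_le ?orbT.
have main k : mart_inc s (c k) (fun w => Xi (c k) w - Xi s w) e.
 elim: k => [|k IH].
  have -> : c 0%N = s.
   by rewrite /c /dyad mul0r (min_idPr (le_trans s0 st)) (max_idPl s0).
  under eq_fun do rewrite subrr; exact: mart_inc0.
 rewrite (_ : (fun w => _) = (fun w => (Xi (c k) w - Xi s w) + (Xi (c k.+1) w - Xi (c k) w))); last by apply/funext => w; ring.
 apply: (mart_incD hF s0 (cs k) (cc k) IH).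
 have [ck|ck] := eqVneq (c k) (c k.+1).
  rewrite -ck; under eq_fun do rewrite subrr; apply: mart_inc0 => //.
  exact: le_trans s0 (cs k).
 have clt : c k < c k.+1 by rewrite lt_neqAle ck cc.
 have dk : dyad L k <= t.
  rewrite leNgt; apply/negP => tk; move: ck.
  have tk' : t < dyad L k.+1 by apply: (lt_le_trans tk); exact: dyad_le.
  by rewrite /c (min_idPl (ltW tk)) (min_idPl (ltW tk')) eqxx.
 have dk1 : s <= dyad L k.+1.
  rewrite leNgt; apply/negP => tk; move: ck.
  have tk' : dyad L k < s by apply: le_lt_trans tk; exact: dyad_le.
  have h1 : Num.min t (dyad L k) <= s by rewrite ge_min (ltW tk') orbT.
  have h2 : Num.min t (dyad L k.+1) <= s by rewrite ge_min (ltW tk) orbT.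
  by rewrite /c (max_idPl h1) (max_idPl h2) eqxx.
 apply: (h k) => //; first by rewrite le_max le_min dk lexx orbT.
 by rewrite ge_max dk1 ge_min lexx orbT.
suff [k <-] : exists k, c k = t by exact: main.
exists ((Num.truncn t).+1 * 2 ^ L)%N.
have tk : t <= dyad L ((Num.truncn t).+1 * 2 ^ L).
 by rewrite /dyad natrM natrX mulfK ?expf_neq0// ltW// truncnS_gt.
by rewrite /c (min_idPl tk) (max_idPr st).
Qed.

(** Besides boundedness and adaptedness, continuity is required for every outcome, so integrands
    carry no exceptional set. *)
Definition bac (H : R -> T -> R) := bap F (fun _ : unit => H) /\ forall w, pcont (H ^~ w).

Lemma bac_bound H : bac H -> exists K : R, [/\ 0 < K, forall t w, 0 <= t -> `|H t w| <= K &
 forall t, 0 <= t -> msr (F t) (H t)].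
Proof.
move=> [[K K0 h] _]; exists K; split=> // [t w t0|t t0]; have [] := h tt t t0 => //.
Qed.

(** Otherwise there are pairs of times at distance at most [1 / (n + 1)] with a fixed L2 gap.
    Uniform continuity of each path sends the differences to zero pointwise, and dominated
    convergence contradicts the gap. *)
Lemma bac_L2_continuous H : bac H -> forall T0 e : R, 0 < e -> exists2 dl : R, 0 < dl &
 forall r s, 0 <= r -> r <= T0 -> 0 <= s -> s <= T0 -> `|r - s| <= dl ->
 Ex (fun w => (H r w - H s w) ^+ 2) <= e.
Proof.
move=> hH T0 e e0; have [K [K0 bH mH]] := bac_bound hH.
apply: contrapT => nh.
have bad n : exists rs : R * R, [/\ 0 <= rs.1 <= T0, 0 <= rs.2 <= T0, `|rs.1 - rs.2| <= n.+1%:R^-1 &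
  e < Ex (fun w => (H rs.1 w - H rs.2 w) ^+ 2)].
 apply: contrapT => nb; apply: nh; exists n.+1%:R^-1; first by rewrite invr_gt0.
 move=> r s r0 rT s0 sT rs; rewrite leNgt; apply/negP => h; apply: nb.
 by exists (r, s); split; rewrite /= ?r0 ?rT ?s0 ?sT.
have [rs hrs] := choice bad.
pose X n w := (H (rs n).1 w - H (rs n).2 w) ^+ 2.
have mX n : measf (X n).
 have [/andP[a _] /andP[b _] _ _] := hrs n.
 by apply: measurable_funX; apply: measurable_funB; [exact: msr_meas (filt_alg hF a) (mH _ a)|exact: msr_meas (filt_alg hF b) (mH _ b)].
have bX n w : `|X n w| <= (2 * K) ^+ 2.
 have [/andP[a _] /andP[b _] _ _] := hrs n.
 rewrite normrX lerXn2r ?nnegrE ?mulr_ge0 ?(ltW K0)// (le_trans (ler_normB _ _))//.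
 by rewrite mulr_natl mulr2n lerD// bH.
have X0 : {ae P, forall w, X n w @[n --> \oo] --> 0}.
 apply: aeW => w; apply/cvgrPdist_le => eps eps0.
 have c1 : 0 < Num.min 1 eps by rewrite lt_min ltr01.
 have [dl dl0 hd] := hH.2 w T0 _ c1.
 have [N hN] : exists N : nat, N.+1%:R^-1 <= dl.
  exists (Num.truncn dl^-1); rewrite -[leRHS]invrK lef_pV2 ?posrE ?invr_gt0// ltW// truncnS_gt//.
 exists N => // n /= Nn.
 have [/andP[a a'] /andP[b b'] ab _] := hrs n.
 have h := hd _ _ a a' b b' (le_trans ab (le_trans _ hN)).
 rewrite sub0r normrN /X normrX.
 have h' : `|H (rs n).1 w - H (rs n).2 w| <= Num.min 1 eps.
  by apply: h; rewrite lef_pV2 ?posrE// ler_nat ltnS.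
 move: h'; rewrite le_min => /andP[u1 u2].
 by rewrite expr2 (le_trans _ u2)// ler_piMl.
have := @Ex_DCT0 _ _ _ P X (fun=> (2 * K) ^+ 2) mX (L1_cst _ _) bX X0.
move=> /cvgrPdist_lt/(_ _ e0)[N _ /(_ N (leqnn N))] /=.
have [_ _ _ h] := hrs N; rewrite sub0r normrN ltNge => /negP; apply.
by rewrite (le_trans (ltW h))// ler_norm.
Qed.

Section step_integrals.
Variables (v : Iw) (H : R -> T -> R).
Hypothesis hH : bac H.

(** The left endpoint sum on the grid of mesh [2^-L]. The bound [L * 2 ^ L] stops it at time [L]:
    the sum is finite, and covers any bounded interval once [L] is large. *)
Definition stepint (L : nat) (t : R) (w : T) : R := \sum_(k < L * 2 ^ L)
 H (dyad L k) w * (W v (Num.min t (dyad L k.+1)) w - W v (Num.min t (dyad L k)) w).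

Lemma stepint_cell L k p q w : (k < L * 2 ^ L)%N -> dyad L k <= p -> p <= q ->
 q <= dyad L k.+1 -> stepint L q w - stepint L p w = H (dyad L k) w * dW W v p q w.
Proof.
move=> kL kp pq qk; rewrite /stepint -sumrB (bigD1 (Ordinal kL)) //=.
rewrite big1 ?addr0 => [|i ik].
 rewrite (min_idPl qk) (min_idPr (le_trans kp pq)) (min_idPl (le_trans pq qk)) (min_idPr kp).
 by rewrite /dW; ring.
have [{}ik|ik'] := ltnP i k.
 have h1 := le_trans (dyad_le L ik) kp; have h2 := le_trans h1 pq.
 have h3 := le_trans (dyad_le L (leqnSn i)) h1; have h4 := le_trans h3 pq.
 by rewrite (min_idPr h1) (min_idPr h2) (min_idPr h3) (min_idPr h4) subrr.
have {ik ik'} ki : (k < i)%N by rewrite ltn_neqAle ik' eq_sym andbT.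
have h1 := le_trans qk (dyad_le L ki); have h2 := le_trans pq h1.
have h3 := le_trans h1 (dyad_le L (leqnSn i)); have h4 := le_trans h2 (dyad_le L (leqnSn i)).
by rewrite (min_idPl h1) (min_idPl h2) (min_idPl h3) (min_idPl h4); ring.
Qed.

Lemma stepint0 L w : stepint L 0 w = 0.
Proof. by rewrite /stepint big1// => i _; rewrite !(min_idPl (dyad_ge0 _ _)) subrr mulr0. Qed.

Lemma stepint_msr L t : 0 <= t -> msr (F t) (stepint L t).
Proof.
move=> t0; have sa := filt_sa hF t0; have [K [K0 bH mH]] := bac_bound hH.
apply: msr_sum => // i.
have [it|it] := leP (dyad L i) t; last first.
 rewrite (_ : (fun w => _) = fun=> 0); first exact: msr_cst.
 apply/funext => w; rewrite (min_idPl _) ?subrr ?mulr0//.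
 by rewrite (le_trans (ltW it))// dyad_le.
apply: msrM => //.
 by apply: msr_sub (mH _ (dyad_ge0 _ _)); exact: (filt_le hF (dyad_ge0 _ _) it).
have wmin c : 0 <= c -> msr (F t) (W v (Num.min t c)).
 move=> c0; have m0 : 0 <= Num.min t c by rewrite le_min t0 c0.
 have mt : Num.min t c <= t by rewrite ge_min lexx.
 exact: (msr_sub (filt_le hF m0 mt) (W_msr hW v m0)).
apply: (msrB sa); first exact: (wmin _ (dyad_ge0 _ _)).
exact: (msr_sub (filt_le hF (dyad_ge0 _ _) it) (W_msr hW v (dyad_ge0 _ _))).
Qed.

Lemma ae_pcont_W : {ae P, forall w, pcont (W v ^~ w)}.
Proof.
case: hW => /(_ v)[_ cW] _ _; apply: filterS cW => w h; exact/within_pcont.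
Qed.

Lemma msr_diff_H a b p : 0 <= a -> 0 <= b -> a <= p -> b <= p ->
 msr (F p) (fun w => H a w - H b w) /\ exists K : R, forall w, `|H a w - H b w| <= K.
Proof.
move=> a0 b0 ap bp; have [K [K0 bH mH]] := bac_bound hH; split.
 apply: (msrB (filt_sa hF (le_trans a0 ap))).
  exact: msr_sub (filt_le hF a0 ap) (mH _ a0).
 exact: msr_sub (filt_le hF b0 bp) (mH _ b0).
by exists (K + K) => w; rewrite (le_trans (ler_normB _ _))// lerD// bH.
Qed.

(** Ito's isometry: inside a cell, two step integrals differ by a difference of values of [H] times
    [dW], and [H] is continuous in L2. The last clause, which compares the integral with its frozen
    integrand, is what becomes a germ. *)
Lemma ito_exists : exists J : R -> T -> R, [/\ forall t, 0 <= t -> msr (F t) (J t),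
 forall w, pcont (J ^~ w), forall w, J 0 w = 0 &
 forall T0 e : R, 0 < e -> exists2 dl : R, 0 < dl &
 forall s t, 0 <= s -> s <= t -> t <= T0 -> t - s <= dl ->
  mart_inc s t (fun w => J t w - J s w - H s w * dW W v s t w) e].
Proof.
pose e (j : nat) : R := (2 ^+ j)^-1 ^+ 3 / j.+1%:R.
have z0 j : 0 < (2 ^+ j)^-1 :> R by rewrite invr_gt0 exprn_gt0.
have e0 j : 0 < e j by rewrite divr_gt0 ?exprn_gt0.
have ej j : e j * j%:R <= (2 ^+ j)^-1 ^+ 3.
 by rewrite /e -mulrA ler_piMr ?exprn_ge0 ?(ltW (z0 _))// mulrC ler_pdivrMr// mul1r ler_nat.
have lvl (j : nat) : exists N0 : nat, forall r s, 0 <= r -> r <= j%:R -> 0 <= s -> s <= j%:R ->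
  `|r - s| <= (2 ^+ N0)^-1 -> Ex (fun w => (H r w - H s w) ^+ 2) <= e j.
 have [dl dl0 hd] := bac_L2_continuous hH j%:R (e0 j).
 have [N0 hN] := invr_exp2_small dl0; exists N0 => r s r0 rj s0 sj rs.
 by apply: hd => //; exact: le_trans rs (hN _ (leqnn _)).
have [N0 hN0] := choice lvl.
(* The cumulative sum makes the levels increasing and at least [N0 j]; the added [j] makes the step
   integral of level [N j] cover [[0, j]]. *)
pose N j := (\sum_(i < j.+1) N0 i + j)%N.
have Nmono i j : (i <= j)%N -> (N i <= N j)%N.
 move=> /subnK <-; elim: (j - i)%N => // n IH; rewrite addSn.
 apply: leq_trans IH _; rewrite /N [X in (_ <= X + _)%N]big_ord_recr /= -addnA leq_add2l.
 by rewrite addnS leqW// leq_addl.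
have Nj j : (j <= N j)%N by exact: leq_addl.
have N0j j : (N0 j <= N j)%N by rewrite /N big_ord_recr/= -addnA addnCA leq_addr.
have pow a b : (a <= b)%N -> (2 ^+ b)^-1 <= (2 ^+ a)^-1 :> R.
 by move=> ab; rewrite lef_pV2 ?posrE ?exprn_gt0// ler_weXn2l// ler1n.
have diff j i s t : (j <= i)%N -> 0 <= s -> s <= t -> t <= j%:R ->
  mart_inc s t (fun w => (stepint (N i) t w - stepint (N j) t w) -
   (stepint (N i) s w - stepint (N j) s w)) (e j).
 move=> ji s0 st tj.
 apply: (@mart_inc_cells (N i) (fun t w => stepint (N i) t w - stepint (N j) t w)) => //.
  exact: ltW.
 move=> k p q sp pq qt kp qk; have p0 := le_trans s0 sp.
 have [c1 c2] := @dyad_coarse R (N j) (N i) k (Nmono _ _ ji).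
 set k' := (k %/ _)%N in c1 c2.
 have kj : dyad (N i) k < j%:R :> R by apply: (le_lt_trans kp); apply: (lt_le_trans pq); exact: le_trans tj.
 have h1 := @dyad_lt_bound R _ k j (leq_trans (Nj j) (Nmono _ _ ji)) kj.
 have h2 := @dyad_lt_bound R _ k' j (Nj j) (le_lt_trans c1 kj).
 rewrite (_ : (fun w => _) = (fun w => (H (dyad (N i) k) w - H (dyad (N j) k') w) * dW W v p q w)); last first.
  apply/funext => w; rewrite mulrBl -(stepint_cell w h1 kp (ltW pq) qk).
  rewrite -(stepint_cell w h2 (le_trans c1 kp) (ltW pq) (le_trans qk c2)); ring.
 have [m1 [K bK]] := msr_diff_H (dyad_ge0 (N i) k) (dyad_ge0 (N j) k') kp (le_trans c1 kp).
 apply: (mart_inc_dW hF hW v p0 (ltW pq) m1 bK).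
 apply: hN0; rewrite ?dyad_ge0 ?(ltW kj) ?(ltW (le_lt_trans c1 kj))//.
 rewrite ger0_norm ?subr_ge0//; apply: le_trans (pow _ _ (N0j j)).
 have := le_trans (dyad_le (N i) (leqnSn k)) c2; rewrite (dyadS (N j)); lra.
have [|||||J [mJ cJ J0 limJ]] := @martingale_limit _ _ _ P F hF (fun j => stepint (N j)) e.
- by move=> j t t0; exact: stepint_msr.
- by move=> j w; exact: stepint0.
- apply: filterS ae_pcont_W => w h j; apply: pcont_sum => k.
 apply: pcontZ; apply: pcontB; apply: (@pcont_min _ (W v ^~ w)) => //; exact: dyad_ge0.
- by move=> j s t s0 st tj; exact: diff.
- exact: ej.
exists J; split => // T0 eps eps0.
have [dl dl0 hd] := bac_L2_continuous hH T0 eps0.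
exists (dl / 2) => [|s t s0 st tT ts]; first by rewrite divr_gt0.
have t0 := le_trans s0 st.
have [M hM] := invr_exp2_small (divr_gt0 dl0 (ltr0Sn R 1)).
pose j0 := maxn M (Num.truncn T0).+1.
have Tj : T0 <= j0%:R.
 by rewrite (le_trans (ltW (truncnS_gt T0)))// ler_nat leq_maxr.
pose Z i w := stepint (N (i + j0)) t w - stepint (N (i + j0)) s w - H s w * dW W v s t w.
apply: (@mart_inc_cvg _ _ _ P F hF s t Z) => //.
- move=> i; rewrite (_ : Z i = (fun w => (stepint (N (i + j0)) t w - H s w * W v t w) -
   (stepint (N (i + j0)) s w - H s w * W v s w))); last by apply/funext => w; rewrite /Z /dW; ring.
 apply: (@mart_inc_cells (N (i + j0)) (fun t w => stepint (N (i + j0)) t w - H s w * W v t w)) => //.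
  exact: ltW.
 move=> k p q sp pq qt kp qk; have p0 := le_trans s0 sp.
 have Tj' : T0 <= (i + j0)%:R by rewrite (le_trans Tj)// ler_nat leq_addl.
 have kj : dyad (N (i + j0)) k < (i + j0)%:R :> R.
  by apply: (le_lt_trans kp); apply: (lt_le_trans pq); apply: le_trans Tj'; exact: le_trans tT.
 have h1 := @dyad_lt_bound R _ k _ (Nj _) kj.
 rewrite (_ : (fun w => _) = (fun w => (H (dyad (N (i + j0)) k) w - H s w) * dW W v p q w)); last by apply/funext => w; rewrite mulrBl -(stepint_cell w h1 kp (ltW pq) qk) /dW; ring.
 have [m1 [K bK]] := msr_diff_H (dyad_ge0 (N (i + j0)) k) s0 kp sp.
 apply: (mart_inc_dW hF hW v p0 (ltW pq) m1 bK).
 have pT : p <= T0 by apply: le_trans tT; apply: le_trans qt; exact: ltW.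
 apply: hd; rewrite ?dyad_ge0//; [exact: le_trans kp pT|exact: le_trans st tT|].
 have : (2 ^+ N (i + j0))^-1 <= dl / 2.
  apply: hM; apply: leq_trans (Nj _).
  by rewrite (leq_trans _ (leq_addl _ _))// leq_maxl.
 move: qk; rewrite dyadS ler_norml => qk hz; apply/andP; split; lra.
- move=> eps' eps'0; have [M' hM'] := invr_exp2_small eps'0.
 exists M' => i ji; have := diff (M' + j0)%N (i + j0)%N s t.
 rewrite leq_add2r => /(_ ji s0 st) h.
 have tm : t <= (M' + j0)%:R by rewrite (le_trans tT)// (le_trans Tj)// ler_nat leq_addl.
 have [_ _ _] := h tm.
 rewrite (_ : (fun w => _) = (fun w => (Z i w - Z M' w) ^+ 2)); last by apply/funext => w; rewrite /Z; congr (_ ^+ 2); ring.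
 move=> hE; apply: (le_trans hE); apply: le_trans (hM' (M' + j0)%N (leq_addr _ _)).
 apply: (@le_trans _ _ (e (M' + j0)%N * (M' + j0)%:R)).
  by rewrite ler_wpM2l ?(ltW (e0 _))//; lra.
 apply: (le_trans (ej _)).
 rewrite exprS ler_piMr ?(ltW (z0 _))// exprn_ile1 ?(ltW (z0 _))//.
 by rewrite invf_le1 ?exprn_gt0// exprn_ege1// ler1n.
- have sa := filt_sa hF t0; have [K [K0 bH mH]] := bac_bound hH.
 apply: msrB => //; first by apply: msrB => //; [exact: mJ|exact: msr_sub (filt_le hF s0 st) (mJ _ s0)].
 apply: msrM => //; first exact: msr_sub (filt_le hF s0 st) (mH _ s0).
 exact: (dW_msr hF hW v s0 st).
apply: filterS limJ => w h; apply: cvgB; last exact: cvg_cst.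
apply: cvgB.
 by rewrite (cvg_shiftn j0 (fun n => stepint (N n) t w) (nbhs (J t w))); exact: h.
by rewrite (cvg_shiftn j0 (fun n => stepint (N n) s w) (nbhs (J s w))); exact: h.
Qed.

End step_integrals.
End ito_integral.

Lemma ler_normB2 (R : realType) (a b K : R) : `|a| <= K -> `|b| <= K -> `|a - b| <= 2 * K.
Proof. by move=> ha hb; rewrite (le_trans (ler_normB _ _))// mulr_natl mulr2n lerD. Qed.

Lemma choice_pos_min (R : realType) (J : finType) (Q : J -> R -> Prop) :
 (forall j, exists2 dl : R, 0 < dl & Q j dl) ->
 (forall j (a b : R), a <= b -> Q j b -> Q j a) ->
 exists2 dl : R, 0 < dl & forall j, Q j dl.
Proof.
move=> h mono.
have [dl hdl] := boolp.choice (fun j => let: ex_intro2 dl dl0 q := h j in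
  ex_intro (fun dl => 0 < dl /\ Q j dl) dl (conj dl0 q)).
exists (\big[Num.min/1]_j dl j).
 by apply: lt_bigmin => // j _; case: (hdl j).
by move=> j; apply: mono (hdl j).2; exact: bigmin_le.
Qed.

Lemma cvg_sumr (R : realType) (J : finType) (u : J -> nat -> R) (l : J -> R) :
 (forall j, u j n @[n --> \oo] --> l j) -> \sum_j u j n @[n --> \oo] --> \sum_j l j.
Proof.
move=> h; elim: (index_enum J) => [|j r IH].
 by under eq_fun do rewrite big_nil; rewrite big_nil; exact: cvg_cst.
by under eq_fun do rewrite big_cons; rewrite big_cons; exact: cvgD.
Qed.

(** * Ito processes and time integrals, with their germs *)

Section ito_processes.
Context {d} {T : measurableType d} {R : realType} (P : probability T R)
 (F : R -> set (set T)) (hF : complete_filtration P F)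
 (Iw : finType) (W : Iw -> R -> T -> R) (hW : brownian_motion P F W).
Local Notation Ex := (Ex P).
Local Notation L1 := (L1 P).
Local Notation L2 := (L2 P).
Local Notation mart_inc := (mart_inc P F).
Implicit Types (H X Y : R -> T -> R).

(** Continuity for every outcome instead of almost every one. All processes built here have it; only
    the given ones need a modification first. *)
Definition sure (X : R -> T -> R) := (forall t, 0 <= t -> msr (F t) (X t)) /\ forall w, pcont (X ^~ w).

Definition inc X : unit -> R -> R -> T -> R := fun _ s t w => X t w - X s w.
Definition cfam (th : Iw -> R -> T -> R) : unit -> Iw -> R -> T -> R := fun _ => th.
Definition cpar X : unit -> R -> T -> R := fun _ => X.
Definition null : unit -> R -> T -> R := fun _ _ _ => 0.
Definition nullI : unit -> Iw -> R -> T -> R := fun _ _ _ _ => 0.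

Lemma bapI_cfam th : (forall v, bac F (th v)) -> bapI F (cfam th).
Proof. by move=> h v; case: (h v). Qed.

Theorem ito_vec (th : Iw -> R -> T -> R) : (forall v, bac F (th v)) ->
 exists J : R -> T -> R, [/\ sure J, forall w, J 0 w = 0,
  germ P F W (inc J) null (cfam th) & germ2 P W (inc J) (cfam th)].
Proof.
move=> hth.
have [Jv hJ] := choice (fun v => ito_exists hF hW v (hth v)).
pose J t w := \sum_v Jv v t w.
have key : forall T0 e : R, 0 < e -> exists2 dl : R, 0 < dl & forall s t, 0 <= s -> s <= t -> t <= T0 -> t - s <= dl ->
  mart_inc s t (fun w => J t w - J s w - stoch W (cfam th) tt s t w) e.
 move=> T0 e e0.
 have n0 : 0 <= #|Iw|%:R * #|Iw|%:R :> R by rewrite mulr_ge0.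
 pose e1 := e / (#|Iw|%:R * #|Iw|%:R + 1).
 have e10 : 0 < e1 by rewrite divr_gt0// ltr_wpDl.
 have [||dl dl0 hdl] := @choice_pos_min R Iw (fun v dl => forall s t, 0 <= s -> s <= t -> t <= T0 -> t - s <= dl ->
   mart_inc s t (fun w => Jv v t w - Jv v s w - th v s w * dW W v s t w) e1).
 - by move=> v; have [_ _ _ h] := hJ v; exact: h.
 - by move=> v a b ab h s t s0 st tT ts; apply: h => //; exact: le_trans ts ab.
 exists dl => // s t s0 st tT ts.
 pose m v w := Jv v t w - Jv v s w - th v s w * dW W v s t w.
 have hm v := hdl v s t s0 st tT ts.
 have L2m v : L2 (m v) by case: (hm v).
 rewrite (_ : (fun w => _) = fun w => \sum_v m v w); last by apply/funext => w; rewrite /m /J !sumrB.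
 have ts0 : 0 <= t - s by rewrite subr_ge0.
 split.
 - by apply: L2_sum => v _.
 - by apply: msr_sum => [|v]; [exact: (filt_sa hF (le_trans s0 st))|case: (hm v)].
 - apply: perp_sum => //; first exact: (filt_alg hF s0).
  by move=> v; case: (hm v).
 apply: (@le_trans _ _ (Ex (fun w => #|Iw|%:R * \sum_v m v w ^+ 2))).
  apply: Ex_le; first by exact: (L2_sum _ (fun v _ => L2m v)).2.
   by apply: L1Z; apply: L1_sum => v _; exact: (L2m v).2.
  by move=> w; exact: sqr_sum_le.
 rewrite ExZ; last by apply: L1_sum => v _; exact: (L2m v).2.
 rewrite Ex_sum; last by move=> v _; exact: (L2m v).2.
 apply: (@le_trans _ _ (#|Iw|%:R * \sum_(v : Iw) e1 * (t - s))).
  rewrite ler_wpM2l//; apply: ler_sum => v _; by case: (hm v).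
 rewrite sumr_const -(mulr_natl (e1 * _)) !mulrA; apply: ler_wpM2r => //.
 rewrite ler_pdivrMr ?ltr_wpDl//.
 by rewrite mulrDr mulr1 [e * _]mulrC lerDl ltW.
have mJ : sure J.
 split => [t t0|w]; first by apply: msr_sum => [|v]; [exact: (filt_sa hF t0)|have [h _ _ _] := hJ v; exact: h].
 by apply: pcont_sum => v; have [_ h _ _] := hJ v; exact: h.
exists J; split => //.
- by move=> w; rewrite /J big1// => v _; have [_ _ h _] := hJ v; rewrite h.
- move=> T0 e e0; have [dl dl0 hdl] := key T0 e e0; exists dl => // -[] s t s0 st tT ts.
 have [a b c' e'] := hdl s t s0 st tT ts.
 exists (fun w => J t w - J s w - stoch W (cfam th) tt s t w); split => //.
 have E w : J t w - J s w - (t - s) * null tt s w - stoch W (cfam th) tt s t w -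
   (J t w - J s w - stoch W (cfam th) tt s t w) = 0 by rewrite /null mulr0 subr0 subrr.
 apply: (L1_norm_eq E); split; first exact: L1_cst.
 by under eq_fun do rewrite normr0; rewrite Ex_cst mulr_ge0 ?(ltW e0)// subr_ge0.
move=> T0 e e0; have [dl dl0 hdl] := key T0 e e0; exists dl => // -[] s t s0 st tT ts.
have [a b c' e'] := hdl s t s0 st tT ts; split => //.
have sJ r : 0 <= r -> L2 (fun w => J t w - J s w - stoch W (cfam th) tt s t w) by [].
rewrite (_ : inc J tt s t = fun w => (J t w - J s w - stoch W (cfam th) tt s t w) + stoch W (cfam th) tt s t w); last by apply/funext => w; rewrite subrK.
apply: L2D => //; exact: (stoch_L2 hF hW (bapI_cfam hth) tt s0 st).
Qed.

Lemma null_stoch x s t : stoch W nullI x s t = fun=> 0.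
Proof. by apply/funext => w; rewrite /stoch big1// => v _; rewrite mul0r. Qed.

Lemma germ2_lin (J : finType) (Th : Type) (c : J -> R) (Z : J -> Th -> R -> R -> T -> R) th :
 (forall j, bapI F (th j)) -> (forall j, germ2 P W (Z j) (th j)) ->
 germ2 P W (fun x s t w => \sum_j c j * Z j x s t w)
  (fun x v t w => \sum_j c j * th j x v t w).
Proof.
move=> hth h T0 e e0.
pose C := #|J|%:R * \sum_j c j ^+ 2 + 1.
have C0 : 0 < C by rewrite ltr_wpDl// mulr_ge0// sumr_ge0// => j _; exact: sqr_ge0.
have e1 : 0 < e / C by rewrite divr_gt0.
have [||dl dl0 hdl] := @choice_pos_min R J (fun j dl => forall x s t, 0 <= s -> s <= t -> t <= T0 -> t - s <= dl ->
   L2 (Z j x s t) /\ Ex (fun w => (Z j x s t w - stoch W (th j) x s t w) ^+ 2) <= (e / C) * (t - s)).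
- by move=> j; exact: h.
- by move=> j a b ab q x s t s0 st tT ts; apply: q => //; exact: le_trans ts ab.
exists dl => // x s t s0 st tT ts.
have hZ j := (hdl j x s t s0 st tT ts).1.
have L2D j : L2 (fun w => Z j x s t w - stoch W (th j) x s t w).
 by apply: L2B; [exact: hZ|exact: (stoch_L2 hF hW (hth j) x s0 st)].
split; first by apply: L2_sum => j _; apply: L2Z; exact: hZ.
have E w : \sum_j c j * Z j x s t w - stoch W (fun x v t w => \sum_j c j * th j x v t w) x s t w =
  \sum_j c j * (Z j x s t w - stoch W (th j) x s t w).
 under [RHS]eq_bigr do rewrite mulrBr; rewrite sumrB; congr (_ - _).
 rewrite /stoch; under eq_bigr do rewrite mulr_suml; rewrite exchange_big/=.
 by apply: eq_bigr => j _; rewrite mulr_sumr; apply: eq_bigr => v _; rewrite mulrA.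
under eq_fun do rewrite E.
have L2c j : L2 (fun w => c j * (Z j x s t w - stoch W (th j) x s t w)) by apply: L2Z; exact: L2D.
apply: (@le_trans _ _ (Ex (fun w => #|J|%:R * \sum_j (c j * (Z j x s t w - stoch W (th j) x s t w)) ^+ 2))).
 apply: Ex_le; first exact: (L2_sum _ (fun j _ => L2c j)).2.
  by apply: L1Z; apply: L1_sum => j _; exact: (L2c j).2.
 by move=> w; exact: sqr_sum_le.
rewrite ExZ; last by apply: L1_sum => j _; exact: (L2c j).2.
rewrite Ex_sum; last by move=> j _; exact: (L2c j).2.
have ts0 : 0 <= t - s by rewrite subr_ge0.
apply: (@le_trans _ _ (#|J|%:R * \sum_j c j ^+ 2 * (e / C * (t - s)))).
 rewrite ler_wpM2l//; apply: ler_sum => j _.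
 under eq_fun do rewrite exprMn.
 rewrite ExZ; last exact: (L2D j).2.
 by rewrite ler_wpM2l ?sqr_ge0//; exact: (hdl j x s t s0 st tT ts).2.
apply: (@le_trans _ _ (C * (e / C * (t - s)))).
 rewrite -mulr_suml mulrA; apply: ler_wpM2r; first by rewrite mulr_ge0 ?(ltW e1).
 by rewrite /C lerDl.
by rewrite mulrA [C * _]mulrC divfK ?gt_eqF.
Qed.

Lemma germ2_ext (Z Z' : unit -> R -> R -> T -> R) th th' : bapI F th' -> germ2 P W Z th ->
 (forall u s t, 0 <= s -> s <= t -> measf (Z' u s t) /\
   {ae P, forall w, Z u s t w = Z' u s t w}) ->
 (forall u v t w, 0 <= t -> th u v t w = th' u v t w) -> germ2 P W Z' th'.
Proof.
move=> hth g eZ eth T0 e e0; have [dl dl0 h] := g T0 e e0; exists dl => // u s t s0 st tT ts.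
have [L2Z EZ] := h u s t s0 st tT ts; have [mZ' aZ] := eZ u s t s0 st.
have seq : stoch W th u s t = stoch W th' u s t by apply/funext => w; apply: eq_bigr => v _; rewrite eth.
have L2s := stoch_L2 hF hW hth u s0 st.
have L2Z' : L2 (Z' u s t).
 split => //; apply: (L1_ae _ _ L2Z.2); first exact: measurable_funX.
 by apply: filterS aZ => w ->.
rewrite seq in EZ; split => //; rewrite -(Ex_ae _ _ (X := fun w => (Z u s t w - stoch W th' u s t w) ^+ 2))//.
- by apply: measurable_funX; apply: measurable_funB; [exact: L2_meas L2Z|exact: L2_meas L2s].
- by apply: measurable_funX; apply: measurable_funB => //; exact: L2_meas L2s.
- by apply: filterS aZ => w ->.
Qed.

(** Chebyshev's inequality applied to [germ_sum] when the noise is zero: the sums follow the Riemann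
    sums of the drift in probability. *)
Lemma germ_subdivision (Z : unit -> R -> R -> T -> R) b : bap F b ->
 germ P F W Z b nullI -> forall T0 e eta : R, 0 < e -> 0 < eta ->
 exists2 dl : R, 0 < dl & forall (N : nat) (s : nat -> R), s 0%N = 0 -> s N <= T0 ->
  (forall i, (i < N)%N -> 0 <= s i.+1 - s i <= dl) ->
  (P [set w | (e <= `|\sum_(i < N) (Z tt (s i) (s i.+1) w - (s i.+1 - s i) * b tt (s i) w)|)%R] <= eta%:E)%E.
Proof.
move=> hb hZ T0 e eta e0 eta0.
have hn : bapI F nullI by move=> v; exact: (bap_cst hF).
have [dl dl0 h] := germ_sum hF hb hn hZ T0 (mulr_gt0 e0 eta0).
exists dl => // N s s00 sN hs.
have [|LS ES] := h tt N s _ sN hs; first by rewrite s00.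
move: LS ES; set S := (X in L1 X).
have SE : S = fun w => \sum_(i < N) (Z tt (s i) (s i.+1) w - (s i.+1 - s i) * b tt (s i) w).
 by apply/funext => w; apply: eq_bigr => i _; rewrite null_stoch subr0.
have -> : [set w | (e <= `|\sum_(i < N) (Z tt (s i) (s i.+1) w - (s i.+1 - s i) * b tt (s i) w)|)%R] =
 [set w | (e <= `|S w|)%R] by rewrite SE.
move=> LS ES; apply: (le_trans (chebyshev1 LS e0)).
by rewrite lee_fin ler_pdivrMr// mulrC.
Qed.

Lemma sure_continuous_adapted X : sure X -> continuous_adapted P F X.
Proof.
move=> [mX cX]; split; first by move=> t t0 B mB; exact: mX.
by apply: aeW => w; apply/within_pcont.
Qed.

(** The process is replaced by zero on a null event, which belongs to [F 0] by completeness. *)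
Lemma continuous_adapted_sure X : continuous_adapted P F X ->
 exists2 X', sure X' & {ae P, forall w t, X' t w = X t w}.
Proof.
move=> [mX cX]; have [N [mN PN FN hN]] := ae_measurable_null hF cX.
exists (fun t w => \1_(~` N) w * X t w).
 split=> [t t0|w].
  have sa := filt_sa hF t0; apply: (msrM sa).
   by apply: (msr_indic sa); apply: (subalgC sa); exact: FN.
  by move=> B mB; exact: mX.
 have [wN|wN] := boolP (w \in N); rewrite indicE in_setC ?wN ?(negbTE wN)/=.
  by under eq_fun do rewrite mul0r; exact: pcont_cst.
 under eq_fun do rewrite mul1r; apply/within_pcont; apply: hN.
 by move=> h; move: wN; rewrite mem_set.
exists N; split => // w /existsNP[t]; apply: contra_notP => wN.
by rewrite indicE in_setC memNset//= mul1r.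
Qed.

(** The germ of [H dX - dY] has neither drift nor noise, so its sums over subdivisions vanish in
    probability. The Ito integrals of the final equation are recognized in this way. *)
Lemma germ_ito_integral H X Y bX thX : bap F (cpar H) -> continuous_adapted P F H ->
 continuous_adapted P F X -> continuous_adapted P F Y -> (forall w, Y 0 w = 0) ->
 germ P F W (inc X) bX thX ->
 germ P F W (inc Y) (fun x t w => H t w * bX x t w) (fun x v t w => H t w * thX x v t w) ->
 ito_integral P F H X Y.
Proof.
move=> hH cH cX cY Y0 gX gY; split => // t t0 e eta e0 eta0.
have g1 := germ_bap hF gX hH.
have g2 := germ_bap hF gY (bap_cst hF _ (-1)).
have g := germD hF g1 g2.
have {g1 g2}g : germ P F W (fun _ s t w => H s w * (X t w - X s w) - (Y t w - Y s w)) null nullI.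
 by apply: (germ_eq g) => *; rewrite /inc /null /nullI /cpar; ring.
have [dl dl0 h] := germ_subdivision (bap_cst hF _ 0) g t e0 eta0.
exists dl => // N s s00 sN hs.
have := h N s s00 _ hs; rewrite sN lexx => /(_ isT).
congr (P _ <= _)%E; apply/seteqP.
have E w : \sum_(i < N) (H (s i) w * (X (s i.+1) w - X (s i) w) - (Y (s i.+1) w - Y (s i) w) -
   (s i.+1 - s i) * 0) = \sum_(i < N) H (s i) w * (X (s i.+1) w - X (s i) w) - Y t w.
 under eq_bigr do rewrite mulr0 subr0.
 rewrite sumrB; congr (_ - _).
 rewrite -(big_mkord predT (fun i => Y (s i.+1) w - Y (s i) w)) telescope_sumr// sN s00 Y0 subr0//.
by split => w /=; rewrite E.
Qed.

Section drift.
Variable H : R -> T -> R.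
Hypothesis hH : bac F H.
Local Notation mu := (@lebesgue_measure R).

Definition tint (t : R) (w : T) : R := \int[mu]_(r in `[0, t]) H r w.

Lemma tint0 w : tint 0 w = 0.
Proof. by rewrite /tint set_itv1 /Rintegral integral_set1. Qed.

Lemma tintB s t w : 0 <= s -> s <= t -> tint t w - tint s w = \int[mu]_(r in `[s, t]) H r w.
Proof.
move=> s0 st; rewrite /tint (@pcont_integralD _ (H ^~ w) 0 s t)//; last exact: hH.2.
by rewrite addrAC subrr add0r.
Qed.

(** Equidistant Riemann sums. Adaptedness of time integrals and bounds on their means are obtained
    as limits of these finite sums, with no use of Fubini's theorem. *)
Definition rsum (s t : R) (N : nat) (w : T) : R :=
 \sum_(i < N.+1) ((t - s) / N.+1%:R) * H (s + i%:R * ((t - s) / N.+1%:R)) w.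

Lemma rsum_cvg s t w : 0 <= s -> s <= t -> rsum s t N w @[N --> \oo] --> tint t w - tint s w.
Proof.
move=> s0 st; rewrite tintB//; apply/cvgrPdist_le => e e0.
have ts0 : 0 <= t - s by rewrite subr_ge0.
have e1 : 0 < e / (t - s + 1) by rewrite divr_gt0// ltr_wpDl.
have [dl dl0 hd] := hH.2 w t _ e1.
exists (Num.truncn ((t - s) / dl)) => // N /= hN.
set h := (t - s) / N.+1%:R.
have h0 : 0 <= h by rewrite divr_ge0.
have hdl : h <= dl.
 rewrite /h ler_pdivrMr// mulrC -ler_pdivrMr// ltW// (lt_le_trans (truncnS_gt _))//.
 by rewrite ler_nat ltnS.
pose p (i : nat) := s + i%:R * h.
have p0 : p 0%N = s by rewrite /p mul0r addr0.
have pN : p N.+1 = t by rewrite /p /h mulrC divfK ?pnatr_eq0// addrC subrK.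
have ps i : p i.+1 - p i = h by rewrite /p -natr1; ring.
have := @riemann_sum _ (H ^~ w) N.+1 p _ dl (hH.2 w).
move=> /(_ (e / (t - s + 1))); rewrite p0 pN => /(_ s0); rewrite /rsum -/h.
under eq_bigr do rewrite ps.
move=> hr; apply: (le_trans (hr _ _)).
- by move=> i _; rewrite ps h0 hdl.
- move=> x y sx xt sy yt; apply: hd => //; exact: le_trans s0 _.
rewrite mulrAC ler_pdivrMr ?ltr_wpDl// ler_wpM2l ?(ltW e0)// lerDl ler01//.
Qed.

Lemma rsum_node (s t : R) N (i : 'I_N.+1) : s <= t ->
 s <= s + i%:R * ((t - s) / N.+1%:R) /\ s + i%:R * ((t - s) / N.+1%:R) <= t.
Proof.
move=> st; have ts0 : 0 <= t - s by rewrite subr_ge0.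
split; first by rewrite lerDl mulr_ge0// divr_ge0.
rewrite -lerBrDl mulrC -mulrA ler_piMr// mulrC ler_pdivrMr// mul1r ler_nat ltnW//.
Qed.

Lemma tint_lip (K s t : R) w : (forall r, 0 <= r -> `|H r w| <= K) -> 0 <= s -> s <= t ->
 `|tint t w - tint s w| <= K * (t - s).
Proof.
move=> bH s0 st; have ts0 : 0 <= t - s by rewrite subr_ge0.
have cv : `|rsum s t N w| @[N --> \oo] --> `|tint t w - tint s w|.
 by apply: cvg_norm; exact: rsum_cvg.
rewrite -(cvg_lim _ cv)//; apply: limr_le; first by apply/cvg_ex; eexists; exact: cv.
apply: nearW => N; apply: le_trans (ler_norm_sum _ _ _) _.
apply: (@le_trans _ _ (\sum_(i < N.+1) ((t - s) / N.+1%:R) * K)).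
 apply: ler_sum => i _; have [a b] := rsum_node i st.
 rewrite normrM ger0_norm ?divr_ge0// ler_wpM2l ?divr_ge0//.
 by rewrite bH// (le_trans s0).
by rewrite sumr_const card_ord -[_ *+ _]mulr_natl mulrA [_%:R * _]mulrC divfK ?pnatr_eq0// mulrC.
Qed.

Lemma sure_tint : sure tint.
Proof.
have [K [K0 bH mH]] := bac_bound hH; split => [t t0|w].
 have sa := filt_sa hF t0.
 apply: (@msr_cvg _ _ _ (F t) sa (rsum 0 t)); last by move=> w; have := @rsum_cvg 0 t w (lexx 0) t0; rewrite tint0 subr0.
 move=> N; apply: (msr_sum sa) => i; apply: (msrM sa); first exact: (msr_cst sa).
 have [a b] := rsum_node i t0; exact: (msr_sub (filt_le hF a b) (mH _ a)).
move=> T0 e e0; have K1 : 0 < 2 * K by rewrite mulr_gt0.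
exists (e / (2 * K)); first by rewrite divr_gt0.
suff main s t : 0 <= s -> s <= t -> `|t - s| <= e / (2 * K) -> `|tint t w - tint s w| <= e.
 move=> s t s0 _ t0 _ st; have [h|/ltW h] := leP s t; last exact: main.
 by rewrite distrC; apply: main => //; rewrite distrC.
move=> s0 st; rewrite ger0_norm ?subr_ge0// => hst.
apply: (le_trans (tint_lip _ s0 st)) => [r r0|]; first exact: bH.
apply: (@le_trans _ _ (K * (e / (2 * K)))); first by rewrite ler_wpM2l ?(ltW K0).
rewrite [K * _]mulrC invfM mulrA divfK ?gt_eqF// ler_pdivrMr// ler_peMr ?(ltW e0)// ler1n//.
Qed.

(** The integral minus [(t - s) H s] is a limit of averages of [H r - H s], which L2 continuity of
    [H] makes small; no martingale part is needed. *)
Lemma germ_tint : germ P F W (inc tint) (cpar H) nullI.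
Proof.
have [K [K0 bH mH]] := bac_bound hH.
move=> T0 e e0; have e2 : 0 < e ^+ 2 by rewrite exprn_gt0.
have [dl dl0 hd] := bac_L2_continuous hF hH T0 e2.
exists dl => // -[] s t s0 st tT ts; exists (fun=> 0).
have [L20 m0 p0 E0] := mart_inc0 hF s0 st (ltW e0); split => //.
have t0 := le_trans s0 st; have ts0 : 0 <= t - s by rewrite subr_ge0.
have msH r : 0 <= r -> measf (H r) by move=> r0; exact: msr_meas (filt_alg hF r0) (mH _ r0).
have mt r : 0 <= r -> measf (tint r).
 by move=> r0; apply: (msr_meas (filt_alg hF r0)); exact: sure_tint.1.
pose Z w := tint t w - tint s w - (t - s) * H s w.
have ZE w : inc tint tt s t w - (t - s) * cpar H tt s w - stoch W nullI tt s t w - 0 = Z w.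
 by rewrite null_stoch /inc /cpar !subr0.
apply: (L1_norm_eq ZE).
have mesh N (c : R) : \sum_(i < N.+1) ((t - s) / N.+1%:R) * c = (t - s) * c.
 by rewrite sumr_const card_ord -[_ *+ _]mulr_natl mulrA [_%:R * _]mulrC divfK ?pnatr_eq0.
have rsumB N w : `|rsum s t N w - (t - s) * H s w| <= \sum_(i < N.+1)
  ((t - s) / N.+1%:R) * `|H (s + i%:R * ((t - s) / N.+1%:R)) w - H s w|.
 rewrite -(mesh N (H s w)) -sumrB; apply: le_trans (ler_norm_sum _ _ _) _; apply: ler_sum => i _.
 by rewrite -mulrBr normrM [X in X * _]ger0_norm ?divr_ge0.
have rbd N w : `|rsum s t N w - (t - s) * H s w| <= (t - s) * (2 * K).
 apply: (le_trans (rsumB N w)); rewrite -(mesh N (2 * K)); apply: ler_sum => i _.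
 have [a b] := rsum_node i st; rewrite ler_wpM2l ?divr_ge0//.
 by apply: ler_normB2; apply: bH => //; exact: le_trans s0 a.
have mr N : measf (rsum s t N).
 apply: measurable_sum => i; apply: measurable_funM; first exact: measurable_cst.
 by have [a b] := rsum_node i st; apply: msH; exact: le_trans s0 a.
have cv w : `|rsum s t N w - (t - s) * H s w| @[N --> \oo] --> `|Z w|.
 by apply: cvg_norm; apply: cvgB; [exact: rsum_cvg|exact: cvg_cst].
have mZ : measf Z.
 apply: measurable_funB; first by apply: measurable_funB; exact: mt.
 by apply: measurable_funM; [exact: measurable_cst|exact: msH].
have [|||||LZ EZ] := @Ex_DCT _ _ _ P (fun N w => `|rsum s t N w - (t - s) * H s w|) (fun w => `|Z w|) (fun=> (t - s) * (2 * K)).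
- move=> N; apply: measurableT_comp => //; apply: measurable_funB => //.
 by apply: measurable_funM; [exact: measurable_cst|exact: msH].
- exact: measurableT_comp.
- exact: L1_cst.
- by move=> N w; rewrite normr_id.
- exact: aeW.
split; first by apply: (L1_le mZ _ LZ) => w.
rewrite -(cvg_lim _ EZ)//; apply: limr_le; first by apply/cvg_ex; eexists; exact: EZ.
apply: nearW => N.
have Ld r : 0 <= r -> L2 (fun w => H r w - H s w).
 move=> r0; apply: (@L2_bounded _ _ _ _ _ (2 * K)); first by apply: measurable_funB; exact: msH.
 by move=> w; apply: ler_normB2; exact: bH.
have node (i : 'I_N.+1) : 0 <= s + i%:R * ((t - s) / N.+1%:R).
 by have [a b] := rsum_node i st; exact: le_trans s0 a.
apply: (@le_trans _ _ (Ex (fun w => \sum_(i < N.+1) ((t - s) / N.+1%:R) *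
  `|H (s + i%:R * ((t - s) / N.+1%:R)) w - H s w|))).
 apply: Ex_le.
 - apply: L1_bounded => [|w]; last by rewrite normr_id; exact: rbd.
  apply: measurableT_comp => //; apply: measurable_funB => //.
  by apply: measurable_funM; [exact: measurable_cst|exact: msH].
 - apply: L1_sum => i _; apply: L1Z; apply: L1_abs; apply: L2_L1; exact: Ld.
 - exact: rsumB.
rewrite Ex_sum; last by move=> i _; apply: L1Z; apply: L1_abs; apply: L2_L1; exact: Ld.
apply: (@le_trans _ _ (\sum_(i < N.+1) ((t - s) / N.+1%:R) * e)).
 apply: ler_sum => i _; rewrite ExZ; last by apply: L1_abs; apply: L2_L1; exact: Ld.
 rewrite ler_wpM2l ?divr_ge0//; have [a b] := rsum_node i st.
 have -> : e = Num.sqrt (e ^+ 2) by rewrite sqrtr_sqr ger0_norm ?(ltW e0).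
 apply: Ex_CS1; first exact: Ld.
 apply: hd => //; [exact: le_trans b tT|exact: le_trans st tT|].
 rewrite addrAC subrr add0r ger0_norm ?mulr_ge0 ?divr_ge0//.
 by apply: le_trans ts; rewrite -(lerD2l s) addrCA subrr addr0.
by rewrite mesh mulrC.
Qed.
End drift.

Lemma tint_lin (J : finType) (c : J -> R) (H : J -> R -> T -> R) t w : (forall j, bac F (H j)) ->
 0 <= t -> tint (fun t w => \sum_j c j * H j t w) t w = \sum_j c j * tint (H j) t w.
Proof.
move=> hH t0.
have hS : bac F (fun t w => \sum_j c j * H j t w).
 split; last by move=> w'; apply: pcont_sum => j; apply: pcontZ; exact: (hH j).2.
 by apply: (bap_sum hF) => j; apply: (bapM hF (bap_cst hF _ (c j))); exact: (hH j).1.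
have c1 := rsum_cvg hS (w := w) (lexx 0) t0.
have c2 : rsum (fun t w => \sum_j c j * H j t w) 0 t N w @[N --> \oo] -->
  \sum_j c j * (tint (H j) t w - tint (H j) 0 w).
 have -> : (fun N => rsum (fun t w => \sum_j c j * H j t w) 0 t N w) =
   (fun N => \sum_j c j * rsum (H j) 0 t N w).
  apply/funext => N; rewrite /rsum; under [RHS]eq_bigr do rewrite mulr_sumr.
  rewrite exchange_big/=; apply: eq_bigr => i _; rewrite mulr_sumr.
  by apply: eq_bigr => j _; ring.
 by apply: cvg_sumr => j; apply: cvgM; [exact: cvg_cst|exact: (rsum_cvg (hH j) (w := w) (lexx 0) t0)].
have := cvg_unique _ c1 c2; rewrite tint0 subr0 => ->//.
by apply: eq_bigr => j _; rewrite tint0 subr0.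
Qed.

End ito_processes.

(** * Brackets with paths of finite variation; convergence in probability along subsequences *)

Section bounded_variation_sums.
Context {R : realType}.

Definition ugrid (t : R) (N i : nat) : R := i%:R * (t / N.+1%:R).

Lemma ugrid0 t N : ugrid t N 0 = 0. Proof. by rewrite /ugrid mul0r. Qed.

Lemma ugridN t N : ugrid t N N.+1 = t.
Proof. by rewrite /ugrid mulrC divfK ?pnatr_eq0. Qed.

Lemma ugridB t N i : ugrid t N i.+1 - ugrid t N i = t / N.+1%:R.
Proof. by rewrite /ugrid -natr1; ring. Qed.

Lemma ugrid_mono t N i : 0 <= t -> ugrid t N i <= ugrid t N i.+1.
Proof. by move=> t0; rewrite -subr_ge0 ugridB divr_ge0. Qed.

Lemma ugrid_itv t N i : 0 <= t -> (i <= N.+1)%N -> 0 <= ugrid t N i /\ ugrid t N i <= t.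
Proof.
move=> t0 iN; split; first by rewrite mulr_ge0// divr_ge0.
by rewrite -[leRHS](ugridN t N) /ugrid ler_wpM2r ?divr_ge0// ler_nat.
Qed.

Lemma ugrid_telescope (f : R -> R) t N :
 \sum_(i < N.+1) (f (ugrid t N i.+1) - f (ugrid t N i)) = f t - f 0.
Proof.
rewrite -(big_mkord predT (fun i => f (ugrid t N i.+1) - f (ugrid t N i))) telescope_sumr//.
by rewrite ugridN ugrid0.
Qed.

Lemma ugrid_mesh (t dl : R) : 0 <= t -> 0 < dl -> exists N0, forall N, (N0 <= N)%N -> t / N.+1%:R <= dl.
Proof.
move=> t0 dl0; exists (Num.truncn (t / dl)) => N hN.
rewrite ler_pdivrMr// mulrC -ler_pdivrMr// ltW// (lt_le_trans (truncnS_gt _))//.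
by rewrite ler_nat ltnS.
Qed.

Lemma variation_sum_le (f : R -> R) (s : nat -> R) N : (forall i, s i <= s i.+1) ->
 ((\sum_(i < N) `|f (s i.+1) - f (s i)|)%:E <= total_variation (s 0%N) (s N) f)%E.
Proof.
move=> smono; elim: N => [|N IH]; first by rewrite big_ord0 total_variation_ge0.
have s0N : s 0%N <= s N by elim: N {IH} => // n IH; exact: le_trans IH (smono n).
rewrite big_ord_recr/= (total_variationD _ s0N (smono N)) EFinD.
by apply: leeD => //; exact: total_variation_ge.
Qed.

(** The sums are at most the total variation of [f] times the oscillation of [g] on the mesh. This
    removes the correction terms from the bracket of the solution with its driver. *)
Lemma bounded_variation_null_bracket (f g : R -> R) t : 0 <= t -> bounded_variation 0 t f ->
 pcont g -> \sum_(i < N.+1) (f (ugrid t N i.+1) - f (ugrid t N i)) *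
  (g (ugrid t N i.+1) - g (ugrid t N i)) @[N --> \oo] --> 0.
Proof.
move=> t0 bf cg; apply/cvgrPdist_le => e e0.
have /(bounded_variationP _ t0) fV := bf.
pose V := fine (total_variation 0 t f).
have V0 : 0 <= V by apply: fine_ge0; exact: total_variation_ge0.
have e1 : 0 < e / (V + 1) by rewrite divr_gt0// ltr_wpDl.
have [dl dl0 hd] := cg t _ e1; have [N0 hN] := ugrid_mesh t0 dl0.
exists N0 => // N /= /hN mesh; rewrite sub0r normrN.
apply: le_trans (ler_norm_sum _ _ _) _.
apply: (@le_trans _ _ (\sum_(i < N.+1) `|f (ugrid t N i.+1) - f (ugrid t N i)| * (e / (V + 1)))).
 apply: ler_sum => i _; rewrite normrM ler_wpM2l//.
 have [a b] := ugrid_itv t0 (ltn_ord i); have [a' b'] := ugrid_itv t0 (ltnW (ltn_ord i)).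
 by apply: hd => //; rewrite ugridB ger0_norm ?divr_ge0.
rewrite -mulr_suml; apply: (@le_trans _ _ (V * (e / (V + 1)))).
 rewrite ler_wpM2r ?(ltW e1)// /V -lee_fin fineK//.
 by have := @variation_sum_le f (ugrid t N) N.+1 (fun i => ugrid_mono N i t0); rewrite ugrid0 ugridN.
by rewrite mulrA ler_pdivrMr ?ltr_wpDl// mulrC ler_wpM2l ?(ltW e0)// lerDl.
Qed.

End bounded_variation_sums.

Section convergence_in_probability.
Context {d} {T : measurableType d} {R : realType} (P : probability T R).

Definition cvg_prob (X : nat -> T -> R) (Y : T -> R) := forall e eta : R, 0 < e -> 0 < eta ->
 exists N0, forall N, (N0 <= N)%N -> (P [set w | (e <= `|X N w - Y w|)%R] <= eta%:E)%E.

(** A single subsequence serves a finite family, so several limits can be compared on one path. *)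
Lemma cvg_prob_subsequence (K : finType) (X : K -> nat -> T -> R) (Y : K -> T -> R) :
 (forall k N, measf (X k N)) -> (forall k, measf (Y k)) ->
 (forall k, cvg_prob (X k) (Y k)) ->
 exists2 phi : nat -> nat, forall n, (n <= phi n)%N &
  {ae P, forall w, forall k, X k (phi n) w @[n --> \oo] --> Y k w}.
Proof.
move=> mX mY h.
have z0 n : 0 < (2 ^+ n)^-1 :> R by rewrite invr_gt0 exprn_gt0.
have step n : exists N, (n <= N)%N /\ forall k, (P [set w | ((2 ^+ n)^-1 <= `|X k N w - Y k w|)%R] <= ((2 ^+ n)^-1)%:E)%E.
 have [N0 hN0] := choice (fun k => h k _ _ (z0 n) (z0 n)).
 exists (n + \max_k N0 k)%N; split; first exact: leq_addr.
 by move=> k; apply: hN0; rewrite (leq_trans (leq_bigmax k))// leq_addl.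
have [phi hphi] := choice step.
exists phi; first by move=> n; case: (hphi n).
apply: ae_forallC => k.
have mA n : measurable [set w | (2 ^+ n)^-1 <= `|X k (phi n) w - Y k w|].
 by apply: measurable_ge; apply: measurableT_comp => //; exact: measurable_funB.
apply: filterS (borel_cantelli_dyadic mA (fun n => (hphi n).2 k)) => w [m hm].
apply/cvgrPdist_le => e e0; have [M hM] := invr_exp2_small e0.
exists (maxn m M) => // n /=; rewrite geq_max => /andP[mn Mn].
rewrite distrC leNgt; apply/negP => lt; apply: (hm n mn) => /=.
by apply: ltW; apply: le_lt_trans lt; exact: hM.
Qed.

Lemma subdivision_cvg_prob (Sum : nat -> (nat -> R) -> T -> R) t Y : 0 <= t ->
 subdivision_limit P Sum t Y -> cvg_prob (fun N => Sum N.+1 (ugrid t N)) Y.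
Proof.
move=> t0 h e eta e0 eta0; have [dl dl0 hd] := h e eta e0 eta0.
have [N0 hN] := ugrid_mesh t0 dl0; exists N0 => N /hN mesh.
apply: hd; [exact: ugrid0|exact: ugridN|move=> i _].
by rewrite ugridB mesh divr_ge0.
Qed.
End convergence_in_probability.

(** * Linear Stratonovich systems, localized by clipping *)

Section linear_system.
Context {d} {T : measurableType d} {R : realType} (P : probability T R)
 (F : R -> set (set T)) (hF : complete_filtration P F)
 (Iw : finType) (W : Iw -> R -> T -> R) (hW : brownian_motion P F W).
Variables (A E : finType) (src : E -> A) (x : E -> Iw -> R) (g : A -> E -> R).
Variables (X X' : A -> R -> T -> R) (S : E -> R -> T -> R).

(** An edge [e] stands for one Stratonovich integral: its integrand is the component [src e], its
    driver has the constant weight [x e v] on [W v], and [g a e] is its coefficient in the equation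
    of the component [a]. *)
Definition drv e t w := \sum_v x e v * W v t w.

Hypothesis hX : forall a, continuous_adapted P F (X a).
Hypothesis hS : forall e, stratonovich_integral P F (X (src e)) (drv e) (S e).
Hypothesis hsde : {ae P, forall w t, 0 <= t -> forall a, X a t w = X a 0 w + \sum_e g a e * S e t w}.
Hypothesis sX' : forall a, sure F (X' a).
Hypothesis eX' : {ae P, forall w a t, X' a t w = X a t w}.

Definition gram e e' := \sum_v x e v * x e' v.
(** Half the sum of the brackets of each integrand with its driver. The inner sum is the equation of
    the component [src e], inserted to obtain that bracket. *)
Definition lin_drift (a : A) (h : A -> R) : R :=
 2^-1 * \sum_e g a e * \sum_e' g (src e) e' * (gram e e' * h (src e')).
Definition lin_noise (a : A) (v : Iw) (h : A -> R) : R := \sum_e g a e * (x e v * h (src e)).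

Variable K : R.
Hypothesis K0 : 0 < K.

(** No bound on the solution is available yet. Clipped integrands are bounded, and equal to the true
    ones as long as the path remains in [[-K, K]]. *)
Definition clip (y : R) := Num.max (- K) (Num.min y K).

Lemma clip_id y : `|y| <= K -> clip y = y.
Proof. by rewrite ler_norml => /andP[a b]; rewrite /clip (min_idPl b) (max_idPr a). Qed.

Lemma clip_bound y : `|clip y| <= K.
Proof.
rewrite ler_norml le_max lexx/= ge_max ge_min lexx orbT andbT.
by rewrite (le_trans _ (ltW K0))// oppr_le0 ltW.
Qed.

Lemma clip_cont : continuous clip.
Proof.
move=> y; apply: (@continuous_max _ _ (fun=> - K) (fun y => Num.min y K)); first exact: cvg_cst.
by apply: continuous_min; [exact: cvg_id|exact: cvg_cst].
Qed.

Definition clipped (a : A) (t : R) (w : T) : R := clip (X' a t w).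

Lemma bac_cst c : bac F (fun _ _ => c).
Proof. by split; [exact: (bap_cst hF _ c)|move=> w; exact: pcont_cst]. Qed.

Lemma bacD Y Y' : bac F Y -> bac F Y' -> bac F (fun t w => Y t w + Y' t w).
Proof. by move=> [a b] [a' b']; split; [exact: (bapD hF a a')|move=> w; exact: pcontD]. Qed.

Lemma bacM Y Y' : bac F Y -> bac F Y' -> bac F (fun t w => Y t w * Y' t w).
Proof. by move=> [a b] [a' b']; split; [exact: (bapM hF a a')|move=> w; exact: pcontM]. Qed.

Lemma bac_sum (I : Type) (r : seq I) (Q : pred I) (Y : I -> R -> T -> R) :
 (forall i, bac F (Y i)) -> bac F (fun t w => \sum_(i <- r | Q i) Y i t w).
Proof.
move=> h; split; last by move=> w; apply: pcont_sum => i; exact: (h i).2.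
by apply: (bap_sum hF) => i; exact: (h i).1.
Qed.

Lemma bac_clipped a : bac F (clipped a).
Proof.
split; last by move=> w; apply: (pcont_comp clip_cont); exact: (sX' a).2.
apply: (@bap_comp _ _ _ F unit (fun _ => X' a) clip).
- exact: continuous_measurable_fun clip_cont.
- by exists K => // y; exact: clip_bound.
- by move=> _ t t0; exact: (sX' a).1.
Qed.

Definition gclip e v t w := x e v * clipped (src e) t w.

Lemma bac_gclip e v : bac F (gclip e v).
Proof. by apply: bacM; [exact: bac_cst|exact: bac_clipped]. Qed.

Definition drv_noise e : Iw -> R -> T -> R := fun v _ _ => x e v.

Lemma bac_drv_noise e v : bac F (drv_noise e v).
Proof. exact: bac_cst. Qed.

Lemma inc_drv e u s t w : inc (drv e) u s t w = stoch W (cfam (drv_noise e)) u s t w.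
Proof.
by rewrite /inc /drv /stoch -sumrB; apply: eq_bigr => v _; rewrite /cfam /drv_noise /dW mulrBr.
Qed.

Lemma germ2_drv e : germ2 P W (inc (drv e)) (cfam (drv_noise e)).
Proof.
move=> T0 eps e0; exists 1 => // u s t s0 st _ _.
have -> : inc (drv e) u s t = stoch W (cfam (drv_noise e)) u s t.
 by apply/funext => w; exact: inc_drv.
split; first exact: (stoch_L2 hF hW (bapI_cfam (bac_drv_noise e)) u s0 st).
under eq_fun do rewrite subrr expr0n/=; rewrite Ex_cst mulr_ge0 ?(ltW e0)// subr_ge0//.
Qed.

Lemma germ_drv e : germ P F W (inc (drv e)) (@null _ _ _) (cfam (drv_noise e)).
Proof.
move=> T0 eps e0; exists 1 => // u s t s0 st tT ts; exists (fun=> 0).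
have [a b' c' e'] := mart_inc0 hF s0 st (ltW e0); split => //.
have E0 w : inc (drv e) u s t w - (t - s) * null u s w - stoch W (cfam (drv_noise e)) u s t w - 0 = 0.
 by rewrite inc_drv /null; ring.
apply: (L1_norm_eq E0); split; first exact: L1_cst.
by under eq_fun do rewrite normr0; rewrite Ex_cst mulr_ge0 ?(ltW e0)// subr_ge0.
Qed.

Definition gbracket e e' t w := \sum_v gclip e' v t w * drv_noise e v t w.

Lemma gbracketE e e' t w : gbracket e e' t w = gram e e' * clipped (src e') t w.
Proof.
rewrite /gbracket /gram mulr_suml; apply: eq_bigr => v _; rewrite /gclip /drv_noise; ring.
Qed.

Lemma bac_gbracket e e' : bac F (gbracket e e').
Proof. by apply: bac_sum => v; apply: bacM; [exact: bac_gclip|exact: bac_drv_noise]. Qed.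

Lemma msr_meast (Y : R -> T -> R) t : 0 <= t -> msr (F t) (Y t) -> measf (Y t).
Proof. by move=> t0 mY; exact: (msr_meas (filt_alg hF t0) mY). Qed.

Lemma ca_measurable (Y : R -> T -> R) t : 0 <= t -> continuous_adapted P F Y -> measf (Y t).
Proof. by move=> t0 cY; apply: (msr_meast t0) => B; exact: cY.1. Qed.

(** Replaces a stopping time by a condition on single paths: identities are proved on each path up
    to its exit, and no stopped process is introduced. *)
Definition bounded_until t w := forall a s, 0 <= s -> s <= t -> `|X' a s w| <= K.

Lemma eq_dyadic (I J : R -> R) t : pcont I -> pcont J ->
 (forall L k, dyad L k <= t -> I (dyad L k) = J (dyad L k)) -> forall s, 0 <= s -> s <= t -> I s = J s.
Proof.
move=> cI cJ h s s0 st; apply/eqP; rewrite -subr_eq0 -normr_le0.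
apply: (@pcont_dyad_le R (fun s => I s - J s) (fun=> 0) t) => //; first exact: pcontB.
by move=> L k kt; rewrite (h L k kt) subrr normr0.
Qed.

Section fixed_integrals.
Variables (Ii C J : E -> R -> T -> R).
Hypothesis hI : forall e, ito_integral P F (X (src e)) (drv e) (Ii e).
Hypothesis hC : forall e, covariation P F (X (src e)) (drv e) (C e).
Hypothesis SE : forall e t w, S e t w = Ii e t w + 2^-1 * C e t w.
Hypothesis sJ : forall e, sure F (J e).
Hypothesis J0 : forall e w, J e 0 w = 0.
Hypothesis gJ : forall e, germ P F W (inc (J e)) (@null _ _ _) (cfam (gclip e)).
Hypothesis g2J : forall e, germ2 P W (inc (J e)) (cfam (gclip e)).

Lemma cvg_prob_germ (Z : unit -> R -> R -> T -> R) b t : 0 <= t -> bap F b ->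
 germ P F W Z b (@nullI _ _ _ _) ->
 cvg_prob P (fun N w => \sum_(i < N.+1) (Z tt (ugrid t N i) (ugrid t N i.+1) w -
   (ugrid t N i.+1 - ugrid t N i) * b tt (ugrid t N i) w)) (fun=> 0).
Proof.
move=> t0 hb gZ e eta e0 eta0.
have [dl dl0 h] := germ_subdivision hF hb gZ t e0 eta0.
have [N0 hN] := ugrid_mesh t0 dl0; exists N0 => N /hN mesh.
have := h N.+1 (ugrid t N) (ugrid0 t N); rewrite ugridN lexx => /(_ isT).
have hs i : (i < N.+1)%N -> 0 <= ugrid t N i.+1 - ugrid t N i <= dl.
 by move=> _; rewrite ugridB mesh divr_ge0.
by move=> /(_ hs); congr (P _ <= _)%E; apply/seteqP; split => w /=; rewrite subr0.
Qed.

(** Applied to a telescoping [Z], whose sum does not depend on the subdivision: convergence to zero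
    then forces the sum itself to be zero. *)
Lemma germ_sum_null (Z : unit -> R -> R -> T -> R) t : 0 <= t ->
 (forall s s', 0 <= s -> 0 <= s' -> measf (Z tt s s')) ->
 germ P F W Z (@null _ _ _) (@nullI _ _ _ _) ->
 {ae P, forall w c, (forall N, \sum_(i < N.+1) Z tt (ugrid t N i) (ugrid t N i.+1) w = c) -> c = 0}.
Proof.
move=> t0 mZ gZ; have := cvg_prob_germ t0 (bap_cst hF _ 0) gZ.
under eq_fun do under eq_fun do under eq_bigr do rewrite mulr0 subr0.
move=> cp; have [||| phi _ cv] := @cvg_prob_subsequence _ _ _ P unit
  (fun _ N w => \sum_(i < N.+1) Z tt (ugrid t N i) (ugrid t N i.+1) w) (fun _ _ => 0).
- move=> _ N; apply: measurable_sum => i; have [a _] := ugrid_itv t0 (ltn_ord i).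
 by have [a' _] := ugrid_itv t0 (ltnW (ltn_ord i)); exact: mZ.
- by move=> _; exact: measurable_cst.
- by [].
apply: filterS cv => w cw c h; have := cw tt; under eq_fun do rewrite h.
by move=> c0; have c1 := cvg_cst c; exact: (cvg_unique _ (c1 _ _ _) c0).
Qed.

Lemma germ_JB e : germ P F W (fun u s t w => cpar (clipped (src e)) u s w * inc (drv e) u s t w - inc (J e) u s t w)
 (@null _ _ _) (@nullI _ _ _ _).
Proof.
have g1 := germ_bap hF (germ_drv e) (bac_clipped (src e)).1.
have g2 := germ_bap hF (gJ e) (bap_cst hF _ (-1)).
apply: (germ_eq (germD hF g1 g2)) => [u r s w _ _|u s w _|u v s w _].
- by rewrite mulN1r.
- by rewrite /null; ring.
- by rewrite /nullI /cpar /cfam /gclip /drv_noise; ring.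
Qed.

(** While a path stays in [[-K, K]] clipping changes nothing, so the sums defining the given
    integral differ from those with limit [J] by nothing. Both limits are taken along one almost
    surely convergent subsequence, at dyadic times, and extended by continuity. *)
Lemma ito_ident : {ae P, forall w t, 0 <= t -> bounded_until t w -> forall e, Ii e t w = J e t w}.
Proof.
have dy : {ae P, forall w (Lk : nat * nat) e, bounded_until (dyad Lk.1 Lk.2) w ->
  Ii e (dyad Lk.1 Lk.2) w = J e (dyad Lk.1 Lk.2) w}.
 apply: ae_forallC => -[L k]; apply: ae_forallC => e /=.
 have t0 := @dyad_ge0 R L k; set t := dyad L k in t0 *.
 pose Sm N w := \sum_(i < N.+1) X (src e) (ugrid t N i) w * (drv e (ugrid t N i.+1) w - drv e (ugrid t N i) w).
 pose Z N w := \sum_(i < N.+1) (cpar (clipped (src e)) tt (ugrid t N i) w * inc (drv e) tt (ugrid t N i) (ugrid t N i.+1) w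
   - inc (J e) tt (ugrid t N i) (ugrid t N i.+1) w - (ugrid t N i.+1 - ugrid t N i) * null tt (ugrid t N i) w).
 have itv N (i : 'I_N.+1) := (@ugrid_itv _ t N i.+1 t0 (ltn_ord i), @ugrid_itv _ t N i t0 (ltnW (ltn_ord i))).
 have [cX cD cI hI'] := hI e.
 have [||| phi hphi cv] := @cvg_prob_subsequence _ _ _ P bool (fun b => if b then Sm else Z)
   (fun b => if b then Ii e t else fun=> 0).
 - case=> N; apply: measurable_sum => i; have [[a b] [a' b']] := itv N i.
   by apply: measurable_funM; [exact: ca_measurable|apply: measurable_funB; exact: ca_measurable].
  apply: measurable_funB; last by apply: measurable_funM; exact: measurable_cst.
  apply: measurable_funB; last by apply: measurable_funB; apply: msr_meast => //; exact: (sJ e).1.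
  apply: measurable_funM; last by apply: measurable_funB; exact: ca_measurable.
  by have [K1 [_ _ m]] := bac_bound (bac_clipped (src e)); exact: msr_meast a' (m _ a').
 - by case; [exact: ca_measurable|exact: measurable_cst].
 - case; first exact: (subdivision_cvg_prob t0 (hI' t t0)).
  exact: (cvg_prob_germ t0 (bap_cst hF _ 0) (germ_JB e)).
 apply: filterS2 cv eX' => w cw ew bw.
 have cS := cw true; have cZ := cw false; rewrite /= in cS cZ.
 have SmE N : Sm N w = Z N w + J e t w.
  have -> : J e t w = \sum_(i < N.+1) inc (J e) tt (ugrid t N i) (ugrid t N i.+1) w.
   by rewrite (ugrid_telescope (J e ^~ w)) J0 subr0.
  rewrite -big_split/=; apply: eq_bigr => i _; have [[a b] [a' b']] := itv N i.
  by rewrite /null /cpar /clipped clip_id ?bw// ew /inc; ring.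
 have cS' : Sm (phi n) w @[n --> \oo] --> 0 + J e t w.
  by under eq_fun do rewrite SmE; apply: cvgD; [exact: cZ|exact: cvg_cst].
 by rewrite -[RHS]add0r; exact: (cvg_unique _ cS cS').
have cI : {ae P, forall w e, pcont (Ii e ^~ w)}.
 apply: ae_forallC => e; have [_ _ [_ cI] _] := hI e.
 by apply: filterS cI => w /within_pcont.
apply: filterS2 dy cI => w hw cw t t0 bt e.
apply: (@eq_dyadic (Ii e ^~ w) (J e ^~ w) t) => //; first exact: (sJ e).2.
by move=> L k kt; apply: (hw (L, k)) => a s s0 sk; apply: bt => //; exact: le_trans kt.
Qed.

(** The equation expresses the increments of the integrand through those of [J] and of [C]. The
    former have the density [gbracket] as bracket with the driver; the latter contribute nothing
    because [C] has finite variation. *)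
Lemma cov_ident : {ae P, forall w t, 0 <= t -> bounded_until t w ->
 forall e, C e t w = \sum_e' g (src e) e' * tint (gbracket e e') t w}.
Proof.
have gJD e e' := germ2_prod hF hW (bapI_cfam (bac_gclip e')) (bapI_cfam (bac_drv_noise e)) (g2J e') (germ2_drv e).
have cC : {ae P, forall w e, pcont (C e ^~ w)}.
 apply: ae_forallC => e; have [[_ cI] _ _] := hC e.
 by apply: filterS cI => w /within_pcont.
have bC : {ae P, forall w e t, 0 <= t -> bounded_variation 0 t (C e ^~ w)}.
 by apply: ae_forallC => e; have [_ b _] := hC e.
have cD : {ae P, forall w e, pcont (drv e ^~ w)}.
 apply: ae_forallC => e; have [_ [_ cI] _ _] := hI e.
 by apply: filterS cI => w /within_pcont.
have dy : {ae P, forall w (Lk : nat * nat) e, bounded_until (dyad Lk.1 Lk.2) w ->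
  C e (dyad Lk.1 Lk.2) w = \sum_e' g (src e) e' * tint (gbracket e e') (dyad Lk.1 Lk.2) w}.
 apply: ae_forallC => -[L k]; apply: ae_forallC => e /=.
 have t0 := @dyad_ge0 R L k; set t := dyad L k in t0 *.
 pose Sm N w := \sum_(i < N.+1) (X (src e) (ugrid t N i.+1) w - X (src e) (ugrid t N i) w) * (drv e (ugrid t N i.+1) w - drv e (ugrid t N i) w).
 pose Z e' N w := \sum_(i < N.+1) (inc (J e') tt (ugrid t N i) (ugrid t N i.+1) w * inc (drv e) tt (ugrid t N i) (ugrid t N i.+1) w
   - (ugrid t N i.+1 - ugrid t N i) * (\sum_v cfam (gclip e') tt v (ugrid t N i) w * cfam (drv_noise e) tt v (ugrid t N i) w)).
 have itv N (i : 'I_N.+1) := (@ugrid_itv _ t N i.+1 t0 (ltn_ord i), @ugrid_itv _ t N i t0 (ltnW (ltn_ord i))).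
 have [cX cD' cI hI'] := hI e; have [cCe _ hC'] := hC e.
 have [||| phi hphi cv] := @cvg_prob_subsequence _ _ _ P (option E) (fun b => if b is Some e' then Z e' else Sm)
   (fun b => if b is Some e' then fun=> 0 else C e t).
 - case=> [e'|] N; apply: measurable_sum => i; have [[a b] [a' b']] := itv N i; last by apply: measurable_funM; apply: measurable_funB; exact: ca_measurable.
  apply: measurable_funB; last first.
   apply: measurable_funM; first exact: measurable_cst.
   have [K1 [_ _ m]] := bac_bound (bac_gbracket e e'); exact: msr_meast a' (m _ a').
  apply: measurable_funM; last by apply: measurable_funB; exact: ca_measurable.
  by apply: measurable_funB; apply: msr_meast => //; exact: (sJ e').1.
 - by case=> [e'|]; [exact: measurable_cst|exact: ca_measurable].
 - case=> [e'|]; last exact: (subdivision_cvg_prob t0 (hC' t t0)).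
  exact: (cvg_prob_germ t0 (bac_gbracket e e').1 (gJD e e')).
 apply: filterS3 (filterI cv (filterI eX' hsde)) (filterI ito_ident cC) (filterI bC cD) => w [cw [ew sw]] [iw cCw] [bCw cDw] bw.
 have cS := cw None; rewrite /= in cS.
 (* The Stratonovich integrals are split into their Ito part, already identified with [J] on such a
    path, and half the bracket [C]. *)
 have XE a s : 0 <= s -> s <= t -> X a s w = X a 0 w + \sum_e' g a e' * (J e' s w + 2^-1 * C e' s w).
  move=> s0 st; rewrite sw//; congr (_ + _); apply: eq_bigr => e' _; congr (_ * _).
  by rewrite SE iw// => a' r r0 rs; apply: bw => //; exact: le_trans st.
 have SmE N : Sm N w = \sum_e' g (src e) e' * ((Z e' N w + rsum (gbracket e e') 0 t N w) +
   2^-1 * \sum_(i < N.+1) (C e' (ugrid t N i.+1) w - C e' (ugrid t N i) w) * (drv e (ugrid t N i.+1) w - drv e (ugrid t N i) w)).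
  have Ze e' : Z e' N w + rsum (gbracket e e') 0 t N w = \sum_(i < N.+1) inc (J e') tt (ugrid t N i) (ugrid t N i.+1) w * inc (drv e) tt (ugrid t N i) (ugrid t N i.+1) w.
   rewrite /Z /rsum -big_split/=; apply: eq_bigr => i _.
   by rewrite ugridB subr0 add0r /gbracket /cfam /ugrid subrK.
  under [RHS]eq_bigr => e' _ do rewrite Ze mulr_sumr -big_split/= mulr_sumr.
  rewrite exchange_big/=; apply: eq_bigr => i _; have [[a b] [a' b']] := itv N i.
  rewrite (XE _ (ugrid t N i.+1))// (XE _ (ugrid t N i))// opprD addrACA subrr add0r -sumrB mulr_suml; apply: eq_bigr => e' _.
  by rewrite /inc; ring.
 have cS' : Sm (phi n) w @[n --> \oo] --> \sum_e' g (src e) e' * ((0 + (tint (gbracket e e') t w - tint (gbracket e e') 0 w)) + 2^-1 * 0).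
  under eq_fun do rewrite SmE.
  have phioo : phi n @[n --> \oo] --> \oo.
   by move=> Q [M _ hM]; exists M => // n /= Mn; apply: hM => /=; exact: leq_trans (hphi n).
  apply: cvg_sumr => e'; apply: cvgM; first exact: cvg_cst.
  apply: cvgD.
   apply: cvgD; first exact: (cw (Some e')).
   exact: (cvg_comp _ _ phioo (rsum_cvg (bac_gbracket e e') (w := w) (lexx 0) t0)).
  apply: cvgM; first exact: cvg_cst.
  exact: (cvg_comp _ _ phioo (bounded_variation_null_bracket t0 (bCw e' t t0) (cDw e))).
 rewrite (cvg_unique _ cS cS')//; apply: eq_bigr => e' _.
 by rewrite tint0 mulr0 addr0 add0r subr0.
apply: filterS2 dy cC => w hw cw t t0 bt e.
apply: (@eq_dyadic (C e ^~ w) (fun t => \sum_e' g (src e) e' * tint (gbracket e e') t w) t) => //.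
 by apply: pcont_sum => e'; apply: pcontZ; exact: (sure_tint hF (bac_gbracket e e')).2.
by move=> L k kt; apply: (hw (L, k)) => a s s0 sk; apply: bt => //; exact: le_trans kt.
Qed.

End fixed_integrals.

Lemma germ2_drift (Z Z' : unit -> R -> R -> T -> R) th (K1 : R) : bapI F th ->
 germ2 P W Z th ->
 (forall u s t, 0 <= s -> s <= t -> measf (Z' u s t)) ->
 (forall u s t w, 0 <= s -> s <= t -> `|Z' u s t w - Z u s t w| <= K1 * (t - s)) ->
 germ2 P W Z' th.
Proof.
move=> hth gZ mZ' hZ T0 e e0.
have e4 : 0 < e / 4 by rewrite divr_gt0.
have [dl dl0 hd] := gZ T0 _ e4.
have c0 : 0 < 4 * (K1 ^+ 2 + 1) by rewrite mulr_gt0// ltr_wpDl// sqr_ge0.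
exists (Num.min dl (e / (4 * (K1 ^+ 2 + 1)))); first by rewrite lt_min dl0 divr_gt0.
move=> u s t s0 st tT; rewrite le_min => /andP[ts ts'].
have ts0 : 0 <= t - s by rewrite subr_ge0.
have [L2Z EZ] := hd u s t s0 st tT ts.
have L2d : L2 P (fun w => Z' u s t w - Z u s t w).
 apply: (@L2_bounded _ _ _ _ _ (K1 * (t - s))); last by move=> w; exact: hZ.
 by apply: measurable_funB; [exact: mZ'|exact: L2_meas L2Z].
have L2s := stoch_L2 hF hW hth u s0 st.
split.
 by rewrite (_ : Z' u s t = fun w => (Z' u s t w - Z u s t w) + Z u s t w); [exact: L2D|apply/funext => w; rewrite subrK].
rewrite (_ : (fun w => _) = fun w => ((Z' u s t w - Z u s t w) + (Z u s t w - stoch W th u s t w)) ^+ 2); last by apply/funext => w; rewrite addrA subrK.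
apply: (le_trans (Ex_sqrD L2d (L2B L2Z L2s))).
have b1 : Ex P (fun w => (Z' u s t w - Z u s t w) ^+ 2) <= (K1 * (t - s)) ^+ 2.
 rewrite -(Ex_cst P ((K1 * (t - s)) ^+ 2)); apply: Ex_le; [exact: L2d.2|exact: L1_cst|move=> w].
 rewrite -(real_normK (num_real (_ - _))) lerXn2r ?nnegrE// ?hZ//.
 by rewrite (le_trans _ (hZ u s t w s0 st)).
have b2 : (K1 * (t - s)) ^+ 2 <= e / 4 * (t - s).
 rewrite exprMn (_ : (t - s) ^+ 2 = (t - s) * (t - s))// mulrA ler_wpM2r//.
 apply: (@le_trans _ _ ((K1 ^+ 2 + 1) * (e / (4 * (K1 ^+ 2 + 1))))).
  by apply: ler_pM => //; rewrite ?sqr_ge0// lerDl.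
 have z0 : K1 ^+ 2 + 1 != 0 by rewrite gt_eqF// ltr_wpDl// sqr_ge0.
 by rewrite le_eqVlt; apply/orP; left; apply/eqP; field.
lra.
Qed.

Definition drift_at (a : A) (t : R) (w : T) := lin_drift a (fun b => clipped b t w).
Definition noise_at (a : A) (v : Iw) (t : R) (w : T) := lin_noise a v (fun b => clipped b t w).

Lemma bac_noise_at a v : bac F (noise_at a v).
Proof.
apply: bac_sum => e; apply: bacM; first exact: bac_cst.
by apply: bacM; [exact: bac_cst|exact: bac_clipped].
Qed.

Lemma bac_drift_at a : bac F (drift_at a).
Proof.
apply: bacM; first exact: bac_cst.
apply: bac_sum => e; apply: bacM; first exact: bac_cst.
apply: bac_sum => e'; apply: bacM; first exact: bac_cst.
by apply: bacM; [exact: bac_cst|exact: bac_clipped].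
Qed.

(** [Y] is driven by the clipped coefficients, hence has germs with bounded coefficients at all
    times; the solution follows it up to its exit from [[-K, K]]. *)
Theorem linear_localized : exists Y : A -> R -> T -> R,
 [/\ forall a, sure F (Y a), forall a w, Y a 0 w = 0,
   forall a, germ P F W (inc (Y a)) (cpar (drift_at a)) (cfam (noise_at a)),
   forall a, germ2 P W (inc (Y a)) (cfam (noise_at a)) &
   {ae P, forall w t, 0 <= t -> bounded_until t w -> forall a, X' a t w = X' a 0 w + Y a t w}].
Proof.
have ex e : exists IC : (R -> T -> R) * (R -> T -> R), [/\ ito_integral P F (X (src e)) (drv e) IC.1,
  covariation P F (X (src e)) (drv e) IC.2 & forall t w, S e t w = IC.1 t w + 2^-1 * IC.2 t w].
 by have [I [C [h1 h2 h3]]] := hS e; exists (I, C).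
have [IC hIC] := choice ex.
have [J hJ] := choice (fun e => ito_vec hF hW (bac_gclip e)).
have sJ e : sure F (J e) by case: (hJ e).
have J0 e w : J e 0 w = 0 by case: (hJ e).
have gJ e : germ P F W (inc (J e)) (@null _ _ _) (cfam (gclip e)) by case: (hJ e).
have g2J e : germ2 P W (inc (J e)) (cfam (gclip e)) by case: (hJ e).
have hI e : ito_integral P F (X (src e)) (drv e) (IC e).1 by case: (hIC e).
have hC e : covariation P F (X (src e)) (drv e) (IC e).2 by case: (hIC e).
have SE e t w : S e t w = (IC e).1 t w + 2^-1 * (IC e).2 t w by case: (hIC e).
pose Y a t w := \sum_e g a e * J e t w + tint (drift_at a) t w.
have sY a : sure F (Y a).
 have [m c] := sure_tint hF (bac_drift_at a); split=> [t t0|w].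
  have sa := filt_sa hF t0.
  apply: (msrD sa); last exact: m.
  by apply: (msr_sum sa) => e; apply: (msrM sa); [exact: (msr_cst sa)|exact: (sJ e).1].
 by apply: pcontD => //; apply: pcont_sum => e; apply: pcontZ; exact: (sJ e).2.
have YE a u s t w : inc (Y a) u s t w = \sum_e g a e * inc (J e) u s t w + inc (tint (drift_at a)) u s t w.
 by rewrite /inc /Y; under [X in _ = X + _]eq_bigr do rewrite mulrBr; rewrite sumrB; ring.
have mY a u s t : 0 <= s -> s <= t -> measf (inc (Y a) u s t).
 move=> s0 st; apply: measurable_funB; apply: msr_meast; rewrite ?(le_trans s0 st)//.
  by apply: (sY a).1; exact: le_trans s0 st.
 exact: (sY a).1.
have nE a v t w : noise_at a v t w = \sum_e g a e * gclip e v t w by [].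
exists Y; split => //.
- by move=> a w; rewrite /Y tint0 addr0 big1// => e _; rewrite J0 mulr0.
- move=> a; have g1 := germ_lin hF (g a) gJ; have g2 := germ_tint hF W (bac_drift_at a).
 apply: (germ_eq (germD hF g1 g2)) => [u s t w s0 st|u t w _|u v t w _].
 + by rewrite YE.
 + by rewrite big1 ?add0r// => e _; rewrite /null mulr0.
 + by rewrite /nullI addr0.
- move=> a; have [K1 [K10 bd md]] := bac_bound (bac_drift_at a).
 apply: (@germ2_drift (fun u s t w => \sum_e g a e * inc (J e) u s t w) _ _ K1).
 + exact: (bapI_cfam (bac_noise_at a)).
 + exact: (germ2_lin hF hW (g a) (fun e => bapI_cfam (bac_gclip e)) g2J).
 + by move=> u s t s0 st; exact: mY.
 + move=> u s t w s0 st; rewrite YE addrAC subrr add0r.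
  by apply: (tint_lip (bac_drift_at a)) => // r r0; exact: bd.
have h1 := ito_ident hI sJ J0 gJ.
have h2 := cov_ident hI hC SE sJ J0 gJ g2J.
apply: filterS2 (filterI h1 h2) (filterI eX' hsde) => w [h1w h2w] [ew sw] t t0 bt a.
rewrite !ew sw//; congr (_ + _).
have -> : Y a t w = \sum_e g a e * J e t w + \sum_e (2^-1 * g a e) * \sum_e' g (src e) e' * tint (gbracket e e') t w.
 congr (_ + _).
 have -> : drift_at a = fun t w => \sum_e (2^-1 * g a e) * \sum_e' g (src e) e' * gbracket e e' t w.
  apply/funext => r; apply/funext => w'; rewrite /drift_at /lin_drift mulr_sumr.
  apply: eq_bigr => e _; rewrite mulrA; congr (_ * _); apply: eq_bigr => e' _.
  by rewrite gbracketE.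
 rewrite (tint_lin hF)//; last by move=> e; apply: bac_sum => e'; apply: bacM; [exact: bac_cst|exact: bac_gbracket].
 apply: eq_bigr => e _; congr (_ * _); rewrite (tint_lin hF)// => e'; exact: bac_gbracket.
rewrite -big_split/=; apply: eq_bigr => e _.
by rewrite SE h1w// h2w//; ring.
Qed.

(** By the product rule, increments of the quadratic form are a combination of those of [Y] and of
    their products. The two hypotheses cancel its noise and its drift, so the telescoping sum has a
    null germ. *)
Lemma quadratic_invariant (q : A * A -> R) :
 (forall h v, \sum_p q p * (h p.1 * lin_noise p.2 v h + h p.2 * lin_noise p.1 v h) = 0) ->
 (forall h, \sum_p q p * (h p.1 * lin_drift p.2 h + h p.2 * lin_drift p.1 h +
   \sum_v lin_noise p.1 v h * lin_noise p.2 v h) = 0) ->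
 {ae P, forall w t, 0 <= t -> bounded_until t w ->
  \sum_p q p * (X' p.1 t w * X' p.2 t w) = \sum_p q p * (X' p.1 0 w * X' p.2 0 w)}.
Proof.
move=> hn hd; have [Y [sY Y0 gY g2Y hY]] := linear_localized.
have hB a := bapI_cfam (bac_noise_at a).
pose Zp (p : A * A) (u : unit) s t w := (cpar (clipped p.1) u s w * inc (Y p.2) u s t w +
 cpar (clipped p.2) u s w * inc (Y p.1) u s t w) + inc (Y p.1) u s t w * inc (Y p.2) u s t w.
have gp p := germD hF (germD hF (germ_bap hF (gY p.2) (bac_clipped p.1).1)
 (germ_bap hF (gY p.1) (bac_clipped p.2).1)) (germ2_prod hF hW (hB p.1) (hB p.2) (g2Y p.1) (g2Y p.2)).
pose Z (u : unit) s t w := \sum_p q p * Zp p u s t w.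
have mY a s : 0 <= s -> measf (Y a s).
 by move=> s0; apply: (msr_meast s0); exact: (sY a).1.
have mc a s : 0 <= s -> measf (clipped a s).
 by move=> s0; have [K1 [_ _ m]] := bac_bound (bac_clipped a); exact: (msr_meast s0 (m _ s0)).
have mZ u s t : 0 <= s -> 0 <= t -> measf (Z u s t).
 move=> s0 t0; apply: measurable_sum => p; apply: measurable_funM; first exact: measurable_cst.
 have mi a : measf (inc (Y a) u s t) by apply: measurable_funB; exact: mY.
 apply: measurable_funD; last exact: measurable_funM.
 by apply: measurable_funD; apply: measurable_funM => //; exact: mc.
have gZ : germ P F W Z (@null _ _ _) (@nullI _ _ _ _).
 apply: (germ_eq (germ_lin hF q gp)) => [//|u t w _|u v t w _].
 - by rewrite /null -[RHS](hd (fun b => clipped b t w)).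
 - rewrite /nullI -[RHS](hn (fun b => clipped b t w) v).
  by apply: eq_bigr => p _; rewrite addr0.
pose Q s w := \sum_p q p * (X' p.1 s w * X' p.2 s w).
have dy : {ae P, forall w (Lk : nat * nat), bounded_until (dyad Lk.1 Lk.2) w ->
  Q (dyad Lk.1 Lk.2) w = Q 0 w}.
 apply: ae_forallC => -[L k] /=; have t0 := @dyad_ge0 R L k; set t := dyad L k in t0 *.
 apply: filterS2 (germ_sum_null t0 (mZ tt) gZ) hY => w zw hw bw.
 have XE a s : 0 <= s -> s <= t -> X' a s w = X' a 0 w + Y a s w.
  by move=> s0 st; apply: hw => // a' r r0 rs; apply: bw => //; exact: le_trans st.
 apply/eqP; rewrite -subr_eq0; apply/eqP/zw => N; rewrite -(ugrid_telescope (Q ^~ w) t N).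
 apply: eq_bigr => i _; have [a b] := ugrid_itv t0 (ltn_ord i).
 have [a' b'] := ugrid_itv t0 (ltnW (ltn_ord i)).
 rewrite /Q -sumrB; apply: eq_bigr => p _; rewrite -mulrBr; congr (_ * _).
 rewrite /Zp /cpar /clipped !clip_id ?bw//.
 rewrite (XE p.1 (ugrid t N i.+1))// (XE p.2 (ugrid t N i.+1))// (XE p.1 (ugrid t N i))// (XE p.2 (ugrid t N i))// /inc.
 ring.
apply: filterS dy => w hw t t0 bt.
apply: (@eq_dyadic (Q ^~ w) (fun=> Q 0 w) t) => //.
- by apply: pcont_sum => p; apply: pcontZ; apply: pcontM; [exact: (sX' p.1).2|exact: (sX' p.2).2].
- exact: pcont_cst.
by move=> L k kt; apply: (hw (L, k)) => a s s0 sk; apply: bt => //; exact: le_trans kt.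
Qed.
End linear_system.

(** * Covariances of the entries of the driver of [U] *)

Section unitary_noise.
Variables (R : realType) (n : nat).
Implicit Types (l j a b : 'I_n) (p q : 'I_n -> R).

Definition dlt l j : R := (l == j)%:R.

Lemma dltC l j : dlt l j = dlt j l.
Proof. by rewrite /dlt eq_sym. Qed.

Lemma sum_dlt l (F : 'I_n -> R) : \sum_a dlt l a * F a = F l.
Proof.
rewrite (bigD1 l)//= /dlt eqxx mul1r big1 ?addr0// => a al.
by rewrite eq_sym (negbTE al) mul0r.
Qed.

Lemma sum_dlt2 l j (F : 'I_n -> 'I_n -> R) :
 \sum_a \sum_b dlt l a * (dlt j b * F a b) = F l j.
Proof.
under eq_bigr do rewrite -mulr_sumr sum_dlt.
by rewrite sum_dlt.
Qed.

Lemma sum_upper_pair (F : 'I_n * 'I_n -> R) :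
 \sum_(p : upper_pair n) F (val p) = \sum_(p : 'I_n * 'I_n | (p.1 < p.2)%N) F p.
Proof.
rewrite [RHS](reindex_omap (fun p : upper_pair n => val p) insub); last by move=> p pp; rewrite insubT.
apply: eq_bigl => p; rewrite valK eqxx andbT; by case: p.
Qed.

Lemma sum_upper_sym (f : 'I_n -> 'I_n -> R) : (forall a b, f a b = f b a) ->
 \sum_a \sum_b f a b = 2 * \sum_(p : upper_pair n) f (val p).1 (val p).2 + \sum_a f a a.
Proof.
move=> fC; rewrite pair_bigA /= (sum_upper_pair (fun p : 'I_n * 'I_n => f p.1 p.2)).
rewrite (bigID (fun p : 'I_n * 'I_n => (p.1 < p.2)%N))/=.
rewrite [X in _ + X](bigID (fun p : 'I_n * 'I_n => (p.2 < p.1)%N))/=.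
rewrite mulr_natl mulr2n -addrA; congr (_ + (_ + _)).
 rewrite (reindex_inj (h := fun p : 'I_n * 'I_n => (p.2, p.1)))/=; last by move=> [? ?] [? ?] [-> ->].
 apply: eq_big => [[a b]|[a b] _]/=; last exact: fC.
 by case: ltngtP.
rewrite (reindex_omap (fun a => (a, a)) (fun p : 'I_n * 'I_n => if p.1 == p.2 then Some p.1 else None))/=.
 by apply: eq_bigl => a; rewrite ltnn eqxx/= eqxx.
move=> [a b]/= /andP[]; rewrite -!leqNgt => ba ab.
have /eqP -> : a == b by rewrite -val_eqE eqn_leq ab ba.
by rewrite eqxx.
Qed.

(** The coefficient of [W v] in the real part of the entry [(l, j)] of the driver, antisymmetric in
    [l] and [j]; [noiseY] is its symmetric counterpart for the imaginary part. *)
Definition noiseX l j (v : unitary_index n) : R :=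
 match v with
 | inl (inl p) => dlt l (val p).1 * dlt j (val p).2 - dlt l (val p).2 * dlt j (val p).1
 | _ => 0
 end.

Definition noiseY l j (v : unitary_index n) : R :=
 match v with
 | inl (inl _) => 0
 | inl (inr p) => dlt l (val p).1 * dlt j (val p).2 + dlt l (val p).2 * dlt j (val p).1
 | inr i => Num.sqrt 2 * (dlt l i * dlt j i)
 end.

Lemma noiseXC l j v : noiseX j l v = - noiseX l j v.
Proof. by case: v => [[p|p]|i] /=; ring. Qed.

Lemma noiseYC l j v : noiseY j l v = noiseY l j v.
Proof. by case: v => [[p|p]|i] /=; ring. Qed.

Lemma sum_unitary_index (F : unitary_index n -> R) : \sum_v F v =
 \sum_(p : upper_pair n) F (inl (inl p)) + \sum_(p : upper_pair n) F (inl (inr p)) + \sum_i F (inr i).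
Proof. by rewrite !big_sumType. Qed.

Lemma gramXX l j l' j' : \sum_v noiseX l j v * noiseX l' j' v =
 dlt l l' * dlt j j' - dlt l j' * dlt j l'.
Proof.
rewrite sum_unitary_index /= [X in _ + X + _]big1 ?[X in _ + X]big1 ?addr0; [|by move=> *; rewrite mul0r|by move=> *; rewrite mul0r].
pose g a b := dlt l' a * dlt j' b - dlt l' b * dlt j' a.
pose f a b := (dlt l a * dlt j b - dlt l b * dlt j a) * g a b.
have := @sum_upper_sym f (fun a b => ltac:(rewrite /f /g; ring)).
rewrite [X in _ = _ + X]big1 ?addr0; last by move=> a _; rewrite /f; ring.
have -> : \sum_a \sum_b f a b = g l j - g j l.
 rewrite -(sum_dlt2 l j g) -(sum_dlt2 j l g) -sumrB; apply: eq_bigr => a _.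
 by rewrite -sumrB; apply: eq_bigr => b _; rewrite /f; ring.
rewrite /g /f => h; rewrite (dltC l l') (dltC j j') (dltC l j') (dltC j l').
move: h; set S := \sum_p _; lra.
Qed.

(** The factor [sqrt 2] of the diagonal noises is exactly what completes the sum over upper pairs to
    half of the sum over all pairs. *)
Lemma gramYY l j l' j' : \sum_v noiseY l j v * noiseY l' j' v =
 dlt l l' * dlt j j' + dlt l j' * dlt j l'.
Proof.
rewrite sum_unitary_index /= big1 ?add0r; last by move=> *; rewrite mul0r.
pose g a b := dlt l' a * dlt j' b + dlt l' b * dlt j' a.
pose f a b := (dlt l a * dlt j b + dlt l b * dlt j a) * g a b.
have := @sum_upper_sym f (fun a b => ltac:(rewrite /f /g; ring)).
have -> : \sum_a \sum_b f a b = g l j + g j l.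
 rewrite -(sum_dlt2 l j g) -(sum_dlt2 j l g) -big_split; apply: eq_bigr => a _.
 by rewrite -big_split; apply: eq_bigr => b _; rewrite /f/=; ring.
have -> : \sum_a f a a = 4 * (dlt j l * (dlt l' l * dlt j' l)).
 transitivity (\sum_a dlt l a * (4 * (dlt j a * (dlt l' a * dlt j' a)))).
  by apply: eq_bigr => a _; rewrite /f /g; ring.
 by rewrite sum_dlt.
have -> : \sum_(i < n) Num.sqrt 2 * (dlt l i * dlt j i) * (Num.sqrt 2 * (dlt l' i * dlt j' i)) = 2 * (dlt j l * (dlt l' l * dlt j' l)).
 transitivity (\sum_a dlt l a * (Num.sqrt 2 ^+ 2 * (dlt j a * (dlt l' a * dlt j' a)))).
  by apply: eq_bigr => a _; ring.
 by rewrite sum_dlt sqr_sqrtr// ler0n.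
rewrite /g /f => h; rewrite (dltC l l') (dltC j j') (dltC l j') (dltC j l').
move: h; set S := \sum_p _; lra.
Qed.

Lemma gramXY l j l' j' : \sum_v noiseX l j v * noiseY l' j' v = 0.
Proof. by rewrite big1// => -[[p|p]|i] _ /=; ring. Qed.

(* The noises of the real and imaginary parts of the entries of [u dA], for the
   row vector [u = p + i q]. *)
Definition noiseR p q j v := \sum_l (p l * noiseX l j v - q l * noiseY l j v).
Definition noiseI p q j v := \sum_l (p l * noiseY l j v + q l * noiseX l j v).

Lemma sum_bilin (x y : 'I_n -> unitary_index n -> R) p q (G : 'I_n -> 'I_n -> R) :
 (forall l l', \sum_v x l v * y l' v = G l l') ->
 \sum_v (\sum_l p l * x l v) * (\sum_l q l * y l v) = \sum_l \sum_l' p l * q l' * G l l'.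
Proof.
move=> h; under eq_bigr do rewrite mulr_suml.
rewrite exchange_big/=; apply: eq_bigr => l _.
under eq_bigr do rewrite mulr_sumr.
rewrite exchange_big/=; apply: eq_bigr => l' _.
by rewrite -h mulr_sumr; apply: eq_bigr => v _; ring.
Qed.

Lemma sum_gram (s : R) p q j j' :
 \sum_l \sum_l' p l * q l' * (dlt l l' * dlt j j' + s * (dlt l j' * dlt j l')) =
 dlt j j' * \sum_l p l * q l + s * (p j' * q j).
Proof.
rewrite (_ : p j' * q j = \sum_l \sum_l' dlt j' l * (dlt j l' * (p l * q l'))); last by rewrite sum_dlt2.
rewrite !mulr_sumr -big_split; apply: eq_bigr => l _ /=.
rewrite -[dlt j j' * _](sum_dlt l (fun l' => dlt j j' * (p l * q l'))) mulr_sumr -big_split.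
apply: eq_bigr => l' _ /=; rewrite (dltC j' l); ring.
Qed.

Let XX j j' l l' : \sum_v noiseX l j v * noiseX l' j' v = dlt l l' * dlt j j' + (-1) * (dlt l j' * dlt j l').
Proof. by rewrite gramXX mulN1r. Qed.

Let YY j j' l l' : \sum_v noiseY l j v * noiseY l' j' v = dlt l l' * dlt j j' + 1 * (dlt l j' * dlt j l').
Proof. by rewrite gramYY mul1r. Qed.

Let XY j j' l l' : \sum_v noiseX l j v * noiseY l' j' v = 0.
Proof. exact: gramXY. Qed.

Let YX j j' l l' : \sum_v noiseY l j v * noiseX l' j' v = 0.
Proof. by rewrite -[RHS](gramXY l' j' l j); apply: eq_bigr => v _; rewrite mulrC. Qed.

Let zero p q : \sum_l \sum_l' p l * q l' * (0 : R) = 0.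
Proof. by rewrite big1// => l _; rewrite big1// => l' _; rewrite mulr0. Qed.

Lemma gramRR p q p' q' j j' : \sum_v noiseR p q j v * noiseR p' q' j' v =
 dlt j j' * \sum_l (p l * p' l + q l * q' l) - p j' * p' j + q j' * q' j.
Proof.
transitivity (\sum_v ((\sum_l p l * noiseX l j v) * (\sum_l p' l * noiseX l j' v)
  - (\sum_l p l * noiseX l j v) * (\sum_l q' l * noiseY l j' v)
  - (\sum_l q l * noiseY l j v) * (\sum_l p' l * noiseX l j' v)
  + (\sum_l q l * noiseY l j v) * (\sum_l q' l * noiseY l j' v))).
 by apply: eq_bigr => v _; rewrite /noiseR !sumrB; ring.
rewrite big_split/= sumrB sumrB (sum_bilin _ _ (XX j j')) (sum_bilin _ _ (XY j j')) (sum_bilin _ _ (YX j j')) (sum_bilin _ _ (YY j j')).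
by rewrite !sum_gram !zero big_split/=; ring.
Qed.

Lemma gramII p q p' q' j j' : \sum_v noiseI p q j v * noiseI p' q' j' v =
 dlt j j' * \sum_l (p l * p' l + q l * q' l) + p j' * p' j - q j' * q' j.
Proof.
transitivity (\sum_v ((\sum_l p l * noiseY l j v) * (\sum_l p' l * noiseY l j' v)
  + (\sum_l p l * noiseY l j v) * (\sum_l q' l * noiseX l j' v)
  + (\sum_l q l * noiseX l j v) * (\sum_l p' l * noiseY l j' v)
  + (\sum_l q l * noiseX l j v) * (\sum_l q' l * noiseX l j' v))).
 by apply: eq_bigr => v _; rewrite /noiseI !big_split/=; ring.
rewrite !big_split/= (sum_bilin _ _ (XX j j')) (sum_bilin _ _ (XY j j')) (sum_bilin _ _ (YX j j')) (sum_bilin _ _ (YY j j')).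
by rewrite !sum_gram !zero; ring.
Qed.

Lemma gramRI p q p' q' j j' : \sum_v noiseR p q j v * noiseI p' q' j' v =
 dlt j j' * \sum_l (p l * q' l - q l * p' l) - p j' * q' j - q j' * p' j.
Proof.
transitivity (\sum_v ((\sum_l p l * noiseX l j v) * (\sum_l p' l * noiseY l j' v)
  + (\sum_l p l * noiseX l j v) * (\sum_l q' l * noiseX l j' v)
  - (\sum_l q l * noiseY l j v) * (\sum_l p' l * noiseY l j' v)
  - (\sum_l q l * noiseY l j v) * (\sum_l q' l * noiseX l j' v))).
 by apply: eq_bigr => v _; rewrite /noiseR /noiseI !sumrB/= !big_split/=; ring.
rewrite sumrB sumrB big_split/= (sum_bilin _ _ (XX j j')) (sum_bilin _ _ (XY j j')) (sum_bilin _ _ (YX j j')) (sum_bilin _ _ (YY j j')).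
by rewrite !sum_gram !zero sumrB; ring.
Qed.

Lemma antisym_sum p q v : \sum_j \sum_l p j * (q l * noiseX l j v) + \sum_j \sum_l q j * (p l * noiseX l j v) = 0.
Proof.
rewrite [X in _ + X]exchange_big -big_split big1//= => j _; rewrite -big_split big1//= => l _.
by rewrite (noiseXC l j); ring.
Qed.

Lemma sym_sum p q v : \sum_j \sum_l p j * (q l * noiseY l j v) = \sum_j \sum_l q j * (p l * noiseY l j v).
Proof.
rewrite exchange_big; apply: eq_bigr => j _; apply: eq_bigr => l _ /=.
by rewrite (noiseYC l j); ring.
Qed.

(** The driver is anti-Hermitian: the antisymmetry of [noiseX] and the symmetry of [noiseY] cancel
    the noise of the Hermitian product of two rows. *)
Lemma noise_inner_re p q p' q' v :
 \sum_l (p l * noiseR p' q' l v + p' l * noiseR p q l v + (q l * noiseI p' q' l v + q' l * noiseI p q l v)) = 0.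
Proof.
transitivity ((\sum_j \sum_l p j * (p' l * noiseX l j v) + \sum_j \sum_l p' j * (p l * noiseX l j v))
 + (\sum_j \sum_l q j * (q' l * noiseX l j v) + \sum_j \sum_l q' j * (q l * noiseX l j v))
 + (\sum_j \sum_l q j * (p' l * noiseY l j v) - \sum_j \sum_l p' j * (q l * noiseY l j v))
 + (\sum_j \sum_l q' j * (p l * noiseY l j v) - \sum_j \sum_l p j * (q' l * noiseY l j v))).
 rewrite -!sumrB -!big_split/=; apply: eq_bigr => j _.
 rewrite /noiseR /noiseI !mulr_sumr -!sumrB -!big_split/=; apply: eq_bigr => l _; ring.
by rewrite !antisym_sum (sym_sum q p') (sym_sum q' p) !subrr !addr0.
Qed.

Lemma noise_inner_im p q p' q' v :
 \sum_l (q l * noiseR p' q' l v + p' l * noiseI p q l v - (p l * noiseI p' q' l v + q' l * noiseR p q l v)) = 0.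
Proof.
transitivity ((\sum_j \sum_l q j * (p' l * noiseX l j v) + \sum_j \sum_l p' j * (q l * noiseX l j v))
 - (\sum_j \sum_l p j * (q' l * noiseX l j v) + \sum_j \sum_l q' j * (p l * noiseX l j v))
 + (\sum_j \sum_l p' j * (p l * noiseY l j v) - \sum_j \sum_l p j * (p' l * noiseY l j v))
 + (\sum_j \sum_l q' j * (q l * noiseY l j v) - \sum_j \sum_l q j * (q' l * noiseY l j v))).
 rewrite -!big_split/= -!sumrB -!big_split/=; apply: eq_bigr => j _.
 rewrite /noiseR /noiseI !mulr_sumr -!big_split/= -!sumrB -!big_split/=; apply: eq_bigr => l _; ring.
by rewrite !antisym_sum (sym_sum p' p) (sym_sum q' q) !subrr !addr0.
Qed.

(** This bracket term compensates the drift [- n] that each of the two rows contributes to their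
    product. *)
Lemma gram_inner_re p q p' q' :
 \sum_j (\sum_v noiseR p q j v * noiseR p' q' j v + \sum_v noiseI p q j v * noiseI p' q' j v) =
 2 * n%:R * \sum_l (p l * p' l + q l * q' l).
Proof.
transitivity (\sum_(j < n) 2 * \sum_l (p l * p' l + q l * q' l)).
 by apply: eq_bigr => j _; rewrite gramRR gramII /dlt eqxx mulr1n; ring.
by rewrite sumr_const card_ord -mulr_natl; ring.
Qed.

Lemma gram_inner_im p q p' q' :
 \sum_j (\sum_v noiseI p q j v * noiseR p' q' j v - \sum_v noiseR p q j v * noiseI p' q' j v) =
 2 * n%:R * \sum_l (q l * p' l - p l * q' l).
Proof.
transitivity (\sum_(j < n) 2 * \sum_l (q l * p' l - p l * q' l)).
 apply: eq_bigr => j _; under eq_bigr do rewrite mulrC.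
 rewrite !gramRI /dlt eqxx mulr1n.
 have -> : \sum_l (p' l * q l - q' l * p l) = \sum_l (q l * p' l - p l * q' l).
  by apply: eq_bigr => l _; ring.
 have -> : \sum_l (p l * q' l - q l * p' l) = - \sum_l (q l * p' l - p l * q' l).
  by rewrite -sumrN; apply: eq_bigr => l _; ring.
 ring.
by rewrite sumr_const card_ord -mulr_natl; ring.
Qed.

(** With [sum_noiseY2], this computes the square of the driver increment:
    [(1 - n) - (1 + n) = - 2 n]. Half of it is the Ito correction, hence the drift [- n] of every
    component of [U]. *)
Lemma sum_noiseX2 l j : \sum_r \sum_v noiseX l r v * noiseX r j v = (1 - n%:R) * dlt l j.
Proof.
under eq_bigr do rewrite gramXX.
rewrite sumrB; have -> : \sum_i dlt l i * dlt i j = dlt l j by rewrite sum_dlt.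
have -> : \sum_(i < n) dlt l j * dlt i i = n%:R * dlt l j.
 under eq_bigr do rewrite /dlt eqxx mulr1; by rewrite sumr_const card_ord mulr_natl.
ring.
Qed.

Lemma sum_noiseY2 l j : \sum_r \sum_v noiseY l r v * noiseY r j v = (1 + n%:R) * dlt l j.
Proof.
under eq_bigr do rewrite gramYY.
rewrite big_split/=; have -> : \sum_i dlt l i * dlt i j = dlt l j by rewrite sum_dlt.
have -> : \sum_(i < n) dlt l j * dlt i i = n%:R * dlt l j.
 under eq_bigr do rewrite /dlt eqxx mulr1; by rewrite sumr_const card_ord mulr_natl.
ring.
Qed.

End unitary_noise.

Section unitary_driver.
Context {d} {T : measurableType d} {R : realType} (n : nat).
Variable W : unitary_index n -> R -> T -> R.

Lemma Re_sum (I : finType) (F : I -> R[i]) : complex.Re (\sum_i F i) = \sum_i complex.Re (F i).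
Proof. by rewrite (big_morph (@complex.Re R) (id1 := 0) (op1 := +%R))// => -[? ?] [? ?]. Qed.

Lemma Im_sum (I : finType) (F : I -> R[i]) : complex.Im (\sum_i F i) = \sum_i complex.Im (F i).
Proof. by rewrite (big_morph (@complex.Im R) (id1 := 0) (op1 := +%R))// => -[? ?] [? ?]. Qed.

Lemma driverE t w l j : unitary_driver W t w l j =
 ((\sum_v noiseX R l j v * W v t w) +i* (\sum_v noiseY R l j v * W v t w))%C.
Proof.
pose A := \sum_(p : upper_pair n) (dlt R l (val p).1 * dlt R j (val p).2 - dlt R l (val p).2 * dlt R j (val p).1) * W (inl (inl p)) t w.
pose B := \sum_(p : upper_pair n) (dlt R l (val p).1 * dlt R j (val p).2 + dlt R l (val p).2 * dlt R j (val p).1) * W (inl (inr p)) t w.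
pose C := \sum_(i < n) Num.sqrt 2 * (dlt R l i * dlt R j i) * W (inr i) t w.
have z0 (I : finType) (F : I -> R) : \sum_i 0 * F i = 0 by rewrite big1// => i _; rewrite mul0r.
have -> : \sum_v noiseX R l j v * W v t w = A by rewrite sum_unitary_index /= !z0 !addr0.
have -> : \sum_v noiseY R l j v * W v t w = B + C by rewrite sum_unitary_index /= z0 add0r.
rewrite /unitary_driver mxE [X in X + _]mxE [X in _ + X + _]mxE !summxE.
have -> : \sum_i ((W (inl (inl i)) t w)%:C%C *: (delta_mx (val i).1 (val i).2 - delta_mx (val i).2 (val i).1) : 'M[R[i]]_n) l j = A%:C%C.
 rewrite /A rmorph_sum; apply: eq_bigr => p _; rewrite !mxE /dlt -!mulnb !natrM.
 by rewrite mulrC rmorphM rmorphB !rmorphM !rmorph_nat.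
have -> : \sum_i ((W (inl (inr i)) t w)%:C%C *: (delta_mx (val i).1 (val i).2 + delta_mx (val i).2 (val i).1) : 'M[R[i]]_n) l j = B%:C%C.
 rewrite /B rmorph_sum; apply: eq_bigr => p _; rewrite !mxE /dlt -!mulnb !natrM.
 by rewrite mulrC rmorphM rmorphD !rmorphM !rmorph_nat.
have -> : \sum_i (((Num.sqrt 2 * W (inr i) t w)%:C%C * 'i%C) *: delta_mx i i : 'M[R[i]]_n) l j = 'i%C * C%:C%C.
 rewrite /C rmorph_sum mulr_sumr; apply: eq_bigr => p _; rewrite !mxE /dlt -!mulnb !natrM.
 by rewrite !rmorphM !rmorph_nat/=; ring.
by simpc.
Qed.

End unitary_driver.

(** * The equation of [U] as a real linear system *)

Section unitary_coefficients.
Variables (R : realType) (n : nat).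

Definition ucomp := ('I_n * 'I_n * bool)%type.
Definition uedge := ('I_n * 'I_n * 'I_n * (bool * bool))%type.

(* The edge (k, l, j, (b1, b2)) stands for the contribution of the part b1 of
   U_kl and of the part b2 of A_lj to dU_kj; true means imaginary. *)
Definition usrc (e : uedge) : ucomp := (e.1.1.1, e.1.1.2, e.2.1).
Definition unoise (c : bool) (l j : 'I_n) (v : unitary_index n) : R := if c then noiseY R l j v else noiseX R l j v.
Definition ucoef (e : uedge) (v : unitary_index n) : R := unoise e.2.2 e.1.1.2 e.1.2 v.
Definition usign (c b1 b2 : bool) : R :=
 if c then (b1 (+) b2)%:R else if b1 == b2 then (-1) ^+ b1 else 0.
Definition ug (a : ucomp) (e : uedge) : R :=
 dlt R a.1.1 e.1.1.1 * (dlt R a.1.2 e.1.2 * usign a.2 e.2.1 e.2.2).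

Lemma sum_uedge k j c (phi : uedge -> R) : \sum_e ug (k, j, c) e * phi e =
 \sum_l (if c then phi (k, l, j, (false, true)) + phi (k, l, j, (true, false))
     else phi (k, l, j, (false, false)) - phi (k, l, j, (true, true))).
Proof.
transitivity (\sum_(x : 'I_n * 'I_n * 'I_n) \sum_(y : bool * bool) ug (k, j, c) (x, y) * phi (x, y)).
 by rewrite pair_bigA/=; apply: eq_bigr => -[].
transitivity (\sum_(x : 'I_n * 'I_n) \sum_(j' : 'I_n) \sum_(y : bool * bool) ug (k, j, c) (x, j', y) * phi (x, j', y)).
 by rewrite [RHS]pair_bigA/=; apply: eq_bigr => -[].
transitivity (\sum_(k' : 'I_n) \sum_(l : 'I_n) \sum_(j' : 'I_n) \sum_(y : bool * bool) ug (k, j, c) (k', l, j', y) * phi (k', l, j', y)).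
 by rewrite [RHS]pair_bigA/=; apply: eq_bigr => -[].
rewrite exchange_big/=; apply: eq_bigr => l _.
transitivity (\sum_a \sum_b dlt R k a * (dlt R j b * \sum_(y : bool * bool) usign c y.1 y.2 * phi (a, l, b, y))).
 apply: eq_bigr => a _; apply: eq_bigr => b _; rewrite !mulr_sumr; apply: eq_bigr => y _.
 by rewrite /ug/=; ring.
rewrite sum_dlt2.
transitivity (\sum_(b1 : bool) \sum_(b2 : bool) usign c b1 b2 * phi (k, l, j, (b1, b2))).
 by rewrite pair_bigA/=; apply: eq_bigr => -[].
by rewrite !big_bool /usign; case: c; rewrite /= ?expr0 ?expr1; ring.
Qed.

Lemma lin_noiseE k j c v h : lin_noise usrc ucoef ug (k, j, c) v h =
 (if c then @noiseI R n else @noiseR R n) (fun l => h (k, l, false)) (fun l => h (k, l, true)) j v.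
Proof.
by rewrite /lin_noise sum_uedge; case: c; rewrite /noiseI /noiseR; apply: eq_bigr => l _;
 rewrite /ucoef /usrc /unoise /=; ring.
Qed.

Lemma lin_driftE a h : lin_drift usrc ucoef ug a h = - n%:R * h a.
Proof.
case: a => [[k j] c]; rewrite /lin_drift sum_uedge.
pose GX l l' : R := \sum_v noiseX R l j v * noiseX R l' l v.
pose GY l l' : R := \sum_v noiseY R l j v * noiseY R l' l v.
have main : \sum_l \sum_l' (GX l l' - GY l l') * h (k, l', c) = - (2 * n%:R) * h (k, j, c).
 rewrite exchange_big/=.
 transitivity (\sum_l' dlt R j l' * (- (2 * n%:R) * h (k, l', c))); last by rewrite sum_dlt.
 apply: eq_bigr => l' _; rewrite -mulr_suml sumrB.
 have -> : \sum_l GX l l' = (1 - n%:R) * dlt R l' j.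
  by rewrite -sum_noiseX2; apply: eq_bigr => r _; apply: eq_bigr => v _; rewrite mulrC.
 have -> : \sum_l GY l l' = (1 + n%:R) * dlt R l' j.
  by rewrite -sum_noiseY2; apply: eq_bigr => r _; apply: eq_bigr => v _; rewrite mulrC.
 by rewrite (dltC R j l'); ring.
have gXY l l' m m' : \sum_v noiseX R l m v * noiseY R l' m' v = 0 by exact: gramXY.
have gYX l l' m m' : \sum_v noiseY R l m v * noiseX R l' m' v = 0.
 by rewrite -[RHS](gramXY R l' m' l m); apply: eq_bigr => v _; rewrite mulrC.
have -> : - n%:R * h (k, j, c) = 2^-1 * (- (2 * n%:R) * h (k, j, c)) by field.
congr (_ * _); rewrite -main; apply: eq_bigr => l _.
case: c {main} => /=; rewrite /usrc /= !sum_uedge -?big_split -?sumrB; apply: eq_bigr => l' _;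
 rewrite /gram /ucoef /unoise /= !gXY !gYX /GX /GY; ring.
Qed.

(** The quadratic form in the real components of [U] that equals the real part of the Hermitian
    product of the rows [k] and [k'], in the shape used by [quadratic_invariant]; [qim] gives the
    imaginary part. *)
Definition qre k k' (p : ucomp * ucomp) : R :=
 \sum_l ((p == ((k, l, false), (k', l, false)))%:R + (p == ((k, l, true), (k', l, true)))%:R).
Definition qim k k' (p : ucomp * ucomp) : R :=
 \sum_l ((p == ((k, l, true), (k', l, false)))%:R - (p == ((k, l, false), (k', l, true)))%:R).

Lemma sum_pred1 (I : finType) (x : I) (F : I -> R) : \sum_p (p == x)%:R * F p = F x.
Proof.
rewrite (bigD1 x)//= eqxx mul1r big1 ?addr0// => y yx.
by rewrite (negbTE yx) mul0r.
Qed.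

Lemma sum_qre k k' F : \sum_p qre k k' p * F p =
 \sum_l (F ((k, l, false), (k', l, false)) + F ((k, l, true), (k', l, true))).
Proof.
under eq_bigr do rewrite mulr_suml; rewrite exchange_big/=; apply: eq_bigr => l _.
by under eq_bigr do rewrite mulrDl; rewrite big_split/= !sum_pred1.
Qed.

Lemma sum_qim k k' F : \sum_p qim k k' p * F p =
 \sum_l (F ((k, l, true), (k', l, false)) - F ((k, l, false), (k', l, true))).
Proof.
under eq_bigr do rewrite mulr_suml; rewrite exchange_big/=; apply: eq_bigr => l _.
by under eq_bigr do rewrite mulrBl; rewrite sumrB/= !sum_pred1.
Qed.

Local Notation noise := (lin_noise usrc ucoef ug).
Local Notation drift := (lin_drift usrc ucoef ug).
Local Notation part b h k := (fun l => h (k, l, b)).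

Lemma noise_qre k k' h v :
 \sum_p qre k k' p * (h p.1 * noise p.2 v h + h p.2 * noise p.1 v h) = 0.
Proof.
rewrite sum_qre/= -[RHS](noise_inner_re (part false h k) (part true h k)
 (part false h k') (part true h k') v).
by apply: eq_bigr => l _; rewrite !lin_noiseE.
Qed.

Lemma noise_qim k k' h v :
 \sum_p qim k k' p * (h p.1 * noise p.2 v h + h p.2 * noise p.1 v h) = 0.
Proof.
rewrite sum_qim/= -[RHS](noise_inner_im (part false h k) (part true h k)
 (part false h k') (part true h k') v).
by apply: eq_bigr => l _; rewrite !lin_noiseE.
Qed.

Lemma drift_qre k k' h : \sum_p qre k k' p * (h p.1 * drift p.2 h +
 h p.2 * drift p.1 h + \sum_v noise p.1 v h * noise p.2 v h) = 0.
Proof.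
rewrite sum_qre/=; have := gram_inner_re (part false h k) (part true h k)
 (part false h k') (part true h k').
rewrite mulr_sumr => /eqP; rewrite -subr_eq0 -sumrB => /eqP E; rewrite -[RHS]E.
apply: eq_bigr => l _; rewrite !lin_driftE.
under eq_bigr do rewrite !lin_noiseE.
under [X in _ + (_ + X)]eq_bigr do rewrite !lin_noiseE.
ring.
Qed.

Lemma drift_qim k k' h : \sum_p qim k k' p * (h p.1 * drift p.2 h +
 h p.2 * drift p.1 h + \sum_v noise p.1 v h * noise p.2 v h) = 0.
Proof.
rewrite sum_qim/=; have := gram_inner_im (part false h k) (part true h k)
 (part false h k') (part true h k').
rewrite mulr_sumr => /eqP; rewrite -subr_eq0 -sumrB => /eqP E; rewrite -[RHS]E.
apply: eq_bigr => l _; rewrite !lin_driftE.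
under eq_bigr do rewrite !lin_noiseE.
under [X in _ - (_ + X)]eq_bigr do rewrite !lin_noiseE.
ring.
Qed.

End unitary_coefficients.

(** * Unitarity, and the germs of the entries of [U] *)

Section unitary_process.
Context {d} {T : measurableType d} {R : realType} (P : probability T R)
 (F : R -> set (set T)) (hF : complete_filtration P F) (n : nat)
 (W : unitary_index n -> R -> T -> R) (hW : brownian_motion P F W)
 (U : R -> T -> 'M[R[i]]_n) (hU : unitary_sde P F W U).

Definition ucomponent (a : ucomp n) t w : R :=
 if a.2 then complex.Im (U t w a.1.1 a.1.2) else complex.Re (U t w a.1.1 a.1.2).

Definition inner_re (X : ucomp n -> R -> T -> R) k k' t w := \sum_l
 (X (k, l, false) t w * X (k', l, false) t w + X (k, l, true) t w * X (k', l, true) t w).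
Definition inner_im (X : ucomp n -> R -> T -> R) k k' t w := \sum_l
 (X (k, l, true) t w * X (k', l, false) t w - X (k, l, false) t w * X (k', l, true) t w).

Lemma ca_component a : continuous_adapted P F (ucomponent a).
Proof. by case: a => [[k j] []]; have [h _] := hU; case: (h k j). Qed.

Lemma linear_sde : exists S : uedge n -> R -> T -> R,
 (forall e, stratonovich_integral P F (ucomponent (usrc e)) (drv W (@ucoef R n) e) (S e)) /\
 {ae P, forall w t, 0 <= t -> forall a, ucomponent a t w = ucomponent a 0 w + \sum_e @ug R n a e * S e t w}.
Proof.
have [_ [S [hS eS]]] := hU.
have ex (x : 'I_n * 'I_n * 'I_n) : exists f : bool * bool -> R -> T -> R,
  (forall b, stratonovich_integral P F (ucomponent (usrc (x, b))) (drv W (@ucoef R n) (x, b)) (f b)) /\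
  forall t w, S x.1.1 x.1.2 x.2 t w = ((f (false, false) t w - f (true, true) t w) +i* (f (false, true) t w + f (true, false) t w))%C.
 case: x => [[k l] j] /=; have [Srr [Sii [Sri [Sir [hrr hii hri hir SE]]]]] := hS k l j.
 have dr : (fun t w => complex.Re (unitary_driver W t w l j)) = drv W (@ucoef R n) (k, l, j, (false, false)).
  by apply/funext => t; apply/funext => w; rewrite driverE.
 have di : (fun t w => complex.Im (unitary_driver W t w l j)) = drv W (@ucoef R n) (k, l, j, (false, true)).
  by apply/funext => t; apply/funext => w; rewrite driverE.
 rewrite dr in hrr hir; rewrite di in hii hri.
 exists (fun b => if b.1 then (if b.2 then Sii else Sir) else (if b.2 then Sri else Srr)).
 by split => // -[[] []] /=.
have [f hf] := choice ex.
exists (fun e => f e.1 e.2); split; first by move=> [x b]; case: (hf x).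
apply: filterS eS => w ew t t0 [[k j] c]; rewrite sum_uedge /ucomponent /= ew//.
have hS' l : S k l j t w = _ := (hf (k, l, j)).2 t w.
case: c.
 rewrite (_ : complex.Im (_ + _) = complex.Im (U 0 w k j) + complex.Im (\sum_l S k l j t w)); last by case: (U 0 w k j) (\sum_l _) => ? ? [].
 by rewrite Im_sum; congr (_ + _); apply: eq_bigr => l _; rewrite hS'.
rewrite (_ : complex.Re (_ + _) = complex.Re (U 0 w k j) + complex.Re (\sum_l S k l j t w)); last by case: (U 0 w k j) (\sum_l _) => ? ? [].
by rewrite Re_sum; congr (_ + _); apply: eq_bigr => l _; rewrite hS'.
Qed.

Lemma unitary_inner (X : ucomp n -> R -> T -> R) t w : (forall a, X a t w = ucomponent a t w) ->
 U t w \is unitarymx -> forall k k', inner_re X k k' t w = dlt R k k' /\ inner_im X k k' t w = 0.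
Proof.
move=> XE /unitarymxP uU k k'.
have := congr1 (fun M : 'M[R[i]]_n => M k k') uU; rewrite !mxE.
have -> : \sum_j U t w k j * ((U t w) ^t*)%sesqui j k' = (inner_re X k k' t w +i* inner_im X k k' t w)%C.
 rewrite /inner_re /inner_im; apply/eqP; rewrite eq_complex Re_sum Im_sum; apply/andP; split; apply/eqP;
  apply: eq_bigr => l _; rewrite !mxE !XE /ucomponent /=; case: (U t w k l) => a b; case: (U t w k' l) => a' b' /=; ring.
rewrite /dlt => h; split; first by have := congr1 (@complex.Re R) h; case: (k == k').
by have := congr1 (@complex.Im R) h; case: (k == k').
Qed.

Section sure_version.
Variable X : ucomp n -> R -> T -> R.
Hypothesis sX : forall a, sure F (X a).
Hypothesis eX : {ae P, forall w a t, X a t w = ucomponent a t w}.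

(** The products of rows are conserved until the exit from each integer level. A continuous path is
    bounded on [[0, t]], so some level is never left before time [t]. *)
Lemma ae_unitary : {ae P, forall w, U 0 w \is unitarymx} ->
 {ae P, forall w t, 0 <= t -> forall k k', inner_re X k k' t w = dlt R k k' /\ inner_im X k k' t w = 0}.
Proof.
move=> uU0; have [S [hS eS]] := linear_sde.
have K0 (K : nat) : 0 < K.+1%:R :> R by [].
have hr : {ae P, forall w K k k' t, 0 <= t -> bounded_until X K.+1%:R t w ->
  \sum_p qre R k k' p * (X p.1 t w * X p.2 t w) = \sum_p qre R k k' p * (X p.1 0 w * X p.2 0 w)}.
 do 3 apply: ae_forallC => ?.
 exact: (quadratic_invariant hF hW hS eS sX eX (K0 _) (noise_qre _ _) (drift_qre _ _)).
have hi : {ae P, forall w K k k' t, 0 <= t -> bounded_until X K.+1%:R t w ->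
  \sum_p qim R k k' p * (X p.1 t w * X p.2 t w) = \sum_p qim R k k' p * (X p.1 0 w * X p.2 0 w)}.
 do 3 apply: ae_forallC => ?.
 exact: (quadratic_invariant hF hW hS eS sX eX (K0 _) (noise_qim _ _) (drift_qim _ _)).
apply: filterS2 (filterI hr hi) (filterI uU0 eX) => w [hrw hiw] [uw ew] t t0 k k'.
have [K bK] : exists K : nat, bounded_until X K.+1%:R t w.
 have ex a : exists K : nat, forall s, 0 <= s -> s <= t -> `|X a s w| <= K%:R.
  have [K K0' bK] := pcont_bounded t ((sX a).2 w); exists (Num.truncn K).+1 => s s0 st.
  by rewrite (le_trans (bK s s0 st))// ltW// truncnS_gt.
 have [Ka hKa] := choice ex; exists (\max_a Ka a)%N => a s s0 st.
 by rewrite (le_trans (hKa a s s0 st))// ler_nat (leq_trans (leq_bigmax a)).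
have [u1 u2] := unitary_inner (fun a => ew a 0) uw k k'.
split.
 by have := hrw K k k' t t0 bK; rewrite !sum_qre /= => h; rewrite -u1 /inner_re -h.
by have := hiw K k k' t t0 bK; rewrite !sum_qim /= => h; rewrite -u2 /inner_im -h.
Qed.

Definition row_noise k j (c : bool) v t w :=
 (if c then @noiseI R n else @noiseR R n) (fun l => X (k, l, false) t w) (fun l => X (k, l, true) t w) j v.

Hypothesis uX : forall t w, 0 <= t -> forall k k', inner_re X k k' t w = dlt R k k' /\ inner_im X k k' t w = 0.

Lemma unitary_bound a t w : 0 <= t -> `|X a t w| <= 1.
Proof.
case: a => [[k j] c] t0; have [h _] := uX w t0 k k.
rewrite -(@ler_pXn2r _ 2) ?nnegrE// expr1n real_normK ?num_real//.
have : X (k, j, c) t w ^+ 2 <= inner_re X k k t w.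
 rewrite /inner_re (bigD1 j)//=; have := sqr_ge0 (X (k, j, ~~ c) t w) => h1.
 have h2 : 0 <= \sum_(l < n | l != j) (X (k, l, false) t w * X (k, l, false) t w + X (k, l, true) t w * X (k, l, true) t w).
  by apply: sumr_ge0 => l _; rewrite addr_ge0// -expr2 sqr_ge0.
 by case: c h1 => /= h1; rewrite !expr2 in h1 *; lra.
by rewrite h /dlt eqxx.
Qed.

Lemma bac_unitary a : bac F (X a).
Proof.
split; last exact: (sX a).2.
by exists 1 => // _ t t0; split; [exact: (sX a).1|move=> w; exact: unitary_bound].
Qed.

Lemma bac_row_noise k j c v : bac F (row_noise k j c v).
Proof.
by case: c; apply: (bac_sum hF) => l; [apply: (bacD hF)|rewrite (_ : (fun t w => _) = fun t w => X (k, l, false) t w * noiseX R l j v + X (k, l, true) t w * - noiseY R l j v);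
 [apply: (bacD hF)|by apply/funext => t; apply/funext => w; rewrite mulrN]];
 apply: (bacM hF); (exact: bac_unitary || exact: (bac_cst hF)).
Qed.

(** Entries of a unitary matrix have modulus at most one, so clipping at level one is harmless at
    all times and the localized germs become germs of the entries themselves. *)
Lemma unitary_germs k j c :
 germ P F W (inc (X (k, j, c))) (cpar (fun t w => - n%:R * X (k, j, c) t w)) (cfam (row_noise k j c)) /\
 germ2 P W (inc (X (k, j, c))) (cfam (row_noise k j c)).
Proof.
have [S [hS eS]] := linear_sde.
have [Y [sY Y0 gY g2Y eY]] := linear_localized hF hW hS eS sX eX ltr01.
have cl a t w : 0 <= t -> clipped X 1 a t w = X a t w.
 by move=> t0; rewrite /clipped clip_id// unitary_bound.
have eXY : {ae P, forall w a t, 0 <= t -> X a t w = X a 0 w + Y a t w}.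
 apply: filterS eY => w h a t t0; apply: h => // b s s0 _; exact: unitary_bound.
have mX a t : 0 <= t -> measf (X a t).
 by move=> t0; apply: (msr_meast hF t0); exact: (sX a).1.
have ei (u : unit) s t : 0 <= s -> s <= t -> measf (inc (X (k, j, c)) u s t) /\
   {ae P, forall w, inc (Y (k, j, c)) u s t w = inc (X (k, j, c)) u s t w}.
 move=> s0 st; have t0 := le_trans s0 st; split; first by apply: measurable_funB; exact: mX.
 apply: filterS eXY => w h; rewrite /inc (h _ t)// (h _ s)//; ring.
have en (u : unit) v t w : 0 <= t -> cfam (noise_at (@usrc n) (@ucoef R n) (@ug R n) X 1 (k, j, c)) u v t w = cfam (row_noise k j c) u v t w.
 move=> t0; rewrite /cfam /noise_at lin_noiseE /row_noise.
 have E b : (fun l => clipped X 1 (k, l, b) t w) = (fun l => X (k, l, b) t w).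
  by apply/funext => l; rewrite cl.
 by rewrite !E.
have bn := bapI_cfam (bac_row_noise k j c).
split; last exact: (germ2_ext hF hW bn (g2Y _) ei en).
apply: (germ_ext hF hW (gY (k, j, c))) => //.
- by move=> u t w t0; rewrite /cpar /drift_at lin_driftE cl.
- by move=> u s t s0 st; apply: measurable_funM; [exact: measurable_cst|exact: mX].
Qed.

End sure_version.
End unitary_process.

(** * Second order Taylor expansion in one variable *)

Section taylor.
Context {R : realType}.
Variables (f f1 f2 : R -> R) (a c : R).
Hypothesis ac : a <= c.
Hypothesis D1 : forall z, a <= z -> z <= c -> is_derive z 1 f (f1 z).
Hypothesis D2 : forall z, a <= z -> z <= c -> is_derive z 1 f1 (f2 z).

Definition clamp (y : R) := Num.max a (Num.min y c).

Lemma clamp_id y : a <= y -> y <= c -> clamp y = y.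
Proof. by move=> h1 h2; rewrite /clamp (min_idPl h2) (max_idPr h1). Qed.

Lemma clamp_itv y : a <= clamp y /\ clamp y <= c.
Proof. by split; rewrite /clamp ?le_max ?lexx// ge_max ac ge_min lexx orbT. Qed.

Lemma clamp_cont : continuous clamp.
Proof.
move=> y; apply: (@continuous_max _ _ (fun=> a) (fun y => Num.min y c)); first exact: cvg_cst.
by apply: continuous_min; [exact: cvg_id|exact: cvg_cst].
Qed.

Lemma derive_continuous (g : R -> R) (dg z : R) : is_derive z 1 g dg -> {for z, continuous g}.
Proof. by move=> h; apply: differentiable_continuous; apply/derivable1_diffP; exact: ex_derive. Qed.

Lemma clamp_comp_cont (g : R -> R) : (forall z, a <= z -> z <= c -> {for z, continuous g}) ->
 continuous (fun y => g (clamp y)).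
Proof.
move=> h y; apply: (@continuous_comp _ _ _ clamp g); first exact: clamp_cont.
by have [h1 h2] := clamp_itv y; exact: h.
Qed.

Lemma bounded_on_segment (g : R -> R) : (forall z, a <= z -> z <= c -> {for z, continuous g}) ->
 exists2 K : R, 0 < K & forall y, `|g (clamp y)| <= K.
Proof.
move=> h; have hc := clamp_comp_cont h.
have [|z _ hz] := @EVT_max R (fun y => `|g (clamp y)|) a c ac.
 apply: continuous_subspaceT => y; apply: continuous_comp; first exact: hc.
 exact: norm_continuous.
exists (`|g (clamp z)| + 1); first by rewrite ltr_wpDl.
move=> y; have [h1 h2] := clamp_itv y.
have := hz (clamp y); rewrite in_itv/= h1 h2 => /(_ isT).
by rewrite clamp_id// => h3; rewrite (le_trans h3)// lerDl.
Qed.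

Lemma mvt_le (g dg : R -> R) (x y L : R) : a <= x -> x <= c -> a <= y -> y <= c ->
 (forall z, a <= z -> z <= c -> is_derive z 1 g (dg z)) ->
 (forall z, a <= z -> z <= c -> `|z - x| <= `|y - x| -> `|dg z| <= L) ->
 `|g y - g x| <= L * `|y - x|.
Proof.
move=> ax xc ay yc Dg hL.
suff main u v : a <= u -> u <= v -> v <= c -> (forall z, u <= z -> z <= v -> `|dg z| <= L) ->
  `|g v - g u| <= L * `|v - u|.
 have [xy|/ltW yx] := leP x y.
  apply: main => // z xz zy; apply: hL; [exact: le_trans xz|exact: le_trans zy yc|].
  by rewrite !ger0_norm ?subr_ge0// lerD2r.
 rewrite distrC [`|y - x|]distrC; apply: main => // z yz zx; apply: hL; [exact: le_trans yz|exact: le_trans zx xc|].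
 by rewrite distrC [`|y - x|]distrC !ger0_norm ?subr_ge0// lerD2l lerN2.
move=> au uv vc hz.
have [||z] := @MVT_segment R g dg u v uv.
- move=> z; rewrite in_itv/= => /andP[/ltW uz /ltW zv]; apply: Dg; [exact: le_trans uz|exact: le_trans zv vc].
- apply: continuous_in_subspaceT => z; rewrite inE/= in_itv/= => /andP[uz zv].
 by apply: derive_continuous; apply: Dg; [exact: le_trans uz|exact: le_trans zv vc].
rewrite in_itv/= => /andP[uz zv] ->; rewrite normrM.
by rewrite ler_wpM2r// hz.
Qed.

(** The mean value inequality applied twice: the remainder [g] and its derivative [g1] vanish at
    [x], and the derivative of [g1] is [f2 z - f2 x]. *)
Lemma taylor2 (x y e : R) : a <= x -> x <= c -> a <= y -> y <= c ->
 (forall z, a <= z -> z <= c -> `|z - x| <= `|y - x| -> `|f2 z - f2 x| <= e) ->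
 `|f y - f x - f1 x * (y - x) - 2^-1 * f2 x * (y - x) ^+ 2| <= e * (y - x) ^+ 2.
Proof.
move=> ax xc ay yc h.
have e0 : 0 <= e by apply: le_trans (h x ax xc _); rewrite ?subrr ?normr0.
pose g z := f z - f x - f1 x * (z - x) - 2^-1 * f2 x * (z - x) ^+ 2.
pose g1 z := f1 z - f1 x - f2 x * (z - x).
have Dx (z : R) : is_derive z 1 (fun z : R => z - x) (1 : R).
 by have := is_deriveB (is_derive_id z (1 : R)) (is_derive_cst x z (1 : R)); rewrite subr0.
have Dg z : a <= z -> z <= c -> is_derive z 1 g (g1 z).
 move=> az zc; have h1 := D1 az zc.
 have h2 := is_deriveB h1 (is_derive_cst (f x) z (1 : R)).
 have h3 := is_deriveB h2 (is_deriveZ (f1 x) (Dx z)).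
 have h4 := is_deriveB h3 (is_deriveZ (2^-1 * f2 x) (is_deriveX 2 (Dx z))).
 move: h4; set G := (X in is_derive _ _ X _) => h4.
 have <- : G = g by apply/funext => u; rewrite /G /g !fctE /GRing.scale.
 apply: is_derive_eq h4 _.
 by rewrite /g1 /GRing.scale/= expr1 subr0 !mulr1; field.
have Dg1 z : a <= z -> z <= c -> is_derive z 1 g1 (f2 z - f2 x).
 move=> az zc; have h1 := D2 az zc.
 have h2 := is_deriveB h1 (is_derive_cst (f1 x) z (1 : R)).
 have h3 := is_deriveB h2 (is_deriveZ (f2 x) (Dx z)).
 move: h3; set G := (X in is_derive _ _ X _) => h3.
 have <- : G = g1 by apply/funext => u; rewrite /G /g1 !fctE /GRing.scale.
 apply: is_derive_eq h3 _.
 by rewrite /GRing.scale/= subr0 mulr1.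
have gx : g x = 0 by rewrite /g !subrr expr0n/= !mulr0 !subr0.
have g1x : g1 x = 0 by rewrite /g1 !subrr mulr0 subr0.
have b1 z : a <= z -> z <= c -> `|z - x| <= `|y - x| -> `|g1 z| <= e * `|y - x|.
 move=> az zc zy; have := @mvt_le g1 (fun z => f2 z - f2 x) x z e ax xc az zc Dg1.
 rewrite g1x subr0 => /(_ _)h'; apply: le_trans (h' _) _; last by rewrite ler_wpM2l.
 by move=> u au uc uz; apply: h => //; exact: le_trans uz zy.
have := @mvt_le g g1 x y (e * `|y - x|) ax xc ay yc Dg b1.
by rewrite gx subr0 -mulrA -normrM -expr2 ger0_norm ?sqr_ge0.
Qed.

End taylor.

(** * Ito's formula for germs *)

Section ito_formula.
Context {d} {T : measurableType d} {R : realType} (P : probability T R)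
 (F : R -> set (set T)) (hF : complete_filtration P F)
 (Iw : finType) (W : Iw -> R -> T -> R) (hW : brownian_motion P F W).
Variable Th : Type.
Local Notation L1 := (L1 P).
Implicit Types (X : Th -> R -> T -> R).

Lemma bap_ext (Y Y' : Th -> R -> T -> R) : bap F Y -> (forall x t w, 0 <= t -> Y x t w = Y' x t w) -> bap F Y'.
Proof.
move=> [K K0 h] E; exists K => // x t t0; have [m b] := h x t t0.
have -> : Y' x t = Y x t by apply/funext => w; rewrite E.
by split.
Qed.

Definition tinc X x s t w := X x t w - X x s w.

Lemma germ_const (Z : unit -> R -> R -> T -> R) b th : germ P F W Z b th ->
 germ P F W (fun (_ : Th) => Z tt) (fun _ => b tt) (fun _ => th tt).
Proof. by move=> h T0 e e0; have [dl dl0 hd] := h T0 e e0; exists dl => // x; exact: hd. Qed.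

Lemma bap_meas (Y : Th -> R -> T -> R) x t : bap F Y -> 0 <= t -> measf (Y x t).
Proof. by move=> [K _ h] t0; have [m _] := h x t t0; exact: msr_meas (filt_alg hF t0) m. Qed.

(** Ito's formula in abstract form: [V] needs only a second order expansion in the increments of
    [X], with [B2] in the place of half the second derivative. It serves functions on a compact
    interval and the cosine on the whole line. *)
Lemma germ_taylor (V X B1 B2 b : Th -> R -> T -> R) (th : Th -> Iw -> R -> T -> R) (K : R) :
 (forall x t, 0 <= t -> measf (V x t)) -> (forall x t, 0 <= t -> measf (X x t)) ->
 bap F B1 -> bap F B2 -> bapI F th -> germ P F W (tinc X) b th -> germ2 P W (tinc X) th ->
 let Rm x s t w := tinc V x s t w - B1 x s w * tinc X x s t w - B2 x s w * tinc X x s t w ^+ 2 in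
 (forall x s t w, 0 <= s -> s <= t -> `|Rm x s t w| <= K * tinc X x s t w ^+ 2) ->
 (forall e : R, 0 < e -> exists2 dl : R, 0 < dl & forall x s t w, 0 <= s -> s <= t ->
   `|tinc X x s t w| <= dl -> `|Rm x s t w| <= e * tinc X x s t w ^+ 2) ->
 germ P F W (tinc V) (fun x t w => B1 x t w * b x t w + B2 x t w * \sum_v th x v t w ^+ 2)
  (fun x v t w => B1 x t w * th x v t w).
Proof.
move=> mV mX b1 b2 hth gX g2X Rm RK Re.
have E x s t w : \sum_(j : unit) tinc X x s t w ^+ 2 = tinc X x s t w ^+ 2.
 by rewrite big_const card_unit /= addr0.
have gR : germ P F W Rm (fun _ _ _ => 0) (fun _ _ _ _ => 0).
 apply: (@germ_remainder _ _ _ P F hF Iw W hW Th unit (fun _ => tinc X) (fun _ => th) Rm K) => //.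
 - move=> x s t s0 st; have t0 := le_trans s0 st.
  have mx : measf (tinc X x s t) by apply: measurable_funB; exact: mX.
  apply: measurable_funB.
   apply: measurable_funB; first by apply: measurable_funB; exact: mV.
   by apply: measurable_funM => //; exact: bap_meas b1 s0.
  by apply: measurable_funM; [exact: bap_meas b2 s0|exact: measurable_funX].
 - by move=> x s t w s0 st; rewrite E; exact: RK.
 move=> e /Re[dl dl0 hd]; exists dl => // x s t w s0 st /(_ tt); rewrite E; exact: hd.
have g2 := germ_bap hF (germ2_prod hF hW hth hth g2X g2X) b2.
apply: (germ_eq (germD hF (germD hF (germ_bap hF gX b1) g2) gR)) => [x s t w s0 st|x t w t0|x v t w t0].
- by rewrite /Rm; ring.
- by rewrite addr0; congr (_ + _ * _); apply: eq_bigr => v _; rewrite expr2.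
- by rewrite mulr0 !addr0.
Qed.

Section formula.
Variables (X : Th -> R -> T -> R) (b : Th -> R -> T -> R) (th : Th -> Iw -> R -> T -> R).
Variables (f f1 f2 : R -> R) (a c : R).
Hypothesis D1 : forall z, a <= z -> z <= c -> is_derive z 1 f (f1 z).
Hypothesis D2 : forall z, a <= z -> z <= c -> is_derive z 1 f1 (f2 z).
Hypothesis C2 : forall z, a <= z -> z <= c -> {for z, continuous f2}.
Hypothesis ac : a <= c.
Hypothesis mX : forall x t, 0 <= t -> msr (F t) (X x t).
Hypothesis rX : forall x t w, 0 <= t -> a <= X x t w /\ X x t w <= c.
Hypothesis hb : bap F b.
Hypothesis hth : bapI F th.
Hypothesis gX : germ P F W (tinc X) b th.

Lemma tinc_meas x s t : 0 <= s -> s <= t -> measf (tinc X x s t).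
Proof.
move=> s0 st; have t0 := le_trans s0 st.
by apply: measurable_funB; [exact: msr_meas (filt_alg hF t0) (mX _ t0)|exact: msr_meas (filt_alg hF s0) (mX _ s0)].
Qed.

Lemma germ2_itv : germ2 P W (tinc X) th.
Proof.
apply: (germ2_bounded hF hW (K := c - a) hb hth gX) => x s t s0 st.
split=> [|w]; first exact: tinc_meas.
have [h1 h2] := rX x w s0; have [h3 h4] := rX x w (le_trans s0 st).
rewrite /tinc ler_norml; apply/andP; split; lra.
Qed.

Lemma bap_itv (g : R -> R) : (forall z, a <= z -> z <= c -> {for z, continuous g}) ->
 bap F (fun x t w => g (X x t w)).
Proof.
move=> cg; apply: (@bap_ext (fun x t w => g (clamp a c (X x t w)))).
 apply: (@bap_comp _ _ _ F Th X (fun y => g (clamp a c y))) => //.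
  exact: continuous_measurable_fun (clamp_comp_cont ac cg).
 exact: (bounded_on_segment ac cg).
by move=> x t w t0; have [h1 h2] := rX x w t0; rewrite clamp_id.
Qed.

Lemma ito_formula : germ P F W (tinc (fun x t w => f (X x t w)))
 (fun x t w => f1 (X x t w) * b x t w + 2^-1 * f2 (X x t w) * \sum_v th x v t w ^+ 2)
 (fun x v t w => f1 (X x t w) * th x v t w).
Proof.
have c0 z : a <= z -> z <= c -> {for z, continuous f} by move=> az zc; exact: derive_continuous (D1 az zc).
have c1 z : a <= z -> z <= c -> {for z, continuous f1} by move=> az zc; exact: derive_continuous (D2 az zc).
have b0 := bap_itv c0; have b1 := bap_itv c1.
have b2 : bap F (fun x t w => 2^-1 * f2 (X x t w)) by apply: (bapM hF (bap_cst hF _ 2^-1)); exact: bap_itv.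
have [K K0 hK] := bounded_on_segment ac C2.
apply: (@germ_taylor _ X _ _ _ _ (2 * K)) => // [x t t0|x t t0||x s t w s0 st|e e0].
- exact: bap_meas b0 t0.
- exact: msr_meas (filt_alg hF t0) (mX _ t0).
- exact: germ2_itv.
- have [h1 h2] := rX x w s0; have [h3 h4] := rX x w (le_trans s0 st).
 apply: (taylor2 D1 D2) => // z az zc _.
 have := hK z; have := hK (X x s w); rewrite !clamp_id// => k1 k2.
 by rewrite (le_trans (ler_normB _ _))// mulr_natl mulr2n lerD.
have Cw : {within [set` `[a, c]], continuous f2}.
 by apply: continuous_in_subspaceT => z; rewrite inE/= in_itv/= => /andP[az zc]; exact: C2.
have [dl dl0 hd] := compact_unif (@segment_compact R a c) Cw e0.
exists dl => // x s t w s0 st hz.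
have [h1 h2] := rX x w s0; have [h3 h4] := rX x w (le_trans s0 st).
apply: (taylor2 D1 D2) => // z az zc zy; apply: hd; rewrite /= ?in_itv/= ?az ?zc ?h1 ?h2//.
exact: le_trans zy hz.
Qed.

(** Adding up [germ_weak] over a fine subdivision converts a pointwise bound on the drift into a
    bound on the growth of the mean; the weight [Y] allows conditioning on the past. *)
Lemma drift_le x (C : R) s t (Y : T -> R) : 0 <= C -> (forall r w, 0 <= r -> b x r w <= C) ->
 0 <= s -> s <= t -> msr (F s) Y -> (forall w, 0 <= Y w <= 1) ->
 Ex P (fun w => Y w * (X x t w - X x s w)) <= C * (t - s).
Proof.
move=> C0 hC s0 st mY bY; have t0 := le_trans s0 st; have ts0 : 0 <= t - s by rewrite subr_ge0.
have bY1 w : `|Y w| <= 1 by have /andP[h1 h2] := bY w; rewrite ger0_norm.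
apply/ler_addgt0Pr => eps eps0.
have e1 : 0 < eps / (t - s + 1) by rewrite divr_gt0// ltr_wpDl.
have [dl dl0 hd] := germ_weak hF hW hb hth gX t e1.
have [N0 /(_ N0 (leqnn _)) mesh] := ugrid_mesh ts0 dl0.
pose p i := s + ugrid (t - s) N0 i.
have p0 : p 0%N = s by rewrite /p ugrid0 addr0.
have pN : p N0.+1 = t by rewrite /p ugridN addrC subrK.
have pB i : p i.+1 - p i = (t - s) / N0.+1%:R by rewrite /p -(ugridB (t - s) N0 i); ring.
have mY' := msr_meas (filt_alg hF s0) mY.
have bX i w : (i <= N0.+1)%N -> `|X x (p i) w| <= `|a| + `|c|.
 move=> iN; have [h1 h2] := ugrid_itv ts0 iN.
 have pi0 : 0 <= p i by rewrite addr_ge0.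
 have [h3 h4] := rX x w pi0; rewrite ler_norml; apply/andP; split.
  by have := ler_norm (- a); rewrite normrN; have := normr_ge0 c; lra.
 by have := ler_norm c; have := normr_ge0 a; lra.
have mp i : (i <= N0.+1)%N -> 0 <= p i /\ measf (X x (p i)).
 move=> iN; have [h1 h2] := ugrid_itv ts0 iN; have pi0 : 0 <= p i by rewrite addr_ge0.
 by split => //; exact: msr_meas (filt_alg hF pi0) (mX _ pi0).
have LX i : (i <= N0.+1)%N -> L1 (fun w => Y w * X x (p i) w).
 move=> iN; have [pi0 m] := mp i iN; apply: (@L1_bounded _ _ _ _ _ (`|a| + `|c|)).
  exact: measurable_funM.
 by move=> w; rewrite normrM -[leRHS]mul1r ler_pM// bX.
have -> : (fun w => Y w * (X x t w - X x s w)) = fun w => \sum_(i < N0.+1) (Y w * X x (p i.+1) w - Y w * X x (p i) w).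
 apply/funext => w; rewrite -(big_mkord predT (fun i => Y w * X x (p i.+1) w - Y w * X x (p i) w)) telescope_sumr//.
 by rewrite p0 pN mulrBr.
rewrite Ex_sum; last by move=> i _; apply: L1B; apply: LX => //; exact: ltnW.
apply: (@le_trans _ _ (\sum_(i < N0.+1) (C + eps / (t - s + 1)) * ((t - s) / N0.+1%:R))).
 apply: ler_sum => i _.
 have [pi0 mi] := mp i (ltnW (ltn_ord i)).
 have pii : p i <= p i.+1 by rewrite -subr_ge0 pB divr_ge0.
 have pt : p i.+1 <= t by have [_ h] := ugrid_itv ts0 (ltn_ord i); rewrite /p -lerBrDl.
 have mYi : msr (F (p i)) Y.
  apply: msr_sub mY; apply: (filt_le hF s0); rewrite /p lerDl.
  by have [h _] := ugrid_itv ts0 (ltnW (ltn_ord i)).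
 have hle : p i.+1 - p i <= dl by rewrite pB.
 have [LZ EZ] := hd x (p i) (p i.+1) pi0 pii pt hle Y mYi bY1.
 have [Kb Kb0 hKb] := bap_bound hb.
 have Lb : L1 (fun w => Y w * ((p i.+1 - p i) * b x (p i) w)).
  apply: (@L1_bounded _ _ _ _ _ ((p i.+1 - p i) * Kb)).
   by apply: measurable_funM => //; apply: measurable_funM; [exact: measurable_cst|exact: (bap_meas x hb pi0)].
  move=> w; rewrite normrM -[leRHS]mul1r ler_pM// normrM ger0_norm ?subr_ge0//.
  by rewrite ler_wpM2l ?subr_ge0// hKb.
 have -> : (fun w => Y w * X x (p i.+1) w - Y w * X x (p i) w) = fun w =>
   Y w * (tinc X x (p i) (p i.+1) w - (p i.+1 - p i) * b x (p i) w) + Y w * ((p i.+1 - p i) * b x (p i) w).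
  by apply/funext => w; rewrite /tinc; ring.
 rewrite ExD// mulrDl addrC; apply: lerD; last by rewrite -(pB i) (le_trans (ler_norm _)).
 rewrite -(pB i) -[leRHS](Ex_cst P); apply: Ex_le => //; first exact: L1_cst.
 move=> w; have /andP[h1 h2] := bY w.
 have h3 : 0 <= p i.+1 - p i by rewrite subr_ge0.
 rewrite mulrC -mulrA [C * _]mulrC ler_wpM2l//.
 have hCw := hC (p i) w pi0.
 apply: (@le_trans _ _ (C * Y w)); first by rewrite ler_wpM2r.
 by rewrite ler_piMr.
rewrite sumr_const card_ord -(mulr_natl (_ * _)) mulrCA [_%:R * _]mulrC divfK ?pnatr_eq0//.
rewrite mulrDl lerD2l mulrAC ler_pdivrMr ?ltr_wpDl//.
by rewrite ler_wpM2l ?(ltW eps0)// lerDl.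
Qed.

End formula.
End ito_formula.

(** * Squared moduli of a unit row vector times the unitary Brownian motion *)

Section row_vectors.
Context {d} {T : measurableType d} {R : realType} (P : probability T R)
 (F : R -> set (set T)) (hF : complete_filtration P F) (n : nat)
 (W : unitary_index n -> R -> T -> R) (hW : brownian_motion P F W)
 (U : R -> T -> 'M[R[i]]_n) (hU : unitary_sde P F W U).
Variable X : ucomp n -> R -> T -> R.
Hypothesis sX : forall a, sure F (X a).
Hypothesis eX : {ae P, forall w a t, X a t w = ucomponent U a t w}.
Hypothesis uX : forall t w, 0 <= t -> forall k k', inner_re X k k' t w = dlt R k k' /\ inner_im X k k' t w = 0.

Variable Th : Type.
Variables ar ai : Th -> 'I_n -> T -> R.
Hypothesis mar : forall x k, msr (F 0) (ar x k).
Hypothesis mai : forall x k, msr (F 0) (ai x k).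
Hypothesis norm_a : forall x w, \sum_k (ar x k w ^+ 2 + ai x k w ^+ 2) = 1.

(* The row vector (ar + i ai) . X. *)
Definition up x j t w := \sum_k (ar x k w * X (k, j, false) t w - ai x k w * X (k, j, true) t w).
Definition uq x j t w := \sum_k (ar x k w * X (k, j, true) t w + ai x k w * X (k, j, false) t w).

Lemma ler_norm1_sqr (y : R) : y ^+ 2 <= 1 -> `|y| <= 1.
Proof. by move=> h; rewrite -(@ler_pXn2r _ 2) ?nnegrE// expr1n real_normK ?num_real. Qed.

Lemma ar_bound x k w : `|ar x k w| <= 1 /\ `|ai x k w| <= 1.
Proof.
have := norm_a x w; rewrite (bigD1 k)//= => h.
have h2 : 0 <= \sum_(l < n | l != k) (ar x l w ^+ 2 + ai x l w ^+ 2).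
 by apply: sumr_ge0 => l _; rewrite addr_ge0// sqr_ge0.
have h3 := sqr_ge0 (ar x k w); have h4 := sqr_ge0 (ai x k w).
by split; apply: ler_norm1_sqr; lra.
Qed.

Lemma bap_ar k : bap F (fun x (_ : R) w => ar x k w).
Proof.
exists 1 => // x t t0; split; first exact: msr_sub (filt_le hF (lexx 0) t0) (mar x k).
by move=> w; case: (ar_bound x k w).
Qed.

Lemma bap_ai k : bap F (fun x (_ : R) w => ai x k w).
Proof.
exists 1 => // x t t0; split; first exact: msr_sub (filt_le hF (lexx 0) t0) (mai x k).
by move=> w; case: (ar_bound x k w).
Qed.

Lemma bap_X a : bap F (fun (_ : Th) t w => X a t w).
Proof.
exists 1 => // _ t t0; split; first exact: (sX a).1.
by move=> w; exact: (unitary_bound uX).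
Qed.

Lemma bap_up j : bap F (fun x => up x j).
Proof.
by apply: (bap_sum hF) => k; apply: (bapB hF); apply: (bapM hF); [exact: bap_ar|exact: bap_X|exact: bap_ai|exact: bap_X].
Qed.

Lemma bap_uq j : bap F (fun x => uq x j).
Proof.
by apply: (bap_sum hF) => k; apply: (bapD hF); apply: (bapM hF); [exact: bap_ar|exact: bap_X|exact: bap_ai|exact: bap_X].
Qed.

Lemma pcont_up x j w : pcont (up x j ^~ w).
Proof. by apply: pcont_sum => k; apply: pcontB; apply: pcontZ; exact: (sX _).2. Qed.

Lemma pcont_uq x j w : pcont (uq x j ^~ w).
Proof. by apply: pcont_sum => k; apply: pcontD; apply: pcontZ; exact: (sX _).2. Qed.

Lemma row_norm x t w : 0 <= t -> \sum_j (up x j t w * up x j t w + uq x j t w * uq x j t w) = 1.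
Proof.
move=> t0.
transitivity (\sum_k \sum_k' ((ar x k w * ar x k' w + ai x k w * ai x k' w) * inner_re X k k' t w +
  (ar x k w * ai x k' w - ai x k w * ar x k' w) * inner_im X k k' t w)).
 transitivity (\sum_j \sum_k \sum_k' ((ar x k w * ar x k' w + ai x k w * ai x k' w) *
   (X (k, j, false) t w * X (k', j, false) t w + X (k, j, true) t w * X (k', j, true) t w) +
   (ar x k w * ai x k' w - ai x k w * ar x k' w) *
   (X (k, j, true) t w * X (k', j, false) t w - X (k, j, false) t w * X (k', j, true) t w))).
  apply: eq_bigr => j _; rewrite /up /uq !mulr_suml -big_split; apply: eq_bigr => k _ /=.
  by rewrite !mulr_sumr -big_split; apply: eq_bigr => k' _ /=; ring.
 rewrite exchange_big; apply: eq_bigr => k _; rewrite exchange_big; apply: eq_bigr => k' _ /=.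
 by rewrite big_split /inner_re /inner_im !mulr_sumr.
rewrite -[RHS](norm_a x w); apply: eq_bigr => k _.
transitivity (\sum_k' dlt R k k' * (ar x k w * ar x k' w + ai x k w * ai x k' w)); last by rewrite sum_dlt !expr2.
by apply: eq_bigr => k' _; have [-> ->] := uX w t0 k k'; ring.
Qed.

Definition urn x j v t w := noiseR (fun l => up x l t w) (fun l => uq x l t w) j v.
Definition uin x j v t w := noiseI (fun l => up x l t w) (fun l => uq x l t w) j v.

Lemma bapI_urn j : bapI F (fun x => urn x j).
Proof.
move=> v; apply: (bap_sum hF) => l.
by apply: (bapB hF); apply: (bapM hF); (exact: bap_up || exact: bap_uq || exact: (bap_cst hF)).
Qed.

Lemma bapI_uin j : bapI F (fun x => uin x j).
Proof.
move=> v; apply: (bap_sum hF) => l.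
by apply: (bapD hF); apply: (bapM hF); (exact: bap_up || exact: bap_uq || exact: (bap_cst hF)).
Qed.

Let gc k j c := (germ_const Th (unitary_germs hF hW hU sX eX uX k j c).1).

Let sumnoise x k j v t w :
 ar x k w * row_noise X k j false v t w - ai x k w * row_noise X k j true v t w =
 \sum_l ((ar x k w * X (k, l, false) t w - ai x k w * X (k, l, true) t w) * noiseX R l j v -
  (ar x k w * X (k, l, true) t w + ai x k w * X (k, l, false) t w) * noiseY R l j v).
Proof.
by rewrite /row_noise /noiseR /noiseI !mulr_sumr -sumrB; apply: eq_bigr => l _; ring.
Qed.

Lemma germ_up j : germ P F W (tinc (fun x => up x j)) (fun x t w => - n%:R * up x j t w) (fun x => urn x j).
Proof.
have g k := germD hF (germ_bap hF (gc k j false) (bap_ar k)) (germ_bap hF (germ_bap hF (gc k j true) (bap_ai k)) (bap_cst hF _ (-1))).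
apply: (germ_eq (germ_lin hF (fun=> 1) g)).
- by move=> x s t w s0 st; rewrite /tinc /up -sumrB; apply: eq_bigr => k _; rewrite /inc; ring.
- by move=> x t w t0; rewrite /up mulr_sumr; apply: eq_bigr => k _; rewrite /cpar; ring.
- move=> x v t w t0; rewrite /urn /noiseR /up /uq.
 under [RHS]eq_bigr do rewrite !mulr_suml -sumrB.
 rewrite [RHS]exchange_big/=; apply: eq_bigr => k _.
 by rewrite -sumnoise /cfam; ring.
Qed.

Lemma germ_uq j : germ P F W (tinc (fun x => uq x j)) (fun x t w => - n%:R * uq x j t w) (fun x => uin x j).
Proof.
have g k := germD hF (germ_bap hF (gc k j true) (bap_ar k)) (germ_bap hF (gc k j false) (bap_ai k)).
apply: (germ_eq (germ_lin hF (fun=> 1) g)).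
- by move=> x s t w s0 st; rewrite /tinc /uq -sumrB; apply: eq_bigr => k _; rewrite /inc; ring.
- by move=> x t w t0; rewrite /uq mulr_sumr; apply: eq_bigr => k _; rewrite /cpar; ring.
- move=> x v t w t0; rewrite /uin /noiseI /up /uq.
 under [RHS]eq_bigr do rewrite !mulr_suml -big_split.
 rewrite [RHS]exchange_big/=; apply: eq_bigr => k _.
 rewrite /cfam /row_noise /noiseR /noiseI mul1r !mulr_sumr -big_split; apply: eq_bigr => l _ /=; ring.
Qed.

Lemma upq_itv x j t w : 0 <= t -> (-1 <= up x j t w /\ up x j t w <= 1) /\ (-1 <= uq x j t w /\ uq x j t w <= 1).
Proof.
move=> t0; have := row_norm x w t0; rewrite (bigD1 j)//= => h.
have h2 : 0 <= \sum_(l < n | l != j) (up x l t w * up x l t w + uq x l t w * uq x l t w).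
 by apply: sumr_ge0 => l _; rewrite addr_ge0// -expr2 sqr_ge0.
have h3 := sqr_ge0 (up x j t w); have h4 := sqr_ge0 (uq x j t w).
rewrite !expr2 in h3 h4.
have : `|up x j t w| <= 1 by apply: ler_norm1_sqr; rewrite expr2; lra.
have : `|uq x j t w| <= 1 by apply: ler_norm1_sqr; rewrite expr2; lra.
by rewrite !ler_norml => /andP[? ?] /andP[? ?].
Qed.

Let bN (Y : Th -> R -> T -> R) : bap F Y -> bap F (fun x t w => - n%:R * Y x t w).
Proof. by move=> h; apply: (bapM hF) => //; exact: (bap_cst hF). Qed.

Let mbap (Y : Th -> R -> T -> R) : bap F Y -> forall x t, 0 <= t -> msr (F t) (Y x t).
Proof. by move=> [K _ h] x t t0; case: (h x t t0). Qed.

Lemma germ2_up j : germ2 P W (tinc (fun x => up x j)) (fun x => urn x j).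
Proof.
apply: (germ2_itv hF hW (a := -1) (c := 1) (mbap (bap_up j)) _ (bN (bap_up j)) (bapI_urn j) (germ_up j)).
by move=> x t w t0; case: (upq_itv x j w t0).
Qed.

Lemma germ2_uq j : germ2 P W (tinc (fun x => uq x j)) (fun x => uin x j).
Proof.
apply: (germ2_itv hF hW (a := -1) (c := 1) (mbap (bap_uq j)) _ (bN (bap_uq j)) (bapI_uin j) (germ_uq j)).
by move=> x t w t0; case: (upq_itv x j w t0).
Qed.

Definition lam x j t w := up x j t w ^+ 2 + uq x j t w ^+ 2.
Definition lnoise x j v t w := 2 * (up x j t w * urn x j v t w + uq x j t w * uin x j v t w).

Lemma lam_sum x t w : 0 <= t -> \sum_j lam x j t w = 1.
Proof. by move=> t0; rewrite -(row_norm x w t0); apply: eq_bigr => j _; rewrite /lam !expr2. Qed.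

Lemma lam_ge0 x j t w : 0 <= lam x j t w.
Proof. by rewrite addr_ge0// sqr_ge0. Qed.

Lemma lam_le1 x j t w : 0 <= t -> lam x j t w <= 1.
Proof.
move=> t0; rewrite -(lam_sum x w t0) (bigD1 j)//= lerDl; apply: sumr_ge0 => l _; exact: lam_ge0.
Qed.

Lemma bap_lam j : bap F (fun x => lam x j).
Proof. by apply: (bapD hF); apply: (bapX hF); [exact: bap_up|exact: bap_uq]. Qed.

Lemma pcont_lam x j w : pcont (lam x j ^~ w).
Proof.
by apply: pcontD; (under [X in pcont X]eq_fun do rewrite expr2); apply: pcontM; (exact: pcont_up || exact: pcont_uq).
Qed.

Lemma bapI_lnoise j : bapI F (fun x => lnoise x j).
Proof.
move=> v; apply: (bapM hF (bap_cst hF _ 2)); apply: (bapD hF); apply: (bapM hF);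
 (exact: bap_up || exact: bap_uq || exact: bapI_urn || exact: bapI_uin).
Qed.

Lemma lnoise_gram x j j' t w : 0 <= t -> \sum_v lnoise x j v t w * lnoise x j' v t w =
 4 * (dlt R j j' * lam x j t w - lam x j t w * lam x j' t w).
Proof.
move=> t0.
transitivity (4 * (up x j t w * up x j' t w * \sum_v urn x j v t w * urn x j' v t w +
 uq x j t w * uq x j' t w * \sum_v uin x j v t w * uin x j' v t w +
 up x j t w * uq x j' t w * \sum_v urn x j v t w * uin x j' v t w +
 uq x j t w * up x j' t w * \sum_v urn x j' v t w * uin x j v t w)).
 rewrite /lnoise; move: (up x j t w) (uq x j t w) (up x j' t w) (uq x j' t w) => p q p' q'.
 by rewrite !mulr_sumr -!big_split mulr_sumr; apply: eq_bigr => v _ /=; ring.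
rewrite /urn /uin gramRR gramII !gramRI row_norm//.
have -> : \sum_l (up x l t w * uq x l t w - uq x l t w * up x l t w) = 0.
 by rewrite big1// => l _; ring.
rewrite /lam; have [->|jj] := eqVneq j j'; first by rewrite /dlt eqxx mulr1n; ring.
by rewrite /dlt (negbTE jj) mulr0n; ring.
Qed.

(** The drift [- n] of the entries contributes [- 2 n] times [lam]. The brackets of the real and
    imaginary parts, [1 - p^2 + q^2] and [1 + p^2 - q^2] for a row of norm one, contribute [2]. *)
Lemma germ_lam j : germ P F W (tinc (fun x => lam x j)) (fun x t w => 2 * (1 - n%:R * lam x j t w)) (fun x => lnoise x j).
Proof.
have b2 (Y : Th -> R -> T -> R) : bap F Y -> bap F (fun x t w => 2 * Y x t w).
 by move=> h; apply: (bapM hF) => //; exact: (bap_cst hF).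
have gp := germD hF (germ_bap hF (germ_up j) (b2 _ (bap_up j))) (germ2_prod hF hW (bapI_urn j) (bapI_urn j) (germ2_up j) (germ2_up j)).
have gq := germD hF (germ_bap hF (germ_uq j) (b2 _ (bap_uq j))) (germ2_prod hF hW (bapI_uin j) (bapI_uin j) (germ2_uq j) (germ2_uq j)).
apply: (germ_eq (germD hF gp gq)).
- by move=> x s t w s0 st; rewrite /tinc /lam; ring.
- move=> x t w t0; rewrite /urn /uin gramRR gramII row_norm// /dlt eqxx mulr1n /lam; ring.
- by move=> x v t w t0; rewrite /lnoise; ring.
Qed.

End row_vectors.

(** * The coordinates of the process on the simplex never vanish *)

Section nonhitting.
Context {d} {T : measurableType d} {R : realType} (P : probability T R)
 (F : R -> set (set T)) (hF : complete_filtration P F)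
 (Iw : finType) (W : Iw -> R -> T -> R) (hW : brownian_motion P F W).
Variable L : R -> T -> R.
Variables (n : nat) (th : Iw -> R -> T -> R).
Hypothesis sL : sure F L.
Hypothesis rL : forall t w, 0 <= t -> 0 <= L t w /\ L t w <= 1.
Hypothesis hth : bapI F (cfam th).
Hypothesis gL : germ P F W (tinc (cpar L)) (fun _ t w => 2 * (1 - n%:R * L t w)) (cfam th).
Hypothesis qL : forall t w, 0 <= t -> \sum_v th v t w ^+ 2 = 4 * (L t w - L t w ^+ 2).

(* The logarithm is superharmonic up to a bounded term: this is the critical
   dimension. *)
Definition barrier (eps y : R) : R := ln 2 - ln (y + eps).
Definition energy eps t w := barrier eps (L t w).

Lemma barrier_derive (eps z : R) : 0 < eps -> 0 <= z ->
 is_derive z (1 : R) (barrier eps) (- (z + eps)^-1) /\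
 is_derive z (1 : R) (fun y => - (y + eps)^-1) ((z + eps)^-1 ^+ 2).
Proof.
move=> e0 z0; have ze : 0 < z + eps by rewrite ltr_wpDl.
have Dz : is_derive z (1 : R) (fun y : R => y + eps) (1 : R).
 by have := is_deriveD (is_derive_id z (1 : R)) (is_derive_cst eps z (1 : R)); rewrite addr0.
split.
 have h := is_deriveB (is_derive_cst (ln 2) z (1 : R)) (@is_derive1_comp R (@ln R) (fun y => y + eps) z _ _ (is_derive1_ln ze) Dz).
 apply: is_derive_eq h _; by rewrite mulr1 sub0r.
have h := is_deriveN (@is_deriveV R (fun y : R => y + eps) z _ _ (lt0r_neq0 ze) Dz).
apply: is_derive_eq h _.
by rewrite /GRing.scale/= mulr1 opprK exprVn.
Qed.

(** The terms [2 y] coming from the variance and from the drift cancel, so nothing of order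
    [1 / eps] survives; the rest is at most [2 n y (y + eps)] over [(y + eps)^2]. *)
Lemma drift_bound (y eps : R) : 0 <= y -> y <= 1 -> 0 < eps ->
 - (y + eps)^-1 * (2 * (1 - n%:R * y)) + 2^-1 * (y + eps)^-1 ^+ 2 * (4 * (y - y ^+ 2)) <= 2 * n%:R.
Proof.
move=> y0 y1 e0; have ze : 0 < y + eps by rewrite ltr_wpDl.
rewrite (_ : _ + _ = (2 * (y - y ^+ 2) - 2 * (1 - n%:R * y) * (y + eps)) / (y + eps) ^+ 2); last by field; rewrite gt_eqF.
rewrite ler_pdivrMr ?exprn_gt0//.
have n0 : 0 <= n%:R :> R by [].
have h1 : 0 <= n%:R * eps * (y + eps) by rewrite !mulr_ge0// ltW.
have h2 := sqr_ge0 y.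
have -> : 2 * n%:R * (y + eps) ^+ 2 = 2 * (n%:R * y) * (y + eps) + 2 * (n%:R * eps * (y + eps)) by ring.
have -> : 2 * (1 - n%:R * y) * (y + eps) = 2 * y + 2 * eps - 2 * (n%:R * y) * (y + eps) by ring.
lra.
Qed.

Lemma energy_drift eps s t (Y : T -> R) : 0 < eps -> 0 <= s -> s <= t -> msr (F s) Y ->
 (forall w, 0 <= Y w <= 1) -> Ex P (fun w => Y w * (energy eps t w - energy eps s w)) <= 2 * n%:R * (t - s).
Proof.
move=> e0 s0 st mY bY.
have D1 (z : R) : 0 <= z -> z <= 1 -> is_derive z (1 : R) (barrier eps) (- (z + eps)^-1).
 by move=> z0 _; case: (barrier_derive e0 z0).
have D2 (z : R) : 0 <= z -> z <= 1 -> is_derive z (1 : R) (fun y => - (y + eps)^-1) ((z + eps)^-1 ^+ 2).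
 by move=> z0 _; case: (barrier_derive e0 z0).
have C2 (z : R) : 0 <= z -> z <= 1 -> {for z, continuous (fun y => (y + eps)^-1 ^+ 2)}.
 move=> z0 z1; have ze : 0 < z + eps by rewrite ltr_wpDl.
 have c1 := derive_continuous (D2 z z0 z1).
 have -> : (fun y => (y + eps)^-1 ^+ 2) = (fun y => - (y + eps)^-1 * - (y + eps)^-1).
  by apply/funext => y; rewrite mulrNN.
 exact: (continuousM c1 c1).
have mL (x : unit) t' : 0 <= t' -> msr (F t') (cpar L x t') by exact: sL.1.
have rL' (x : unit) t' w : 0 <= t' -> 0 <= cpar L x t' w /\ cpar L x t' w <= 1 by exact: rL.
have bL : bap F (cpar L).
 exists 1 => // x t' t0; split; first exact: sL.1.
 by move=> w; have [h1 h2] := rL w t0; rewrite ger0_norm.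
have hb : bap F (fun _ : unit => fun t w => 2 * (1 - n%:R * L t w)).
 apply: (bapM hF (bap_cst hF _ 2)); apply: (bapB hF (bap_cst hF _ 1)).
 by apply: (bapM hF (bap_cst hF _ _)); exact: bL.
have g := ito_formula hF hW D1 D2 C2 ler01 mL rL' hb hth gL.
have c0 (z : R) : 0 <= z -> z <= 1 -> {for z, continuous (barrier eps)} by move=> z0 z1; exact: derive_continuous (D1 z z0 z1).
have c1 (z : R) : 0 <= z -> z <= 1 -> {for z, continuous (fun y => - (y + eps)^-1)} by move=> z0 z1; exact: derive_continuous (D2 z z0 z1).
have be := bap_itv ler01 mL rL' c0; have b1 := bap_itv ler01 mL rL' c1; have b2 := bap_itv ler01 mL rL' C2.
have [K K0 hK] := bap_bound be.
apply: (@drift_le _ _ _ P F hF Iw W hW unit (fun _ => energy eps) _ _ (- K) K _ _ _ _ g tt (2 * n%:R)) => //.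
- by move=> x t' t0; have [K' _ h] := be; case: (h tt t' t0).
- by move=> x t' w t0; have := hK tt t' w t0; rewrite ler_norml => /andP[].
- apply: (bapD hF); first by apply: (bapM hF) => //; exact: b1.
 apply: (bapM hF); first by apply: (bapM hF (bap_cst hF _ _)); exact: b2.
 by apply: (bap_sum hF) => v; apply: (bapX hF); exact: hth.
- by move=> v; apply: (bapM hF); [exact: b1|exact: hth].
- by move=> r w r0; rewrite /cpar /cfam qL//; have [h1 h2] := rL w r0; exact: drift_bound.
Qed.

Lemma energy_bap eps : 0 < eps -> bap F (cpar (energy eps)).
Proof.
move=> e0; have mL (x : unit) t : 0 <= t -> msr (F t) (cpar L x t) by exact: sL.1.
have rL' (x : unit) t w : 0 <= t -> 0 <= cpar L x t w /\ cpar L x t w <= 1 by exact: rL.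
apply: (bap_itv ler01 mL rL') => z z0 _; exact: derive_continuous (barrier_derive e0 z0).1.
Qed.

Section passage.
Variables (a eta : R) (l : nat).
Hypothesis a0 : 0 < a.
Hypothesis eta0 : 0 < eta.
Hypothesis eta1 : eta <= 1.
(** With this value, the level [a] is passed as soon as [L <= eps]: then [L + eps <= 2 eps], and the
    barrier is at least [- ln eps = a]. *)
Let eps := expR (- a).
Let V k w := energy eps (dyad l k) w.
Let eps0 : 0 < eps. Proof. exact: expR_gt0. Qed.
Let eps1 : eps <= 1. Proof. by rewrite /eps -expR0 ler_expR oppr_le0 ltW. Qed.
Let d0 k : 0 <= dyad l k :> R. Proof. exact: dyad_ge0. Qed.

Let V0 k w : 0 <= V k w.
Proof.
have [h1 h2] := rL w (d0 k); have h3 : 0 < L (dyad l k) w + eps by rewrite ltr_wpDl.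
by rewrite subr_ge0 ler_ln ?posrE// -[leRHS]/(1 + 1) lerD.
Qed.

(** A discrete substitute for a stopping time, along dyadic times. The condition on [L 0] keeps the
    initial energy bounded independently of [eps]. *)
Definition surviving k := [set w | eta <= L 0 w /\ forall i, (i <= k)%N -> V i w < a].
Definition passed k := [set w | eta <= L 0 w /\ exists2 i, (i <= k)%N & a <= V i w].

Let mV k : msr (F (dyad l k)) (V k).
Proof. by have [K _ h] := energy_bap eps0; case: (h tt (dyad l k) (d0 k)). Qed.

Let bV : exists2 K : R, 0 < K & forall k w, `|V k w| <= K.
Proof. by have [K K0 h] := bap_bound (energy_bap eps0); exists K => // k w; exact: (h tt). Qed.

Let mS0 k : F (dyad l k) [set w | eta <= L 0 w].
Proof.
apply: (filt_le hF (lexx 0) (d0 k)); have := sL.1 0 (lexx 0).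
move=> /(_ `[eta, +oo[%classic (measurable_itv _)); congr (F 0 _).
by apply/seteqP; split => w /=; rewrite in_itv/= andbT.
Qed.

Let mVlt k i : (i <= k)%N -> F (dyad l k) [set w | V i w < a].
Proof.
move=> ik; apply: (filt_le hF (d0 i) (dyad_le l ik)).
by have := mV i (measurable_itv `]-oo, a[); congr (F _ _).
Qed.

Lemma surviving_measurable k j : (k <= j)%N -> F (dyad l j) (surviving k).
Proof.
have sa := filt_sa hF (d0 j).
elim: k => [|k IH] kj.
 rewrite (_ : surviving 0 = [set w | eta <= L 0 w] `&` [set w | V 0 w < a]).
  by apply: (subalgI sa); [exact: mS0|exact: mVlt].
 apply/seteqP; split => w [h1 h2]; split=> //; first exact: h2.
 by move=> i; rewrite leqn0 => /eqP ->.
rewrite (_ : surviving k.+1 = surviving k `&` [set w | V k.+1 w < a]).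
 by apply: (subalgI sa); [apply: IH; exact: ltnW|exact: mVlt].
apply/seteqP; split => w.
 by move=> [h1 h2]; split; [split => // i ik; apply: h2; exact: leqW|exact: h2].
move=> [[h1 h2] h3]; split => // i; rewrite leq_eqVlt => /predU1P[->//|].
by rewrite ltnS; exact: h2.
Qed.

Let passedE k : passed k = [set w | eta <= L 0 w] `&` ~` surviving k.
Proof.
apply/seteqP; split => w.
 by move=> [h1 [i ik h]]; split => // -[_ /(_ i ik)]; rewrite ltNge h.
move=> [h1 h2]; split => //; apply: contrapT => h3; apply: h2; split => // i ik.
by rewrite ltNge; apply/negP => h4; apply: h3; exists i.
Qed.

Lemma passed_measurable k : measurable (passed k).
Proof.
have sa := filt_sa hF (d0 k); apply: (filt_alg hF (d0 k)).2.
by rewrite passedE; apply: (subalgI sa); [exact: mS0|apply: (subalgC sa); exact: surviving_measurable].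
Qed.

Let mD k : measurable (surviving k).
Proof. by apply: (filt_alg hF (d0 k)).2; exact: surviving_measurable. Qed.

Let mVm k : measf (V k).
Proof. exact: msr_meas (filt_alg hF (d0 k)) (mV k). Qed.

(** The energy stopped at level [a]. Two indices separate the time [k] at which passage is decided
    from the time [j] of the energy: the drift bound advances [j], then [PhiS] advances [k]. *)
Let Phi k j w := a * \1_(passed k) w + \1_(surviving k) w * V j w.

Let LPhi k j : L1 P (Phi k j).
Proof.
have [K K0 hK] := bV; apply: (@L1_bounded _ _ _ _ _ (a + K)).
 apply: measurable_funD; apply: measurable_funM.
 - exact: measurable_cst.
 - by apply: measurable_indic; exact: passed_measurable.
 - by apply: measurable_indic; exact: mD.
 - exact: mVm.
move=> w; rewrite (le_trans (ler_normD _ _))// !normrM (ger0_norm (ltW a0)); apply: lerD.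
 by have [->|->] := @indic01 _ _ R (passed k) w; rewrite ?normr1 ?normr0 ?mulr1 ?mulr0// ltW.
by have [->|->] := @indic01 _ _ R (surviving k) w; rewrite ?normr1 ?normr0 ?mul1r ?mul0r ?hK// ltW.
Qed.

Let PhiS k w : Phi k.+1 k.+1 w <= Phi k k.+1 w.
Proof.
rewrite /Phi !indicE.
have [g|g] := pselect (passed k w).
 have g' : passed k.+1 w by case: g => h1 [i ik h]; split => //; exists i => //; exact: leqW.
 have n1 : ~ surviving k.+1 w by case: g' => h1 [i ik h] [_ /(_ i ik)]; rewrite ltNge h.
 have n2 : ~ surviving k w by case: g => h1 [i ik h] [_ /(_ i ik)]; rewrite ltNge h.
 by rewrite (mem_set g) (mem_set g') (memNset n1) (memNset n2).
rewrite (memNset g) mulr0 add0r.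
have [s|s] := pselect (surviving k w); last first.
 have n0 : ~ (eta <= L 0 w) by move=> h; apply: g; rewrite passedE.
 have n1 : ~ surviving k.+1 w by case.
 have n2 : ~ passed k.+1 w by case.
 by rewrite (memNset n1) (memNset n2) (memNset s) !mul0r mulr0 addr0.
rewrite (mem_set s) mul1r; have [h|h] := ltP (V k.+1 w) a.
 have n2 : ~ passed k.+1 w.
  move=> [_ [i ]]; rewrite leq_eqVlt => /predU1P[->|]; first by rewrite leNgt h.
  by rewrite ltnS => ik; case: s => _ /(_ i ik); rewrite ltNge => /negP.
 have s1 : surviving k.+1 w.
  by case: s => s1 s2; split => // i; rewrite leq_eqVlt => /predU1P[->//|]; rewrite ltnS; exact: s2.
 by rewrite (memNset n2) (mem_set s1) mulr0 add0r mul1r.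
have n2 : ~ surviving k.+1 w by move=> [_ /(_ k.+1 (leqnn _))]; rewrite ltNge h.
have g1 : passed k.+1 w by case: s => s1 _; split => //; exists k.+1.
by rewrite (memNset n2) (mem_set g1) mulr1 mul0r addr0.
Qed.

(** Optional stopping in discrete form: the mean of [Phi] starts below [ln 2 - ln eta] and grows at
    rate at most [2 n]. The bound depends neither on [a] nor on the mesh, so high levels are rarely
    passed. *)
Lemma passage_bound k : a * fine (P (passed k)) <= ln 2 - ln eta + 2 * n%:R * dyad l k.
Proof.
have main : Ex P (Phi k k) <= ln 2 - ln eta + 2 * n%:R * dyad l k.
 elim: k => [|k IH].
  have d00 : dyad l 0 = 0 :> R by rewrite /dyad mul0r.
  rewrite d00 mulr0 addr0 -[leRHS](Ex_cst P); apply: Ex_le => //; first exact: L1_cst.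
  have C0 : 0 <= ln 2 - ln eta by rewrite subr_ge0 ler_ln ?posrE// (le_trans eta1)// ler1n.
  move=> w; have [h|h] := pselect (eta <= L 0 w); last first.
   have n1 : ~ surviving 0 w by case.
   have n2 : ~ passed 0 w by case.
   by rewrite /Phi !indicE (memNset n1) (memNset n2) mulr0 mul0r addr0.
  apply: (@le_trans _ _ (V 0 w)).
   rewrite /Phi !indicE; have [h2|h2] := ltP (V 0 w) a.
    have n2 : ~ passed 0 w by move=> [_ [i ]]; rewrite leqn0 => /eqP ->; rewrite leNgt h2.
    have s1 : surviving 0 w by split => // i; rewrite leqn0 => /eqP ->.
    by rewrite (memNset n2) (mem_set s1) mulr0 add0r mul1r.
   have n2 : ~ surviving 0 w by move=> [_ /(_ 0%N (leqnn _))]; rewrite ltNge h2.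
   have g1 : passed 0 w by split => //; exists 0%N.
   by rewrite (memNset n2) (mem_set g1) mulr1 mul0r addr0.
  rewrite /V /energy /barrier lerD2l lerN2 /dyad mul0r ler_ln ?posrE//.
   by rewrite (le_trans h)// lerDl ltW.
  by rewrite ltr_wpDr ?(ltW eps0)// (lt_le_trans eta0).
 apply: (@le_trans _ _ (Ex P (Phi k k.+1))); first by apply: Ex_le => // w; exact: PhiS.
 have -> : Phi k k.+1 = fun w => Phi k k w + \1_(surviving k) w * (energy eps (dyad l k.+1) w - energy eps (dyad l k) w).
  by apply/funext => w; rewrite /Phi /V; ring.
 have LS : L1 P (fun w => \1_(surviving k) w * (energy eps (dyad l k.+1) w - energy eps (dyad l k) w)).
  have [K K0 hK] := bV; apply: (@L1_bounded _ _ _ _ _ (2 * K)).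
   by apply: measurable_funM; [apply: measurable_indic; exact: mD|apply: measurable_funB; exact: mVm].
  move=> w; rewrite normrM; apply: (@le_trans _ _ (1 * (2 * K))); last by rewrite mul1r.
  apply: ler_pM => //; last by apply: ler_normB2; [exact: (hK k.+1)|exact: (hK k)].
  exact: indic_le1.
 rewrite ExD//.
 have sa := filt_sa hF (d0 k).
 have h := @energy_drift eps (dyad l k) (dyad l k.+1) \1_(surviving k) eps0 (d0 k) (dyad_le l (leqnSn k))
  (msr_indic sa (surviving_measurable (leqnn k))).
 have {}h : Ex P (fun w => \1_(surviving k) w * (energy eps (dyad l k.+1) w - energy eps (dyad l k) w)) <= 2 * n%:R * (dyad l k.+1 - dyad l k).
  by apply: h => w; rewrite indicE ler0n lern1 leq_b1.
 have := h; have := IH; lra.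
apply: le_trans main; have mk := passed_measurable k; rewrite -(@Ex_indic _ _ _ P _ mk) -(@ExZ _ _ _ P _ _ (L1_indic P mk)).
apply: Ex_le => //; first by apply: L1Z; apply: L1_indic; exact: passed_measurable.
by move=> w; rewrite /Phi lerDl mulr_ge0// indicE.
Qed.

End passage.

(** For a start above [1 / (j + 1)] and a horizon [T0], passing the level [m + 1] has probability at
    most [C / (m + 1)], uniformly in the dyadic grid. Outside a null event some level is never
    passed, which bounds [L] below at dyadic times. *)
Theorem nonhitting : {ae P, forall w, 0 < L 0 w -> forall t, 0 <= t -> 0 < L t w}.
Proof.
have key (j T0 : nat) : {ae P, forall w, j.+1%:R^-1 <= L 0 w -> exists2 c : R, 0 < c &
  forall l k, (dyad l k : R) <= T0%:R -> c <= L (dyad l k) w}.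
 have eta0 : 0 < j.+1%:R^-1 :> R by rewrite invr_gt0.
 have eta1 : j.+1%:R^-1 <= 1 :> R by rewrite invf_le1// ler1n.
 pose C : R := ln 2 - ln j.+1%:R^-1 + 2 * n%:R * T0%:R.
 pose B (m l : nat) := passed m.+1%:R j.+1%:R^-1 l (T0 * 2 ^ l).
 have dT l : dyad l (T0 * 2 ^ l) = T0%:R :> R by rewrite /dyad natrM natrX mulfK// expf_neq0.
 have m0 (m : nat) : 0 < m.+1%:R :> R by [].
 have mB m l : measurable (B m l) by exact: passed_measurable.
 have PB m l : (P (B m l) <= (C / m.+1%:R)%:E)%E.
  rewrite -(fineK (fin_num_measure P _ (mB m l))) lee_fin ler_pdivlMr// mulrC.
  by have := passage_bound l (m0 m) eta0 eta1 (T0 * 2 ^ l)%N; rewrite dT.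
 pose E m := \bigcup_l B m l.
 have mE m : measurable (E m) by apply: bigcup_measurable.
 have PE m : (P (E m) <= (C / m.+1%:R)%:E)%E.
  have nd : nondecreasing_seq (B m).
   apply/nondecreasing_seqP => l; apply/subsetPset => w [h1 [i ik h]]; split => //.
   exists (i * 2)%N; first by rewrite expnSr mulnA leq_mul2r ik orbT.
   by rewrite (_ : dyad l.+1 _ = dyad l i)// /dyad natrM exprSr -mulf_div divff// mulr1.
  have h := @nondecreasing_cvg_mu _ _ _ P (B m) (mB m) (mE m) nd.
  rewrite -(cvg_lim _ h)//; apply: lime_le; first by apply/cvg_ex; eexists; exact: h.
  by apply: nearW => l; exact: PB.
 have C0 : 0 <= C.
  by rewrite addr_ge0 ?mulr_ge0// subr_ge0 ler_ln ?posrE// (le_trans eta1)// ler1n.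
 exists (\bigcap_m E m); split.
 - by apply: bigcap_measurable => // m _; exact: mE.
 - apply/eqP; rewrite eq_le measure_ge0 andbT; apply/lee_addgt0Pr => e e0; rewrite add0e.
  have [m hm] : exists m : nat, C / m.+1%:R <= e.
   exists (Num.truncn (C / e)); rewrite ler_pdivrMr// mulrC -ler_pdivrMr// ltW// truncnS_gt//.
  apply: (@le_trans _ _ (P (E m))).
   apply: le_measure; rewrite ?inE//; first by apply: bigcap_measurable => // k _; exact: mE.
   by move=> w; apply.
  by apply: (le_trans (PE m)); rewrite lee_fin.
 move=> w /= nh m _; apply: contrapT => nE; apply: nh => hw.
 exists (expR (- m.+1%:R)); first exact: expR_gt0.
 move=> l k kT; rewrite leNgt; apply/negP => lt; apply: nE; exists l => //; split => //.
 have kT' : (dyad l k : R) <= dyad l (T0 * 2 ^ l) by apply: (le_trans kT); rewrite -(dT l).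
 exists k; first by move: kT'; rewrite /dyad ler_pM2r ?invr_gt0 ?exprn_gt0// ler_nat.
 rewrite /energy /barrier; set eps := expR _ in lt *.
 have e0 : 0 < eps by exact: expR_gt0.
 have [L0 _] := rL w (dyad_ge0 l k).
 have le : L (dyad l k) w + eps <= 2 * eps by rewrite mulr_natl mulr2n lerD2r ltW.
 have : ln (L (dyad l k) w + eps) <= ln (2 * eps) by rewrite ler_ln ?posrE ?mulr_gt0// ltr_wpDl.
 rewrite lnM ?posrE// /eps expRK; lra.
have ae_all : {ae P, forall w (j T0 : nat), j.+1%:R^-1 <= L 0 w -> exists2 c : R, 0 < c &
  forall l k, (dyad l k : R) <= T0%:R -> c <= L (dyad l k) w}.
 by apply: ae_forallC => j; apply: ae_forallC => T0; exact: key.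
apply: filterS ae_all => w hw L0 t t0.
pose j := Num.truncn (L 0 w)^-1.
have hj : j.+1%:R^-1 <= L 0 w by rewrite -[leRHS]invrK lef_pV2 ?posrE ?invr_gt0// ltW// truncnS_gt.
have [c c0 hc] := hw j (Num.truncn t).+1 hj.
apply: (lt_le_trans c0).
(* A lower bound by [c] is the vanishing of [min (y - c, 0)], a form to which [pcont_dyad_le]
   applies. *)
have cm : continuous (fun y : R => Num.min (y - c) 0).
 move=> y; apply: (@continuous_min _ _ (fun y => y - c) (fun=> 0)); last exact: cvg_cst.
 by apply: cvgB; [exact: cvg_id|exact: cvg_cst].
have hd l k : dyad l k <= t -> `|Num.min (L (dyad l k) w - c) 0| <= 0.
 move=> kt; rewrite (min_idPr _) ?normr0// subr_ge0; apply: hc.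
 by rewrite (le_trans kt)// ltW// truncnS_gt.
have := @pcont_dyad_le R (fun s => Num.min (L s w - c) 0) (fun=> 0) t 0 (pcont_comp cm (sL.2 w)) hd t t0 (lexx t).
by rewrite normr_le0 => /eqP h; rewrite -subr_ge0 -h ge_min lexx.
Qed.

End nonhitting.

(** * Flag coordinates and the last row of a unitary matrix *)

Section flag_lambda.
Context {R : realType} (m : nat).
Implicit Types M : 'M[R[i]]_m.+1.

Definition sqnorm (z : R[i]) : R := complex.Re z ^+ 2 + complex.Im z ^+ 2.

Lemma sqnorm_ge0 z : 0 <= sqnorm z.
Proof. by rewrite addr_ge0// sqr_ge0. Qed.

Lemma sqnormM x y : sqnorm (x * y) = sqnorm x * sqnorm y.
Proof. by case: x => a b; case: y => a' b'; rewrite /sqnorm /=; ring. Qed.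

Lemma sqnorm_gt0 z : (0 < sqnorm z) = (z != 0).
Proof.
case: z => a b; rewrite lt0r sqnorm_ge0 andbT; congr (~~ _); rewrite /sqnorm /= eq_complex /=.
by rewrite paddr_eq0 ?sqr_ge0// !sqrf_eq0.
Qed.

Lemma normc_sqr (z : R[i]) : Normc.normc z ^+ 2 = sqnorm z.
Proof. by case: z => a b; rewrite /Normc.normc sqr_sqrtr// addr_ge0// sqr_ge0. Qed.

Lemma column_norm M j : M \is unitarymx -> \sum_k sqnorm (M k j) = 1.
Proof.
move=> /unitarymxP uM; have := mulmx1C uM => /(congr1 (fun N : 'M[R[i]]_m.+1 => complex.Re (N j j))).
rewrite !mxE eqxx /= Re_sum => <-; apply: eq_bigr => k _; rewrite !mxE.
by case: (M k j) => a b; rewrite /sqnorm /=; ring.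
Qed.

(** The column [j] has norm one, so [1 + r^2] is the inverse of the squared modulus of its last
    entry. *)
Lemma flag_lambdaE M j : M \is unitarymx -> M ord_max j != 0 -> flag_lambda M 0 j = sqnorm (M ord_max j).
Proof.
move=> uM M0; have s0 : 0 < sqnorm (M ord_max j) by rewrite sqnorm_gt0.
rewrite mxE /flag_radius sqr_sqrtr; last by apply: sumr_ge0 => k _; exact: sqr_ge0.
under eq_bigr do rewrite normc_sqr.
have e k : sqnorm (flag_coord M k j) = sqnorm (M (lift ord_max k) j) / sqnorm (M ord_max j).
 by apply: (mulIf (lt0r_neq0 s0)); rewrite -mulrA mulVf ?lt0r_neq0// mulr1 -sqnormM /flag_coord mulfVK.
under eq_bigr do rewrite e; rewrite -mulr_suml.
have := column_norm j uM; rewrite (bigD1_ord ord_max)//= => h.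
have -> : \sum_(i < m) sqnorm (M (lift ord_max i) j) = 1 - sqnorm (M ord_max j) by rewrite -h; ring.
by field; rewrite lt0r_neq0//=; apply/eqP; lra.
Qed.

End flag_lambda.

Definition unitary_at {d : measure_display} {T : measurableType d} {R : realType} {n : nat}
  (X : ucomp n -> R -> T -> R) t w :=
 forall k k', inner_re X k k' t w = dlt R k k' /\ inner_im X k k' t w = 0.

(** * A version that is unitary, with a nonvanishing last row, for every outcome *)

Section regular_version.
Context {d} {T : measurableType d} {R : realType} (P : probability T R)
 (F : R -> set (set T)) (hF : complete_filtration P F).
Variable m : nat.
Let n := m.+1.
Context (W : unitary_index n -> R -> T -> R) (hW : brownian_motion P F W)
 (U : R -> T -> 'M[R[i]]_n) (hU : unitary_sde P F W U).
Hypothesis hU0 : {ae P, forall w, flag_chart (U 0 w)}.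

Lemma unitary_at_ext (X X' : ucomp n -> R -> T -> R) t t' w w' :
 (forall a, X a t w = X' a t' w') -> unitary_at X' t' w' -> unitary_at X t w.
Proof.
move=> e h k k'; have [e1 e2] := h k k'; split; [rewrite -e1|rewrite -e2];
 by rewrite /inner_re /inner_im; apply: eq_bigr => l _; rewrite !e.
Qed.

(** With [no_row] as imaginary part, this is the last vector of the canonical basis; its product
    with the matrix is the last row. *)
Definition last_row (x : unit) (k : 'I_n) (w : T) : R := dlt R ord_max k.
Definition no_row (x : unit) (k : 'I_n) (w : T) : R := 0.

Lemma up_last_row (X : ucomp n -> R -> T -> R) x j t w : up X last_row no_row x j t w = X (ord_max, j, false) t w.
Proof. by rewrite /up; under eq_bigr do rewrite mul0r subr0; rewrite sum_dlt. Qed.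

Lemma uq_last_row (X : ucomp n -> R -> T -> R) x j t w : uq X last_row no_row x j t w = X (ord_max, j, true) t w.
Proof. by rewrite /uq; under eq_bigr do rewrite mul0r addr0; rewrite sum_dlt. Qed.

Lemma lam_last_row (X : ucomp n -> R -> T -> R) x j t w :
 (forall a, X a t w = ucomponent U a t w) -> lam X last_row no_row x j t w = sqnorm (U t w ord_max j).
Proof. by move=> e; rewrite /lam up_last_row uq_last_row !e. Qed.

Lemma norm_last_row (x : unit) (w : T) : \sum_k (last_row x k w ^+ 2 + no_row x k w ^+ 2) = 1 :> R.
Proof.
rewrite -[RHS](@sum_dlt R n ord_max (fun=> 1)); apply: eq_bigr => k _.
by rewrite /last_row /no_row /dlt; case: eqP => _ /=; ring.
Qed.

Lemma msr_last_row x k : msr (F 0) (last_row x k).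
Proof. exact: (msr_cst (filt_sa hF (lexx 0))). Qed.

Lemma msr_no_row x k : msr (F 0) (no_row x k).
Proof. exact: (msr_cst (filt_sa hF (lexx 0))). Qed.

(** On the exceptional event the paths become the constant [c]. It will be read off an initial
    matrix in the chart, so that the redefined paths have the desired properties as well. *)
Lemma modify (X : ucomp n -> R -> T -> R) (c : ucomp n -> R) (Q : T -> Prop) : (forall a, sure F (X a)) ->
 {ae P, forall w a t, X a t w = ucomponent U a t w} -> {ae P, forall w, Q w} ->
 exists X' : ucomp n -> R -> T -> R, [/\ forall a, sure F (X' a),
  {ae P, forall w a t, X' a t w = ucomponent U a t w} &
  forall w, (forall a t, X' a t w = c a) \/ (Q w /\ forall a t, X' a t w = X a t w)].
Proof.
move=> sX eX /(ae_measurable_null hF)[N [mN PN FN hN]].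
have E w a t : \1_(~` N) w * X a t w + c a * \1_N w = if w \in N then c a else X a t w.
 by rewrite !indicE in_setC; case: (w \in N) => /=; ring.
exists (fun a t w => \1_(~` N) w * X a t w + c a * \1_N w); split.
- move=> a; split=> [t t0|w].
  have sa := filt_sa hF t0; apply: (msrD sa).
   apply: (msrM sa); last exact: (sX a).1.
   by apply: (msr_indic sa); apply: (subalgC sa); exact: FN.
  by apply: (msrM sa (msr_cst sa _)); apply: (msr_indic sa); exact: FN.
 under eq_fun do rewrite E; case: (w \in N); [exact: pcont_cst|exact: (sX a).2].
- have : {ae P, forall w, ~ N w} by exists N; split => // w /contrapT.
 apply: filterS2 eX => w e nN a t; rewrite E memNset//; exact: e.
- move=> w; have [wN|wN] := boolP (w \in N); [left|right].
  by move=> a t; rewrite E wN.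
 by split=> [|a t]; [apply: hN => h; rewrite mem_set in wN|rewrite E (negbTE wN)].
Qed.

(** Two modifications in this order: the germs of [lam] require unitarity for every outcome, and
    only with them can positivity be proved, then imposed everywhere in turn. *)
Theorem regular_version : exists X : ucomp n -> R -> T -> R,
 [/\ forall a, sure F (X a), {ae P, forall w a t, X a t w = ucomponent U a t w},
   forall t w, 0 <= t -> unitary_at X t w &
   forall x j t w, 0 <= t -> 0 < lam X last_row no_row x j t w].
Proof.
have [X0 hX0] : exists X0 : ucomp n -> R -> T -> R, forall a, sure F (X0 a) /\ {ae P, forall w t, X0 a t w = ucomponent U a t w}.
 have ex a : exists Y : R -> T -> R, sure F Y /\ {ae P, forall w t, Y t w = ucomponent U a t w}.
  by have [Y] := continuous_adapted_sure hF (ca_component hU a); exists Y.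
 by have [X0 h] := choice ex; exists X0.
have sX0 a := (hX0 a).1.
have eX0 : {ae P, forall w a t, X0 a t w = ucomponent U a t w}.
 by apply: ae_forallC => a; exact: (hX0 a).2.
(* An event of probability one is not empty, which supplies a matrix to serve as the constant
   path. *)
have [w0 cw0] : exists w0, flag_chart (U 0 w0).
 apply: contrapT => /forallNP h; have [N [mN PN sN]] := hU0.
 have NT : N = setT by apply/seteqP; split => // w _; apply: sN; exact: h.
 by move: PN; rewrite NT probability_setT => /eqP; rewrite onee_eq0.
have uU0 : {ae P, forall w, U 0 w \is unitarymx} by apply: filterS hU0 => w [].
pose c a := ucomponent U a 0 w0.
have uc (X : ucomp n -> R -> T -> R) t w : (forall a t, X a t w = c a) -> unitary_at X t w.
 move=> h; have [u _] := cw0.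
 apply: (@unitary_at_ext X (fun a _ _ => c a) t 0 w w0) => // .
 exact: (@unitary_inner _ _ _ _ U (fun a _ _ => c a) 0 w0 (fun=> erefl) u).
have pc (X : ucomp n -> R -> T -> R) x j t w : (forall a t, X a t w = c a) -> 0 < lam X last_row no_row x j t w.
 by move=> h; rewrite /lam up_last_row uq_last_row !h; have [_ /(_ j)] := cw0; rewrite -sqnorm_gt0.
have [X1 [sX1 eX1 hX1]] := modify c sX0 eX0 (ae_unitary hF hW hU sX0 eX0 uU0).
have uX1 t w : 0 <= t -> unitary_at X1 t w.
 move=> t0; have [h|[h e]] := hX1 w; first exact: uc.
 by apply: (unitary_at_ext _ (h t t0)) => a; exact: e.
pose L j := lam X1 last_row no_row tt j.
have hit j : {ae P, forall w, 0 < L j 0 w -> forall t, 0 <= t -> 0 < L j t w}.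
 have fE (Y : unit -> R -> T -> R) : cpar (Y tt) = Y by apply/funext => -[].
 have fV (Y : unit -> unitary_index n -> R -> T -> R) : cfam (Y tt) = Y by apply/funext => -[].
 have b := bap_lam hF sX1 uX1 msr_last_row msr_no_row norm_last_row j.
 apply: (@nonhitting _ _ _ _ _ hF _ _ hW _ n (lnoise X1 last_row no_row tt j)).
 - split=> [t t0|w]; first by have [K _ h] := b; case: (h tt t t0).
  exact: (pcont_lam sX1).
 - move=> t w t0; split; first exact: lam_ge0.
  exact: (lam_le1 uX1 norm_last_row).
 - rewrite (fV (fun x => lnoise X1 last_row no_row x j)).
  exact: (bapI_lnoise hF sX1 uX1 msr_last_row msr_no_row norm_last_row).
 - rewrite (fV (fun x => lnoise X1 last_row no_row x j)) (fE (fun x => lam X1 last_row no_row x j)).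
  have := germ_lam hF hW hU sX1 eX1 uX1 msr_last_row msr_no_row norm_last_row j.
  by rewrite -(fE (fun x t w => 2 * (1 - n%:R * lam X1 last_row no_row x j t w))).
 - move=> t w t0; under eq_bigr do rewrite expr2.
  by rewrite (lnoise_gram uX1 norm_last_row)// /dlt eqxx mul1r expr2.
have pos : {ae P, forall w j t, 0 <= t -> 0 < L j t w}.
 apply: ae_forallC => j; apply: filterS2 (filterI hU0 eX1) (hit j) => w [[_ h] e] h2 t t0.
 by apply: h2 => //; rewrite /L (lam_last_row _ _ (fun a => e a 0)) sqnorm_gt0.
have [X [sX eX hX]] := modify c sX1 eX1 pos; exists X; split => //.
- move=> t w t0; have [h|[_ e]] := hX w; first exact: uc.
 by apply: (unitary_at_ext _ (uX1 t w t0)) => a; exact: e.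
- move=> x j t w t0; have [h|[h e]] := hX w; first exact: pc.
 by have := h j t t0; rewrite /L /lam !up_last_row !uq_last_row !e.
Qed.

End regular_version.

(** * Stability of adapted continuous processes and of Ito integrals *)

Section complements.
Context {d} {T : measurableType d} {R : realType} (P : probability T R)
 (F : R -> set (set T)) (hF : complete_filtration P F).
Implicit Types X Y H : R -> T -> R.

Lemma msr_inv G (X : T -> R) : sigma_algebra setT G -> (forall w, 0 <= X w) -> msr G X -> msr G (fun w => (X w)^-1).
Proof.
move=> sa X0 mX; have -> : (fun w => (X w)^-1) = (fun w => powR (X w) (-1)).
 by apply/funext => w; rewrite powR_inv1.
by apply: (msr_comp (f := fun x => powR x (-1))) => //; exact: measurable_powR.
Qed.

Lemma msr_sqrt G (X : T -> R) : msr G X -> msr G (fun w => Num.sqrt (X w)).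
Proof. by apply: msr_comp; apply: continuous_measurable_fun; exact: sqrt_continuous. Qed.

Lemma sureM X Y : sure F X -> sure F Y -> sure F (fun t w => X t w * Y t w).
Proof.
move=> [mX cX] [mY cY]; split=> [t t0|w]; last exact: pcontM.
by apply: (msrM (filt_sa hF t0)); [exact: mX|exact: mY].
Qed.

Lemma sureD X Y : sure F X -> sure F Y -> sure F (fun t w => X t w + Y t w).
Proof.
move=> [mX cX] [mY cY]; split=> [t t0|w]; last exact: pcontD.
by apply: (msrD (filt_sa hF t0)); [exact: mX|exact: mY].
Qed.

Lemma sure_cst c : sure F (fun _ _ => c).
Proof. by split=> [t t0|w]; [exact: (msr_cst (filt_sa hF t0))|exact: pcont_cst]. Qed.

Lemma sureZ c X : sure F X -> sure F (fun t w => c * X t w).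
Proof. by move=> h; apply: (sureM (sure_cst c) h). Qed.

Lemma sure_sum (I : Type) (r : seq I) (Q : pred I) (X : I -> R -> T -> R) :
 (forall i, sure F (X i)) -> sure F (fun t w => \sum_(i <- r | Q i) X i t w).
Proof.
move=> h; elim: r => [|i r IH]; first by under eq_fun do under eq_fun do rewrite big_nil; exact: sure_cst.
under eq_fun do under eq_fun do rewrite big_cons.
by case: (Q i) => //; exact: sureD.
Qed.

Lemma bac_sure H : bac F H -> sure F H.
Proof. by move=> h; have [K [_ _ m]] := bac_bound h; split => //; case: h. Qed.

(** The integrand of the conclusion is a function of [flag_lambda], continuous only almost surely,
    while the integral is constructed for the regular version; the sums agree off a null event. *)
Lemma ito_integral_ext H H' X Y : ito_integral P F H X Y -> continuous_adapted P F H' ->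
 {ae P, forall w t, 0 <= t -> H t w = H' t w} -> ito_integral P F H' X Y.
Proof.
move=> [cH cX cY hI] cH' HH'; split => // t t0 e eta e0 eta0.
have [dl dl0 h] := hI t t0 e eta e0 eta0; exists dl => // N s s0 sN hs.
have si i : (i <= N)%N -> 0 <= s i.
 elim: i => [|i IH] iN; first by rewrite s0.
 by have := hs i iN; have := IH (ltnW iN); lra.
have mY := ca_measurable hF t0 cY.
have ms (K : R -> T -> R) : continuous_adapted P F K ->
  measf (fun w => \sum_(i < N) K (s i) w * (X (s i.+1) w - X (s i) w)).
 move=> cK; apply: measurable_sum => i; have i0 := si i (ltnW (ltn_ord i)).
 apply: measurable_funM; first exact: (ca_measurable hF i0 cK).
 by apply: measurable_funB; apply: (ca_measurable hF _ cX) => //; exact: si.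
have mE (K : R -> T -> R) : continuous_adapted P F K ->
  measurable [set w | e <= `|\sum_(i < N) K (s i) w * (X (s i.+1) w - X (s i) w) - Y t w|].
 move=> cK; have m := measurableT_comp (@normr_measurable R setT) (measurable_funB (ms K cK) mY).
 have := m measurableT [set` `[e, +oo[] (measurable_itv _); rewrite setTI.
 by congr (measurable _); apply/seteqP; split => w /=; rewrite in_itv/= andbT.
apply: le_trans (h N s s0 sN hs); have [N1 [mN1 PN1 sN1]] := HH'.
apply: (@le_trans _ _ (P ([set w | e <= `|\sum_(i < N) H (s i) w * (X (s i.+1) w - X (s i) w) - Y t w|] `|` N1))).
 apply: le_measure; rewrite ?inE; [exact: mE|by apply: measurableU => //; exact: mE|].
 move=> w /= hw; have [nw|nw] := pselect (N1 w); [by right|left].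
 have {}nw t' : 0 <= t' -> H t' w = H' t' w.
  by apply: contrapT => h'; apply: nw; apply: sN1 => h2; apply: h'; exact: h2.
 by under eq_bigr => i _ do rewrite (nw _ (si _ (ltnW (ltn_ord i)))).
have := measureU2 P (mE _ cH) mN1; move=> h3.
by apply: (le_trans h3); rewrite [X in (_ + X)%E]PN1 adde0.
Qed.

Variables (Iw : finType) (W : Iw -> R -> T -> R).

Lemma sure_null_constant Z : sure F Z -> germ P F W (inc Z) (@null _ _ _) (@nullI _ _ _ _) ->
 {ae P, forall w t, 0 <= t -> Z t w = Z 0 w}.
Proof.
move=> sZ gZ.
have mZ s : 0 <= s -> measf (Z s).
 by move=> s0; apply: (msr_meast hF s0); exact: sZ.1.
have dy : {ae P, forall w (Lk : nat * nat), Z (dyad Lk.1 Lk.2) w = Z 0 w}.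
 apply: ae_forallC => -[L k] /=; have t0 := @dyad_ge0 R L k; set t := dyad L k in t0 *.
 have mi s s' : 0 <= s -> 0 <= s' -> measf (inc Z tt s s').
  by move=> s0 s0'; apply: measurable_funB; exact: mZ.
 apply: filterS (germ_sum_null hF t0 mi gZ) => w zw.
 by apply/eqP; rewrite -subr_eq0; apply/eqP/zw => N; rewrite -(ugrid_telescope (Z ^~ w) t N).
apply: filterS dy => w hw t t0.
by apply: (@eq_dyadic _ (Z ^~ w) (fun=> Z 0 w) t (sZ.2 w) (pcont_cst _)) => // L k _; exact: (hw (L, k)).
Qed.

End complements.

(** * The stochastic differential equation on the simplex *)

Section simplex_sde.
Context {d} {T : measurableType d} {R : realType} (P : probability T R)
 (F : R -> set (set T)) (hF : complete_filtration P F).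
Variable n : nat.
Variable W : unitary_index n -> R -> T -> R.
Hypothesis hW : brownian_motion P F W.
Variables p q : 'I_n -> R -> T -> R.
Hypothesis bp : forall j, bac F (p j).
Hypothesis bq : forall j, bac F (q j).

Definition sql j t w := p j t w ^+ 2 + q j t w ^+ 2.
Hypothesis sql_gt0 : forall j t w, 0 <= t -> 0 < sql j t w.

Definition sql_drift j t w := 2 * (1 - n%:R * sql j t w).
Definition sql_noise j v t w := 2 * (p j t w * noiseR (p^~ t ^~ w) (q^~ t ^~ w) j v
                  + q j t w * noiseI (p^~ t ^~ w) (q^~ t ^~ w) j v).
Hypothesis germ_sql : forall j, germ P F W (inc (sql j)) (cpar (sql_drift j)) (cfam (sql_noise j)).

(** For [u = p + i q], [rot] and [irot] are the real and imaginary parts of [u_j] times the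
    conjugate of [u_l]. *)
Definition rot l j t w := p l t w * p j t w + q l t w * q j t w.
Definition irot l j t w := q j t w * p l t w - p j t w * q l t w.
(** Half the noise of the coordinate [j] that comes from [u_l] and the entry [(l, j)] of the driver.
    It is antisymmetric in [l] and [j], so one real Brownian motion serves both coordinates, with
    opposite signs. *)
Definition edge l j v t w : R := rot l j t w * noiseX R l j v + irot l j t w * noiseY R l j v.
Definition geo l j t w := Num.sqrt (sql l t w * sql j t w).
Definition unit_edge l j v t w : R := (geo l j t w)^-1 * edge l j v t w.

Lemma edgeC l j v t w : edge j l v t w = - edge l j v t w.
Proof. by rewrite /edge noiseXC noiseYC /rot /irot; ring. Qed.

Lemma geoC l j t w : geo j l t w = geo l j t w.
Proof. by rewrite /geo mulrC. Qed.

Lemma sql_ge0 j t w : 0 <= sql j t w.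
Proof. by rewrite addr_ge0// sqr_ge0. Qed.

Lemma rot_irot l j t w : rot l j t w ^+ 2 + irot l j t w ^+ 2 = sql l t w * sql j t w.
Proof. by rewrite /rot /irot /sql; ring. Qed.

Lemma geo_gt0 l j t w : 0 <= t -> 0 < geo l j t w.
Proof. by move=> t0; rewrite sqrtr_gt0 mulr_gt0// sql_gt0. Qed.

Lemma geo_sqr l j t w : geo l j t w ^+ 2 = sql l t w * sql j t w.
Proof. by rewrite sqr_sqrtr// mulr_ge0// sql_ge0. Qed.

Lemma sql_noiseE j v t w : sql_noise j v t w = 2 * \sum_(l | l != j) edge l j v t w.
Proof.
rewrite /sql_noise; congr (2 * _).
have -> : \sum_(l | l != j) edge l j v t w = \sum_l edge l j v t w.
 rewrite [RHS](bigD1 j)//= (_ : edge j j v t w = 0) ?add0r//.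
 by have := edgeC j j v t w; lra.
rewrite /noiseR /noiseI !mulr_sumr -big_split; apply: eq_bigr => l _ /=.
by rewrite /edge /rot /irot; ring.
Qed.

(** Different unordered pairs of indices involve uncorrelated entries of the driver. For a single
    pair, the squared length of [edge] is [rot^2 + irot^2], that is [geo^2]. *)
Lemma unit_edge_gram (e e' : upper_pair n) t w : 0 <= t ->
 \sum_v unit_edge (val e).1 (val e).2 v t w * unit_edge (val e').1 (val e').2 v t w = (e == e')%:R.
Proof.
case: e => -[l j] /= lj; case: e' => -[l' j'] /= lj' t0.
have lnj : (l == j) = false by rewrite -val_eqE; apply: ltn_eqF.
have swap : (l == j') && (j == l') = false.
 by apply/negP => /andP[/eqP e1 /eqP e2]; move: lj lj'; rewrite e1 e2 => a /(ltn_trans a); rewrite ltnn.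
set c := geo l j t w; set c' := geo l' j' t w.
have c0 : c != 0 by rewrite lt0r_neq0// geo_gt0.
transitivity (c^-1 * c'^-1 * (rot l j t w * rot l' j' t w * (\sum_v noiseX R l j v * noiseX R l' j' v)
 + rot l j t w * irot l' j' t w * (\sum_v noiseX R l j v * noiseY R l' j' v)
 + irot l j t w * rot l' j' t w * (\sum_v noiseX R l' j' v * noiseY R l j v)
 + irot l j t w * irot l' j' t w * (\sum_v noiseY R l j v * noiseY R l' j' v))).
 rewrite !mulr_sumr -!big_split mulr_sumr; apply: eq_bigr => v _ /=; rewrite /unit_edge /edge -/c -/c'; ring.
rewrite gramXX gramYY !gramXY /dlt -!natrM !mulnb swap /=.
set f1 := exist _ _ _; set f2 := exist _ _ _.
have -> : (f1 == f2) = (l == l') && (j == j') by rewrite -(inj_eq val_inj) /= -xpair_eqE.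
case: eqP => [e1|_] /=; last by ring.
case: eqP => [e2|_] /=; last by ring.
rewrite /c' -e1 -e2 -/c.
transitivity (c^-1 * c^-1 * (rot l j t w ^+ 2 + irot l j t w ^+ 2)); first by ring.
by rewrite rot_irot -geo_sqr -/c; field.
Qed.

Lemma bac_rot l j : bac F (rot l j).
Proof. by apply: (bacD hF); apply: (bacM hF). Qed.

Lemma bac_irot l j : bac F (irot l j).
Proof.
rewrite (_ : irot l j = fun t w => q j t w * p l t w + -1 * (p j t w * q l t w)).
 by apply: (bacD hF); [exact: (bacM hF)|apply: (bacM hF (bac_cst hF _)); exact: (bacM hF)].
by apply/funext => t; apply/funext => w; rewrite /irot; ring.
Qed.

Lemma bac_edge l j v : bac F (edge l j v).
Proof.
by apply: (bacD hF); apply: (bacM hF); rewrite ?(bac_cst hF)//; [exact: bac_rot|exact: (bac_cst hF)|exact: bac_irot|exact: (bac_cst hF)].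
Qed.

Lemma bac_sql j : bac F (sql j).
Proof. by apply: (bacD hF); apply: (bacM hF). Qed.

Lemma sure_geo l j : sure F (geo l j).
Proof.
have [m c] := sureM hF (bac_sure (bac_sql l)) (bac_sure (bac_sql j)).
split=> [t t0|w]; first by apply: msr_sqrt; exact: m.
exact: (pcont_comp (@sqrt_continuous R) (c w)).
Qed.

Lemma bac_geo l j : bac F (geo l j).
Proof.
split; last exact: (sure_geo l j).2.
have [K [K0 hK _]] := bac_bound (bac_sql l); have [K' [K0' hK' _]] := bac_bound (bac_sql j).
exists (Num.sqrt (K * K')) => [|_ t t0]; first by rewrite sqrtr_gt0 mulr_gt0.
split=> [|w]; first exact: (sure_geo l j).1.
rewrite ger0_norm ?sqrtr_ge0// ler_wsqrtr// ler_pM ?sql_ge0//.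
 by rewrite (le_trans (ler_norm _))// hK.
by rewrite (le_trans (ler_norm _))// hK'.
Qed.

(** Both [rot] and [irot] are at most [geo] in modulus, so the quotient is bounded up to the
    boundary of the simplex; continuity in time rests on [geo > 0]. *)
Lemma bac_unit_edge l j v : bac F (unit_edge l j v).
Proof.
have s : sure F (unit_edge l j v).
 have [m c] := sure_geo l j.
 apply: (sureM hF _ (bac_sure (bac_edge l j v))); split=> [t t0|w].
  by apply: (msr_inv (filt_sa hF t0)) => [w|]; [exact: sqrtr_ge0|exact: m].
 by apply: pcont_inv => [//|t t0]; exact: geo_gt0.
split; last exact: s.2.
exists (1 + (`|noiseX R l j v| + `|noiseY R l j v|)) => [|_ t t0]; first by rewrite ltr_wpDr ?addr_ge0.
split=> [|w]; first exact: s.1.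
have g0 := geo_gt0 l j w t0.
rewrite /unit_edge normrM normfV (ger0_norm (ltW g0)) mulrC ler_pdivrMr//.
have b (y : R) : y ^+ 2 <= sql l t w * sql j t w -> `|y| <= geo l j t w.
 rewrite -geo_sqr => h; rewrite -(@ler_pXn2r _ 2) ?nnegrE ?(ltW g0)//.
 by rewrite real_normK ?num_real.
have b1 : `|rot l j t w| <= geo l j t w by apply: b; rewrite -rot_irot lerDl sqr_ge0.
have b2 : `|irot l j t w| <= geo l j t w by apply: b; rewrite -rot_irot lerDr sqr_ge0.
rewrite /edge (le_trans (ler_normD _ _))// !normrM.
have := ler_wpM2r (normr_ge0 (noiseX R l j v)) b1.
have := ler_wpM2r (normr_ge0 (noiseY R l j v)) b2.
rewrite mulrDl mulrDl mul1r (mulrC (`|noiseX R l j v|)) (mulrC (`|noiseY R l j v|)); lra.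
Qed.

Lemma bac_drift j : bac F (sql_drift j).
Proof.
rewrite (_ : sql_drift j = fun t w => 2 + (-2 * n%:R) * sql j t w).
 by apply: (bacD hF (bac_cst hF _)); apply: (bacM hF (bac_cst hF _)); exact: bac_sql.
by apply/funext => t; apply/funext => w; rewrite /sql_drift; ring.
Qed.

Definition osign (l j : 'I_n) : R := if (l < j)%N then 1 else -1.

(** The coordinate minus its drift integral and minus twice the sum of the [I l j] has a null germ,
    hence is constant. Each [I l j] has noise [edge], which equals [geo] times [unit_edge], and is
    therefore the integral of [geo] against [gamma]. *)
Theorem simplex_sde : exists gamma I : 'I_n -> 'I_n -> R -> T -> R,
 [/\ forall e : upper_pair n, [/\ sure F (gamma (val e).1 (val e).2), forall w, gamma (val e).1 (val e).2 0 w = 0,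
    germ P F W (inc (gamma (val e).1 (val e).2)) (@null _ _ _) (cfam (unit_edge (val e).1 (val e).2)) &
    germ2 P W (inc (gamma (val e).1 (val e).2)) (cfam (unit_edge (val e).1 (val e).2))],
   forall l j : 'I_n, (j < l)%N -> forall t w, gamma l j t w = - gamma j l t w,
   forall l j : 'I_n, l != j -> ito_integral P F (geo l j) (gamma l j) (I l j) &
   {ae P, forall w t, 0 <= t -> forall j : 'I_n,
    sql j t w = sql j 0 w + tint (sql_drift j) t w + 2 * \sum_(l | l != j) I l j t w}].
Proof.
have exG l j := ito_vec hF hW (bac_unit_edge l j).
have exJ l j := ito_vec hF hW (bac_edge l j).
have [G hG] : exists G : 'I_n * 'I_n -> R -> T -> R, forall e, [/\ sure F (G e), forall w, G e 0 w = 0,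
  germ P F W (inc (G e)) (@null _ _ _) (cfam (unit_edge e.1 e.2)) & germ2 P W (inc (G e)) (cfam (unit_edge e.1 e.2))].
 by have [G h] := choice (fun e : 'I_n * 'I_n => exG e.1 e.2); exists G.
have [I hI] : exists I : 'I_n * 'I_n -> R -> T -> R, forall e, [/\ sure F (I e), forall w, I e 0 w = 0,
  germ P F W (inc (I e)) (@null _ _ _) (cfam (edge e.1 e.2)) & germ2 P W (inc (I e)) (cfam (edge e.1 e.2))].
 by have [I h] := choice (fun e : 'I_n * 'I_n => exJ e.1 e.2); exists I.
(* Only integrals of increasing pairs enter, so antisymmetry holds by construction, for every
   outcome, instead of almost surely. *)
pose gamma l j t w := osign l j * G (if (l < j)%N then (l, j) else (j, l)) t w.
have gamma_lt (l j : 'I_n) : (l < j)%N -> gamma l j = G (l, j).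
 by move=> h; apply/funext => t; apply/funext => w; rewrite /gamma /osign h mul1r.
exists gamma, (fun l j => I (l, j)); split.
- case=> -[l j] /= lj; rewrite !gamma_lt//; have [a b c d'] := hG (l, j); split => //.
- move=> l j jl t w; rewrite /gamma /osign jl ltnNge (ltnW jl)/=; ring.
- move=> l j lj; have [sI I0 gI _] := hI (l, j).
 have sg : sure F (gamma l j) by apply: (sureZ hF); case: (hG (if (l < j)%N then (l, j) else (j, l))).
 have gg : germ P F W (inc (gamma l j)) (@null _ _ _) (cfam (unit_edge l j)).
  have [sG _ gG _] := hG (if (l < j)%N then (l, j) else (j, l)).
  apply: (germ_eq (germ_bap hF gG (bap_cst hF _ (osign l j)))).
  - by move=> x s t w s0 st; rewrite /inc /gamma; ring.
  - by move=> x t w t0; rewrite /null mulr0.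
  - move=> x v t w t0; rewrite /cfam /osign; case: ifP => h /=; first by rewrite mul1r.
   by rewrite /unit_edge geoC edgeC; ring.
 apply: (germ_ito_integral hF _ _ _ _ _ gg) => //.
 + exact: (bac_geo l j).1.
 + exact: (sure_continuous_adapted P (sure_geo l j)).
 + exact: (sure_continuous_adapted P sg).
 + exact: (sure_continuous_adapted P sI).
 apply: (germ_eq gI) => //.
 + by move=> x t w t0; rewrite /null mulr0.
 + by move=> x v t w t0; rewrite /cfam /unit_edge mulrA divff ?mul1r// lt0r_neq0// geo_gt0.
(* The condition [l != j] is absorbed into a coefficient so that [germ_lin], which sums over the
   whole index type, applies. *)
pose c (j l : 'I_n) : R := if l != j then -2 else 0.
pose Z j t w := (sql j t w + -1 * tint (sql_drift j) t w) + \sum_l c j l * I (l, j) t w.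
have ZE j t w : Z j t w = sql j t w - tint (sql_drift j) t w - 2 * \sum_(l | l != j) I (l, j) t w.
 have -> : 2 * \sum_(l | l != j) I (l, j) t w = - \sum_l c j l * I (l, j) t w.
  rewrite big_mkcond mulr_sumr -sumrN; apply: eq_bigr => l _.
  by rewrite /c; case: ifP => _; ring.
 by rewrite /Z; ring.
have sZ j : sure F (Z j).
 apply: (sureD hF); last by apply: (sure_sum hF) => l; apply: (sureZ hF); case: (hI (l, j)).
 by apply: (sureD hF); [exact: (bac_sure (bac_sql j))|apply: (sureZ hF); exact: (sure_tint hF (bac_drift j))].
have gZ j : germ P F W (inc (Z j)) (@null _ _ _) (@nullI _ _ _ _).
 have gI l : germ P F W (inc (I (l, j))) (@null _ _ _) (cfam (edge l j)) by case: (hI (l, j)).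
 have g1 := germ_bap hF (germ_tint hF W (bac_drift j)) (bap_cst hF unit (-1)).
 apply: (germ_eq (germD hF (germD hF (germ_sql j) g1) (germ_lin hF (c j) gI))).
 - by move=> x s t w s0 st; rewrite /inc /Z; under eq_bigr do rewrite mulrBr; rewrite sumrB; ring.
 - by move=> x t w t0; rewrite /null /cpar; under eq_bigr do rewrite mulr0; rewrite big1//; ring.
 - move=> x v t w t0; rewrite /nullI /cfam sql_noiseE [\sum_(l | _) _]big_mkcond mulr_sumr mulr0 addr0 -big_split big1// => l _.
  by rewrite /c /=; case: ifP => _; ring.
have : {ae P, forall w j t, 0 <= t -> Z j t w = Z j 0 w}.
 by apply: ae_forallC => j; exact: (sure_null_constant hF (sZ j) (gZ j)).
apply: filterS => w h t t0 j; have := h j t t0; rewrite !ZE tint0.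
have -> : \sum_(l | l != j) I (l, j) 0 w = 0 by apply: big1 => l _; case: (hI (l, j)).
lra.
Qed.

End simplex_sde.

(** * Gronwall's lemma, and the cosine of a martingale with constant bracket *)

(** In the discrete form that [germ_weak] delivers: no derivative, only a one-step estimate whose
    error rate [e] is arbitrarily small. Along a grid of step [h], induction gives
    [D <= e (i h) exp (C i h)], and [e] tends to zero. *)
Lemma gronwall (R : realType) (D : R -> R) (s t C : R) : 0 <= C -> s <= t -> D s = 0 -> (forall r, 0 <= D r) ->
 (forall e : R, 0 < e -> exists2 dl : R, 0 < dl & forall r r', s <= r -> r <= r' -> r' <= t -> r' - r <= dl ->
   D r' <= D r + (C * D r + e) * (r' - r)) -> D t = 0.
Proof.
move=> C0 st Ds D0 hD; apply/eqP; rewrite eq_le D0 andbT; apply/ler_addgt0Pr => eps eps0; rewrite add0r.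
have ts0 : 0 <= t - s by rewrite subr_ge0.
set B := (t - s) * expR (C * (t - s)).
have B0 : 0 <= B by rewrite mulr_ge0// expR_ge0.
have e0 : 0 < eps / (B + 1) by rewrite divr_gt0// ltr_wpDl.
set e := eps / (B + 1) in e0.
have [dl dl0 hd] := hD _ e0.
have [N0 /(_ N0 (leqnn _)) mesh] := ugrid_mesh ts0 dl0.
pose p i := s + ugrid (t - s) N0 i.
have pE i : p i = s + ugrid (t - s) N0 i by [].
have p0 : p 0%N = s by rewrite pE ugrid0 addr0.
have pN : p N0.+1 = t by rewrite pE ugridN addrC subrK.
have pB i : p i.+1 - p i = (t - s) / N0.+1%:R by rewrite !pE -(ugridB (t - s) N0 i); ring.
set h := (t - s) / N0.+1%:R in pB mesh; have h0 : 0 <= h by rewrite divr_ge0.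
have main i : (i <= N0.+1)%N -> D (p i) <= e * (i%:R * h) * expR (C * (i%:R * h)).
 elim: i => [|i IH] iN; first by rewrite p0 Ds; apply: mulr_ge0 (expR_ge0 _); apply: (mulr_ge0 (ltW e0)); apply: mulr_ge0.
 have [a1 a2] := ugrid_itv ts0 (ltnW iN); have [b1 b2] := ugrid_itv ts0 iN.
 have sp : s <= p i by rewrite lerDl.
 have pp : p i <= p i.+1 by rewrite -subr_ge0 pB.
 have pt : p i.+1 <= t by rewrite pE -lerBrDl.
 have hdl : p i.+1 - p i <= dl by rewrite pB.
 have := hd _ _ sp pp pt hdl; rewrite pB => step; have {}IH := IH (ltnW iN).
 set E := expR (C * (i%:R * h)) in IH.
 have E1 : 1 + C * h <= expR (C * h) by exact: expR_ge1Dx.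
 have iS : i.+1%:R = i%:R + 1 :> R by rewrite natr1.
 have ES : expR (C * (i.+1%:R * h)) = E * expR (C * h).
  by rewrite /E -expRD iS; congr expR; ring.
 have E'1 : 1 <= E * expR (C * h).
  by rewrite -ES -expR0 ler_expR mulr_ge0// mulr_ge0.
 rewrite ES; set E' := expR (C * h) in E1 E'1 *.
 have Ch : 0 <= C * h by rewrite mulr_ge0.
 have s1 : D (p i) * (1 + C * h) <= e * (i%:R * h) * E * E'.
  apply: ler_pM => //; by rewrite addr_ge0.
 have s2 : e * h <= e * h * (E * E') by rewrite ler_peMr// mulr_ge0// ltW.
 rewrite iS; have -> : e * ((i%:R + 1) * h) * (E * E') = e * (i%:R * h) * E * E' + e * h * (E * E') by ring.
 move: step s1 s2; have -> : D (p i) + (C * D (p i) + e) * h = D (p i) * (1 + C * h) + e * h by ring.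
 lra.
have := main N0.+1 (leqnn _); rewrite pN /h mulrC [(_ / _)]mulrC mulVKf ?pnatr_eq0// => /le_trans; apply.
by rewrite mulrC -mulrA -/B /e mulrAC ler_pdivrMr ?ltr_wpDl// ler_wpM2l ?(ltW eps0)// lerDl ler01.
Qed.

Section cosine.
Context {d} {T : measurableType d} {R : realType} (P : probability T R)
 (F : R -> set (set T)) (hF : complete_filtration P F)
 (Iw : finType) (W : Iw -> R -> T -> R) (hW : brownian_motion P F W).
Variable Y : R -> T -> R.
Variable th : Iw -> R -> T -> R.
Variable c : R.
Hypothesis sY : forall t, 0 <= t -> msr (F t) (Y t).
Hypothesis hth : bapI F (cfam th).
Hypothesis gY : germ P F W (inc Y) (@null _ _ _) (cfam th).
Hypothesis g2Y : germ2 P W (inc Y) (cfam th).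
Hypothesis qth : forall t w, 0 <= t -> \sum_v th v t w ^+ 2 = c.

Lemma is_derive_cosD (f z : R) : is_derive z (1 : R) (fun y : R => cos (y + f)) (- sin (z + f)).
Proof.
have h := is_deriveD (is_derive_id z (1 : R)) (is_derive_cst f z (1 : R)); rewrite addr0 in h.
have := @is_derive1_comp _ cos (fun y => y + f) z _ _ (is_derive_cos (z + f)) h.
by rewrite mulr1.
Qed.

Lemma is_derive_sinD (f z : R) : is_derive z (1 : R) (fun y : R => - sin (y + f)) (- cos (z + f)).
Proof.
have h := is_deriveD (is_derive_id z (1 : R)) (is_derive_cst f z (1 : R)); rewrite addr0 in h.
have := is_deriveN (@is_derive1_comp _ sin (fun y => y + f) z _ _ (is_derive_sin (z + f)) h).
by rewrite mulr1.
Qed.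

Lemma cos_lip (f x y : R) : `|cos (y + f) - cos (x + f)| <= `|y - x|.
Proof.
pose a := Num.min x y; pose b := Num.max x y.
have := @mvt_le R a b (fun y => cos (y + f)) (fun z => - sin (z + f)) x y 1.
rewrite mul1r; apply; rewrite ?ge_min ?le_max ?lexx ?orbT//.
- by move=> z _ _; exact: is_derive_cosD.
- by move=> z _ _ _; rewrite normrN sin_max.
Qed.

Lemma cos_taylor (f x y e : R) : (forall z, `|z - x| <= `|y - x| -> `|cos (z + f) - cos (x + f)| <= e) ->
 `|cos (y + f) - cos (x + f) - (- sin (x + f)) * (y - x) - 2^-1 * (- cos (x + f)) * (y - x) ^+ 2| <= e * (y - x) ^+ 2.
Proof.
move=> h; pose a := Num.min x y; pose b := Num.max x y.
have ha : a <= x /\ a <= y by rewrite !ge_min !lexx orbT.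
have hb : x <= b /\ y <= b by rewrite !le_max !lexx orbT.
apply: (@taylor2 R (fun y => cos (y + f)) (fun y => - sin (y + f)) (fun y => - cos (y + f)) a b) => //;
 try by case: ha; case: hb.
- by move=> z _ _; exact: is_derive_cosD.
- by move=> z _ _; exact: is_derive_sinD.
- by move=> z _ _ hz; rewrite -opprD normrN; exact: h.
Qed.

Let mY t : 0 <= t -> measf (Y t).
Proof. by move=> t0; exact: (msr_meast hF t0 (sY t0)). Qed.

Lemma bap_trig (g : R -> R) : continuous g -> (forall x, `|g x| <= 1) -> bap F (cpar (fun t w => g (Y t w))).
Proof.
move=> cg bg; exists 1 => // u t t0; split=> [|w]; last exact: bg.
by apply: msr_comp (sY t0); exact: continuous_measurable_fun.
Qed.

Lemma continuous_cosD (f : R) : continuous (fun y : R => cos (y + f)).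
Proof. by move=> y; exact: derive_continuous (is_derive_cosD f y). Qed.

Lemma continuous_sinD (f : R) : continuous (fun y : R => - sin (y + f)).
Proof. by move=> y; exact: derive_continuous (is_derive_sinD f y). Qed.

(** A constant bracket [c] makes the drift proportional to the cosine itself, which closes the
    equation of the characteristic function. The phase [f] covers the sine as well. *)
Lemma germ_cos (f : R) : germ P F W (inc (fun t w => cos (Y t w + f)))
 (cpar (fun t w => - (c / 2) * cos (Y t w + f))) (cfam (fun v t w => - sin (Y t w + f) * th v t w)).
Proof.
have b0 : bap F (cpar (fun t w => cos (Y t w + f))).
 by apply: (bap_trig (@continuous_cosD f)) => x; exact: cos_max.
have b1 : bap F (cpar (fun t w => - sin (Y t w + f))).
 by apply: (bap_trig (@continuous_sinD f)) => x; rewrite normrN sin_max.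
have E y : - 2^-1 * cos y = 2^-1 * - cos y :> R by rewrite mulNr mulrN.
have g := @germ_taylor _ _ _ P F hF Iw W hW unit (cpar (fun t w => cos (Y t w + f))) (cpar Y) _ _ _ _ 2
 _ _ b1 (bapM hF (bap_cst hF _ (- 2^-1)) b0) hth gY g2Y _ _.
apply: (germ_eq (g _ _ _ _)) => // [x t t0|x s t w s0 st|e e0|x t w t0].
- exact: (bap_meas hF tt b0 t0).
- rewrite /tinc /cpar E; apply: cos_taylor => z _.
 by rewrite (le_trans (ler_normB _ _))// -[leRHS]/(1 + 1) lerD ?cos_max.
- exists e => // x s t w s0 st hz; rewrite /tinc /cpar E.
 by apply: cos_taylor => z hz'; rewrite (le_trans (cos_lip _ _ _))// (le_trans hz').
by rewrite /null /cpar /cfam qth//; field.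
Qed.

End cosine.

(** * Equality of laws from equality of trigonometric expectations *)

Section step_polynomial.
Variable R : realType.

Lemma bernoulli (y : R) N : -1 <= y -> 1 + N%:R * y <= (1 + y) ^+ N.
Proof.
move=> y1; elim: N => [|N IH]; first by rewrite mul0r addr0 expr0.
have h : 0 <= 1 + y by lra.
rewrite exprS; apply: le_trans (ler_wpM2l h IH).
have : 0 <= N%:R * y ^+ 2 by rewrite mulr_ge0// sqr_ge0.
rewrite -natr1 expr2; lra.
Qed.

(** A polynomial approximation of a step at [1 / 2]. With [N = k 2^k], the product
    [N u^k = k (2 u)^k] tends to zero for [u < 1 / 2] and is at least [k] for [u >= 1 / 2]. *)
Definition stepp (k : nat) (u : R) : R := (1 - u ^+ k) ^+ (k * 2 ^ k).

Lemma stepp_itv k u : 0 <= u -> u <= 1 -> 0 <= stepp k u /\ stepp k u <= 1.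
Proof.
move=> u0 u1; have h0 : 0 <= u ^+ k by rewrite exprn_ge0.
have h1 : u ^+ k <= 1 by rewrite exprn_ile1.
by split; [rewrite exprn_ge0// subr_ge0|rewrite exprn_ile1 ?subr_ge0// gerBl].
Qed.

(** With [x = u^k], the product of [(1 - x)^N] and [(1 + x)^N] is at most one, while Bernoulli's
    inequality bounds the second factor below by [1 + k]. *)
Lemma stepp_cvg0 u : 2^-1 <= u -> u <= 1 -> stepp k u @[k --> \oo] --> 0.
Proof.
move=> u2 u1; have u0 : 0 <= u by rewrite (le_trans _ u2).
apply: (@squeeze_cvgr _ _ _ _ (fun=> 0) (@harmonic R)); [|exact: cvg_cst|exact: cvg_harmonic].
apply: nearW => k; have [-> _] := stepp_itv k u0 u1 => /=.
set N := (k * 2 ^ k)%N; set x := u ^+ k.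
have x0 : 0 <= x by rewrite exprn_ge0.
have x1 : x <= 1 by rewrite exprn_ile1.
have Nx : k%:R <= N%:R * x.
 rewrite /N natrM natrX -mulrA -exprMn ler_peMr// exprn_ege1//.
 by rewrite -(@ler_pM2l _ 2^-1)// mulr1 mulKf.
have xm1 : -1 <= x by rewrite (le_trans _ x0)// lerN10.
have B := bernoulli N xm1.
have prod : stepp k u * (1 + x) ^+ N <= 1.
 rewrite /stepp -/N -/x -exprMn.
 have -> : (1 - x) * (1 + x) = 1 - x ^+ 2 by ring.
 by rewrite exprn_ile1 ?subr_ge0 ?gerBl ?sqr_ge0// exprn_ile1.
rewrite -[leRHS]mul1r ler_pdivlMr//; apply: le_trans prod.
rewrite ler_wpM2l ?(stepp_itv k u0 u1).1//; apply: le_trans B.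
by rewrite -natr1 addrC lerD2l.
Qed.

Lemma stepp_cvg1 u : 0 <= u -> u < 2^-1 -> stepp k u @[k --> \oo] --> (1 : R).
Proof.
move=> u0 u2; have u1 : u <= 1 by lra.
(* The square root splits [(2 u)^k] as [z^k z^k]: one factor keeps [k z^k] bounded, the other tends
   to zero. *)
pose z := Num.sqrt (2 * u).
have z0 : 0 <= z by rewrite sqrtr_ge0.
have z2 : z ^+ 2 = 2 * u by rewrite sqr_sqrtr// mulr_ge0.
have z1 : z < 1.
 by rewrite -(@ltr_pXn2r _ 2) ?nnegrE// expr1n z2 mulrC -ltr_pdivlMr// div1r.
have key k : k%:R * z ^+ k <= (1 - z)^-1.
 rewrite -[leRHS]mul1r ler_pdivlMr ?subr_gt0//.
 have h (y : R) m : 0 <= y -> y <= 1 -> m%:R * y ^+ m * (1 - y) <= 1 - y ^+ m.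
  move=> y0 y1; elim: m => [|m IH]; first by rewrite mul0r mul0r expr0 subrr.
  have q : 0 <= y ^+ m by rewrite exprn_ge0.
  have q' : y ^+ m.+1 <= y ^+ m by rewrite exprS ler_piMl.
  have a0 : 0 <= m%:R * (1 - y) by rewrite mulr_ge0// subr_ge0.
  have := ler_wpM2l a0 q'.
  have -> : m.+1%:R * y ^+ m.+1 * (1 - y) = m%:R * (1 - y) * y ^+ m.+1 + y ^+ m.+1 * (1 - y) by rewrite -natr1; ring.
  have : y ^+ m.+1 * (1 - y) <= y ^+ m * (1 - y) by rewrite ler_wpM2r ?subr_ge0.
  have e : y ^+ m * (1 - y) = y ^+ m - y ^+ m.+1 by rewrite exprS; ring.
  move: IH; rewrite -mulrA [X in X <= _ -> _]mulrA [X in _ -> _ -> _ <= X -> _]mulrC; lra.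
 by apply: (le_trans (h z k z0 (ltW z1))); rewrite gerBl exprn_ge0.
apply: (@squeeze_cvgr _ _ _ _ (fun k => 1 - (1 - z)^-1 * z ^+ k) (fun=> 1)); last 2 first.
- rewrite -[X in _ --> X]subr0; apply: cvgB; first exact: cvg_cst.
 rewrite -(mulr0 (1 - z)^-1); apply: cvgMr; apply: cvg_expr.
 by rewrite ger0_norm.
- exact: cvg_cst.
apply: nearW => k; have [_ ->] := stepp_itv k u0 u1; rewrite andbT.
have um : -1 <= - u ^+ k by rewrite lerN2 exprn_ile1.
apply: le_trans (bernoulli (k * 2 ^ k) um); rewrite mulrN lerD2l lerN2.
rewrite natrM natrX -mulrA -exprMn -z2 -exprM mulnC exprM expr2 mulrA ler_wpM2r ?exprn_ge0//.
Qed.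

End step_polynomial.

Section equal_laws.
Context {d} {T : measurableType d} {R : realType} (P : probability T R).
Variable A : set T.
Hypothesis mA : measurable A.
Variable I : finType.
Variable X : bool -> I -> T -> R.
Hypothesis mX : forall b i, measf (X b i).

Definition arg (xi : I -> R) (f : R) b w := \sum_i xi i * X b i w + f.
Hypothesis equal_cos : forall xi f, Ex P (fun w => \1_A w * cos (arg xi f true w)) = Ex P (fun w => \1_A w * cos (arg xi f false w)).

Implicit Types G H : bool -> T -> R.

Definition bmeas G := exists K : R, forall b, measf (G b) /\ forall w, `|G b w| <= K.

(* The pairs of functions whose product with the trigonometric monomials have
   the same expectation, and the pairs that multiply them into themselves. *)
Definition matched G := bmeas G /\ forall xi f,
 Ex P (fun w => \1_A w * (G true w * cos (arg xi f true w))) =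
 Ex P (fun w => \1_A w * (G false w * cos (arg xi f false w))).
Definition multiplier H := bmeas H /\ forall G, matched G -> matched (fun b w => G b w * H b w).

Lemma bmeas_cst c : bmeas (fun _ _ => c).
Proof. by exists `|c| => b; split => //; exact: measurable_cst. Qed.

Lemma bmeasD G H : bmeas G -> bmeas H -> bmeas (fun b w => G b w + H b w).
Proof.
move=> [K h] [K' h']; exists (K + K') => b; have [m k] := h b; have [m' k'] := h' b.
by split=> [|w]; [exact: measurable_funD|rewrite (le_trans (ler_normD _ _))// lerD].
Qed.

Lemma bmeasM G H : bmeas G -> bmeas H -> bmeas (fun b w => G b w * H b w).
Proof.
move=> [K h] [K' h']; exists (K * K') => b; have [m k] := h b; have [m' k'] := h' b.
by split=> [|w]; [exact: measurable_funM|rewrite normrM ler_pM].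
Qed.

Lemma marg xi f b : measf (arg xi f b).
Proof.
apply: measurable_funD; last exact: measurable_cst.
by apply: measurable_sum => i; apply: measurable_funM => //; exact: measurable_cst.
Qed.

Lemma mcos xi f b : measf (fun w => cos (arg xi f b w)).
Proof. by apply: measurableT_comp (marg xi f b); apply: continuous_measurable_fun; exact: continuous_cos. Qed.

Lemma L1_matched G xi f b : bmeas G -> L1 P (fun w => \1_A w * (G b w * cos (arg xi f b w))).
Proof.
move=> [K h]; have [m k] := h b; apply: (@L1_bounded _ _ _ _ _ (1 * (K * 1))).
 by apply: measurable_funM; [exact: measurable_indic|apply: measurable_funM => //; exact: mcos].
move=> w; rewrite normrM ler_pM// ?normrM ?ler_pM ?cos_max//.
exact: indic_le1.
Qed.

Lemma matched1 : matched (fun _ _ => 1).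
Proof.
split; first exact: bmeas_cst.
by move=> xi f; under eq_fun do rewrite mul1r; rewrite equal_cos; under [in RHS]eq_fun do rewrite mul1r.
Qed.

Lemma matched_lin a G H : matched G -> matched H -> matched (fun b w => a * G b w + H b w).
Proof.
move=> [bG hG] [bH hH]; split; first by apply: bmeasD => //; apply: bmeasM => //; exact: bmeas_cst.
move=> xi f.
have E b : Ex P (fun w => \1_A w * ((a * G b w + H b w) * cos (arg xi f b w))) =
  a * Ex P (fun w => \1_A w * (G b w * cos (arg xi f b w))) + Ex P (fun w => \1_A w * (H b w * cos (arg xi f b w))).
 rewrite -ExZ ?L1_matched// -ExD ?L1_matched//; last by apply: L1Z; exact: L1_matched.
 by congr (Ex P _); apply/funext => w; ring.
by rewrite !E hG hH.
Qed.

Lemma multiplier_ext H H' : multiplier H -> (forall b w, H b w = H' b w) -> multiplier H'.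
Proof. by move=> h e; have <- : H = H' by apply/funext => b; apply/funext => w. Qed.

Lemma multiplier_cst c : multiplier (fun _ _ => c).
Proof.
split=> [|G hG]; first exact: bmeas_cst.
have z : matched (fun _ _ => 0).
 split; first exact: bmeas_cst.
 by move=> xi f; congr (Ex P _); apply/funext => w; rewrite !mul0r !mulr0.
have := matched_lin c hG z; congr matched; apply/funext => b; apply/funext => w.
by rewrite addr0 mulrC.
Qed.

Lemma multiplierD G H : multiplier G -> multiplier H -> multiplier (fun b w => G b w + H b w).
Proof.
move=> [bG hG] [bH hH]; split=> [|K hK]; first exact: bmeasD.
have := matched_lin 1 (hG _ hK) (hH _ hK); congr matched; apply/funext => b; apply/funext => w.
by rewrite mul1r mulrDr.
Qed.

Lemma multiplierM G H : multiplier G -> multiplier H -> multiplier (fun b w => G b w * H b w).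
Proof.
move=> [bG hG] [bH hH]; split=> [|K hK]; first exact: bmeasM.
have := hH _ (hG _ hK); congr matched; apply/funext => b; apply/funext => w.
by rewrite mulrA.
Qed.

Lemma multiplierX H n : multiplier H -> multiplier (fun b w => H b w ^+ n).
Proof.
move=> hH; elim: n => [|n IH]; first exact: (multiplier_cst 1).
by apply: multiplier_ext (multiplierM hH IH) _ => b w; rewrite exprS.
Qed.

Lemma multiplier_prod (J : Type) (r : seq J) (H : J -> bool -> T -> R) : (forall j, multiplier (H j)) ->
 multiplier (fun b w => \prod_(j <- r) H j b w).
Proof.
move=> h; elim: r => [|j r IH].
 by apply: multiplier_ext (multiplier_cst 1) _ => b w; rewrite big_nil.
by apply: multiplier_ext (multiplierM (h j) IH) _ => b w; rewrite big_cons.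
Qed.

(** Product-to-sum formulas: multiplication by the sine of one coordinate shifts the frequency [xi]
    and the phase, which the hypothesis allows to be arbitrary. *)
Lemma multiplier_sin i a f : multiplier (fun b w => sin (a * X b i w + f)).
Proof.
have bS : bmeas (fun b w => sin (a * X b i w + f)).
 exists 1 => b; split=> [|w]; last exact: sin_max.
 apply: measurableT_comp; first by apply: continuous_measurable_fun; exact: continuous_sin.
 by apply: measurable_funD; [apply: measurable_funM => //; exact: measurable_cst|exact: measurable_cst].
split=> // G [bG hG]; split; first exact: bmeasM.
move=> xi g.
pose xp j := xi j + a * (i == j)%:R; pose xm j := xi j - a * (i == j)%:R.
have sx (y : I -> R) : \sum_j (i == j)%:R * y j = y i.
 rewrite (bigD1 i)//= eqxx mul1r big1 ?addr0// => j; rewrite eq_sym => /negbTE ->.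
 by rewrite mul0r.
have E b w : G b w * sin (a * X b i w + f) * cos (arg xi g b w) =
  2^-1 * (G b w * cos (arg xp (g + f - pi / 2) b w)) - 2^-1 * (G b w * cos (arg xm (g - f - pi / 2) b w)).
 have e1 : arg xp (g + f - pi / 2) b w = arg xi g b w + (a * X b i w + f) - pi / 2.
  rewrite /arg; under eq_bigr do rewrite mulrDl -mulrA; rewrite big_split/= -mulr_sumr sx; ring.
 have e2 : arg xm (g - f - pi / 2) b w = arg xi g b w - (a * X b i w + f) - pi / 2.
  rewrite /arg; under eq_bigr do rewrite mulrBl -mulrA; rewrite sumrB/= -mulr_sumr sx; ring.
 by rewrite e1 e2 !cosBpihalf; move: (a * X b i w + f) => S; rewrite sinD sinB; field.
have M b : Ex P (fun w => \1_A w * (G b w * sin (a * X b i w + f) * cos (arg xi g b w))) =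
  2^-1 * Ex P (fun w => \1_A w * (G b w * cos (arg xp (g + f - pi / 2) b w))) -
  2^-1 * Ex P (fun w => \1_A w * (G b w * cos (arg xm (g - f - pi / 2) b w))).
 rewrite -!ExZ ?L1_matched// -ExB; try by apply: L1Z; exact: L1_matched.
 by congr (Ex P _); apply/funext => w; rewrite E; ring.
by rewrite !M !hG.
Qed.

Lemma multiplier_lim (Hn : nat -> bool -> T -> R) H (K : R) : (forall n, multiplier (Hn n)) ->
 (forall n b w, `|Hn n b w| <= K) -> (forall b w, Hn n b w @[n --> \oo] --> H b w) -> multiplier H.
Proof.
move=> hn bn cn.
have mn n b : measf (Hn n b) by have [[K' h] _] := hn n; case: (h b).
have bH : bmeas H.
 exists K => b; split; first by apply: (@measurable_fun_cvg _ _ _ _ (fun n => Hn n b)) => // w _; exact: cn.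
 move=> w; have h : `|Hn n b w| @[n --> \oo] --> `|H b w| by apply: cvg_norm; exact: cn.
 rewrite -(cvg_lim _ h)//; apply: limr_le; first exact: cvgP h.
 by apply: nearW => n; exact: bn.
split=> // G mG; have [bG hG] := mG; split; first exact: bmeasM.
move=> xi f; have [KG hKG] := bG.
have c b : Ex P (fun w => \1_A w * (G b w * Hn n b w * cos (arg xi f b w))) @[n --> \oo] -->
  Ex P (fun w => \1_A w * (G b w * H b w * cos (arg xi f b w))).
 have [m k] := hKG b.
 have ms (J : T -> R) : measf J -> measf (fun w => \1_A w * (G b w * J w * cos (arg xi f b w))).
  move=> mJ; apply: measurable_funM; first exact: measurable_indic.
  by apply: measurable_funM; [exact: measurable_funM|exact: mcos].
 have [|||||_] := @Ex_DCT _ _ _ P (fun n w => \1_A w * (G b w * Hn n b w * cos (arg xi f b w)))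
  (fun w => \1_A w * (G b w * H b w * cos (arg xi f b w))) (fun=> KG * K).
 - by move=> n; exact: ms.
 - by apply: ms; have [K' h] := bH; case: (h b).
 - exact: L1_cst.
 - move=> n w; rewrite normrM -[leRHS]mul1r ler_pM//.
   exact: indic_le1.
  by rewrite normrM -[leRHS]mulr1 ler_pM ?cos_max// normrM ler_pM.
 - by apply: aeW => w; apply: cvgMr; apply: cvgMl; apply: cvgMr; exact: cn.
 exact.
have e n : Ex P (fun w => \1_A w * (G true w * Hn n true w * cos (arg xi f true w))) =
  Ex P (fun w => \1_A w * (G false w * Hn n false w * cos (arg xi f false w))).
 by have [_ h] := hn n; have [_ ->] := h G mG.
have := c true; under eq_fun do rewrite e; move=> c1.
exact: (cvg_unique _ c1 (c false)).
Qed.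

(** For large [m] the sine of [(X - c) / (m + 1)] has the sign of [X - c]. Step polynomials of
    [(1 - y) / 2] converge to the indicator of [y > 0], the value at [y = 0] included. *)
Lemma multiplier_ray i (c : R) : multiplier (fun b w => (c < X b i w)%R%:R).
Proof.
have bool01 (q : bool) : `|q%:R : R| <= 1 by case: q; rewrite ?normr1 ?normr0.
pose y (m : nat) b w := sin (m.+1%:R^-1 * X b i w + - (m.+1%:R^-1 * c)).
pose u m b w := 2^-1 * (1 - y m b w).
have u01 m b w : 0 <= u m b w /\ u m b w <= 1.
 have := sin_max (m.+1%:R^-1 * X b i w + - (m.+1%:R^-1 * c)); rewrite -/(y m b w) ler_norml /u => /andP[h1 h2].
 by split; lra.
have mu m : multiplier (u m).
 apply: multiplierM (multiplier_cst _) _; apply: multiplierD (multiplier_cst _) _.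
 apply: multiplier_ext (multiplierM (multiplier_cst (-1)) (multiplier_sin i _ _)) _ => b w.
 by rewrite mulN1r.
have ms k m : multiplier (fun b w => stepp k (u m b w)).
 apply: multiplierX; apply: multiplierD (multiplier_cst _) _.
 apply: multiplier_ext (multiplierM (multiplier_cst (-1)) (multiplierX k (mu m))) _ => b w.
 by rewrite mulN1r.
have mp m : multiplier (fun b w => (0 < y m b w)%R%:R).
 apply: (@multiplier_lim (fun k b w => stepp k (u m b w)) _ 1) => //.
  by move=> k b w; have [h1 h2] := u01 m b w; have [h3 h4] := stepp_itv k h1 h2; rewrite ger0_norm.
 move=> b w; have [h1 h2] := u01 m b w; case: ltP => h.
  by apply: stepp_cvg1 => //; rewrite /u; lra.
 by apply: stepp_cvg0 => //; rewrite /u; lra.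
apply: (@multiplier_lim (fun m b w => (0 < y m b w)%R%:R) _ 1) => // b w.
have ym m : y m b w = sin ((X b i w - c) / m.+1%:R) by rewrite /y; congr sin; ring.
apply: (@cvg_near_cst _ _ _ _ _ _); near=> m; rewrite ym.
have small : `|X b i w - c| / m.+1%:R < pi / 2.
 rewrite ltr_pdivrMr// mulrC -ltr_pdivrMr ?divr_gt0 ?pi_gt0//.
 apply: (lt_le_trans (truncnS_gt _)); rewrite ler_nat ltnS.
 by near: m; exact: nbhs_infty_ge.
case: (ltgtP c (X b i w)) => h.
- rewrite sin_gt0_pihalf// divr_gt0 ?subr_gt0//= (le_lt_trans _ small)//.
 by rewrite ler_pM2r ?invr_gt0// ler_norm.
- rewrite -opprB mulNr sinN oppr_gt0 ltNge ltW// sin_gt0_pihalf//.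
 rewrite divr_gt0 ?subr_gt0//= (le_lt_trans _ small)// ler_pM2r ?invr_gt0//.
 by rewrite -normrN opprB ler_norm.
- by rewrite h subrr mul0r sin0 ltxx.
Unshelve. all: by end_near. Qed.

Lemma multiplier_set i (B : set R) : measurable B -> multiplier (fun b w => \1_B (X b i w)).
Proof.
move=> mB'; have mB : (@ocitv R).-sigma.-measurable B by exact: mB'.
move: mB; rewrite RGenOInfty.measurableE => mB.
pose H := [set B : set R | multiplier (fun b w => \1_B (X b i w))].
suff : <<s setT, @RGenOInfty.G R >> `<=` H by apply; exact: mB.
apply: lambda_system_subset => //.
- move=> _ _ [x ->] [y ->]; exists (Num.max x y); apply/seteqP; split => z /=; rewrite !in_itv/= !andbT gt_max.
  by case=> -> ->.
 by case/andP.
- split=> //.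
 + by apply: multiplier_ext (multiplier_cst 1) _ => b w; rewrite indicT.
 + move=> B1 B2 sB h1 h2; apply: multiplier_ext (multiplierD h1 (multiplierM (multiplier_cst (-1)) h2)) _ => b w.
  rewrite !indicE in_setD; case: (boolP (_ \in B2)) => h /=; last by rewrite andbT mulr0 addr0.
  have -> : X b i w \in B1 by apply/mem_set/sB; rewrite inE in h.
  by rewrite mulr1 addrN.
 + move=> Bn nd hBn; apply: (@multiplier_lim (fun n b w => \1_(Bn n) (X b i w)) _ 1) => //.
   by move=> n b w; exact: indic_le1.
  move=> b w; apply: (@cvg_near_cst _ _ _ _ _ _); rewrite indicE.
  have [[n _ hn]|h] := pselect ((\bigcup_n Bn n) (X b i w)).
   rewrite mem_set; last by exists n.
   near=> k; rewrite indicE mem_set//; have nk : (n <= k)%N by near: k; exact: nbhs_infty_ge.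
   by have := nd _ _ nk; rewrite subsetEset; apply.
  rewrite memNset//; apply: nearW => k; rewrite indicE memNset// => h'; apply: h.
  by exists k.
- move=> _ [x ->]; apply: multiplier_ext (multiplier_ray i x) _ => b w.
 by rewrite indicE mem_setE/= in_itv/= andbT.
Unshelve. all: by end_near. Qed.

Theorem equal_laws (B : I -> set R) : (forall i, measurable (B i)) ->
 P (A `&` [set w | forall i, B i (X true i w)]) = P (A `&` [set w | forall i, B i (X false i w)]).
Proof.
move=> mB.
have [_ hm] := multiplier_prod (index_enum I) (fun i => multiplier_set i (mB i)).
have [_ h] := hm _ matched1.
have mS b : measurable [set w | forall i, B i (X b i w)].
 rewrite (_ : [set w | _] = \bigcap_(i in setT) (X b i @^-1` B i)).
  apply: fin_bigcap_measurable => [|i _]; first exact: finite_finset.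
  by rewrite -[X in measurable X]setTI; exact: mX.
 by apply/seteqP; split => w h' i; [move=> _; exact: h'|exact: (h' i Logic.I)].
have E b : fine (P (A `&` [set w | forall i, B i (X b i w)])) =
  Ex P (fun w => \1_A w * (1 * (\prod_(i <- index_enum I) \1_(B i) (X b i w)) * cos (arg (fun=> 0) 0 b w))).
 rewrite -(@Ex_indic _ _ _ P); last exact: measurableI.
 congr (Ex P _); apply/funext => w.
 have -> : arg (fun=> 0) 0 b w = 0 by rewrite /arg big1 ?addr0// => i _; rewrite mul0r.
 rewrite cos0 mulr1 mul1r indicI; congr (_ * _).
 rewrite indicE; have [h'|h'] := pselect (forall i, B i (X b i w)).
  by rewrite mem_set// big1// => i _; rewrite indicE mem_set.
 rewrite memNset//; have [i hi] : exists i, ~ B i (X b i w) by apply/existsNP.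
 by rewrite (bigD1 i)//= indicE memNset// mul0r.
rewrite -[LHS]fineK ?fin_num_measure//; last exact: measurableI.
rewrite -[RHS]fineK ?fin_num_measure//; last exact: measurableI.
by rewrite !E h.
Qed.

End equal_laws.

(** * Levy's characterization of Brownian motion *)

Section levy.
Context {d} {T : measurableType d} {R : realType} (P : probability T R)
 (F : R -> set (set T)) (hF : complete_filtration P F)
 (Iw : finType) (W : Iw -> R -> T -> R) (hW : brownian_motion P F W).
Variable I : finType.

Definition orthonormal_noise (X : I -> R -> T -> R) (th : I -> Iw -> R -> T -> R) :=
 [/\ forall i t, 0 <= t -> msr (F t) (X i t), forall i, bapI F (cfam (th i)),
   forall i, germ P F W (inc (X i)) (@null _ _ _) (cfam (th i)),
   forall i, germ2 P W (inc (X i)) (cfam (th i)) &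
   forall i i' t w, 0 <= t -> \sum_v th i v t w * th i' v t w = (i == i')%:R].

Section characteristic_step.
Variables (X : I -> R -> T -> R) (th : I -> Iw -> R -> T -> R).
Hypothesis hX : orthonormal_noise X th.
Variables (s t : R) (A : set T).
Hypothesis s0 : 0 <= s.
Hypothesis FA : F s A.
Variable xi : I -> R.

Let Y r w := \sum_i xi i * X i r w.
Let thY v r w := \sum_i xi i * th i v r w.
Definition characteristic f r := Ex P (fun w => \1_A w * cos (Y r w - Y s w + f)).

Lemma characteristic_step f e : 0 < e -> exists2 dl : R, 0 < dl &
 forall r r', s <= r -> r <= r' -> r' <= t -> r' - r <= dl ->
 `|characteristic f r' - (1 - (r' - r) * ((\sum_i xi i ^+ 2) / 2)) * characteristic f r| <= e * (r' - r).
Proof.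
move=> e0; have [mX bth gX g2X gram] := hX.
set c := \sum_i xi i ^+ 2.
have mY r : 0 <= r -> msr (F r) (Y r).
 move=> r0; have sa := filt_sa hF r0.
 by apply: (msr_sum sa) => i; apply: (msrM sa (msr_cst sa _)); exact: mX.
have bY : bapI F (cfam thY).
 by move=> v; apply: (bap_sum hF) => i; apply: (bapM hF (bap_cst hF _ _)); exact: bth.
have ei (u : unit) r r' : 0 <= r -> r <= r' -> measf (inc Y u r r') /\
  {ae P, forall w, \sum_i xi i * inc (X i) u r r' w = inc Y u r r' w}.
 move=> r0 rr'; split.
  by apply: measurable_funB; apply: (msr_meast hF _ (mY _ _)) => //; exact: le_trans rr'.
 by apply: aeW => w; rewrite /inc /Y -sumrB; apply: eq_bigr => i _; rewrite mulrBr.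
have gY : germ P F W (inc Y) (@null _ _ _) (cfam thY).
 apply: (germ_eq (germ_lin hF xi gX)) => [u r r' w _ _|u r w _|//].
  by rewrite /inc /Y -sumrB; apply: eq_bigr => i _; rewrite mulrBr.
 by rewrite /null big1// => i _; rewrite mulr0.
have g2Y : germ2 P W (inc Y) (cfam thY) by apply: (germ2_ext hF hW bY (germ2_lin hF hW xi bth g2X) ei).
have q r w : 0 <= r -> \sum_v thY v r w ^+ 2 = c.
 move=> r0; transitivity (\sum_i \sum_j xi i * xi j * \sum_v th i v r w * th j v r w).
  under eq_bigr do rewrite expr2 /thY mulr_suml.
  rewrite exchange_big/=; apply: eq_bigr => i _.
  under eq_bigr do rewrite mulr_sumr; rewrite exchange_big/=; apply: eq_bigr => j _.
  by rewrite mulr_sumr; apply: eq_bigr => v _; ring.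
 apply: eq_bigr => i _; rewrite (bigD1 i)//= gram// eqxx mulr1 big1 ?addr0 ?expr2// => j ji.
 by rewrite gram// eq_sym (negbTE ji) mulr0.
have step g : exists2 dl : R, 0 < dl & forall r r' : R, s <= r -> r <= r' -> r' <= t -> r' - r <= dl ->
  forall G : T -> R, msr (F r) G -> (forall w, `|G w| <= 1) ->
  `|Ex P (fun w => G w * (cos (Y r' w + g) - (1 - (r' - r) * (c / 2)) * cos (Y r w + g)))| <= e / 2 * (r' - r).
 have e2 : 0 < e / 2 by rewrite divr_gt0.
 have bc : bap F (cpar (fun r w => - (c / 2) * cos (Y r w + g))).
  apply: (bapM hF (bap_cst hF _ _)).
  by apply: (bap_trig mY (@continuous_cosD R g)) => x; exact: cos_max.
 have bs : bapI F (cfam (fun v r w => - sin (Y r w + g) * thY v r w)).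
  move=> v; apply: (bapM hF) (bY v).
  by apply: (bap_trig mY (@continuous_sinD R g)) => x; rewrite normrN sin_max.
 have [dl dl0 hd] := germ_weak hF hW bc bs (germ_cos hF hW mY bY gY g2Y q g) t e2.
 exists dl => // r r' sr rr' r't rdl G mG G1.
 have [_] := hd tt r r' (le_trans s0 sr) rr' r't rdl G mG G1.
 congr (`|Ex P _| <= _); apply/funext => w; rewrite /inc /cpar; ring.
(* The phases [0] and [- pi / 2] produce the cosine and the sine of [Y]. The addition formula
   recovers the cosine of [Y r - Y s + f] from them, with factors known at time [s]. *)
have [d1 d10 h1] := step 0; have [d2 d20 h2] := step (- (pi / 2)).
exists (Num.min d1 d2) => [|r r' sr rr' r't]; first by rewrite lt_min d10.
rewrite le_min => /andP[k1 k2].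
have r0 := le_trans s0 sr; have r'0 := le_trans r0 rr'.
have sa := filt_sa hF r0.
have mA : msr (F r) (\1_A : T -> R) by apply: (msr_indic sa); exact: (filt_le hF s0 sr).
have mYs : msr (F r) (fun w => Y s w - f).
 by apply: (msrB sa _ (msr_cst sa _)); exact: msr_sub (filt_le hF s0 sr) (mY s s0).
have mG (h : R -> R) : continuous h -> msr (F r) (fun w => \1_A w * h (Y s w - f)).
 by move=> ch; apply: (msrM sa mA); apply: msr_comp mYs; exact: continuous_measurable_fun.
have bG (h : R -> R) w : (forall x, `|h x| <= 1) -> `|\1_A w * h (Y s w - f)| <= 1.
 move=> hb; rewrite normrM -[leRHS]mul1r ler_pM//.
 exact: indic_le1.
have E1 := h1 r r' sr rr' r't k1 _ (mG cos (@continuous_cos R)) (fun w => bG cos w (@cos_max R)).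
have E2 := h2 r r' sr rr' r't k2 _ (mG sin (@continuous_sin R)) (fun w => bG sin w (@sin_max R)).
have mc r1 g : 0 <= r1 -> measf (fun w => cos (Y r1 w + g)).
 move=> r10; apply: (msr_meast hF r10 (Y := fun r w => cos (Y r w + g))).
 by apply: (msr_comp (f := fun y => cos (y + g))) (mY _ r10); apply: continuous_measurable_fun; exact: continuous_cosD.
have L (h : R -> R) g (a : R) : continuous h -> (forall x, `|h x| <= 1) ->
  L1 P (fun w => \1_A w * h (Y s w - f) * (cos (Y r' w + g) - a * cos (Y r w + g))).
 move=> ch hb; apply: (@L1_bounded _ _ _ _ _ (1 * (1 + `|a|))).
  apply: measurable_funM; first exact: (msr_meast hF r0 (mG _ ch)).
  by apply: measurable_funB; [exact: mc|apply: measurable_funM; [exact: measurable_cst|exact: mc]].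
 move=> w; rewrite normrM ler_pM ?bG// (le_trans (ler_normB _ _))// lerD ?cos_max//.
 by rewrite normrM ler_piMr// cos_max.
have Lc r1 : 0 <= r1 -> L1 P (fun w => \1_A w * cos (Y r1 w - Y s w + f)).
 move=> r10; apply: L1_indicM; first exact: (filt_alg hF s0).2.
 apply: (@L1_bounded _ _ _ _ _ 1) => [|w]; last exact: cos_max.
 apply: measurableT_comp; first by apply: continuous_measurable_fun; exact: continuous_cos.
 apply: measurable_funD; last exact: measurable_cst.
 by apply: measurable_funB; [exact: (msr_meast hF r10 (mY _ r10))|exact: (msr_meast hF s0 (mY _ s0))].
set a := 1 - _ in E1 E2 *.
have -> : characteristic f r' - a * characteristic f r =
  Ex P (fun w => \1_A w * cos (Y s w - f) * (cos (Y r' w + 0) - a * cos (Y r w + 0))) +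
  Ex P (fun w => \1_A w * sin (Y s w - f) * (cos (Y r' w - pi / 2) - a * cos (Y r w - pi / 2))).
 rewrite -ExD; [|exact: (L cos 0 a (@continuous_cos R) (@cos_max R))|exact: (L sin _ a (@continuous_sin R) (@sin_max R))].
 rewrite /characteristic -ExZ ?Lc// -ExB ?Lc//; last by apply: L1Z; exact: Lc.
 congr (Ex P _); apply/funext => w; rewrite !addr0 !cosBpihalf.
 have e3 r1 : cos (Y r1 w - Y s w + f) = cos (Y r1 w) * cos (Y s w - f) + sin (Y r1 w) * sin (Y s w - f).
  by rewrite -cosB; congr cos; ring.
 by rewrite !e3; ring.
rewrite (le_trans (ler_normD _ _))// (splitr (e * (r' - r))) lerD//.
 by rewrite mulrAC.
by rewrite mulrAC.
Qed.

End characteristic_step.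

(** Both functions obey the same linear equation and agree at time [s], so neither has to be
    computed: Gronwall's lemma annihilates their difference. *)
Lemma characteristic_eq (X X' : I -> R -> T -> R) th th' s t A xi f : orthonormal_noise X th -> orthonormal_noise X' th' ->
 0 <= s -> s <= t -> F s A -> characteristic X s A xi f t = characteristic X' s A xi f t.
Proof.
move=> hX hX' s0 st FA; set c := (\sum_i xi i ^+ 2) / 2.
have c0 : 0 <= c by rewrite divr_ge0// sumr_ge0// => i _; exact: sqr_ge0.
pose D r := `|characteristic X s A xi f r - characteristic X' s A xi f r|.
suff : D t = 0 by move/eqP; rewrite normr_eq0 subr_eq0 => /eqP.
apply: (@gronwall R D s t c c0 st) => [|r|]; rewrite /D //.
 rewrite (_ : characteristic X s A xi f s = characteristic X' s A xi f s) ?subrr ?normr0//.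
 by rewrite /characteristic; congr (Ex P _); apply/funext => w; rewrite !subrr.
move=> e e0; have e2 : 0 < e / 2 by rewrite divr_gt0.
have [d1 d10 h1] := characteristic_step hX t s0 FA xi f e2.
have [d2 d20 h2] := characteristic_step hX' t s0 FA xi f e2.
exists (Num.min d1 d2) => [|r r' sr rr' r't]; first by rewrite lt_min d10.
rewrite le_min => /andP[k1 k2].
have := h1 r r' sr rr' r't k1; have := h2 r r' sr rr' r't k2; rewrite -/c.
set x := characteristic X _ _ _ _ r; set x' := characteristic X _ _ _ _ r'.
set y := characteristic X' _ _ _ _ r; set y' := characteristic X' _ _ _ _ r' => k3 k4.
have h0 : 0 <= (r' - r) * c by rewrite mulr_ge0// subr_ge0.
have -> : x' - y' = (x' - (1 - (r' - r) * c) * x) - (y' - (1 - (r' - r) * c) * y) + (1 - (r' - r) * c) * (x - y) by ring.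
apply: (le_trans (ler_normD _ _)); rewrite normrM.
have k5 := ler_normB (x' - (1 - (r' - r) * c) * x) (y' - (1 - (r' - r) * c) * y).
have k6 : `|1 - (r' - r) * c| <= 1 + (r' - r) * c by rewrite ler_norml; apply/andP; split; lra.
have k7 := ler_wpM2r (normr_ge0 (x - y)) k6.
have -> : `|x - y| + (c * `|x - y| + e) * (r' - r) = (1 + (r' - r) * c) * `|x - y| + (e / 2 * (r' - r) + e / 2 * (r' - r)) by field.
lra.
Qed.

Lemma equal_increments (X X' : I -> R -> T -> R) th th' s t A (B : I -> set R) :
 orthonormal_noise X th -> orthonormal_noise X' th' ->
 0 <= s -> s <= t -> F s A -> (forall i, measurable (B i)) ->
 P (A `&` [set w | forall i, B i (X i t w - X i s w)]) = P (A `&` [set w | forall i, B i (X' i t w - X' i s w)]).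
Proof.
move=> hX hX' s0 st FA mB; have t0 := le_trans s0 st.
pose Z (b : bool) i w := (if b then X else X') i t w - (if b then X else X') i s w.
apply: (@equal_laws _ _ _ P A ((filt_alg hF s0).2 _ FA) I Z) => //.
 move=> b i; have m (V : I -> R -> T -> R) thV : orthonormal_noise V thV -> measf (fun w => V i t w - V i s w).
  move=> [mV _ _ _ _]; apply: measurable_funB; [exact: (msr_meast hF t0 (mV _ _ t0))|exact: (msr_meast hF s0 (mV _ _ s0))].
 by case: b; [exact: (m _ _ hX)|exact: (m _ _ hX')].
move=> xi f.
have E (V : I -> R -> T -> R) : Ex P (fun w => \1_A w * cos (\sum_i xi i * (V i t w - V i s w) + f)) = characteristic V s A xi f t.
 congr (Ex P _); apply/funext => w; congr (_ * cos (_ + _)); rewrite -sumrB; apply: eq_bigr => i _; exact: mulrBr.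
by rewrite /arg /Z !E; exact: (characteristic_eq _ _ hX hX').
Qed.

(** The comparison is with coordinates of [W] itself, selected by [iota]: they also have orthonormal
    noise, hence the same increments in law given the past, and theirs are Gaussian by
    hypothesis. *)
Theorem levy (X : I -> R -> T -> R) th (iota : I -> Iw) : injective iota -> orthonormal_noise X th ->
 (forall i, sure F (X i)) -> (forall i w, X i 0 w = 0) -> brownian_motion P F X.
Proof.
move=> inj hX sX X0; split.
- by move=> i; exact: sure_continuous_adapted.
- by move=> i; apply: aeW => w; exact: X0.
move=> s t s0 st A FA B mB.
pose x (i : I) (v : Iw) : R := (v == iota i)%:R.
have sx i (f : Iw -> R) : \sum_v x i v * f v = f (iota i) by exact: sum_pred1.
have dE i : drv W x i = W (iota i) by apply/funext => r; apply/funext => w; rewrite /drv sx.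
have bx i : bapI F (cfam (fun v _ _ => x i v)) by move=> v; exact: (bap_cst hF).
have hW' : orthonormal_noise (drv W x) (drv_noise x).
 split=> //.
 - by move=> i r r0; rewrite dE; exact: (W_msr hW).
 - by move=> i; exact: germ_drv.
 - by move=> i; exact: (germ2_drv hF hW).
 - by move=> i i' r w _; rewrite /drv_noise sx /x (inj_eq inj).
rewrite (equal_increments hX hW' s0 (ltW st) FA mB).
(* The sets are transported along [iota] and completed by the whole line on the unselected
   coordinates, which contribute a factor one. *)
pose B' v := if [pick i | iota i == v] is Some i then B i else setT.
have B'E i : B' (iota i) = B i.
 rewrite /B'; case: pickP => [j /eqP/inj -> //|/(_ i)]; by rewrite eqxx.
have B'T v : v \notin iota @: [set: I]%SET -> B' v = setT.
 by rewrite /B'; case: pickP => // i /eqP <-; rewrite imset_f.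
have mB' v : measurable (B' v) by rewrite /B'; case: pickP.
have [_ _ h] := hW; transitivity (P (A `&` [set w | forall v, B' v (W v t w - W v s w)])).
 congr (P (_ `&` _)); apply/seteqP; split => w /= hw.
  move=> v; rewrite /B'; case: pickP => // i /eqP <-.
  by have := hw i; rewrite dE.
 by move=> i; have := hw (iota i); rewrite B'E dE.
rewrite (h s t s0 st A FA B' mB'); congr (_ * _)%E.
rewrite (bigID (mem (iota @: [set: I]%SET)))/= [X in (_ * X)%E]big1 ?mule1; last by move=> v /B'T ->; exact: probability_setT.
rewrite big_imset/=; last by move=> i j _ _; exact: inj.
by rewrite big_mkcond/=; apply: eq_bigr => i _; rewrite inE B'E.
Qed.

End levy.

(** * Polynomial approximation on the simplex *)

Section simplex_polynomials.
Context {R : realType} {n : nat}.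
Implicit Types (x y : 'rV[R]_n) (w : seq 'I_n) (L : seq (R * seq 'I_n)) (phi psi : seq 'I_n -> R).

Lemma row_norm_le x (e : R) : 0 <= e -> (forall j, `|x 0 j| <= e) -> `|x| <= e.
Proof.
move=> e0 h; rewrite [leLHS]mx_normrE; apply/bigmax_leP; split => //= -[i j] _ /=.
by rewrite (ord1 i).
Qed.

Lemma row_coord_le x j : `|x 0 j| <= `|x|.
Proof. by rewrite [leRHS]mx_normrE; apply/bigmax_geP; right => /=; exists (0, j). Qed.

Lemma box_compact (a b : R) : compact [set x : 'rV[R]_n | forall j, a <= x 0 j /\ x 0 j <= b].
Proof.
have := @rV_compact R n (fun=> [set` `[a, b]]) (fun=> @segment_compact R a b).
congr compact; apply/seteqP; split => x /= h j; have := h j; rewrite /= in_itv/=; first by move/andP.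
by case=> -> ->.
Qed.

Lemma simplex_compact : compact (@simplex R n).
Proof.
have cl : closed (@simplex R n).
 rewrite (_ : simplex = (\bigcap_(j in [set: 'I_n]) [set x : 'rV[R]_n | 0 <= x 0 j]) `&` [set x | \sum_j x 0 j = 1]); last by apply/seteqP; split => x [h1 h2]; split => // j; [move=> _; exact: h1|exact: h1].
 apply: closedI.
  apply: closed_bigI => j _; apply: (@closed_comp _ _ (fun x : 'rV[R]_n => x 0 j) [set z | 0 <= z]) => [x _|]; [exact: coord_continuous|exact: closed_ge].
 apply: (@closed_comp _ _ (fun x : 'rV[R]_n => \sum_j x 0 j) [set z | z = 1]) => [x _|]; last exact: closed_eq.
 by apply: (@cvg_big _ _ _ _ _ (@add_continuous _) _ (nbhs x)) => j _; exact: coord_continuous.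
have sub : @simplex R n `<=` [set x : 'rV[R]_n | forall j, 0 <= x 0 j /\ x 0 j <= 1].
 move=> x [x0 x1] j; split => //; rewrite -x1 (bigD1 j)//= lerDl.
 by apply: sumr_ge0 => l _; exact: x0.
exact: (subclosed_compact cl (@box_compact 0 1) sub).
Qed.

Lemma compact_bound (K : set 'rV[R]_n) (f : 'rV[R]_n -> R) : compact K -> {within K, continuous f} ->
 exists2 M : R, 0 < M & forall x, K x -> `|f x| <= M.
Proof.
move=> cK cf; have [M [_ h]] := compact_bounded (continuous_compact cf cK).
exists (`|M| + 1) => [|x Kx]; first by rewrite ltr_wpDl.
by apply: h; [rewrite (le_lt_trans (ler_norm _))// ltrDl|exists x].
Qed.

Definition mono w x : R := \prod_(j <- w) x 0 j.
Definition pol L x : R := \sum_(p <- L) p.1 * mono p.2 x.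
Definition is_pol (f : 'rV[R]_n -> R) := exists L, forall x, f x = pol L x.

Lemma mono_cons j w x : mono (j :: w) x = x 0 j * mono w x.
Proof. by rewrite /mono big_cons. Qed.

Lemma is_pol_cst c : is_pol (fun=> c).
Proof. by exists [:: (c, [::])] => x; rewrite /pol big_seq1 /mono big_nil mulr1. Qed.

Lemma is_polD f g : is_pol f -> is_pol g -> is_pol (fun x => f x + g x).
Proof. by move=> [L h] [L' h']; exists (L ++ L') => x; rewrite h h' /pol big_cat. Qed.

Lemma is_pol_coord j f : is_pol f -> is_pol (fun x => x 0 j * f x).
Proof.
move=> [L h]; exists [seq (p.1, j :: p.2) | p <- L] => x; rewrite h /pol big_map mulr_sumr.
by apply: eq_bigr => p _; rewrite mono_cons mulrCA.
Qed.

Lemma is_pol_sum (I : Type) (r : seq I) (f : I -> 'rV[R]_n -> R) : (forall i, is_pol (f i)) -> is_pol (fun x => \sum_(i <- r) f i x).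
Proof.
move=> h; elim: r => [|i r IH].
 by under eq_fun do rewrite big_nil; exact: is_pol_cst.
by under eq_fun do rewrite big_cons; exact: is_polD.
Qed.

(* The expectation of [phi] at a sample of size [k] with law [x]. *)
Fixpoint sample (k : nat) phi x : R :=
 if k is k'.+1 then \sum_j x 0 j * sample k' (fun w => phi (j :: w)) x else phi [::].

Lemma is_pol_sample k phi : is_pol (sample k phi).
Proof.
elim: k phi => [|k IH] phi; first exact: is_pol_cst.
by apply: is_pol_sum => j; apply: is_pol_coord; exact: IH.
Qed.

Lemma sample_lin k a phi psi x : sample k (fun w => a * phi w + psi w) x = a * sample k phi x + sample k psi x.
Proof.
elim: k phi psi => [|k IH] phi psi //=.
by rewrite mulr_sumr -big_split; apply: eq_bigr => j _; rewrite IH /=; ring.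
Qed.

Section at_point.
Variable x : 'rV[R]_n.
Hypothesis sx : simplex x.

Lemma sample_cst k c : sample k (fun=> c) x = c.
Proof. by elim: k => //= k IH; rewrite IH -mulr_suml sx.2 mul1r. Qed.

Lemma sampleD k phi psi : sample k (fun w => phi w + psi w) x = sample k phi x + sample k psi x.
Proof. by rewrite -[sample k phi x]mul1r -sample_lin; congr sample; apply/funext => w; rewrite mul1r. Qed.

Lemma sampleZ k a phi : sample k (fun w => a * phi w) x = a * sample k phi x.
Proof.
have := sample_lin k a phi (fun=> 0) x; rewrite sample_cst addr0 => <-.
by congr sample; apply/funext => w; rewrite addr0.
Qed.

Lemma sample_sum k (psi : 'I_n -> seq 'I_n -> R) : sample k (fun w => \sum_j psi j w) x = \sum_j sample k (psi j) x.
Proof.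
elim: (index_enum _) => [|j r IH].
 by under eq_fun do rewrite big_nil; rewrite big_nil sample_cst.
by under eq_fun do rewrite big_cons; rewrite big_cons sampleD IH.
Qed.

Lemma sample_le k phi psi : (forall w, size w = k -> phi w <= psi w) -> sample k phi x <= sample k psi x.
Proof.
elim: k phi psi => [|k IH] phi psi h /=; first exact: h.
by apply: ler_sum => j _; rewrite ler_wpM2l ?sx.1// IH// => w sw; apply: h; rewrite /= sw.
Qed.

(** The variance of a binomial count. The shift [y] is there for the induction: drawing one index
    replaces it by [y] plus the deviation of that draw. *)
Lemma sample_variance k j (y : R) : sample k (fun w => ((count_mem j w)%:R - k%:R * x 0 j + y) ^+ 2) x =
 k%:R * (x 0 j * (1 - x 0 j)) + y ^+ 2.
Proof.
elim: k y => [|k IH] y /=; first by rewrite !mul0r subr0 !add0r.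
have e l : sample k (fun w => (((l == j) + count_mem j w)%N%:R - k.+1%:R * x 0 j + y) ^+ 2) x =
  k%:R * (x 0 j * (1 - x 0 j)) + (y + ((l == j)%:R - x 0 j)) ^+ 2.
 rewrite -IH; congr sample; apply/funext => w; rewrite natrD -natr1; ring.
under eq_bigr do rewrite e.
have s1 : \sum_l x 0 l * (l == j)%:R = x 0 j.
 by rewrite (bigD1 j)//= eqxx mulr1 big1 ?addr0// => l /negbTE ->; rewrite mulr0.
have s2 l : x 0 l * (k%:R * (x 0 j * (1 - x 0 j)) + (y + ((l == j)%:R - x 0 j)) ^+ 2) =
  x 0 l * (k%:R * (x 0 j * (1 - x 0 j)) + (y - x 0 j) ^+ 2) + (x 0 l * (l == j)%:R) * (2 * (y - x 0 j) + 1).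
 by case: (l == j) => /=; ring.
under eq_bigr do rewrite s2; rewrite big_split/= -!mulr_suml sx.2 s1 -natr1; ring.
Qed.

End at_point.

Definition frequency k w : 'rV[R]_n := \row_j ((count_mem j w)%:R / k%:R).

Lemma frequency_simplex k w : (0 < k)%N -> size w = k -> simplex (frequency k w).
Proof.
move=> k0 sw; split => [j|]; first by rewrite mxE divr_ge0.
under eq_bigr do rewrite mxE; rewrite -mulr_suml -natr_sum.
have -> : (\sum_(j < n) count_mem j w)%N = k.
 rewrite -sw; elim: w {sw} => [|l w IH] /=; first by rewrite big1.
 by rewrite big_split/= IH (bigD1 l)//= eqxx big1 ?addn0// => j; rewrite eq_sym => /negbTE ->.
by rewrite divff// pnatr_eq0 -lt0n.
Qed.

(** Bernstein's proof: the mean of [f] at the frequencies of a multinomial sample is a polynomial in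
    [x], and the frequencies concentrate at [x] with total variance at most [1 / k]. *)
Theorem simplex_weierstrass f (e : R) : {within simplex, continuous f} -> 0 < e ->
 exists L, forall x, simplex x -> `|f x - pol L x| <= e.
Proof.
move=> cf e0; have e2 : 0 < e / 2 by rewrite divr_gt0.
have [dl dl0 hd] := compact_unif simplex_compact cf e2.
have [M M0 hM] := compact_bound simplex_compact cf.
(* Chebyshev's weight: when some frequency is off by more than [dl], the trivial bound [2 M] is at
   most [C] times the squared deviation. *)
pose C := 2 * M / dl ^+ 2; have C0 : 0 < C by rewrite divr_gt0 ?mulr_gt0// exprn_gt0.
pose k := (Num.truncn (C / (e / 2))).+1.
have kC : C / k%:R <= e / 2.
 by rewrite ler_pdivrMr// mulrC -ler_pdivrMr// ltW// truncnS_gt.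
have [L hL] := is_pol_sample k (fun w => f (frequency k w)); exists L => x sx; rewrite -hL.
have k0 : k%:R != 0 :> R by rewrite pnatr_eq0.
pose V w := \sum_j (frequency k w 0 j - x 0 j) ^+ 2.
have V0 w : 0 <= V w by apply: sumr_ge0 => j _; exact: sqr_ge0.
have close w : size w = k -> `|f (frequency k w) - f x| <= e / 2 + C * V w.
 move=> sw; have sF := frequency_simplex (ltn0Sn _) sw.
 have [h|h] := pselect (forall j, `|frequency k w 0 j - x 0 j| <= dl).
  apply: (@le_trans _ _ (e / 2)); last by rewrite lerDl mulr_ge0// ltW.
  by apply: hd => //; apply: row_norm_le => [|j]; [exact: ltW|have := h j; rewrite !mxE].
 have [j hj] : exists j, ~ `|frequency k w 0 j - x 0 j| <= dl by apply/existsNP.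
 have {}hj : dl < `|frequency k w 0 j - x 0 j| by rewrite ltNge; apply/negP.
 apply: (@le_trans _ _ (2 * M)).
  by rewrite (le_trans (ler_normB _ _))// mulr_natl mulr2n lerD ?hM.
 apply: (@le_trans _ _ (C * V w)); last by rewrite lerDr ltW.
 rewrite /C -mulrA ler_peMr ?mulr_ge0 ?(ltW M0)// mulrC ler_pdivlMr ?exprn_gt0// mul1r.
 rewrite /V (bigD1 j)//= -(real_normK (num_real (frequency k w 0 j - x 0 j))).
 apply: (@le_trans _ _ (`|frequency k w 0 j - x 0 j| ^+ 2)).
  by rewrite ler_pXn2r ?nnegrE ?(ltW dl0) ?(ltW hj).
 by rewrite lerDl; apply: sumr_ge0 => l _; exact: sqr_ge0.
have EV : sample k V x <= k%:R^-1.
 rewrite sample_sum//; apply: (@le_trans _ _ (\sum_j x 0 j * k%:R^-1)); last by rewrite -mulr_suml sx.2 mul1r.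
 apply: ler_sum => j _.
 have -> : sample k (fun w => (frequency k w 0 j - x 0 j) ^+ 2) x =
   k%:R^-1 ^+ 2 * sample k (fun w => ((count_mem j w)%:R - k%:R * x 0 j + 0) ^+ 2) x.
  rewrite -sampleZ//; congr sample; apply/funext => w; rewrite mxE; field.
  exact: k0.
 rewrite sample_variance// expr0n/= addr0 expr2 -mulrA mulKf// mulrC.
 by rewrite ler_wpM2r ?invr_ge0// ler_piMr ?sx.1// gerBl sx.1.
have bd s : s = 1 \/ s = -1 -> s * (sample k (fun w => f (frequency k w)) x - f x) <= e.
 move=> hs.
 have -> : s * (sample k (fun w => f (frequency k w)) x - f x) = sample k (fun w => s * f (frequency k w) + - (s * f x)) x.
  by rewrite sample_lin sample_cst//; ring.
 apply: (@le_trans _ _ (sample k (fun w => C * V w + e / 2) x)).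
  apply: sample_le => // w sw; rewrite -mulrBr [leRHS]addrC; apply: le_trans (close w sw).
  by case: hs => ->; rewrite ?mul1r ?mulN1r ?ler_norm// -normrN ler_norm.
 rewrite sample_lin sample_cst// [leRHS]splitr lerD2r; apply: le_trans kC.
 by rewrite ler_wpM2l// ltW.
have := bd 1 (or_introl erefl); have := bd (-1) (or_intror erefl).
by rewrite mul1r mulN1r distrC ler_norml lerNl => -> ->.
Qed.

End simplex_polynomials.

(** * Second order Taylor expansion on the simplex *)

Section taylor.
Context {R : realType} {n : nat}.
Implicit Types (f : 'rV[R]_n -> R) (x y z : 'rV[R]_n).

Definition box (c : R) : set 'rV[R]_n := [set x | forall j, - c <= x 0 j /\ x 0 j <= c].

Lemma box_bound (g : 'I_n -> 'rV[R]_n -> R) : (forall j, continuous (g j)) ->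
 exists M : 'I_n -> R, forall j x, box 1 x -> `|g j x| <= M j.
Proof.
move=> cg; have ex j : exists M : R, forall x, box 1 x -> `|g j x| <= M.
 have cw : {within box 1, continuous (g j)} by exact: continuous_subspaceT.
 by have [M _ h] := compact_bound (@box_compact R n (-1) 1) cw; exists M.
by have [M hM] := choice ex; exists M.
Qed.

Lemma simplex_box x : simplex x -> box 1 x.
Proof.
move=> [x0 x1] j; split; first by rewrite (le_trans _ (x0 j))// lerN10.
by rewrite -x1 (bigD1 j)//= lerDl; apply: sumr_ge0 => l _; exact: x0.
Qed.

Lemma row_norm_sqr x : `|x| ^+ 2 <= \sum_j x 0 j ^+ 2.
Proof.
set S := \sum_j _; have S0 : 0 <= S by apply: sumr_ge0 => j _; exact: sqr_ge0.
rewrite -(sqr_sqrtr S0) ler_pXn2r ?nnegrE ?sqrtr_ge0//; apply: row_norm_le => [|j]; first exact: sqrtr_ge0.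
rewrite -sqrtr_sqr ler_wsqrtr// /S (bigD1 j)//= lerDl.
by apply: sumr_ge0 => l _; exact: sqr_ge0.
Qed.

Lemma is_derive_coord f z k (c u : R) : (forall x, derivable f x (delta_mx 0 k)) ->
 is_derive u (1 : R) (fun u : R => f (z + (u - c) *: delta_mx 0 k)) (partial k f (z + (u - c) *: delta_mx 0 k)).
Proof.
move=> df; set g := fun u : R => _; set a := z + (u - c) *: delta_mx 0 k.
have E : (fun h : R => h^-1 *: ((g \o shift u) (h *: 1) - g u)) =
     (fun h => h^-1 *: ((f \o shift a) (h *: delta_mx 0 k) - f a)).
 apply/funext => h; rewrite /g /a /= /shift /=; congr (_ *: (f _ - _)).
 by rewrite addrCA -scalerDl; congr (_ + _ *: _); rewrite /GRing.scale/= mulr1; ring.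
by apply: DeriveDef; rewrite /derivable /derive E; [exact: (df a)|].
Qed.

Section first_order.
Variable f : 'rV[R]_n -> R.
Hypothesis hf : has_continuous_partials f.

(** Differentiability is derived from continuous partial derivatives, changing one coordinate at a
    time. The intermediate points leave the simplex, hence the estimates on boxes. *)
Lemma first_order (c e : R) : 0 < e -> exists2 dl : R, 0 < dl & forall x y, box c x -> box c y -> `|y - x| <= dl ->
 `|f y - f x - \sum_j partial j f x * (y 0 j - x 0 j)| <= e * `|y - x|.
Proof.
move=> e0; have e1 : 0 < e / n.+1%:R by rewrite divr_gt0.
have ex (j : 'I_n) : exists2 dl : R, 0 < dl & forall x y, box c x -> box c y -> `|x - y| <= dl -> `|partial j f x - partial j f y| <= e / n.+1%:R.
 have cw : {within box c, continuous (partial j f)} by apply: continuous_subspaceT; exact: (hf j).2.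
 by have [dl dl0 h] := compact_unif (@box_compact R n (- c) c) cw e1; exists dl.
have [dl dl0 hd] := choice_pos_min (Q := fun j (r : R) => forall x y, box c x -> box c y -> `|x - y| <= r -> `|partial j f x - partial j f y| <= e / n.+1%:R) ex
 (fun j a b ab hb x y bx by' xy => hb x y bx by' (le_trans xy ab)).
exists dl => // x y bx by' xy.
(* A staircase from [x] to [y]: its point [z k] has already received the first [k] coordinates of
   [y]. *)
pose z k : 'rV[R]_n := \row_j if (j < k)%N then y 0 j else x 0 j.
have z0 : z 0%N = x by apply/rowP => j; rewrite mxE.
have zn : z n = y by apply/rowP => j; rewrite mxE ltn_ord.
have fE : f y - f x = \sum_(k < n) (f (z k.+1) - f (z k)).
 by rewrite -(big_mkord predT (fun k => f (z k.+1) - f (z k))) telescope_sumr// z0 zn.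
rewrite fE -sumrB; apply: (le_trans (ler_norm_sum _ _ _)).
apply: (@le_trans _ _ (\sum_(k < n) e / n.+1%:R * `|y - x|)); last first.
 rewrite sumr_const card_ord -(mulr_natl (_ * _)).
 have -> : n%:R * (e / n.+1%:R * `|y - x|) = n%:R / n.+1%:R * (e * `|y - x|) by ring.
 by rewrite ler_piMl ?mulr_ge0 ?(ltW e0)// ler_pdivrMr// mul1r ler_nat.
apply: ler_sum => k _.
pose p (u : R) := z k + (u - x 0 k) *: delta_mx 0 k.
have pk u : p u 0 k = u by rewrite !mxE ltnn !eqxx mulr1 addrC subrK.
have pj u j : j != k -> p u 0 j = if (j < k)%N then y 0 j else x 0 j.
 by move=> jk; rewrite !mxE eqxx (negbTE jk) mulr0 addr0.
have zE (u : R) k' : (forall j, j != k -> z k' 0 j = if (j < k)%N then y 0 j else x 0 j) -> z k' 0 k = u -> z k' = p u.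
 by move=> h1 h2; apply/rowP => j; have [->|jk] := eqVneq j k; [rewrite pk|rewrite pj// h1].
have e2 : z k.+1 = p (y 0 k).
 by apply: zE => [j jk|]; rewrite mxE ?leqnn// ltnS leq_eqVlt (inj_eq val_inj) (negbTE jk).
have e3 : z k = p (x 0 k) by apply: zE => [j jk|]; rewrite mxE ?ltnn.
rewrite e2 e3.
pose a := Num.min (x 0 k) (y 0 k); pose b := Num.max (x 0 k) (y 0 k).
have := @mvt_le R a b (fun u => f (p u) - partial k f x * u) (fun u => partial k f (p u) - partial k f x) (x 0 k) (y 0 k) (e / n.+1%:R).
have -> : f (p (y 0 k)) - partial k f x * y 0 k - (f (p (x 0 k)) - partial k f x * x 0 k) =
 f (p (y 0 k)) - f (p (x 0 k)) - partial k f x * (y 0 k - x 0 k) by ring.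
move=> mvt; apply: (@le_trans _ _ (e / n.+1%:R * `|y 0 k - x 0 k|)); last by rewrite ler_wpM2l ?(ltW e1)//; have := row_coord_le (y - x) k; rewrite !mxE.
apply: mvt; rewrite ?ge_min ?le_max ?lexx ?orbT// => u.
 move=> _ _; have h := is_deriveB (is_derive_coord (z k) (x 0 k) u (hf k).1) (is_deriveZ (partial k f x) (is_derive_id u (1 : R))).
 by move: h; rewrite /GRing.scale/= mulr1.
move=> au ub hu; apply: hd => // [j|].
 have [->|jk] := eqVneq j k.
  rewrite pk; have [x1 x2] := bx k; have [y1 y2] := by' k; split.
   by apply: le_trans au; rewrite le_min x1 y1.
  by apply: (le_trans ub); rewrite ge_max x2 y2.
 by rewrite pj//; case: ifP => _; [exact: by'|exact: bx].
apply: row_norm_le => [|j]; first exact: ltW.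
have [->|jk] := eqVneq j k.
 rewrite !mxE -/(p u 0 k); have := pk u; rewrite !mxE => ->; apply: (le_trans hu).
 by apply: le_trans xy; have := row_coord_le (y - x) k; rewrite !mxE.
have := pj u j jk; rewrite !mxE => ->; case: ifP => _; last by rewrite subrr normr0 ltW.
by apply: le_trans xy; have := row_coord_le (y - x) j; rewrite !mxE.
Qed.

Lemma is_derive_line x y (t : R) :
 is_derive t (1 : R) (fun t : R => f (x + t *: (y - x))) (\sum_j partial j f (x + t *: (y - x)) * (y 0 j - x 0 j)).
Proof.
set g := fun t : R => _; set S := \sum_j _.
have coord (r : R) j : (x + r *: (y - x)) 0 j = x 0 j + r * (y 0 j - x 0 j) by rewrite !mxE.
pose c := `|x| + (1 + `|t|) * `|y - x|.
have inbox (h : R) : `|h| <= 1 -> box c (x + (h + t) *: (y - x)).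
 move=> h1 j; apply/andP; rewrite -ler_norml; apply: (le_trans (row_coord_le _ _)).
 rewrite (le_trans (ler_normD _ _))// lerD2l normrZ ler_wpM2r//.
 by rewrite (le_trans (ler_normD _ _))// lerD2r.
have lim : h^-1 *: ((g \o shift t) (h *: 1) - g t) @[h --> (0 : R)^'] --> S.
 apply/cvgrPdist_le => e e0.
 have D0 : 0 < `|y - x| + 1 by rewrite ltr_wpDl.
 have [dl dl0 hd] := first_order c (divr_gt0 e0 D0).
 have d0 : 0 < Num.min 1 (dl / (`|y - x| + 1)) by rewrite lt_min ltr01 divr_gt0.
 near=> h; have hn : h != 0 by near: h; exact: nbhs_dnbhs_neq.
 have hs : `|h| <= Num.min 1 (dl / (`|y - x| + 1)).
  by near: h; apply: dnbhs0_le.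
 move: hs; rewrite le_min => /andP[h1 h2].
 have e1 : (x + (h + t) *: (y - x)) - (x + t *: (y - x)) = h *: (y - x) by rewrite scalerDl; rewrite opprD addrACA subrr add0r addrK.
 have := hd (x + t *: (y - x)) (x + (h + t) *: (y - x)) _ (inbox h h1).
 rewrite e1 normrZ => /(_ _ _)h3.
 have {}h3 := h3 _ _.
 have hb : box c (x + t *: (y - x)) by rewrite -[t]add0r; apply: inbox; rewrite normr0.
 have hdl : `|h| * `|y - x| <= dl.
  move: h2; rewrite ler_pdivlMr// => h2; apply: le_trans h2; rewrite ler_wpM2l// lerDl//.
 have {}h3 := h3 hb hdl.
 have -> : S - h^-1 *: ((g \o shift t) (h *: 1) - g t) =
   - (h^-1 * (f (x + (h + t) *: (y - x)) - f (x + t *: (y - x)) - \sum_j partial j f (x + t *: (y - x)) * ((x + (h + t) *: (y - x)) 0 j - (x + t *: (y - x)) 0 j))).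
  under [X in _ = - (_ * (_ - X))]eq_bigr do rewrite !coord.
  rewrite (_ : \sum_j _ = h * S); last by rewrite mulr_sumr; apply: eq_bigr => j _; ring.
  by rewrite /g /= /shift /= /GRing.scale/= mulr1 [in RHS]mulrBr (mulKf hn); ring.
 rewrite normrN normrM normfV ler_pdivrMl ?normr_gt0//; apply: (le_trans h3).
 rewrite mulrCA ler_wpM2l// -mulrA ler_piMr ?(ltW e0)// mulrC ler_pdivrMr// mul1r lerDl//.
by apply: DeriveDef; [apply: cvgP lim|exact: cvg_lim].
Unshelve. all: by end_near. Qed.

End first_order.

Definition taylor_remainder f x y := f y - f x - \sum_j partial j f x * (y 0 j - x 0 j)
 - 2^-1 * \sum_j \sum_l partial l (partial j f) x * ((y 0 j - x 0 j) * (y 0 l - x 0 l)).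

(** Along the segment, subtracting the first two Taylor terms leaves a function [G] of one variable,
    whose derivative is small by [first_order] applied to the partial derivatives. *)
Lemma second_order f (e : R) : C2 f -> 0 < e -> exists2 dl : R, 0 < dl & forall x y, simplex x -> simplex y ->
 `|y - x| <= dl -> `|taylor_remainder f x y| <= e * `|y - x| ^+ 2.
Proof.
move=> [h1 h2] e0; have e1 : 0 < e / n.+1%:R by rewrite divr_gt0.
have ex (j : 'I_n) : exists2 dl : R, 0 < dl & forall x y, box 1 x -> box 1 y -> `|y - x| <= dl ->
  `|partial j f y - partial j f x - \sum_l partial l (partial j f) x * (y 0 l - x 0 l)| <= e / n.+1%:R * `|y - x|.
 by have [dl dl0 h] := first_order (h2 j) 1 e1; exists dl.
have [dl dl0 hd] := choice_pos_min (Q := fun j (c : R) => forall x y, box 1 x -> box 1 y -> `|y - x| <= c ->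
  `|partial j f y - partial j f x - \sum_l partial l (partial j f) x * (y 0 l - x 0 l)| <= e / n.+1%:R * `|y - x|) ex
 (fun j a b ab hb x y bx by' xy => hb x y bx by' (le_trans xy ab)).
exists dl => // x y sx sy xy.
pose S t := \sum_j partial j f (x + t *: (y - x)) * (y 0 j - x 0 j).
pose Q := \sum_j \sum_l partial l (partial j f) x * ((y 0 j - x 0 j) * (y 0 l - x 0 l)).
have S0 : S 0 = \sum_j partial j f x * (y 0 j - x 0 j) by rewrite /S scale0r addr0.
pose G (t : R) := f (x + t *: (y - x)) - S 0 * t - 2^-1 * Q * t ^+ 2.
have -> : taylor_remainder f x y = G 1 - G 0.
 have e2 : x + (y - x) = y by rewrite addrC subrK.
 by rewrite /G /taylor_remainder -S0 -/Q scale1r scale0r addr0 e2; ring.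
have DG (t : R) : 0 <= t -> t <= 1 -> is_derive t (1 : R) G (S t - S 0 - Q * t).
 move=> t0 t1; have d1 := is_derive_line h1 x y t.
 have d2 := is_deriveB d1 (is_deriveZ (S 0) (is_derive_id t (1 : R))).
 have d3 := is_deriveB d2 (is_deriveZ (2^-1 * Q) (is_deriveX 2 (is_derive_id t (1 : R)))).
 move: d3; set D := (X in is_derive _ _ _ X -> _) => d3; rewrite (_ : _ - Q * t = D)//.
 by rewrite /D -/(S t) /GRing.scale/= -mulr_natr expr1; field.
have inbox (t : R) : 0 <= t -> t <= 1 -> box 1 (x + t *: (y - x)).
 move=> t0 t1; apply: simplex_box; have E j : (x + t *: (y - x)) 0 j = (1 - t) * x 0 j + t * y 0 j by rewrite !mxE; ring.
 split=> [j|]; first by rewrite E addr_ge0 ?mulr_ge0 ?subr_ge0 ?sx.1 ?sy.1.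
 by under eq_bigr do rewrite E; rewrite big_split/= -!mulr_sumr sx.2 sy.2; ring.
have := @mvt_le R 0 1 G (fun t => S t - S 0 - Q * t) 0 1 (e * `|y - x| ^+ 2).
rewrite subr0 normr1 mulr1; apply => // t t0 t1 _.
have -> : S t - S 0 - Q * t = \sum_j (y 0 j - x 0 j) * (partial j f (x + t *: (y - x)) - partial j f x -
  \sum_l partial l (partial j f) x * ((x + t *: (y - x)) 0 l - x 0 l)).
 rewrite S0 /S /Q mulr_suml -!sumrB; apply: eq_bigr => j _.
 have -> : \sum_l partial l (partial j f) x * ((y 0 j - x 0 j) * (y 0 l - x 0 l)) =
   (y 0 j - x 0 j) * \sum_l partial l (partial j f) x * (y 0 l - x 0 l).
  by rewrite mulr_sumr; apply: eq_bigr => l _; ring.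
 have -> : \sum_l partial l (partial j f) x * ((x + t *: (y - x)) 0 l - x 0 l) =
   t * \sum_l partial l (partial j f) x * (y 0 l - x 0 l).
  by rewrite mulr_sumr; apply: eq_bigr => l _; rewrite !mxE; ring.
 by ring.
apply: (le_trans (ler_norm_sum _ _ _)).
apply: (@le_trans _ _ (\sum_(j < n) `|y - x| * (e / n.+1%:R * `|y - x|))); last first.
 rewrite sumr_const card_ord -(mulr_natl (_ * _)).
 have -> : n%:R * (`|y - x| * (e / n.+1%:R * `|y - x|)) = n%:R / n.+1%:R * (e * `|y - x| ^+ 2) by ring.
 by rewrite ler_piMl ?mulr_ge0 ?sqr_ge0 ?(ltW e0)// ler_pdivrMr// mul1r ler_nat.
apply: ler_sum => j _; rewrite normrM ler_pM//.
 by have := row_coord_le (y - x) j; rewrite !mxE.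
have e2 : x + t *: (y - x) - x = t *: (y - x) by rewrite addrC addKr.
have small : `|x + t *: (y - x) - x| <= `|y - x|.
 by rewrite e2 normrZ ger0_norm// ler_piMl.
apply: (le_trans (hd j _ _ (simplex_box sx) (inbox t t0 t1) (le_trans small xy))).
by rewrite ler_wpM2l ?(ltW e1).
Qed.

Lemma C1_within f : has_continuous_partials f -> {within simplex, continuous f}.
Proof.
move=> hf; have [dl dl0 hd] := first_order hf 1 ltr01.
have [M hM] := box_bound (fun j => (hf j).2).
pose C := \sum_j `|M j| + 1; have C0 : 0 < C by rewrite ltr_wpDl// sumr_ge0.
apply/subspace_continuousP => x sx; apply/cvgrPdist_le => e e0.
have d0 : 0 < Num.min dl (e / C) by rewrite lt_min dl0 divr_gt0.
rewrite near_withinE; near=> y => sy.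
have : `|x - y| <= Num.min dl (e / C) by near: y; exact: cvgr_dist_le.
rewrite le_min distrC => /andP[k1 k2].
have := hd x y (simplex_box sx) (simplex_box sy) k1; rewrite mul1r => h.
have b : `|\sum_j partial j f x * (y 0 j - x 0 j)| <= \sum_j `|M j| * `|y - x|.
 apply: (le_trans (ler_norm_sum _ _ _)); apply: ler_sum => j _; rewrite normrM ler_pM//.
  by rewrite (le_trans (hM j x (simplex_box sx)))// ler_norm.
 by have := row_coord_le (y - x) j; rewrite !mxE.
rewrite distrC -(subrK (\sum_j partial j f x * (y 0 j - x 0 j)) (f y - f x)).
apply: (le_trans (ler_normD _ _)); apply: (le_trans (lerD h b)).
rewrite -mulr_suml -[X in X + _]mul1r -mulrDl addrC -/C mulrC.
by rewrite -ler_pdivlMr.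
Unshelve. all: by end_near. Qed.

(** Beyond the distance [dl] the remainder is bounded by a constant [C], which is at most [C / dl^2]
    times the squared distance. *)
Lemma second_order_bound f : C2 f -> exists C : R, forall x y, simplex x -> simplex y ->
 `|taylor_remainder f x y| <= C * `|y - x| ^+ 2.
Proof.
move=> hf; have [dl dl0 hd] := second_order hf ltr01; have [h1 h2] := hf.
have [M M0 hM] := compact_bound simplex_compact (C1_within h1).
have [M1 hM1] := box_bound (fun j => (h1 j).2).
have [M2 hM2] := choice (fun j => box_bound (fun l => (h2 j l).2)).
pose C := 2 * M + \sum_j `|M1 j| + \sum_j \sum_l `|M2 j l|.
have C0 : 0 <= C.
 by rewrite !addr_ge0 ?mulr_ge0 ?(ltW M0)//; apply: sumr_ge0 => // j _; apply: sumr_ge0.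
exists (1 + C / dl ^+ 2) => x y sx sy; rewrite mulrDl mul1r.
have q0 : 0 <= `|y - x| ^+ 2 by exact: sqr_ge0.
have [xy|xy] := leP (`|y - x|) dl.
 have := hd x y sx sy xy; rewrite mul1r => /le_trans; apply.
 by rewrite lerDl mulr_ge0// divr_ge0// sqr_ge0.
have d1 j : `|y 0 j - x 0 j| <= 1.
 have [_ x1] := simplex_box sx j; have [_ y1] := simplex_box sy j.
 by have := sx.1 j; have := sy.1 j; rewrite ler_norml; lra.
apply: (@le_trans _ _ C); last first.
 apply: (@le_trans _ _ (C / dl ^+ 2 * `|y - x| ^+ 2)); last by rewrite lerDr.
 rewrite -mulrA ler_peMr// mulrC ler_pdivlMr ?exprn_gt0// mul1r ler_pXn2r ?nnegrE ?(ltW xy)//.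
 exact: ltW.
have bx := simplex_box sx.
have s1 : `|\sum_j partial j f x * (y 0 j - x 0 j)| <= \sum_j `|M1 j|.
 apply: (le_trans (ler_norm_sum _ _ _)); apply: ler_sum => j _; rewrite normrM -[leRHS]mulr1 ler_pM//.
 by rewrite (le_trans (hM1 j x bx))// ler_norm.
have s2 : `|\sum_j \sum_l partial l (partial j f) x * ((y 0 j - x 0 j) * (y 0 l - x 0 l))| <= \sum_j \sum_l `|M2 j l|.
 apply: (le_trans (ler_norm_sum _ _ _)); apply: ler_sum => j _.
 apply: (le_trans (ler_norm_sum _ _ _)); apply: ler_sum => l _; rewrite normrM -[leRHS]mulr1 ler_pM//.
  by rewrite (le_trans (hM2 j l x bx))// ler_norm.
 by rewrite normrM -[leRHS]mulr1 ler_pM.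
have s3 : `|f y - f x| <= 2 * M by rewrite (le_trans (ler_normB _ _))// mulr_natl mulr2n lerD ?hM.
rewrite /taylor_remainder /C; apply: (le_trans (ler_normB _ _)); apply: lerD.
 by apply: (le_trans (ler_normB _ _)); exact: lerD.
by rewrite normrM ger0_norm// (le_trans _ s2)// ler_piMl// invf_le1// ler1n.
Qed.

End taylor.

(** * Monomials and smooth functions of a process on the simplex *)

Section simplex_system.
Context {d} {T : measurableType d} {R : realType} (P : probability T R)
 (F : R -> set (set T)) (hF : complete_filtration P F)
 (Iw : finType) (W : Iw -> R -> T -> R) (hW : brownian_motion P F W).
Variable n : nat.
Implicit Types f : 'rV[R]_n -> R.

Definition at_row (Th : Type) (l : Th -> 'I_n -> R -> T -> R) x t w : 'rV[R]_n := \row_j l x j t w.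

(** [f] is continuous on the simplex only. There it is a uniform limit of polynomials, and these,
    multiplied by the indicator of the simplex, converge everywhere to the restriction of [f]. *)
Lemma msr_simplex G f (Z : 'I_n -> T -> R) : sigma_algebra setT G -> {within simplex, continuous f} ->
 (forall j, msr G (Z j)) -> msr G (fun w => (f \_ simplex) (\row_j Z j w)).
Proof.
move=> sG cf mZ.
have [L hL] : exists L : nat -> seq (R * seq 'I_n), forall k x, simplex x -> `|f x - pol (L k) x| <= k.+1%:R^-1.
 have ex (k : nat) : exists L : seq (R * seq 'I_n), forall x, simplex x -> `|f x - pol L x| <= k.+1%:R^-1.
  by apply: simplex_weierstrass cf _; rewrite invr_gt0.
 by have [L h] := choice ex; exists L.
pose z w : 'rV[R]_n := \row_j Z j w.
(* The indicator of the simplex written with indicators on the line, so that its measurability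
   follows coordinate by coordinate. *)
pose D w : R := (\prod_j \1_[set` `[0, +oo[] (Z j w)) * \1_[set 1 : R] (\sum_j Z j w).
have DE w : D w = \1_simplex (z w).
 rewrite /D [RHS]indicE; have [sz|nz] := pselect (simplex (z w)).
  rewrite mem_set// big1 ?mul1r => [|j _]; rewrite indicE mem_set//= ?in_itv/= ?andbT.
   by rewrite -sz.2; apply: eq_bigr => j _; rewrite mxE.
  by have := sz.1 j; rewrite mxE.
 rewrite memNset//; have [pos|neg] := pselect (forall j, 0 <= Z j w).
  rewrite [X in _ * X]indicE memNset ?mulr0// => e; apply: nz; split=> [j|]; first by rewrite mxE.
  by under eq_bigr do rewrite mxE.
 have [j hj] : exists j, ~ 0 <= Z j w by apply/existsNP.
 rewrite (bigD1 j)//= (_ : \1__ (Z j w) = 0) ?mul0r//.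
 by rewrite indicE memNset//= in_itv/= andbT.
have mD : msr G D.
 apply: (msrM sG); last first.
  apply: (msr_comp (f := \1_[set 1 : R])); last exact: (msr_sum sG).
  by apply: measurable_indic; exact: measurable_set1.
 apply: (msr_prod sG) => j; apply: (msr_comp (f := \1_[set` `[0 : R, +oo[])) (mZ j).
 by apply: measurable_indic; exact: measurable_itv.
have mpol k : msr G (fun w => pol (L k) (z w)).
 apply: (msr_sum sG) => p; apply: (msrM sG (msr_cst sG _)).
 elim: p.2 => [|j u IH]; first by under eq_fun do rewrite /mono big_nil; exact: (msr_cst sG).
 by under eq_fun do rewrite mono_cons /z mxE; exact: (msrM sG).
apply: (@msr_cvg _ _ _ G sG (fun k w => D w * pol (L k) (z w))) => [k|w]; first exact: (msrM sG).
rewrite /patch; case: ifPn => sz; last first.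
 under eq_fun do rewrite DE indicE (negbTE sz) mul0r; exact: cvg_cst.
under eq_fun do rewrite DE indicE sz mul1r.
apply/cvgrPdist_le => e e0; near=> k.
have sz' : simplex (z w) by rewrite inE in sz.
apply: (le_trans (hL k _ sz')); rewrite -[leRHS]invrK lef_pV2 ?posrE ?invr_gt0//.
apply: (le_trans (ltW (truncnS_gt _))); rewrite ler_nat ltnS.
by near: k; exact: nbhs_infty_ge.
Unshelve. all: by end_near. Qed.

(* The squared moduli of the entries of a unit row vector times the unitary
   Brownian motion form such a system, whatever the (parameter-dependent) row. *)
Definition simplex_system (Th : Type) (l : Th -> 'I_n -> R -> T -> R) (th : 'I_n -> Th -> Iw -> R -> T -> R) :=
 [/\ forall x j t, 0 <= t -> msr (F t) (l x j t),
   forall x t w, 0 <= t -> simplex (at_row l x t w),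
   forall j, bapI F (th j),
   forall j, germ P F W (tinc (fun x => l x j)) (fun x t w => 2 * (1 - n%:R * l x j t w)) (th j) &
   forall x j j' t w, 0 <= t -> \sum_v th j x v t w * th j' x v t w = 4 * (dlt R j j' * l x j t w - l x j t w * l x j' t w)].

(** The generator maps a monomial to terms of lower degree, listed by [low], minus [rate] times
    itself. In the head coefficient [2] comes from the drift of the coordinate [j], and [4] from its
    bracket with each further factor of index [j]. *)
Fixpoint low (u : seq 'I_n) : seq (R * seq 'I_n) :=
 if u is j :: u' then (2 + 4 * (count_mem j u')%:R, u') :: [seq (p.1, j :: p.2) | p <- low u'] else [::].
Fixpoint rate (u : seq 'I_n) : R := if u is j :: u' then rate u' + 2 * n%:R + 4 * (size u')%:R else 0.
Definition mono_gen u (z : 'rV[R]_n) := pol (low u) z - rate u * mono u z.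

Lemma low_size u p : p \in low u -> (size p.2 < size u)%N.
Proof.
elim: u p => //= j u IH p; rewrite inE => /predU1P[->//|/mapP[q qu ->]] /=.
by rewrite ltnS; exact: IH.
Qed.

Lemma rate_ge0 u : 0 <= rate u.
Proof. by elim: u => //= j u IH; rewrite !addr_ge0// mulr_ge0. Qed.

Lemma mono_itv u (z : 'rV[R]_n) : simplex z -> 0 <= mono u z /\ mono u z <= 1.
Proof.
move=> sz; elim: u => [|j u [h1 h2]]; first by rewrite /mono big_nil.
have z1 : z 0 j <= 1 by rewrite -sz.2 (bigD1 j)//= lerDl; apply: sumr_ge0 => i _; exact: sz.1.
by rewrite mono_cons mulr_ge0 ?sz.1//; split => //; rewrite mulr_ile1// sz.1.
Qed.

(** The product rule behind [low] and [rate]: the drift of the new factor, and its bracket with the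
    remaining monomial, which [mono_noise_gram] computes. *)
Lemma mono_genE j u z : mono_gen (j :: u) z =
 z 0 j * mono_gen u z + (2 * (1 - n%:R * z 0 j) + 4 * ((count_mem j u)%:R - (size u)%:R * z 0 j)) * mono u z.
Proof.
rewrite /mono_gen /= mono_cons /pol big_cons big_map /=.
under eq_bigr do rewrite mono_cons mulrCA; rewrite -mulr_sumr; ring.
Qed.

Lemma continuous_mono u : continuous (fun z : 'rV[R]_n => mono u z).
Proof.
have ext (f g : 'rV[R]_n -> R) : (forall z, g z = f z) -> continuous f -> continuous g by move=> /funext ->.
elim: u => [|j u IH].
 by apply: (ext (fun=> 1)); [move=> z; rewrite /mono big_nil|exact: cst_continuous].
apply: (ext (fun z => z 0 j * mono u z)) => [z|z]; first exact: mono_cons.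
by apply: (@continuousM _ _ (fun z : 'rV[R]_n => z 0 j) (fun z => mono u z)); [exact: coord_continuous|exact: IH].
Qed.

Section one_system.
Variables (Th : Type) (l : Th -> 'I_n -> R -> T -> R) (th : 'I_n -> Th -> Iw -> R -> T -> R).
Hypothesis hs : simplex_system l th.

Let ml x j t : 0 <= t -> msr (F t) (l x j t). Proof. by case: hs => h *; exact: h. Qed.
Let sl x t w : 0 <= t -> simplex (at_row l x t w). Proof. by case: hs => _ h *; exact: h. Qed.
Let bth j : bapI F (th j). Proof. by case: hs. Qed.
Let gl j : germ P F W (tinc (fun x => l x j)) (fun x t w => 2 * (1 - n%:R * l x j t w)) (th j). Proof. by case: hs. Qed.
Let gram x j j' t w : 0 <= t -> \sum_v th j x v t w * th j' x v t w = 4 * (dlt R j j' * l x j t w - l x j t w * l x j' t w).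
Proof. by case: hs => _ _ _ _; exact. Qed.

Lemma sys_itv x j t w : 0 <= t -> 0 <= l x j t w /\ l x j t w <= 1.
Proof.
move=> t0; have [h _] := sl x w t0; have := mono_itv [:: j] (sl x w t0).
by rewrite mono_cons /mono big_nil mulr1 mxE.
Qed.

Lemma sys_norm x j t w : 0 <= t -> `|l x j t w| <= 1.
Proof. by move=> /(sys_itv x j w)[h1 h2]; rewrite ger0_norm. Qed.

Lemma bap_sys j : bap F (fun x => l x j).
Proof. by exists 1 => // x t t0; split; [exact: ml|move=> w; exact: sys_norm]. Qed.

Lemma bap_mono u : bap F (fun x t w => mono u (at_row l x t w)).
Proof.
exists 1 => // x t t0; split.
 have sa := filt_sa hF t0; elim: u => [|j u IH].
  by under eq_fun do rewrite /mono big_nil; exact: (msr_cst sa).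
 by under eq_fun do rewrite mono_cons mxE; apply: (msrM sa) => //; exact: ml.
by move=> w; have [h1 h2] := mono_itv u (sl x w t0); rewrite ger0_norm.
Qed.

Lemma germ2_sys j : germ2 P W (tinc (fun x => l x j)) (th j).
Proof.
have hb : bap F (fun x t w => 2 * (1 - n%:R * l x j t w)).
 by apply: (bapM hF (bap_cst hF _ _)); apply: (bapB hF (bap_cst hF _ _)); apply: (bapM hF (bap_cst hF _ _)); exact: bap_sys.
by apply: (germ2_itv hF hW (fun x t => @ml x j t) (fun x t w => @sys_itv x j t w) hb (bth j) (gl j)).
Qed.

Fixpoint mono_noise u x v t w : R :=
 if u is j :: u' then l x j t w * mono_noise u' x v t w + mono u' (at_row l x t w) * th j x v t w else 0.

Lemma bap_noise u : bapI F (mono_noise u).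
Proof.
move=> v; elim: u => [|j u IH] /=; first exact: (bap_cst hF).
by apply: (bapD hF); apply: (bapM hF); [exact: bap_sys|exact: IH|exact: bap_mono|exact: bth].
Qed.

Lemma mono_noise_gram u x j t w : 0 <= t -> \sum_v th j x v t w * mono_noise u x v t w =
 4 * ((count_mem j u)%:R - (size u)%:R * l x j t w) * mono u (at_row l x t w).
Proof.
move=> t0; elim: u => [|i u IH] /=; first by rewrite big1 => [|v _]; rewrite ?mulr0//; ring.
transitivity (l x i t w * (\sum_v th j x v t w * mono_noise u x v t w) +
  mono u (at_row l x t w) * \sum_v th j x v t w * th i x v t w).
 by rewrite !mulr_sumr -big_split; apply: eq_bigr => v _ /=; ring.
rewrite IH gram// mono_cons mxE natrD -(natr1 (size u)) /dlt eq_sym.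
by case: eqP => [->|_] /=; ring.
Qed.

Lemma germ_mono u : germ P F W (tinc (fun x t w => mono u (at_row l x t w)))
 (fun x t w => mono_gen u (at_row l x t w)) (mono_noise u).
Proof.
have mm v x t : 0 <= t -> measf (fun w => mono v (at_row l x t w)).
 by move=> t0; exact: (bap_meas hF x (bap_mono v) t0).
have bg v : bap F (fun x t w => mono_gen v (at_row l x t w)).
 elim: v => [|j v IH].
  apply: (bap_ext (bap_cst hF _ 0)) => x t w _; rewrite /mono_gen /pol /= big_nil; ring.
 apply: (@bap_ext _ _ _ F Th (fun x t w => l x j t w * mono_gen v (at_row l x t w) +
   (2 * (1 - n%:R * l x j t w) + 4 * ((count_mem j v)%:R - (size v)%:R * l x j t w)) * mono v (at_row l x t w))).
  apply: (bapD hF); apply: (bapM hF) => //; [exact: bap_sys| |exact: bap_mono].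
  apply: (bapD hF); apply: (bapM hF (bap_cst hF _ _)); apply: (bapB hF (bap_cst hF _ _));
   apply: (bapM hF (bap_cst hF _ _)); exact: bap_sys.
 by move=> x t w _; rewrite mono_genE mxE.
elim: u => [|j u IH].
 have h0 (j : 'I_0) : germ P F W (fun (_ : Th) _ _ _ => 0) (fun _ _ _ => 0) (fun _ _ _ _ => 0) by case: j.
 apply: (germ_eq (germ_lin hF (fun=> 0) h0)) => [x s t w _ _|x t w _|x v t w _].
 - by rewrite /tinc /mono !big_nil big_ord0 subrr.
 - by rewrite /mono_gen /pol /= big_nil big_ord0; ring.
 - by rewrite big_ord0.
have g2 : germ2 P W (tinc (fun x t w => mono u (at_row l x t w))) (mono_noise u).
 apply: (germ2_itv hF hW (a := 0) (c := 1) _ _ (bg u) (bap_noise u) IH).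
  by move=> x t t0; have [K _ h] := bap_mono u; case: (h x t t0).
 by move=> x t w t0; exact: mono_itv (sl x w t0).
have g := germD hF (germD hF (germ_bap hF IH (bap_sys j)) (germ_bap hF (gl j) (bap_mono u)))
 (germ2_prod hF hW (bth j) (bap_noise u) (germ2_sys j) g2).
apply: (germ_eq g).
- by move=> x s t w s0 st; rewrite /tinc !mono_cons !mxE; ring.
- by move=> x t w t0; rewrite mono_genE mxE mono_noise_gram//; ring.
- by move=> x v t w t0 /=; ring.
Qed.

Lemma bap_simplex f : {within simplex, continuous f} -> bap F (fun x t w => f (at_row l x t w)).
Proof.
move=> cf; have [M M0 hM] := compact_bound simplex_compact cf.
exists M => // x t t0; split=> [|w]; last by apply: hM; exact: sl.
have := msr_simplex (filt_sa hF t0) cf (fun j => @ml x j t t0).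
by congr msr; apply/funext => w; rewrite patchE mem_set//; exact: sl.
Qed.

Definition jacobi_gen f (z : 'rV[R]_n) := \sum_j partial j f z * (2 * (1 - n%:R * z 0 j))
 + 2^-1 * \sum_j \sum_i partial i (partial j f) z * (4 * (dlt R j i * z 0 j - z 0 j * z 0 i)).

Lemma bap_jacobi_gen f : C2 f -> bap F (fun x t w => jacobi_gen f (at_row l x t w)).
Proof.
move=> [h1 h2].
have b1 j : bap F (fun x t w => partial j f (at_row l x t w)).
 by apply: bap_simplex; apply: continuous_subspaceT; exact: (h1 j).2.
have b2 j i : bap F (fun x t w => partial i (partial j f) (at_row l x t w)).
 by apply: bap_simplex; apply: continuous_subspaceT; exact: (h2 j i).2.
apply: (@bap_ext _ _ _ F Th (fun x t w => \sum_j partial j f (at_row l x t w) * (2 * (1 - n%:R * l x j t w))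
 + 2^-1 * \sum_j \sum_i partial i (partial j f) (at_row l x t w) * (4 * (dlt R j i * l x j t w - l x j t w * l x i t w)))).
 apply: (bapD hF).
  apply: (bap_sum hF) => j; apply: (bapM hF) => //; apply: (bapM hF (bap_cst hF _ _)).
  by apply: (bapB hF (bap_cst hF _ _)); apply: (bapM hF (bap_cst hF _ _)); exact: bap_sys.
 apply: (bapM hF (bap_cst hF _ _)); apply: (bap_sum hF) => j; apply: (bap_sum hF) => i.
 apply: (bapM hF) => //; apply: (bapM hF (bap_cst hF _ _)); apply: (bapB hF); apply: (bapM hF);
  (exact: bap_sys || exact: (bap_cst hF)).
move=> x t w _; rewrite /jacobi_gen; congr (_ + _ * _).
 by apply: eq_bigr => j _; rewrite mxE.
by apply: eq_bigr => j _; apply: eq_bigr => i _; rewrite !mxE.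
Qed.

(** Ito's formula in several variables. The Taylor remainder is controlled by the squared supremum
    norm of the displacement, hence by the sum of squared increments, as [germ_remainder]
    demands. *)
Lemma germ_C2 f : C2 f -> germ P F W (tinc (fun x t w => f (at_row l x t w)))
 (fun x t w => jacobi_gen f (at_row l x t w)) (fun x v t w => \sum_j partial j f (at_row l x t w) * th j x v t w).
Proof.
move=> hf; have [h1 h2] := hf.
have b0 := bap_simplex (C1_within h1).
have b1 j : bap F (fun x t w => partial j f (at_row l x t w)).
 by apply: bap_simplex; apply: continuous_subspaceT; exact: (h1 j).2.
have b2 j i : bap F (fun x t w => partial i (partial j f) (at_row l x t w)).
 by apply: bap_simplex; apply: continuous_subspaceT; exact: (h2 j i).2.
have mt j x s t : 0 <= s -> s <= t -> measf (tinc (fun x => l x j) x s t).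
 move=> s0 st; have t0 := le_trans s0 st.
 by apply: measurable_funB; [exact: (bap_meas hF x (bap_sys j) t0)|exact: (bap_meas hF x (bap_sys j) s0)].
pose Rm x s t w := taylor_remainder f (at_row l x s w) (at_row l x t w).
pose Rm' x s t w := f (at_row l x t w) - f (at_row l x s w)
  - \sum_j partial j f (at_row l x s w) * tinc (fun x => l x j) x s t w
  - 2^-1 * \sum_j \sum_i partial i (partial j f) (at_row l x s w) * (tinc (fun x => l x j) x s t w * tinc (fun x => l x i) x s t w).
have RE x s t w : Rm x s t w = Rm' x s t w.
 rewrite /Rm /Rm' /taylor_remainder /tinc; congr (_ - _ - _ * _).
  by apply: eq_bigr => j _; rewrite !mxE.
 by apply: eq_bigr => j _; apply: eq_bigr => i _; rewrite !mxE.
have nE x s t w : `|at_row l x t w - at_row l x s w| ^+ 2 <= \sum_j tinc (fun x => l x j) x s t w ^+ 2.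
 apply: (le_trans (row_norm_sqr _)); apply: ler_sum => j _; by rewrite !mxE.
have gR : germ P F W Rm (fun _ _ _ => 0) (fun _ _ _ _ => 0).
 have [C hC] := second_order_bound hf.
 apply: (@germ_remainder _ _ _ P F hF Iw W hW Th 'I_n (fun j => tinc (fun x => l x j)) th Rm `|C|) => //.
 - exact: germ2_sys.
 - move=> x s t s0 st; have t0 := le_trans s0 st; rewrite (_ : Rm x s t = Rm' x s t); last by apply/funext => w; exact: RE.
  apply: measurable_funB.
   apply: measurable_funB; first by apply: measurable_funB; exact: (bap_meas hF x b0).
   by apply: measurable_sum => j; apply: measurable_funM; [exact: (bap_meas hF x (b1 j) s0)|exact: mt].
  apply: measurable_funM; first exact: measurable_cst.
  apply: measurable_sum => j; apply: measurable_sum => i; apply: measurable_funM; first exact: (bap_meas hF x (b2 j i) s0).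
  by apply: measurable_funM; exact: mt.
 - move=> x s t w s0 st; have t0 := le_trans s0 st; apply: (le_trans (hC _ _ (sl x w s0) (sl x w t0))).
  apply: (@le_trans _ _ (`|C| * `|at_row l x t w - at_row l x s w| ^+ 2)).
   by rewrite ler_wpM2r ?sqr_ge0// ler_norm.
  by rewrite ler_wpM2l.
 move=> e e0; have [dl dl0 hd] := second_order hf e0; exists dl => // x s t w s0 st hz.
 apply: (@le_trans _ _ (e * `|at_row l x t w - at_row l x s w| ^+ 2)); last by rewrite ler_wpM2l// ltW.
 apply: hd; [exact: sl|by apply: sl; exact: le_trans st|].
 by apply: row_norm_le => [|j]; [exact: ltW|rewrite !mxE; exact: hz].
have g1 := germ_lin hF (fun _ : 'I_n => 1) (fun j => germ_bap hF (gl j) (b1 j)).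
have g2 := germ_lin hF (fun _ : 'I_n * 'I_n => 2^-1) (fun p => germ_bap hF
 (germ2_prod hF hW (bth p.1) (bth p.2) (germ2_sys p.1) (germ2_sys p.2)) (b2 p.1 p.2)).
have pairE (A : 'I_n -> 'I_n -> R) : \sum_(p : 'I_n * 'I_n) 2^-1 * A p.1 p.2 = 2^-1 * \sum_j \sum_i A j i.
 by rewrite -mulr_sumr pair_bigA.
apply: (germ_eq (germD hF (germD hF g1 g2) gR)).
- move=> x s t w s0 st; rewrite RE /Rm'.
 rewrite (pairE (fun j i => partial i (partial j f) (at_row l x s w) * (tinc (fun x => l x j) x s t w * tinc (fun x => l x i) x s t w))).
 by under eq_bigr do rewrite mul1r; rewrite /tinc /=; ring.
- move=> x t w t0.
 rewrite (pairE (fun j i => partial i (partial j f) (at_row l x t w) * \sum_v th j x v t w * th i x v t w)).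
 rewrite addr0 /jacobi_gen; congr (_ + _ * _).
  by apply: eq_bigr => j _; rewrite mul1r mxE.
 by apply: eq_bigr => j _; apply: eq_bigr => i _; rewrite gram// !mxE.
- move=> x v t w t0; rewrite [X in _ + X + _]big1 ?addr0; last by move=> p _; rewrite !mulr0.
 by apply: eq_bigr => j _; rewrite mul1r.
Qed.

End one_system.

End simplex_system.

Lemma Ex_norm_le d (T : measurableType d) (R : realType) (P : probability T R) (X : T -> R) K :
 L1 P X -> (forall w, `|X w| <= K) -> `|Ex P X| <= K.
Proof.
move=> hX XK; apply: (le_trans (Ex_norm hX)); rewrite -[leRHS](Ex_cst P).
by apply: Ex_le => //; [exact: L1_abs|exact: L1_cst].
Qed.

(** * The transition semigroup and the Markov property *)

Section transition_semigroup.
Context {d} {T : measurableType d} {R : realType} (P : probability T R)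
 (F : R -> set (set T)) (hF : complete_filtration P F)
 (Iw : finType) (W : Iw -> R -> T -> R) (hW : brownian_motion P F W).
Variable n : nat.
Local Notation Ex := (Ex P).
Local Notation L1 := (L1 P).
Local Notation state := {z : 'rV[R]_n | simplex z}.
Local Notation CK f := {within simplex, continuous f}.
Implicit Types (f g : 'rV[R]_n -> R) (x y : state).

Variables (l : state -> 'I_n -> R -> T -> R) (th : 'I_n -> state -> Iw -> R -> T -> R).
Hypothesis hs : simplex_system P F W l th.
Hypothesis l0 : forall x w, at_row l x 0 w = sval x.
Hypothesis modulus : forall e : R, 0 < e -> exists2 dl : R, 0 < dl &
 forall x y, `|sval x - sval y| <= dl -> forall j t w, 0 <= t -> `|l x j t w - l y j t w| <= e.

(** One process per starting point on a common probability space gives the kernels as plain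
    expectations. The value zero off the simplex is a convention, since only restrictions to the
    simplex matter. *)
Definition transition (t : R) f (z : 'rV[R]_n) : R :=
 if pselect (simplex z) is left h then Ex (fun w => f (at_row l (exist _ z h) t w)) else 0.

Lemma transitionE t f x : transition t f (sval x) = Ex (fun w => f (at_row l x t w)).
Proof.
case: x => z h; rewrite /transition /=; case: pselect => // h'.
by rewrite (Prop_irrelevance h' h).
Qed.

Let sl x t w : 0 <= t -> simplex (at_row l x t w). Proof. by case: hs => _ h *; exact: h. Qed.

Lemma CK_mono (u : seq 'I_n) : CK (@mono R n u).
Proof. by apply: continuous_subspaceT; exact: continuous_mono. Qed.

Lemma L1_state (Th : Type) (l' : Th -> 'I_n -> R -> T -> R) th' f (i : Th) t :
 simplex_system P F W l' th' -> CK f -> 0 <= t -> L1 (fun w => f (at_row l' i t w)).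
Proof.
move=> hs' cf t0; have b := bap_simplex hF hs' cf; have [K _ hK] := bap_bound b.
by apply: (@L1_bounded _ _ _ _ _ K); [exact: (bap_meas hF i b t0)|move=> w; exact: hK].
Qed.

Lemma transition_lin t a f g x : 0 <= t -> CK f -> CK g ->
 transition t (fun z => a * f z + g z) (sval x) = a * transition t f (sval x) + transition t g (sval x).
Proof.
move=> t0 cf cg; rewrite !transitionE -ExZ; last exact: (L1_state _ hs).
by rewrite -ExD//; [apply: L1Z|]; exact: (L1_state _ hs).
Qed.

Lemma CK_lin a f g : CK f -> CK g -> CK (fun z => a * f z + g z).
Proof.
move=> cf cg z; apply: cvgD; last exact: cg.
by apply: cvgM; [exact: cvg_cst|exact: cf].
Qed.

Lemma transition_near t f g (e : R) x : 0 <= t -> CK f -> CK g -> (forall z, simplex z -> `|f z - g z| <= e) ->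
 `|transition t f (sval x) - transition t g (sval x)| <= e.
Proof.
move=> t0 cf cg h; rewrite !transitionE -ExB; [|exact: (L1_state _ hs)|exact: (L1_state _ hs)].
by apply: Ex_norm_le => [|w]; [apply: L1B; exact: (L1_state _ hs)|apply: h; exact: sl].
Qed.

(** [modulus] holds for every outcome and uniformly in time, so continuity in the starting point
    requires no convergence of laws. *)
Lemma CK_transition t f : 0 <= t -> CK f -> CK (transition t f).
Proof.
move=> t0 cf; apply/subspace_continuousP => z sz; apply/cvgrPdist_le => e e0.
have [d1 d10 h1] := compact_unif simplex_compact cf e0.
have [d2 d20 h2] := modulus d10.
rewrite near_withinE; near=> y => sy.
have zy : `|z - y| <= d2 by near: y; exact: cvgr_dist_le.
rewrite -[from_subspace _ _ z]/(transition t f (sval (exist _ z sz))) -[from_subspace _ _ y]/(transition t f (sval (exist _ y sy))).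
rewrite !transitionE -ExB; [|exact: (L1_state _ hs)|exact: (L1_state _ hs)].
set X := exist _ z sz; set Y := exist _ y sy.
apply: Ex_norm_le => [|w]; first by apply: L1B; exact: (L1_state _ hs).
apply: h1; [exact: sl|exact: sl|apply: row_norm_le => [|j]; first exact: ltW].
by rewrite !mxE; apply: (h2 X Y).
Unshelve. all: by end_near. Qed.

Lemma transition0 f x : transition 0 f (sval x) = f (sval x).
Proof. by rewrite transitionE -[RHS](Ex_cst P); congr (Ex _); apply/funext => w; rewrite l0. Qed.

Lemma transition_cst t c x : transition t (fun=> c) (sval x) = c.
Proof. by rewrite transitionE Ex_cst. Qed.

Lemma transition_ge0 t f x : 0 <= t -> (forall z, simplex z -> 0 <= f z) -> 0 <= transition t f (sval x).
Proof. by move=> t0 h; rewrite transitionE; apply: Ex_ge0 => w; apply: h; exact: sl. Qed.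

Lemma bap_mono_gen (Th : Type) (l' : Th -> 'I_n -> R -> T -> R) th' u : simplex_system P F W l' th' ->
 bap F (fun i t w => mono_gen u (at_row l' i t w)).
Proof.
move=> hs'; apply: (bapB hF); last by apply: (bapM hF (bap_cst hF _ _)); exact: (bap_mono hF hs').
by apply: (bap_sum hF) => p; apply: (bapM hF (bap_cst hF _ _)); exact: (bap_mono hF hs').
Qed.

Lemma mono_gen_mean (m : seq 'I_n -> T -> R) (c : T -> R) u : (forall v, L1 (fun w => c w * m v w)) ->
 let gm w := \sum_(p <- low u) p.1 * m p.2 w - rate u * m u w in
 L1 (fun w => c w * gm w) /\ Ex (fun w => c w * gm w) =
 \sum_(p <- low u) p.1 * Ex (fun w => c w * m p.2 w) - rate u * Ex (fun w => c w * m u w).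
Proof.
move=> h gm.
have -> : (fun w => c w * gm w) =
  (fun w => \sum_(p <- low u) p.1 * (c w * m p.2 w) - rate u * (c w * m u w)).
 apply/funext => w; rewrite mulrBr mulr_sumr mulrCA; congr (_ - _).
 by apply: eq_bigr => p _; rewrite mulrCA.
have Lr := L1Z (rate u) (h u).
have Ls : L1 (fun w => \sum_(p <- low u) p.1 * (c w * m p.2 w)).
 by apply: L1_sum => p _; exact: L1Z.
split; first exact: L1B.
rewrite ExB// ExZ// Ex_sum => [|p _]; last exact: L1Z.
by congr (_ - _); apply: eq_bigr => p _; rewrite ExZ.
Qed.

Lemma transition_step u (T0 e : R) : 0 < e -> exists2 dl : R, 0 < dl & forall x r r', 0 <= r -> r <= r' -> r' <= T0 -> r' - r <= dl ->
 `|transition r' (mono u) (sval x) - transition r (mono u) (sval x) - (r' - r) *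
  (\sum_(p <- low u) p.1 * transition r (mono p.2) (sval x) - rate u * transition r (mono u) (sval x))| <= e * (r' - r).
Proof.
move=> e0; have bg := bap_mono_gen u hs.
have [dl dl0 hd] := germ_weak hF hW bg (bap_noise hF hs u) (germ_mono hF hW hs u) T0 e0.
exists dl => // x r r' r0 rr' r'T rdl; have r'0 := le_trans r0 rr'.
have sa := filt_sa hF r0.
have c1 (w : T) : `|1 : R| <= 1 by rewrite normr1.
have [_ h] := hd x r r' r0 rr' r'T rdl (fun=> 1) (msr_cst sa 1) c1.
apply: le_trans h; apply: eq_ler; congr (`|_|).
have Lm v : L1 (fun w => 1 * mono v (at_row l x r w)).
 by under eq_fun do rewrite mul1r; apply: (L1_state _ hs) => //; exact: CK_mono.
have Em v : Ex (fun w => 1 * mono v (at_row l x r w)) = transition r (mono v) (sval x).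
 by rewrite transitionE; congr (Ex _); apply/funext => w; rewrite mul1r.
have [Lg] := mono_gen_mean (m := fun v w => mono v (at_row l x r w)) u Lm.
under eq_bigr do rewrite Em; rewrite Em => <-.
have L1m v r1 : 0 <= r1 -> L1 (fun w => mono v (at_row l x r1 w)) by move=> h1; apply: (L1_state _ hs) => //; exact: CK_mono.
rewrite !transitionE -ExZ// -!ExB ?L1m//; [|exact: L1B (L1m _ _ r'0) (L1m _ _ r0)|exact: L1Z].
by congr (Ex _); apply/funext => w; rewrite /tinc /mono_gen /pol; ring.
Qed.

Lemma transition_pol t c u L x : 0 <= t ->
 transition t (pol ((c, u) :: L)) (sval x) = c * transition t (mono u) (sval x) + transition t (pol L) (sval x) /\ CK (pol L : 'rV[R]_n -> R).
Proof.
move=> t0; have cL (M : seq (R * seq 'I_n)) : CK (pol M : 'rV[R]_n -> R).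
 elim: M => [|[a v] M IH].
  rewrite (_ : pol [::] = fun=> 0); first by apply: continuous_subspaceT; exact: cst_continuous.
  by apply/funext => z; rewrite /pol big_nil.
 rewrite (_ : pol _ = fun z => a * mono v z + pol M z); first exact: CK_lin (@CK_mono v) IH.
 by apply/funext => z; rewrite /pol big_cons.
split=> //; rewrite -transition_lin//; last exact: CK_mono.
by congr (transition t _ _); apply/funext => z; rewrite /pol big_cons.
Qed.

Lemma CK_pol (L : seq (R * seq 'I_n)) x : CK (pol L : 'rV[R]_n -> R).
Proof. by have [_ h] := transition_pol 0 [::] L x (lexx 0). Qed.

Lemma transition_pol_small L (e : R) : 0 < e -> exists2 dl : R, 0 < dl & forall x t, 0 <= t -> t <= dl ->
 `|transition t (pol L) (sval x) - pol L (sval x)| <= e.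
Proof.
elim: L e => [|[c u] L IH] e e0.
 exists 1 => // x t t0 _; have -> : pol [::] = fun _ : 'rV[R]_n => 0 by apply/funext => z; rewrite /pol big_nil.
 by rewrite transition_cst subrr normr0 ltW.
have [d1 d10 h1] := IH (e / 2) (divr_gt0 e0 (ltr0Sn _ _)).
have [d2 d20 h2] := transition_step u 1 ltr01.
pose B : R := \sum_(p <- @low R n u) `|p.1| + @rate R n u + 1.
have B0 : 0 < B by rewrite ltr_wpDl// addr_ge0 ?rate_ge0// sumr_ge0.
have q0 : 0 < e / 2 / (B * (`|c| + 1)) by rewrite !divr_gt0// mulr_gt0// ltr_wpDl.
exists (Num.min (Num.min d1 d2) (Num.min 1 (e / 2 / (B * (`|c| + 1))))) => [|x t t0].
 by rewrite !lt_min d10 d20 ltr01.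
rewrite !le_min => /andP[/andP[k1 k2] /andP[k3 k4]].
have [-> _] := transition_pol c u L x t0.
have := h2 x 0 t (lexx 0) t0 k3; rewrite subr0 => /(_ k2); rewrite mul1r !transition0.
under eq_bigr do rewrite transition0.
set g := \sum_(p <- _) _ - _ => h3.
have m01 v : `|mono v (sval x)| <= 1.
 by have [a b] := mono_itv v (svalP x); rewrite ger0_norm.
have hg : `|g| <= B - 1.
 rewrite /B addrK; apply: (le_trans (ler_normB _ _)); apply: lerD.
  by apply: (le_trans (ler_norm_sum _ _ _)); apply: ler_sum => p _; rewrite normrM ler_piMr.
 by rewrite normrM (ger0_norm (rate_ge0 _)) ler_piMr// rate_ge0.
have h4 : `|transition t (mono u) (sval x) - mono u (sval x)| <= t * B.
 rewrite -(subrK (t * g) (_ - _)); apply: (le_trans (ler_normD _ _)).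
 rewrite normrM (ger0_norm t0); have := ler_wpM2l t0 hg; lra.
have h5 : `|c| * `|transition t (mono u) (sval x) - mono u (sval x)| <= e / 2.
 apply: (@le_trans _ _ ((`|c| + 1) * (t * B))).
  by apply: ler_pM => //; rewrite lerDl.
 have c0 : 0 < B * (`|c| + 1) by rewrite mulr_gt0// ltr_wpDl.
 move: k4; rewrite (ler_pdivlMr _ _ c0); have -> : (`|c| + 1) * (t * B) = t * (B * (`|c| + 1)) by ring.
 exact.
rewrite /pol big_cons -/(pol L (sval x)) opprD addrACA -mulrBr; apply: (le_trans (ler_normD _ _)).
by rewrite normrM [leRHS]splitr lerD// h1.
Qed.

(** The operators are contractions for the supremum norm, which reduces continuity at time zero to
    polynomials; there [transition_step] is uniform in the starting point. *)
Lemma transition_small f (e : R) : CK f -> 0 < e -> exists2 dl : R, 0 < dl & forall x t, 0 <= t -> t <= dl ->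
 `|transition t f (sval x) - f (sval x)| <= e.
Proof.
move=> cf e0; have e3 : 0 < e / 3 by rewrite divr_gt0.
have [L hL] := simplex_weierstrass cf e3.
have [dl dl0 hd] := transition_pol_small L e3; exists dl => // x t t0 tdl.
have h1 := transition_near x t0 cf (@CK_pol L x) hL.
have h2 := hd x t t0 tdl; have h3 := hL _ (svalP x); rewrite distrC in h3.
rewrite (_ : _ - _ = (transition t f (sval x) - transition t (pol L) (sval x)) +
 (transition t (pol L) (sval x) - pol L (sval x)) + (pol L (sval x) - f (sval x))); last by ring.
apply: (le_trans (ler_normD _ _)); apply: (le_trans (lerD (ler_normD _ _) (lexx _))).
rewrite (_ : e = e / 3 + e / 3 + e / 3); last by field.
by apply: lerD => //; exact: lerD.
Qed.

(** [germ_weak] between times [0] and [t] with weight one. Germs are uniform in their parameter,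
    here the starting point, and this gives the uniform convergence required of a generator. *)
Lemma transition_generator f (e : R) : C2 f -> 0 < e -> exists2 dl : R, 0 < dl & forall x t, 0 < t -> t <= dl ->
 `|t^-1 * (transition t f (sval x) - f (sval x)) - jacobi_gen f (sval x)| <= e.
Proof.
move=> hf e0; have bg := bap_jacobi_gen hF hs hf; have cf := C1_within hf.1.
have bn : bapI F (fun x v t w => \sum_j partial j f (at_row l x t w) * th j x v t w).
 move=> v; apply: (bap_sum hF) => j; apply: (bapM hF); last by case: hs => _ _ h _ _; exact: h.
 by apply: (bap_simplex hF hs); apply: continuous_subspaceT; exact: (hf.1 j).2.
have [dl dl0 hd] := germ_weak hF hW bg bn (germ_C2 hF hW hs hf) 1 e0.
exists (Num.min dl 1) => [|x t t0]; first by rewrite lt_min dl0 ltr01.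
rewrite le_min => /andP[k1 k2]; have t0' := ltW t0.
have sa := filt_sa hF (lexx 0).
have c1 (w : T) : `|1 : R| <= 1 by rewrite normr1.
have := hd x 0 t (lexx 0) t0' k2; rewrite subr0 => /(_ k1 (fun=> 1) (msr_cst sa 1) c1)[_].
have -> : Ex (fun w => 1 * (tinc (fun x t w => f (at_row l x t w)) x 0 t w - t * jacobi_gen f (at_row l x 0 w))) =
  transition t f (sval x) - (f (sval x) + t * jacobi_gen f (sval x)).
 rewrite transitionE -[X in _ - X](Ex_cst P) -ExB; [|exact: (L1_state _ hs)|exact: L1_cst].
 by congr (Ex _); apply/funext => w; rewrite /tinc l0; ring.
move=> h; rewrite -(ler_pM2l t0) -{1}(ger0_norm t0') -normrM mulrBr mulVKf ?lt0r_neq0//.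
by rewrite opprD addrA in h; rewrite mulrC in h *; rewrite [t * e]mulrC.
Qed.

Section markov.
Variables (l1 : unit -> 'I_n -> R -> T -> R) (th1 : 'I_n -> unit -> Iw -> R -> T -> R).
Hypothesis hs1 : simplex_system P F W l1 th1.
Variables (s : R) (A : set T).
Hypothesis s0 : 0 <= s.
Hypothesis FA : F s A.
Let Z t w := at_row l1 tt t w.
Let sZ t w : 0 <= t -> simplex (Z t w). Proof. by case: hs1 => _ h *; exact: h. Qed.
Let mA : measurable A. Proof. exact: (filt_alg hF s0).2. Qed.
Let A1 w : `|\1_A w : R| <= 1. Proof. exact: indic_le1. Qed.

Lemma L1_A f t : CK f -> 0 <= t -> L1 (fun w => \1_A w * f (Z t w)).
Proof. by move=> cf t0; apply: L1_indicM => //; exact: (L1_state _ hs1). Qed.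

(** Both sides, as functions of [t], satisfy the equation given by [low] and [rate] and agree at
    zero. Induction on the degree equates the lower terms, and Gronwall's lemma with constant
    [rate u] handles the difference. *)
Lemma markov_mono u t : 0 <= t ->
 Ex (fun w => \1_A w * mono u (Z (s + t) w)) = Ex (fun w => \1_A w * transition t (mono u) (Z s w)).
Proof.
have [N] := ubnP (size u); elim: N u t => // N IH u t; rewrite ltnS => uN t0.
pose e1 v r := Ex (fun w => \1_A w * mono v (Z (s + r) w)).
pose e2 v r := Ex (fun w => \1_A w * transition r (mono v) (Z s w)).
suff : `|e1 u t - e2 u t| = 0 by move/eqP; rewrite normr_eq0 subr_eq0 => /eqP.
have LT r v : 0 <= r -> L1 (fun w => \1_A w * transition r (mono v) (Z s w)).
 by move=> r0; apply: L1_A => //; apply: CK_transition => //; exact: CK_mono.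
have LM r v : 0 <= r -> L1 (fun w => \1_A w * mono v (Z (s + r) w)).
 by move=> r0; apply: L1_A; [exact: CK_mono|exact: addr_ge0].
apply: (@gronwall R (fun r => `|e1 u r - e2 u r|) 0 t (rate u) _ t0) => //; first exact: rate_ge0.
 apply/eqP; rewrite normr_eq0 subr_eq0; apply/eqP; congr (Ex _); apply/funext => w; rewrite addr0.
 by rewrite (transition0 (mono u) (exist _ _ (sZ w s0))).
move=> e e0; have e20 : 0 < e / 2 by rewrite divr_gt0.
have bg := bap_mono_gen u hs1.
have [d1 d10 h1] := germ_weak hF hW bg (bap_noise hF hs1 u) (germ_mono hF hW hs1 u) (s + t) e20.
have [d2 d20 h2] := transition_step u t e20.
exists (Num.min d1 d2) => [|r r' r0 rr' r't]; first by rewrite lt_min d10.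
rewrite le_min => /andP[k1 k2]; have r'0 := le_trans r0 rr'; have h0 : 0 <= r' - r by rewrite subr_ge0.
pose g (q : seq 'I_n -> R) := \sum_(p <- low u) p.1 * q p.2 - rate u * q u.
have step1 : `|e1 u r' - e1 u r - (r' - r) * g (e1 ^~ r)| <= e / 2 * (r' - r).
 have sr0 : 0 <= s + r by exact: addr_ge0.
 have a1 : s + r <= s + r' by rewrite lerD2l.
 have a2 : s + r' <= s + t by rewrite lerD2l.
 have a3 : s + r' - (s + r) = r' - r by ring.
 have := h1 tt (s + r) (s + r') sr0 a1 a2; rewrite a3 => /(_ k1 \1_A) h.
 have [|//|_ ] := h.
  by apply: (msr_indic (filt_sa hF sr0)); apply: (filt_le hF s0 _ FA); rewrite lerDl.
 apply: le_trans; apply: eq_ler; congr (`|_|).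
 have [Lg] := mono_gen_mean (m := fun v w => mono v (Z (s + r) w)) u (fun v => LM r v r0).
 rewrite -/(g (e1 ^~ r)) => <-.
 rewrite /e1 -ExZ// -!ExB ?LM//; [|exact: L1B (LM _ _ r'0) (LM _ _ r0)|exact: L1Z].
 by congr (Ex _); apply/funext => w; rewrite /tinc /mono_gen /pol -/(Z _ w); ring.
have step2 : `|e2 u r' - e2 u r - (r' - r) * g (e2 ^~ r)| <= e / 2 * (r' - r).
 pose q z := transition r' (mono u) z - transition r (mono u) z - (r' - r) * g (fun v => transition r (mono v) z).
 have hq w : `|q (Z s w)| <= e / 2 * (r' - r) by have := h2 (exist _ _ (sZ w s0)) r r' r0 rr' r't k2.
 have [Lg] := mono_gen_mean (m := fun v w => transition r (mono v) (Z s w)) u (fun v => LT r v r0).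
 rewrite -/(g (e2 ^~ r)) => <-.
 have -> : e2 u r' - e2 u r - (r' - r) * Ex (fun w => \1_A w * g (fun v => transition r (mono v) (Z s w))) =
   Ex (fun w => \1_A w * q (Z s w)).
  rewrite /e2 -ExZ// -!ExB ?LT//; [|exact: L1B (LT _ _ r'0) (LT _ _ r0)|exact: L1Z].
  by congr (Ex _); apply/funext => w; rewrite /q; ring.
 have Lq : L1 (fun w => \1_A w * q (Z s w)).
  rewrite (_ : (fun w => _) = fun w => \1_A w * transition r' (mono u) (Z s w) - \1_A w * transition r (mono u) (Z s w)
   - (r' - r) * (\1_A w * g (fun v => transition r (mono v) (Z s w)))); last by apply/funext => w; rewrite /q; ring.
  by apply: L1B; [exact: L1B (LT _ _ r'0) (LT _ _ r0)|exact: L1Z].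
 by apply: (Ex_norm_le Lq) => w; rewrite normrM -[leRHS]mul1r ler_pM.
have gg : g (e1 ^~ r) - g (e2 ^~ r) = - rate u * (e1 u r - e2 u r).
 rewrite /g (_ : \sum_(p <- low u) p.1 * e1 p.2 r = \sum_(p <- low u) p.1 * e2 p.2 r); first by ring.
 apply: eq_big_seq => p pu; congr (_ * _); apply: IH => //.
 exact: leq_trans (low_size pu) uN.
set a := e1 u r in step1 gg *; set a' := e1 u r' in step1 *; set b := e2 u r in step2 gg *; set b' := e2 u r' in step2 *.
have -> : a' - b' = (a' - a - (r' - r) * g (e1 ^~ r)) - (b' - b - (r' - r) * g (e2 ^~ r)) + (a - b) + (r' - r) * (g (e1 ^~ r) - g (e2 ^~ r)) by ring.
rewrite gg; apply: (le_trans (ler_normD _ _)); rewrite !normrM normrN (ger0_norm h0) (ger0_norm (rate_ge0 _)).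
have k3 := ler_normD (a' - a - (r' - r) * g (e1 ^~ r) - (b' - b - (r' - r) * g (e2 ^~ r))) (a - b).
have k4 := ler_normB (a' - a - (r' - r) * g (e1 ^~ r)) (b' - b - (r' - r) * g (e2 ^~ r)).
have -> : `|a - b| + (rate u * `|a - b| + e) * (r' - r) = `|a - b| + (r' - r) * (rate u * `|a - b|) + (e / 2 * (r' - r) + e / 2 * (r' - r)) by field.
lra.
Qed.

(** Polynomials are uniformly dense in the continuous functions on the simplex, and both sides are
    contractions for the supremum norm. *)
Lemma markov f t : CK f -> 0 <= t ->
 Ex (fun w => \1_A w * f (Z (s + t) w)) = Ex (fun w => \1_A w * transition t f (Z s w)).
Proof.
move=> cf t0; have st0 : 0 <= s + t by exact: addr_ge0.
have mpol (L : seq (R * seq 'I_n)) : Ex (fun w => \1_A w * pol L (Z (s + t) w)) = Ex (fun w => \1_A w * transition t (pol L) (Z s w)).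
 elim: L => [|[c u] L IH].
  congr (Ex _); apply/funext => w.
  have -> : pol [::] = fun _ : 'rV[R]_n => 0 by apply/funext => z; rewrite /pol big_nil.
  by rewrite (transition_cst t 0 (exist _ _ (sZ w s0))).
 have cm := @CK_mono u; have cL : CK (pol L) by have [_ h] := transition_pol c u L (exist _ _ (sZ point s0)) t0.
 have e1 : (fun w => \1_A w * pol ((c, u) :: L) (Z (s + t) w)) = fun w => c * (\1_A w * mono u (Z (s + t) w)) + \1_A w * pol L (Z (s + t) w).
  by apply/funext => w; rewrite /pol big_cons /=; ring.
 have e2 : (fun w => \1_A w * transition t (pol ((c, u) :: L)) (Z s w)) =
   fun w => c * (\1_A w * transition t (mono u) (Z s w)) + \1_A w * transition t (pol L) (Z s w).
  by apply/funext => w; have [-> _] := transition_pol c u L (exist _ _ (sZ w s0)) t0; rewrite /=; ring.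
 rewrite e1 e2 !ExD ?IH ?ExZ ?markov_mono//; try apply: L1Z; apply: L1_A => //; exact: CK_transition.
apply/eqP; rewrite -subr_eq0 -normr_le0; apply/ler_addgt0Pr => e e0; rewrite add0r.
have e2 : 0 < e / 2 by rewrite divr_gt0.
have [L hL] := simplex_weierstrass cf e2.
have cL := @CK_pol L (exist _ _ (sZ point s0)).
have close (g h : 'rV[R]_n -> R) r : CK g -> CK h -> 0 <= r -> (forall z, simplex z -> `|g z - h z| <= e / 2) ->
  `|Ex (fun w => \1_A w * g (Z r w)) - Ex (fun w => \1_A w * h (Z r w))| <= e / 2.
 move=> cg ch r0 gh; rewrite -ExB ?L1_A//.
 apply: Ex_norm_le => [|w]; first by apply: L1B; exact: L1_A.
 by rewrite -mulrBr normrM -[leRHS]mul1r ler_pM// gh//; exact: sZ.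
have k1 := close _ _ _ cf cL st0 hL.
have k2 : `|Ex (fun w => \1_A w * transition t (pol L) (Z s w)) - Ex (fun w => \1_A w * transition t f (Z s w))| <= e / 2.
 apply: close => //; try exact: CK_transition.
 by move=> z sz; rewrite distrC; exact: (transition_near (exist _ z sz) t0 cf cL hL).
rewrite mpol in k1; rewrite [leRHS]splitr; apply: le_trans (lerD k1 k2).
by apply: le_trans (ler_normD _ _); rewrite addrA subrK.
Qed.

End markov.

(** The Markov property of the process started at [x], viewed as a system with a trivial parameter,
    tested on the sure event. *)
Lemma transition_semigroup s t f x : 0 <= s -> 0 <= t -> CK f ->
 transition (s + t) f (sval x) = transition s (transition t f) (sval x).
Proof.
move=> s0 t0 cf; have [h1 h2 h3 h4 h5] := hs.
have hs1 : simplex_system P F W (fun _ : unit => l x) (fun j _ => th j x).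
 split=> //.
 - by move=> i j t'; exact: h1.
 - by move=> i t' w; exact: (h2 x).
 - by move=> j v; have [K K0 hK] := h3 j v; exists K => // i; exact: (hK x).
 - by move=> j T0 e e0; have [dl dl0 hd] := h4 j T0 e e0; exists dl => // i; exact: (hd x).
 - by move=> i j j' t' w; exact: h5.
have := markov hs1 s0 (subalgT (filt_sa hF s0)) cf t0; rewrite !transitionE.
by under eq_fun do rewrite indicT mul1r; move=> ->; under eq_fun do rewrite indicT mul1r.
Qed.

Lemma near_at_right (Q : R -> Prop) : (exists2 dl : R, 0 < dl & forall t, 0 < t -> t <= dl -> Q t) ->
 \forall t \near (0 : R)^'+, Q t.
Proof.
move=> [dl dl0 h]; near=> t; apply: h; first by near: t; exact: nbhs_right_gt.
by near: t; exact: nbhs_right_le.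
Unshelve. all: by end_near. Qed.

Theorem transition_feller : feller_semigroup simplex transition.
Proof.
split; [|split; [|split; [|split; [|split; [|split]]]]].
- exact: CK_transition.
- by move=> t a f g t0 cf cg z sz; exact: (transition_lin a (exist _ z sz) t0 cf cg).
- by move=> t f t0 cf h z sz; exact: (transition_ge0 (exist _ z sz) t0 h).
- by move=> t t0 z sz; exact: (transition_cst t 1 (exist _ z sz)).
- by move=> f cf z sz; exact: (transition0 f (exist _ z sz)).
- by move=> s t f s0 t0 cf z sz; exact: (transition_semigroup (exist _ z sz) s0 t0 cf).
- move=> f cf e e0; apply: near_at_right; have [dl dl0 h] := transition_small cf e0.
 by exists dl => // t t0 tdl z sz; exact: (h (exist _ z sz) t (ltW t0) tdl).
Qed.

Lemma transition_has_generator : has_generator simplex transition (@jacobi_gen R n).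
Proof.
move=> f hf e e0; apply: near_at_right; have [dl dl0 h] := transition_generator hf e0.
by exists dl => // t t0 tdl z sz; exact: (h (exist _ z sz) t t0 tdl).
Qed.

End transition_semigroup.

(** * Systems started from an arbitrary point of the simplex *)

Section unitary_rows.
Context {d} {T : measurableType d} {R : realType} (P : probability T R)
 (F : R -> set (set T)) (hF : complete_filtration P F) (n : nat)
 (W : unitary_index n -> R -> T -> R) (hW : brownian_motion P F W)
 (U : R -> T -> 'M[R[i]]_n) (hU : unitary_sde P F W U).
Variable X : ucomp n -> R -> T -> R.
Hypothesis sX : forall a, sure F (X a).
Hypothesis eX : {ae P, forall w a t, X a t w = ucomponent U a t w}.
Hypothesis uX : forall t w, 0 <= t -> unitary_at X t w.

Lemma row_system (Th : Type) (ar ai : Th -> 'I_n -> T -> R) : (forall x k, msr (F 0) (ar x k)) ->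
 (forall x k, msr (F 0) (ai x k)) -> (forall x w, \sum_k (ar x k w ^+ 2 + ai x k w ^+ 2) = 1) ->
 simplex_system P F W (lam X ar ai) (fun j x => lnoise X ar ai x j).
Proof.
move=> mar mai na; split.
- move=> x j t t0; have [K _ h] := bap_lam hF sX uX mar mai na j.
 by case: (h x t t0).
- move=> x t w t0; split=> [j|]; first by rewrite mxE; exact: lam_ge0.
 by under eq_bigr do rewrite mxE; exact: (lam_sum uX na).
- move=> j; exact: (bapI_lnoise hF sX uX mar mai na).
- move=> j; exact: (germ_lam hF hW hU sX eX uX mar mai na).
- move=> x j j' t w t0; exact: (lnoise_gram uX na).
Qed.

Lemma unitary_at_mx t w : unitary_at X t w ->
 (\matrix_(k, j) (X (k, j, false) t w +i* X (k, j, true) t w)%C : 'M[R[i]]_n) \is unitarymx.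
Proof.
move=> h; apply/unitarymxP/matrixP => k k'; rewrite !mxE; have [h1 h2] := h k k'.
apply/eqP; rewrite eq_complex Re_sum Im_sum; apply/andP; split; apply/eqP.
 have -> : complex.Re ((k == k')%:R : R[i]) = dlt R k k' by rewrite /dlt; case: (k == k').
 by rewrite -[RHS]h1; apply: eq_bigr => j _; rewrite !mxE /=; ring.
have -> : complex.Im ((k == k')%:R : R[i]) = 0 by case: (k == k').
by rewrite -[RHS]h2; apply: eq_bigr => j _; rewrite !mxE /=; ring.
Qed.

(** For square matrices orthonormal rows give orthonormal columns; the norm and the initial value of
    the starting row are sums over columns of [U 0]. *)
Lemma columns t w j j' : unitary_at X t w ->
 \sum_k (X (k, j, false) t w * X (k, j', false) t w + X (k, j, true) t w * X (k, j', true) t w) = dlt R j j' /\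
 \sum_k (X (k, j, false) t w * X (k, j', true) t w - X (k, j, true) t w * X (k, j', false) t w) = 0.
Proof.
move=> /unitary_at_mx/unitarymxP/mulmx1C/matrixP/(_ j j'); rewrite !mxE => h.
have := congr1 (@complex.Re R) h; have := congr1 (@complex.Im R) h; rewrite Re_sum Im_sum.
have -> : complex.Re ((j == j')%:R : R[i]) = dlt R j j' by rewrite /dlt; case: (j == j').
have -> : complex.Im ((j == j')%:R : R[i]) = 0 by case: (j == j').
by move=> h1 h2; split; [rewrite -[RHS]h2|rewrite -[RHS]h1]; apply: eq_bigr => k _; rewrite !mxE /=; ring.
Qed.

Local Notation state := {z : 'rV[R]_n | simplex z}.
Implicit Types x y : state.

(* The row sqrt(x) . U_0^*, which [U_0] maps to sqrt(x). *)
Definition start_re x (k : 'I_n) w : R := \sum_j Num.sqrt (sval x 0 j) * X (k, j, false) 0 w.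
Definition start_im x (k : 'I_n) w : R := - \sum_j Num.sqrt (sval x 0 j) * X (k, j, true) 0 w.

Let rt x j : R := Num.sqrt (sval x 0 j).
Let rt2 x j : rt x j * rt x j = sval x 0 j.
Proof. by rewrite -expr2 sqr_sqrtr// (svalP x).1. Qed.

Lemma msr_start x k : msr (F 0) (start_re x k) /\ msr (F 0) (start_im x k).
Proof.
have sa := filt_sa hF (lexx 0).
split; [|apply: (msrN sa)]; apply: (msr_sum sa) => j; apply: (msrM sa (msr_cst sa _)); exact: (sX _).1.
Qed.

Lemma start_norm x w : \sum_k (start_re x k w ^+ 2 + start_im x k w ^+ 2) = 1.
Proof.
have u := uX w (lexx 0).
transitivity (\sum_j \sum_j' rt x j * rt x j' *
  \sum_k (X (k, j, false) 0 w * X (k, j', false) 0 w + X (k, j, true) 0 w * X (k, j', true) 0 w)).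
 have e k : start_re x k w ^+ 2 + start_im x k w ^+ 2 = \sum_j \sum_j' rt x j * rt x j' *
   (X (k, j, false) 0 w * X (k, j', false) 0 w + X (k, j, true) 0 w * X (k, j', true) 0 w).
  rewrite /start_im sqrrN !expr2 /start_re !mulr_suml -big_split; apply: eq_bigr => j _ /=.
  by rewrite !mulr_sumr -big_split; apply: eq_bigr => j' _ /=; rewrite /rt; ring.
 under eq_bigr do rewrite e; rewrite exchange_big/=; apply: eq_bigr => j _.
 by rewrite exchange_big/=; apply: eq_bigr => j' _; rewrite -mulr_sumr.
rewrite -[RHS](svalP x).2; apply: eq_bigr => j _.
rewrite -rt2 -[RHS](sum_dlt j (fun j' => rt x j * rt x j')).
by apply: eq_bigr => j' _; rewrite (columns j j' u).1 mulrC.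
Qed.

Local Notation l2 := (lam X start_re start_im).

Lemma start_row x w : at_row l2 x 0 w = sval x.
Proof.
have u := uX w (lexx 0); apply/rowP => j; rewrite mxE /lam.
have -> : up X start_re start_im x j 0 w = rt x j.
 rewrite -[RHS](sum_dlt j (fun j' => rt x j')).
 transitivity (\sum_k \sum_j' rt x j' * (X (k, j, false) 0 w * X (k, j', false) 0 w + X (k, j, true) 0 w * X (k, j', true) 0 w)).
  apply: eq_bigr => k _; rewrite /start_re /start_im mulNr opprK !mulr_suml -big_split.
  by apply: eq_bigr => j' _ /=; rewrite /rt; ring.
 rewrite exchange_big/=; apply: eq_bigr => j' _; rewrite -mulr_sumr (columns j j' u).1; exact: mulrC.
have -> : uq X start_re start_im x j 0 w = 0.
 transitivity (\sum_j' rt x j' * \sum_k (X (k, j', false) 0 w * X (k, j, true) 0 w - X (k, j', true) 0 w * X (k, j, false) 0 w)).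
  under [RHS]eq_bigr do rewrite mulr_sumr; rewrite exchange_big/=; apply: eq_bigr => k _.
  rewrite /start_re /start_im mulNr !mulr_suml -sumrB.
  by apply: eq_bigr => j' _ /=; rewrite /rt; ring.
 by apply: big1 => j' _; rewrite (columns j' j u).2 mulr0.
by rewrite expr0n/= addr0 expr2 rt2.
Qed.

Lemma sqrt_modulus (a b : R) : 0 <= a -> 0 <= b -> `|Num.sqrt a - Num.sqrt b| <= Num.sqrt `|a - b|.
Proof.
move=> a0 b0; rewrite -sqrtr_sqr ler_wsqrtr// -{2}(sqr_sqrtr a0) -{2}(sqr_sqrtr b0) subr_sqr normrM.
rewrite -(real_normK (num_real (_ - _))) expr2 ler_wpM2l//.
by rewrite (le_trans (ler_normB _ _))// !ger0_norm ?addr_ge0 ?sqrtr_ge0.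
Qed.

Lemma lam_modulus (e : R) : 0 < e -> exists2 dl : R, 0 < dl &
 forall x y, `|sval x - sval y| <= dl -> forall j t w, 0 <= t -> `|l2 x j t w - l2 y j t w| <= e.
Proof.
(* The square root is Hölder of exponent one half, hence a square for [dl]. The factor [8 n^2] is
   one [n] for the starting row, [2 n] for its product with the matrix, [2] for squaring, and [2]
   for the real and imaginary parts. *)
move=> e0; pose C : R := 8 * n%:R * n%:R + 1; have C0 : 0 < C by rewrite ltr_wpDl// !mulr_ge0.
exists ((e / C) ^+ 2) => [|x y xy j t w t0]; first by rewrite exprn_gt0// divr_gt0.
have eC : 0 <= e / C by rewrite ltW// divr_gt0.
have hrt i : `|rt x i - rt y i| <= e / C.
 apply: (le_trans (sqrt_modulus ((svalP x).1 i) ((svalP y).1 i))).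
 rewrite -[leRHS](ger0_norm eC) -[leRHS]sqrtr_sqr ler_wsqrtr//; apply: le_trans xy.
 by have := row_coord_le (sval x - sval y) i; rewrite !mxE.
have ub a s : 0 <= s -> `|X a s w| <= 1 by move=> s0; exact: (unitary_bound uX).
have sums (c : bool) k : `|\sum_i rt x i * X (k, i, c) 0 w - \sum_i rt y i * X (k, i, c) 0 w| <= n%:R * (e / C).
 rewrite -sumrB; apply: (le_trans (ler_norm_sum _ _ _)).
 rewrite -[X in X%:R * _]card_ord mulr_natl -sumr_const; apply: ler_sum => i _.
 by rewrite -mulrBl normrM -[leRHS]mulr1 ler_pM// ub.
have dre k : `|start_re x k w - start_re y k w| <= n%:R * (e / C) by exact: sums.
have dim k : `|start_im x k w - start_im y k w| <= n%:R * (e / C) by rewrite /start_im -opprD normrN; exact: sums.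
have b (c1 c2 : bool) (s : R) : `|s| = 1 -> `|\sum_k (start_re x k w * X (k, j, c1) t w + s * (start_im x k w * X (k, j, c2) t w))
  - \sum_k (start_re y k w * X (k, j, c1) t w + s * (start_im y k w * X (k, j, c2) t w))| <= n%:R * (2 * (n%:R * (e / C))).
 move=> s1; rewrite -sumrB; apply: (le_trans (ler_norm_sum _ _ _)).
 rewrite -[X in X%:R * (2 * _)]card_ord mulr_natl -sumr_const; apply: ler_sum => k _.
 rewrite (_ : _ - _ = (start_re x k w - start_re y k w) * X (k, j, c1) t w + s * ((start_im x k w - start_im y k w) * X (k, j, c2) t w)); last by ring.
 rewrite mulr_natl mulr2n (le_trans (ler_normD _ _))// lerD//.
  by rewrite normrM -[leRHS]mulr1 ler_pM// ub.
 by rewrite normrM s1 mul1r normrM -[leRHS]mulr1 ler_pM// ub.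
have bu : `|up X start_re start_im x j t w - up X start_re start_im y j t w| <= n%:R * (2 * (n%:R * (e / C))).
 have := b false true (-1) (normrN1 _); congr (`|_ - _| <= _); apply: eq_bigr => k _; ring.
have bq : `|uq X start_re start_im x j t w - uq X start_re start_im y j t w| <= n%:R * (2 * (n%:R * (e / C))).
 have := b true false 1 (normr1 _); congr (`|_ - _| <= _); apply: eq_bigr => k _; ring.
have [pz qz] := upq_itv uX start_norm x j w t0; have [py qy] := upq_itv uX start_norm y j w t0.
have s2 (a c : R) : -1 <= a /\ a <= 1 -> -1 <= c /\ c <= 1 -> `|a - c| <= n%:R * (2 * (n%:R * (e / C))) ->
  `|a ^+ 2 - c ^+ 2| <= n%:R * (2 * (n%:R * (e / C))) * 2.
 move=> [a1 a2] [c1 c2] h; rewrite subr_sqr normrM ler_pM//.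
 by rewrite ler_norml; apply/andP; split; lra.
rewrite /lam (_ : _ - _ = (up X start_re start_im x j t w ^+ 2 - up X start_re start_im y j t w ^+ 2) +
 (uq X start_re start_im x j t w ^+ 2 - uq X start_re start_im y j t w ^+ 2)); last by ring.
apply: (le_trans (ler_normD _ _)); apply: (le_trans (lerD (s2 _ _ pz py bu) (s2 _ _ qz qy bq))).
rewrite (_ : _ + _ = (C - 1) / C * e); last by rewrite /C; ring.
by rewrite ler_piMl ?(ltW e0)// ler_pdivrMr// mul1r gerBl.
Qed.

End unitary_rows.

(** * The generator as a Jacobi operator *)

Section jacobi_operators.
Context {R : realType} {n : nat}.
Implicit Types (f : 'rV[R]_n -> R) (x : 'rV[R]_n).

Lemma jacobi_operator_half f x : jacobi_operator (fun=> 2^-1) f x =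
 \sum_(j < n) x 0 j * (1 - x 0 j) * partial j (partial j f) x
 + \sum_(j < n) (1 - n%:R * x 0 j) * partial j f x
 - \sum_(j < n) \sum_(l < n | l != j) x 0 j * x 0 l * partial j (partial l f) x.
Proof.
rewrite /jacobi_operator; congr (_ + _ - _); apply: eq_bigr => j _; congr (_ * _).
by rewrite sumr_const card_ord -(mulr_natl 2^-1); field.
Qed.

Lemma jacobi_gen_operator f x : jacobi_gen f x = 2 * jacobi_operator (fun=> 2^-1) f x.
Proof.
rewrite jacobi_operator_half /jacobi_gen.
have -> : \sum_j partial j f x * (2 * (1 - n%:R * x 0 j)) = 2 * \sum_(j < n) (1 - n%:R * x 0 j) * partial j f x.
 by rewrite mulr_sumr; apply: eq_bigr => j _; ring.
have -> : \sum_j \sum_i partial i (partial j f) x * (4 * (dlt R j i * x 0 j - x 0 j * x 0 i)) =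
  4 * \sum_(j < n) x 0 j * (1 - x 0 j) * partial j (partial j f) x
  - 4 * \sum_(j < n) \sum_(l < n | l != j) x 0 j * x 0 l * partial j (partial l f) x.
 (* Exchanging the two sums aligns the order of the second derivatives with that in
    [jacobi_operator], so no symmetry of mixed derivatives is invoked. *)
 rewrite exchange_big/= !mulr_sumr -sumrB; apply: eq_bigr => j _.
 rewrite (bigD1 j)//= mulr_sumr; congr (_ + _); first by rewrite /dlt eqxx /=; ring.
 rewrite -sumrN; apply: eq_bigr => i ij; rewrite /dlt (negbTE ij) /=; ring.
by field.
Qed.

End jacobi_operators.

Section flag_adapted.
Context {d} {T : measurableType d} {R : realType} {m : nat}.

Lemma sqnormV (z : R[i]) : sqnorm z^-1 = (sqnorm z)^-1.
Proof.
have [->|z0] := eqVneq z 0; first by rewrite invr0 /sqnorm /= expr0n/= addr0 invr0.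
have s0 : sqnorm z != 0 by rewrite lt0r_neq0// sqnorm_gt0.
apply: (mulIf s0); rewrite mulVf// -sqnormM mulVf// /sqnorm /=; ring.
Qed.

(** Adaptedness is needed for [flag_lambda] itself, not for its regular version, so measurability
    must hold also where the last entry vanishes; there the convention that zero is its own inverse
    keeps the formula valid. *)
Lemma msr_flag_lambda G (M : T -> 'M[R[i]]_m.+1) j : sigma_algebra setT G ->
 (forall k j, msr G (fun w => complex.Re (M w k j)) /\ msr G (fun w => complex.Im (M w k j))) ->
 msr G (fun w => flag_lambda (M w) 0 j).
Proof.
move=> sG h; have mS k : msr G (fun w => sqnorm (M w k j)).
 by have [h1 h2] := h k j; apply: (msrD sG); apply: (msrM sG).
have E w : flag_lambda (M w) 0 j = (1 + \sum_(k < m) sqnorm (M w (lift ord_max k) j) * (sqnorm (M w ord_max j))^-1)^-1.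
 rewrite mxE div1r /flag_radius sqr_sqrtr; last by apply: sumr_ge0 => k _; exact: sqr_ge0.
 by congr (1 + _)^-1; apply: eq_bigr => k _; rewrite normc_sqr sqnormM sqnormV.
rewrite (_ : (fun w => _) = fun w => (1 + \sum_(k < m) sqnorm (M w (lift ord_max k) j) * (sqnorm (M w ord_max j))^-1)^-1);
 last by apply/funext.
apply: (msr_inv sG) => [w|]; first by rewrite addr_ge0// sumr_ge0// => k _; rewrite mulr_ge0 ?invr_ge0 ?sqnorm_ge0.
apply: (msrD sG (msr_cst sG _)); apply: (msr_sum sG) => k; apply: (msrM sG) => //.
by apply: (msr_inv sG) => // w; exact: sqnorm_ge0.
Qed.

End flag_adapted.

Lemma ExE (d : measure_display) (T : measurableType d) (R : realType) (P : probability T R) (A : set T) (f : T -> R) :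
 measurable A -> \int[P]_(w in A) f w = Ex P (fun w => \1_A w * f w).
Proof.
move=> mA; rewrite Rintegral_mkcond; congr Ex; apply/funext => w.
by rewrite patch_indic /= mulrC.
Qed.

Lemma ae_pcont_continuous (d : measure_display) (T : measurableType d) (R : realType) (P : probability T R)
 (Y Z : R -> T -> R) : (forall w, pcont (Z ^~ w)) -> {ae P, forall w t, 0 <= t -> Y t w = Z t w} -> as_continuous P Y.
Proof.
move=> cZ; apply: filterS => w e; apply/within_pcont => T0 eps eps0.
have [dl dl0 h] := cZ w T0 eps eps0; exists dl => // s t s0 sT t0 tT st.
by rewrite !e//; exact: h.
Qed.

(** * The two conclusions for the last row of [U] *)

Section last_row.
Context {d} {T : measurableType d} {R : realType} (P : probability T R)
 (F : R -> set (set T)) (hF : complete_filtration P F).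
Variable m : nat.
Local Notation n := m.+1.
Context (W : unitary_index n -> R -> T -> R) (hW : brownian_motion P F W)
 (U : R -> T -> 'M[R[i]]_n) (hU : unitary_sde P F W U).
Variable X : ucomp n -> R -> T -> R.
Hypothesis sX : forall a, sure F (X a).
Hypothesis eX : {ae P, forall w a t, X a t w = ucomponent U a t w}.
Hypothesis uX : forall t w, 0 <= t -> unitary_at X t w.
Local Notation lrow := (@last_row d T R m).
Local Notation nrow := (@no_row d T R m).
Hypothesis pos : forall x j t w, 0 <= t -> 0 < lam X lrow nrow x j t w.

Local Notation lambda := (fun t w => flag_lambda (U t w)).
Let mr (x : unit) k : msr (F 0) (lrow x k). Proof. exact: (msr_last_row hF). Qed.
Let mn (x : unit) k : msr (F 0) (nrow x k). Proof. exact: (msr_no_row hF). Qed.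
Let nr (x : unit) (w : T) : \sum_(k < n) (lrow x k w ^+ 2 + nrow x k w ^+ 2) = 1 :> R. Proof. exact: norm_last_row. Qed.
Local Notation L := (lam X lrow nrow).

(** The regular version is unitary with a nonvanishing last row at all times, so [flag_lambdaE]
    applies on every path where it coincides with [U]. *)
Lemma flag_lambda_row : {ae P, forall w t, 0 <= t -> lambda t w = at_row L tt t w}.
Proof.
apply: filterS eX => w e t t0; have eU : U t w = \matrix_(k, j) (X (k, j, false) t w +i* X (k, j, true) t w)%C.
 by apply/matrixP => k j; rewrite mxE !e /ucomponent /=; case: (U t w k j).
have lE j := lam_last_row tt j (fun a => e a t).
apply/rowP => j; rewrite [RHS]mxE lE flag_lambdaE//.
 by rewrite eU; apply: unitary_at_mx; exact: uX.
by rewrite -sqnorm_gt0 -lE; exact: pos.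
Qed.

Let eL : {ae P, forall w t, 0 <= t -> forall j, lambda t w 0 j = L tt j t w}.
Proof. by apply: filterS flag_lambda_row => w h t t0 j; rewrite h// mxE. Qed.

Let mL j t : 0 <= t -> msr (F t) (fun w => lambda t w 0 j).
Proof.
move=> t0; apply: (msr_flag_lambda j (filt_sa hF t0)) => k i; have [h _] := hU; have [[h1 _] [h2 _]] := h k i.
by split => B mB; [exact: h1|exact: h2].
Qed.

Lemma ca_lambda j : continuous_adapted P F (fun t w => lambda t w 0 j).
Proof.
split; first by move=> t t0 B mB; exact: mL.
apply: (ae_pcont_continuous (Z := L tt j)) => [w|]; first exact: (pcont_lam sX).
by apply: filterS eL => w h t t0; exact: h.
Qed.

Theorem lambda_sde : exists gamma : 'I_n -> 'I_n -> R -> T -> R,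
  [/\ brownian_motion P F (fun p : upper_pair n => gamma (val p).1 (val p).2),
    forall l j : 'I_n, (j < l)%N -> forall t w, gamma l j t w = - gamma j l t w,
    forall j : 'I_n, continuous_adapted P F (fun t w => lambda t w 0 j)
   & exists I : 'I_n -> 'I_n -> R -> T -> R,
     (forall l j : 'I_n, l != j ->
       ito_integral P F (fun t w => Num.sqrt (lambda t w 0 l * lambda t w 0 j)) (gamma l j) (I l j)) /\
     {ae P, forall w, forall t, 0 <= t -> forall j : 'I_n,
       lambda t w 0 j = lambda 0 w 0 j
        + \int[lebesgue_measure]_(s in `[0, t]) (2 * (1 - n%:R * lambda s w 0 j))
        + 2 * \sum_(l < n | l != j) I l j t w}].
Proof.
pose p j := up X lrow nrow tt j.
pose q j := uq X lrow nrow tt j.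
have fE (Y : unit -> R -> T -> R) : cpar (Y tt) = Y by apply/funext => -[].
have fV (Y : unit -> unitary_index n -> R -> T -> R) : cfam (Y tt) = Y by apply/funext => -[].
have bp j : bac F (p j).
 split; last exact: (pcont_up sX).
 by have := bap_up hF sX uX mr mn nr j; rewrite -(fE (fun x => up X _ _ x j)).
have bq j : bac F (q j).
 split; last exact: (pcont_uq sX).
 by have := bap_uq hF sX uX mr mn nr j; rewrite -(fE (fun x => uq X _ _ x j)).
have sp j t w : 0 <= t -> 0 < sql p q j t w by exact: (pos tt).
have gs j : germ P F W (inc (sql p q j)) (cpar (sql_drift p q j)) (cfam (sql_noise p q j)).
 have := germ_lam hF hW hU sX eX uX mr mn nr j.
 by rewrite -(fE (fun x t w => 2 * (1 - n%:R * L x j t w))) -(fV (fun x => lnoise X _ _ x j)).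
have [gamma [I [hg anti hI eq]]] := simplex_sde hF hW bp bq sp gs.
exists gamma; split => //.
(* The reference Brownian motion is made of the coordinates [inl (inl e)] of [W], indexed by the
   same upper pairs as [gamma]. *)
- apply: (@levy _ _ _ P F hF _ W hW _ _ (fun e : upper_pair n => unit_edge p q (val e).1 (val e).2) (fun e => inl (inl e))).
 + by move=> e e' [].
 + split.
  * by move=> e t t0; have [[h _] _ _ _] := hg e; exact: h.
  * by move=> e; apply: bapI_cfam => v; exact: (bac_unit_edge hF bp bq sp).
  * by move=> e; case: (hg e).
  * by move=> e; case: (hg e).
  * by move=> e e' t w t0; exact: (unit_edge_gram sp).
 + by move=> e; case: (hg e).
 + by move=> e; case: (hg e).
- exact: ca_lambda.
exists I; split.
 move=> l j lj; apply: (ito_integral_ext hF (hI l j lj)).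
  split; first by move=> t t0 B mB; apply: (msr_sqrt (msrM (filt_sa hF t0) (mL l t0) (mL j t0))).
  apply: (ae_pcont_continuous (Z := geo p q l j)); first exact: (sure_geo hF bp bq l j).2.
  by apply: filterS eL => w h t t0; rewrite !h.
 by apply: filterS eL => w h t t0; rewrite !h.
apply: filterS2 eL eq => w h1 h2 t t0 j; rewrite !h1//.
rewrite [LHS](h2 t t0 j); congr (_ + _ + _).
by apply: eq_Rintegral => s; rewrite inE /= in_itv /= => /andP[s0 _]; rewrite h1.
Qed.

(** Two systems live on the same space: the last row, which is the given process, and the rows
    started from every point, which define the semigroup. They obey the same moment equations, so
    [markov] links the former to the semigroup of the latter. *)
Theorem lambda_jacobi : jacobi_process P F (fun=> 2^-1) 2 lambda.
Proof.
split; first by move=> j; rewrite (@lt_trans _ _ 0) ?oppr_lt0 ?invr_gt0.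
have hs1 := row_system hF hW hU sX eX uX mr mn nr.
have hs2 := row_system hF hW hU sX eX uX (fun x k => (msr_start hF sX x k).1) (fun x k => (msr_start hF sX x k).2) (start_norm uX).
pose l2 := lam X (start_re X) (start_im X).
have e0 := start_row uX; have mo := lam_modulus uX.
split; first exact: ca_lambda.
split.
 apply: filterS flag_lambda_row => w h t t0; rewrite h//.
 by have [_ h2 _ _ _] := hs1; exact: h2.
exists (transition P l2); split.
- exact: (transition_feller hF hW hs2 e0 mo).
- have := transition_has_generator hF hW hs2 e0.
 by congr has_generator; apply/funext => f; apply/funext => x; exact: jacobi_gen_operator.
move=> s t s0 t0 A FA f cf; have st0 := addr_ge0 s0 t0.
have mA : measurable A by exact: (filt_alg hF s0).2.
have meas (g : 'rV[R]_n -> R) r : {within simplex, continuous g} -> 0 <= r ->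
  \int[P]_(w in A) (g \_ simplex) (lambda r w) = Ex P (fun w => \1_A w * g (at_row L tt r w)).
 move=> cg r0; rewrite ExE//; apply: Ex_ae.
 - apply: measurable_funM; first exact: measurable_indic.
  have := msr_simplex (filt_sa hF r0) cg (fun j => mL j r0).
  move/(msr_meas (filt_alg hF r0)); congr (measurable_fun _ _).
  by apply/funext => w; congr ((g \_ simplex) _); apply/rowP => j; rewrite mxE.
 - by apply: measurable_funM; [exact: measurable_indic|exact: (bap_meas hF tt (bap_simplex hF hs1 cg) r0)].
 - apply: filterS flag_lambda_row => w h; rewrite h// patchE mem_set//.
  by have [_ h2 _ _ _] := hs1; exact: h2.
rewrite !meas//; last exact: (CK_transition hF hs2 mo).
exact: (markov hF hW hs2 e0 mo hs1 s0 FA cf t0).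
Qed.

End last_row.

(* n = m + 1, so that row n of a matrix is row [ord_max]. *)
Theorem theorem3p5 (d : measure_display) (T : measurableType d) (R : realType)
    (P : probability T R) (F : R -> set (set T))
    (hF : complete_filtration P F)
    (m : nat) (n := m.+1) (hn : (2 <= n)%N)
    (W : unitary_index n -> R -> T -> R) (U : R -> T -> 'M[complex R]_n)
    (hU : unitary_brownian_motion P F W U)
    (hU0 : {ae P, forall w, flag_chart (U 0 w)})
    (lambda := fun (t : R) (w : T) => flag_lambda (U t w)) :
  (exists gamma : 'I_n -> 'I_n -> R -> T -> R,
    [/\ brownian_motion P F
          (fun p : upper_pair n => gamma (val p).1 (val p).2),
        forall l j : 'I_n, (j < l)%N ->
          forall t w, gamma l j t w = - gamma j l t w,
        forall j : 'I_n, continuous_adapted P F (fun t w => lambda t w 0 j)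
      & exists I : 'I_n -> 'I_n -> R -> T -> R,
          (forall l j : 'I_n, l != j ->
             ito_integral P F
               (fun t w => Num.sqrt (lambda t w 0 l * lambda t w 0 j))
               (gamma l j) (I l j)) /\
          {ae P, forall w, forall t, 0 <= t -> forall j : 'I_n,
             lambda t w 0 j = lambda 0 w 0 j
               + \int[lebesgue_measure]_(s in `[0, t])
                   (2 * (1 - n%:R * lambda s w 0 j))
               + 2 * \sum_(l < n | l != j) I l j t w}]) /\
  jacobi_process P F (fun=> 2^-1) 2 lambda /\
  (forall (f : 'rV[R]_n -> R) (x : 'rV[R]_n),
     jacobi_operator (fun=> 2^-1) f x =
       \sum_(j < n) x 0 j * (1 - x 0 j) * partial j (partial j f) x
       + \sum_(j < n) (1 - n%:R * x 0 j) * partial j f x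
       - \sum_(j < n) \sum_(l < n | l != j)
           x 0 j * x 0 l * partial j (partial l f) x).
Proof.
have hm : unitary_sde P F W U by case: hU.
have [X [sX eX uX pos]] := regular_version hF hU.1 hm hU0.
split; first exact: (lambda_sde hF hU.1 hm sX eX uX pos).
split; first exact: (lambda_jacobi hF hU.1 hm sX eX uX pos).
exact: jacobi_operator_half.
Qed.
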